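(* The set of isomorphism classes of $4$-dimensional commutative Frobenius $k$-algebras is equal to the set of isomorphism classes of the algebras $C(A)$, where $A$ ranges over the noncommutative conics associated to symmetric regular superpotentials. These algebras are $$k^4,\quad k[u]/(u^2)\times k^2,\quad k[u]/(u^2)\times k[u]/(u^2),\quad k[u]/(u^3)\times k,\quad k[u]/(u^4),\quad k[u,v]/(u^2,v^2).$$
   Context: Let $k$ be an algebraically closed field of characteristic zero. A Frobenius algebra is a finite dimensional $k$-algebra together with a nondegenerate associative bilinear pairing to $k$; isomorphism classes are taken as $k$-algebras. A $3$-dimensional quantum polynomial algebra is a noetherian connected graded $k$-algebra $S$ with global dimension $3$, $\operatorname{Ext}^i_S(k,S)\cong k$ for $i=3$ and $0$ otherwise, and Hilbert series $(1-t)^{-3}$. Let $V$ be a $3$-dimensional vector space with basis $x_1,x_2,x_3$. For $\omega=\sum_i x_i\otimes\omega_i\in V^{\otimes3}$ put $\mathcal{D}(\omega)=T(V)/(\omega_1,\omega_2,\omega_3)$. Then $\omega$ is a superpotential if it is invariant under the cyclic permutation $u_1\otimes u_2\otimes u_3\mapsto u_2\otimes u_3\otimes u_1$, symmetric if it is invariant under all permutations of the tensor factors, and regular if $\mathcal{D}(\omega)$ is a quantum polynomial algebra. A noncommutative conic associated to a symmetric regular superpotential is an algebra $A=S/(f)$ where $S=\mathcal{D}(\omega)$ for a symmetric regular superpotential $\omega$ and $f\in S_2$ is a central regular element. For a quadratic algebra $A=T(V)/(R)$ the quadratic dual is $A^!=T(V^* )/(R^\perp)$. For $A=S/(f)$ there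 is a central regular element $f^!\in A^!_2$, unique up to scalar, with $A^!/(f^!)=S^!$, and $C(A)=A^![(f^!)^{-1}]_0$ is the degree-zero part of the localization. *)

(* Defs.v *)
From HB Require Import structures.
From mathcomp Require Import all_boot all_order all_fingroup all_algebra.
From mathcomp Require Import generic_quotient ring_quotient boolp.
From mathcomp Require Import finmap.
From mathcomp.multinomials Require Import monalg.

Set Implicit Arguments.
Unset Strict Implicit.
Unset Printing Implicit Defensive.

Import GRing.Theory.
Local Open Scope ring_scope.
Local Open Scope quotient_scope.

Section QuotientAlgebra.
Context (R : comNzRingType) (A : algType R).

(* Two-sided ideal generated by G: the finite sums of terms a * g * b. *)
Inductive ideal_gen (G : A -> Prop) : A -> Prop :=
| ideal_gen0 : ideal_gen G 0
| ideal_genD a g b x : G g -> ideal_gen G x -> ideal_gen G (a * g * b + x).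

Lemma ideal_gen_add G x y : ideal_gen G x -> ideal_gen G y -> ideal_gen G (x + y).
Proof.
elim=> [|a g b z Gg _ IH] Hy; first by rewrite add0r.
by rewrite -addrA; apply: ideal_genD => //; apply: IH.
Qed.

Lemma ideal_gen_mull G c x : ideal_gen G x -> ideal_gen G (c * x).
Proof.
elim=> [|a g b z Gg _ IH]; first by rewrite mulr0; constructor.
by rewrite mulrDr !mulrA; apply: ideal_genD.
Qed.

Lemma ideal_gen_mulr G c x : ideal_gen G x -> ideal_gen G (x * c).
Proof.
elim=> [|a g b z Gg _ IH]; first by rewrite mul0r; constructor.
by rewrite mulrDl -(mulrA (a * g)); apply: ideal_genD.
Qed.

Lemma ideal_gen_opp G x : ideal_gen G x -> ideal_gen G (- x).
Proof. by move=> Hx; rewrite -mulN1r; apply: ideal_gen_mull. Qed.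

(* The algebras of the library are nonzero, so the quotient by the unit ideal
   has to be given a junk value: it is taken to be A itself. The quotients formed
   below are all by ideals generated by elements of positive degree of a connected
   graded algebra, so that this case does not occur. *)
Definition qideal (G : A -> Prop) (x : A) : bool :=
  `[< if `[< ideal_gen G 1 >] then x = 0 else ideal_gen G x >].

Variable G : A -> Prop.

Lemma qideal_zmod : zmod_closed (qideal G).
Proof.
rewrite /qideal; split; rewrite /in_mem /=; first by apply/asboolP; case: ifP => // _; constructor.
move=> x y /asboolP Hx /asboolP Hy; apply/asboolP; case: ifP Hx Hy => _.
  by move=> -> ->; rewrite subr0.
by move=> Hx Hy; apply: ideal_gen_add => //; apply: ideal_gen_opp.
Qed.

HB.instance Definition _ := GRing.isZmodClosed.Build A (qideal G) qideal_zmod.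

Lemma qideal_mull a x : qideal G x -> qideal G (a * x).
Proof.
move=> /asboolP Hx; apply/asboolP; case: ifP Hx => _; last exact: ideal_gen_mull.
by move=> ->; rewrite mulr0.
Qed.

Lemma qideal_mulr a x : qideal G x -> qideal G (x * a).
Proof.
move=> /asboolP Hx; apply/asboolP; case: ifP Hx => _; last exact: ideal_gen_mulr.
by move=> ->; rewrite mul0r.
Qed.

Lemma qideal1 : ~~ qideal G 1.
Proof.
apply/asboolP; case: ifP => [_ /eqP|/asboolP //].
by rewrite oner_eq0.
Qed.

Definition qideal_pred : zmodClosed A := GRing.ZmodClosed.clone A (qideal G) _.

Definition quot_alg : Type := Quotient.quot qideal_pred.

HB.instance Definition _ := GRing.Zmodule.on quot_alg.

Definition quot_pi (x : A) : quot_alg := \pi_(Quotient.quot qideal_pred) x.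

Lemma quot_piP (q : quot_alg) : exists x, q = quot_pi x.
Proof. by exists (repr q); rewrite /quot_pi reprK. Qed.

Lemma quot_pi_eq x y : quot_pi x = quot_pi y <-> qideal G (x - y).
Proof.
rewrite /quot_pi; split=> [/eqP|H]; first by rewrite -Quotient.idealrBE.
by apply/eqP; rewrite -Quotient.idealrBE.
Qed.

Lemma quot_pi_is_zmod_morphism : zmod_morphism quot_pi.
Proof. by move=> x y; rewrite /quot_pi !piE. Qed.

HB.instance Definition _ :=
  GRing.isZmodMorphism.Build A quot_alg quot_pi quot_pi_is_zmod_morphism.

Definition quot_one : quot_alg := quot_pi 1.
Definition quot_mul (p q : quot_alg) : quot_alg :=
  quot_pi (repr (p : Quotient.quot qideal_pred) * repr (q : Quotient.quot qideal_pred)).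
Definition quot_scale (c : R) (q : quot_alg) : quot_alg :=
  quot_pi (c *: repr (q : Quotient.quot qideal_pred)).

Lemma quot_repr x : qideal G (repr (quot_pi x : Quotient.quot qideal_pred) - x).
Proof. by apply/quot_pi_eq; rewrite /quot_pi reprK. Qed.

Lemma quot_pi_mul x y : quot_mul (quot_pi x) (quot_pi y) = quot_pi (x * y).
Proof.
apply/quot_pi_eq; set x' := repr _; set y' := repr _.
have -> : x' * y' - x * y = (x' - x) * y' + x * (y' - y).
  by rewrite mulrBl mulrBr addrA subrK.
have H1 : (x' - x) * y' \in qideal G by apply: qideal_mulr; apply: quot_repr.
have H2 : x * (y' - y) \in qideal G by apply: qideal_mull; apply: quot_repr.
exact: rpredD H1 H2.
Qed.

Lemma quot_pi_scale c x : quot_scale c (quot_pi x) = quot_pi (c *: x).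
Proof.
apply/quot_pi_eq; rewrite -scalerBr -[_ - x]mul1r scalerAl.
by apply: qideal_mull; apply: quot_repr.
Qed.

Local Ltac lift3 p q r :=
  have [x ->] := quot_piP p; have [y ->] := quot_piP q; have [z ->] := quot_piP r.

Fact quot_mulA : associative quot_mul.
Proof. by move=> p q r; lift3 p q r; rewrite !quot_pi_mul mulrA. Qed.

Fact quot_mul1q : left_id quot_one quot_mul.
Proof. by move=> p; have [x ->] := quot_piP p; rewrite quot_pi_mul mul1r. Qed.

Fact quot_mulq1 : right_id quot_one quot_mul.
Proof. by move=> p; have [x ->] := quot_piP p; rewrite quot_pi_mul mulr1. Qed.

Fact quot_mulDl : left_distributive quot_mul +%R.
Proof.
by move=> p q r; lift3 p q r; rewrite -raddfD !quot_pi_mul -raddfD mulrDl.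
Qed.

Fact quot_mulDr : right_distributive quot_mul +%R.
Proof.
by move=> p q r; lift3 p q r; rewrite -raddfD !quot_pi_mul -raddfD mulrDr.
Qed.

Fact quot_one_neq0 : quot_one != 0.
Proof.
apply/eqP; rewrite -(raddf0 quot_pi) => /quot_pi_eq; rewrite subr0.
exact/negP/qideal1.
Qed.

HB.instance Definition _ := GRing.Zmodule_isNzRing.Build quot_alg
  quot_mulA quot_mul1q quot_mulq1 quot_mulDl quot_mulDr quot_one_neq0.

Fact quot_scaleA a b p : quot_scale a (quot_scale b p) = quot_scale (a * b) p.
Proof. by have [x ->] := quot_piP p; rewrite !quot_pi_scale scalerA. Qed.

Fact quot_scale1 : left_id 1 quot_scale.
Proof. by move=> p; have [x ->] := quot_piP p; rewrite quot_pi_scale scale1r. Qed.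

Fact quot_scaleDr : right_distributive quot_scale +%R.
Proof.
move=> a p q; have [x ->] := quot_piP p; have [y ->] := quot_piP q.
by rewrite -raddfD !quot_pi_scale -raddfD scalerDr.
Qed.

Fact quot_scaleDl p : {morph quot_scale^~ p : a b / a + b}.
Proof.
by move=> a b; have [x ->] := quot_piP p; rewrite !quot_pi_scale -raddfD scalerDl.
Qed.

HB.instance Definition _ := GRing.Zmodule_isLmodule.Build R quot_alg
  quot_scaleA quot_scale1 quot_scaleDr quot_scaleDl.

Fact quot_scaleAl a (p q : quot_alg) : a *: (p * q) = (a *: p) * q.
Proof.
have [x ->] := quot_piP p; have [y ->] := quot_piP q.
by rewrite /*%R /*:%R /= !(quot_pi_mul, quot_pi_scale) scalerAl.
Qed.

HB.instance Definition _ := GRing.Lmodule_isLalgebra.Build R quot_alg quot_scaleAl.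

Fact quot_scaleAr a (p q : quot_alg) : a *: (p * q) = p * (a *: q).
Proof.
have [x ->] := quot_piP p; have [y ->] := quot_piP q.
by rewrite /*%R /*:%R /= !(quot_pi_mul, quot_pi_scale) scalerAr.
Qed.

HB.instance Definition _ := GRing.Lalgebra_isAlgebra.Build R quot_alg quot_scaleAr.

Fact quot_pi_monoid : monoid_morphism quot_pi.
Proof. by split=> // x y; rewrite -quot_pi_mul. Qed.

HB.instance Definition _ :=
  GRing.isMonoidMorphism.Build A quot_alg quot_pi quot_pi_monoid.

Fact quot_pi_scalable : scalable quot_pi.
Proof. by move=> a x; rewrite -quot_pi_scale. Qed.

HB.instance Definition _ :=
  GRing.isScalable.Build R A quot_alg *:%R quot_pi quot_pi_scalable.

End QuotientAlgebra.

Definition alg_iso (R : comNzRingType) (E F : algType R) : Prop :=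
  exists f : {lrmorphism E -> F}, bijective f.

(* The subspace P of V has dimension n. *)
Definition has_dim (k : fieldType) (V : lmodType k) (P : V -> Prop) (n : nat) :=
  exists b : 'I_n -> V, (forall i, P (b i)) /\
    forall x, P x -> exists! c : 'rV[k]_n, x = \sum_i c 0 i *: b i.

Section FrobeniusAlgebra.
Context (k : fieldType) (E : algType k).

Definition frobenius : Prop :=
  (exists n, @has_dim k E (fun=> True) n) /\
  exists beta : E -> E -> k,
    [/\ forall a x y z, beta (a *: x + y) z = a * beta x z + beta y z,
        forall a x y z, beta x (a *: y + z) = a * beta x y + beta x z,
        forall x y z, beta (x * y) z = beta x (y * z),
        forall x, (forall y, beta x y = 0) -> x = 0
      & forall y, (forall x, beta x y = 0) -> y = 0].

Definition commutative_frobenius4 : Prop :=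
  [/\ frobenius, @has_dim k E (fun=> True) 4 & forall x y : E, x * y = y * x].

End FrobeniusAlgebra.

Section HomologicalAlgebra.
Context (R : nzRingType).

Definition left_noetherian : Prop :=
  forall I : R -> Prop, I 0 -> (forall a x y, I x -> I y -> I (a * x + y)) ->
  exists n (g : 'I_n -> R),
    forall x, I x <-> exists c : 'I_n -> R, x = \sum_i c i * g i.

(* Modules are left modules throughout. *)
Definition projective (P : lmodType R) : Prop :=
  forall (M N : lmodType R) (g : {linear M -> N}) (f : {linear P -> N}),
    (forall y, exists x, g x = y) ->
    exists h : {linear P -> M}, forall x, g (h x) = f x.

Record resolution (M : lmodType R) := Resolution {
  res_mod : nat -> lmodType R;
  res_d : forall i, {linear res_mod i.+1 -> res_mod i};
  res_aug : {linear res_mod 0 -> M};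
  res_projective : forall i, projective (res_mod i);
  res_aug_surj : forall y, exists x, res_aug x = y;
  res_exact0 : forall x, res_aug x = 0 <-> exists y, res_d 0 y = x;
  res_exact : forall i x, res_d i x = 0 <-> exists y, res_d i.+1 y = x
}.

Definition proj_dim_le (M : lmodType R) (n : nat) : Prop :=
  exists r : resolution M, forall i, (n < i)%N -> forall x : res_mod r i, x = 0.

Definition global_dim (n : nat) : Prop :=
  forall m, (forall M : lmodType R, proj_dim_le M m) <-> (n <= m)%N.

Section Cochains.
Variables (M N : lmodType R) (r : resolution M).

Definition cocycle i (f : res_mod r i -> N) : Prop :=
  forall x, f (res_d r i x) = 0.

Definition coboundary i : (res_mod r i -> N) -> Prop :=
  match i return (res_mod r i -> N) -> Prop with
  | 0%N => fun f => forall x, f x = 0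
  | j.+1 => fun f =>
      exists g : {linear res_mod r j -> N}, forall x, f x = g (res_d r j x)
  end.

End Cochains.
End HomologicalAlgebra.

(* dim_k Ext^i_S(M, N) = n, the Ext space being the i-th cohomology of
   Hom_S(P, N) for a projective resolution P of M; a scalar c of k acts on
   Hom_S(P_i, N) through the central element c%:A of S. *)
Definition ext_dim (k : fieldType) (S : algType k) (M N : lmodType S) (i n : nat) :=
  exists (r : resolution M) (z : 'I_n -> {linear res_mod r i -> N}),
    (forall j, cocycle (z j)) /\
    forall f : {linear res_mod r i -> N}, cocycle f ->
    exists! c : 'rV[k]_n,
      coboundary (fun x => f x - \sum_j (c 0 j)%:A *: z j x).

Section GradedAlgebra.
Context (k : fieldType) (S : algType k) (gr : nat -> S -> Prop).

Definition connected_graded : Prop :=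
  [/\ forall n, gr n 0 /\ forall a x y, gr n x -> gr n y -> gr n (a *: x + y),
      forall m n x y, gr m x -> gr n y -> gr (m + n)%N (x * y),
      forall x, exists n (c : nat -> S),
        (forall i, gr i (c i)) /\ x = \sum_(i < n) c i,
      forall n (c : nat -> S), (forall i, gr i (c i)) ->
        \sum_(i < n) c i = 0 -> forall i, (i < n)%N -> c i = 0
    & forall x, gr 0 x <-> exists a : k, x = a%:A].

(* H_S(t) = (1 - t)^-3, i.e. (1 - t)^3 * H_S(t) = 1 as power series. *)
Definition hilbert_series_inv_cube : Prop :=
  exists h : nat -> nat, (forall n, has_dim (gr n) (h n)) /\
    forall n, \sum_(i < n.+1) ((1 - 'X) ^+ 3 : {poly int})`_i * (h (n - i)%N)%:Z
              = (n == 0%N)%:Z.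

(* M is isomorphic to the S-module k = S / S_{>= 1}. *)
Definition trivial_module (M : lmodType S) : Prop :=
  exists q : {linear S^o -> M}, (forall y, exists x, q x = y) /\
    forall x, q x = 0 <->
      ideal_gen (fun y => exists n, (0 < n)%N /\ gr n y) x.

Definition quantum_polynomial3 : Prop :=
  [/\ connected_graded,
      left_noetherian S /\ left_noetherian S^c,
      global_dim S 3,
      exists M : lmodType S, trivial_module M /\
        forall i, ext_dim M S^o i (i == 3%N)
    & hilbert_series_inv_cube].

End GradedAlgebra.

Section CentralElements.
Context (k : fieldType) (B : algType k).

Definition central (z : B) : Prop := forall x, z * x = x * z.

Definition regular_elt (z : B) : Prop :=
  (forall x, z * x = 0 -> x = 0) /\ (forall x, x * z = 0 -> x = 0).

(* iota exhibits L as the localization B[z^-1] at the central element z. *)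
Definition localization (z : B) (L : algType k) (iota : {lrmorphism B -> L}) :=
  [/\ exists u, u * iota z = 1 /\ iota z * u = 1,
      forall l, exists n b, l * iota z ^+ n = iota b
    & forall b, iota b = 0 -> exists n, b * z ^+ n = 0].

(* E is isomorphic to B[z^-1]_0, z being central of degree d. The degree zero
   part consists of the fractions b / z^n with b of degree d * n. *)
Definition deg0_localization (gr : nat -> B -> Prop) (d : nat) (z : B)
    (E : algType k) : Prop :=
  exists (L : algType k) (iota : {lrmorphism B -> L}) (j : {lrmorphism E -> L}),
    [/\ localization z iota, injective j
      & forall l, (exists e, j e = l) <->
          exists n b, gr (d * n)%N b /\ l * iota z ^+ n = iota b].

End CentralElements.

(* T(V) for V of dimension 3 with basis x_0, x_1, x_2. It also serves as T(V^* ),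
   with the x_i standing for the dual basis. *)
Definition tensor_alg (k : comNzRingType) : Type := {malg k[{fmonom 'I_3}]}.

HB.instance Definition _ (k : comNzRingType) := GRing.Lalgebra.on (tensor_alg k).

Fact tensor_alg_scaleAr (k : comNzRingType) (a : k) (x y : tensor_alg k) :
  a *: (x * y) = x * (a *: y).
Proof.
apply/malgP => m; rewrite mcoeffZ.
rewrite (mcoeffMlw m (fsubset_refl (msupp x)) (fsubset_refl (msupp y))).
rewrite (mcoeffMlw m (fsubset_refl (msupp x)) (msuppZ_le a y)).
rewrite mulr_sumr; apply: eq_bigr => i _; rewrite mulr_sumr; apply: eq_bigr => j _.
by rewrite mcoeffZ mulrnAr; congr (_ *+ _); rewrite mulrCA.
Qed.

HB.instance Definition _ (k : comNzRingType) :=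
  GRing.Lalgebra_isAlgebra.Build k (tensor_alg k) (@tensor_alg_scaleAr k).

Section Conics.
Context (k : fieldType).
Local Notation T := (tensor_alg k).

Definition tgen (i : 'I_3) : T := << fmu i >>.

Definition homog (n : nat) (x : T) : Prop :=
  forall m : {fmonom 'I_3}, x@_m != 0 -> fdeg m = n.

(* Grading of a quotient of T(V) by a homogeneous ideal. *)
Definition img_grading (A : algType k) (pi : T -> A) (n : nat) (x : A) : Prop :=
  exists t, homog n t /\ x = pi t.

(* The tensor \sum_(a, b, c) w (a, b, c) x_a (x) x_b (x) x_c. *)
Definition tensor3 := {ffun 3.-tuple 'I_3 -> k}.

Definition superpotential (w : tensor3) : Prop :=
  forall a b c, w [tuple a; b; c] = w [tuple b; c; a].

Definition symmetric_tensor (w : tensor3) : Prop :=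
  forall (s : 'S_3) (t : 3.-tuple 'I_3), w [tuple tnth t (s i) | i < 3] = w t.

(* The omega_i of omega = \sum_i x_i (x) omega_i. *)
Definition D_rel (w : tensor3) (i : 'I_3) : T :=
  \sum_j \sum_l w [tuple i; j; l] *: (tgen j * tgen l).

Definition D_alg (w : tensor3) : algType k := quot_alg (fun x => exists i, x = D_rel w i).

Definition D_pi (w : tensor3) : {lrmorphism T -> D_alg w} := quot_pi _.

Definition D_grading (w : tensor3) (n : nat) (x : D_alg w) : Prop :=
  img_grading (D_pi w) n x.

Arguments D_grading : clear implicits.

Definition regular_tensor (w : tensor3) : Prop := quantum_polynomial3 (D_grading w).

Definition pairing2 (g r : T) : k :=
  \sum_i \sum_j g@_(FMonom [:: i; j]) * r@_(FMonom [:: i; j]).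

(* For A = T(V) / ker pi quadratic, the space of relations of A is the degree 2
   part of ker pi. *)
Definition quadratic_dual (A : algType k) (pi : T -> A) : algType k :=
  quot_alg (fun g => homog 2 g /\
    forall r, homog 2 r -> pi r = 0 -> pairing2 g r = 0).

Definition quadratic_dual_pi (A : algType k) (pi : T -> A) :
  {lrmorphism T -> quadratic_dual pi} := quot_pi _.

Section Conic.
Variables (w : tensor3) (f : D_alg w).

Definition conic_element : Prop :=
  [/\ D_grading w 2 f, central f & regular_elt f].

Definition conic : algType k := quot_alg (fun x : D_alg w => x = f).

Definition conic_pi : T -> conic := fun t => quot_pi _ (D_pi w t).

(* E is isomorphic to C(A) = A^![(f^!)^-1]_0 for A = D(w) / (f); the last but one
   condition says that the kernel of A^! -> S^! is generated by z = f^!. *)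
Definition is_C (E : algType k) : Prop :=
  exists z : quadratic_dual conic_pi,
    [/\ img_grading (quadratic_dual_pi conic_pi) 2 z,
        central z,
        regular_elt z,
        forall t, quadratic_dual_pi (D_pi w) t = 0 <->
          ideal_gen (fun x => x = z) (quadratic_dual_pi conic_pi t)
      & deg0_localization (img_grading (quadratic_dual_pi conic_pi)) 2 z E].

End Conic.

(* k[u]/(u^n), for n > 0, and k[u, v]/(u^2, v^2). *)
Definition trunc_poly (n : nat) : algType k :=
  quot_alg (fun x : {poly k} => x = 'X^n).

Definition trunc_poly2 : algType k :=
  quot_alg (fun x : {mpoly k[2]} => exists i : 'I_2, x = << ucm i >> ^+ 2).

End Conics.

(* Main.v *)
(* A symmetric regular superpotential is never classified: the dimensions 6 and 10 of S_2
   and S_3 suffice to control C(A) in general, and the explicit family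
   w = (xyz symmetrized) + al x^3 + ga y^3, f = z^2 + be x^2 + de y^2 suffices to realize
   every algebra.

   Realization. The algebra S of w is a skew extension with a PBW basis x^a y^b z^c, and a
   Koszul bimodule complex resolves every module. If E has a basis 1, u, v, uv with
   u^2 = al v + be and v^2 = ga u + de, then x_i |-> (u, v, 1) t embeds the quadratic dual of
   A = S/(f) into E[t], whence C(A) = E. Each of the six algebras has such u and v.

   Converse. f is a symmetric tensor, so A^! is commutative; a syzygy count shows that
   t |-> <t, w> is the only functional on S^!_3 and that S^!_4 = 0. Hence E = C(A) has
   dimension 4, and its odd part L_1 = A^!_3 / f^! is dual to E. Choosing for each local
   idempotent of E a generator whose square is invertible on it shows that L_1 is free, so
   that E is Frobenius.

   Classification. For each local idempotent take a nilpotent of maximal order; if the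
   powers obtained do not span, a Frobenius form (simple socle) forces the square-zero
   algebra k[u, v]/(u^2, v^2). *)
From HB Require Import structures.
From mathcomp Require Import all_boot all_order all_fingroup all_algebra.
From mathcomp Require Import generic_quotient ring_quotient boolp.
From mathcomp Require classical_sets.
From mathcomp Require Import finmap.
From mathcomp.multinomials Require Import monalg.
From mathcomp Require Import zify ring ssrAC.
Require Import Defs.

Set Implicit Arguments.
Unset Strict Implicit.
Unset Printing Implicit Defensive.

Import GRing.Theory.
Local Open Scope ring_scope.

(** Regularity is taken literally, so the explicit family must be shown noetherian on both sides, of
    global dimension exactly three over all modules, and with the right Ext groups. For a module M
    the Koszul complex lives on S (x)_k M, a free S-module on a k-basis of M; hence the appeal to
    Zorn's lemma. Its exactness is a comparison of exponents in the PBW basis. The parameters come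
    from duality. When x, y, z go to ut, vt, t, the coordinates of 1, u, v, uv are four functionals
    on products of two generators, and the orthogonal of the relations of A^! is their span. With
    u^2 in the span of 1 and v, and v^2 in that of 1 and u, the coordinates of v, u, uv are yz + zy
    + al x^2, xz + zx + ga y^2 and xy + yx, which are the derivatives of one symmetric cubic tensor;
    the coordinate of 1 is the conic. Classification and realization meet in the predicate [quad],
    which fixes an algebra up to isomorphism. Thus two algebras of the same type are never compared
    directly: each one only has to exhibit u and v. *)

Section Span.
Context (k : nzRingType) (V : lmodType k).

Inductive lspan (G : V -> Prop) : V -> Prop :=
| lspan0 : lspan G 0
| lspanS c g x : G g -> lspan G x -> lspan G (c *: g + x).

Lemma lspan_gen (G : V -> Prop) g : G g -> lspan G g.
Proof. by move=> Gg; rewrite -[g]addr0 -[g]scale1r; apply: lspanS => //; apply: lspan0. Qed.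

Lemma lspanD (G : V -> Prop) x y : lspan G x -> lspan G y -> lspan G (x + y).
Proof.
elim=> [|c g z Gg _ IH] Hy; first by rewrite add0r.
by rewrite -addrA; apply: lspanS => //; apply: IH.
Qed.

Lemma lspanZ (G : V -> Prop) c x : lspan G x -> lspan G (c *: x).
Proof.
elim=> [|d g z Gg _ IH]; first by rewrite scaler0; apply: lspan0.
by rewrite scalerDr scalerA; apply: lspanS.
Qed.

Lemma lspanB (G : V -> Prop) x y : lspan G x -> lspan G y -> lspan G (x - y).
Proof. by move=> Hx Hy; rewrite -scaleN1r; apply: lspanD => //; apply: lspanZ. Qed.

Lemma lspan_sum (G : V -> Prop) (I : Type) (r : seq I) (P : pred I) (F : I -> V) :
  (forall i, P i -> lspan G (F i)) -> lspan G (\sum_(i <- r | P i) F i).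
Proof. by move=> H; elim/big_ind: _ => //; [apply: lspan0 | apply: lspanD]. Qed.

Lemma lspan_sub (G H : V -> Prop) x :
  (forall g, G g -> lspan H g) -> lspan G x -> lspan H x.
Proof.
move=> GH; elim=> [|c g y Gg _ IH]; first exact: lspan0.
by apply: lspanD => //; apply/lspanZ/GH.
Qed.

Lemma lspan_closed (G P : V -> Prop) x :
  P 0 -> (forall c y z, P y -> P z -> P (c *: y + z)) -> (forall g, G g -> P g) ->
  lspan G x -> P x.
Proof. by move=> P0 PD GP; elim=> [|c g y Gg _ IH] //; apply: PD => //; apply: GP. Qed.

Lemma lspan_fin n (b : 'I_n -> V) x :
  lspan (fun y => exists i, y = b i) x -> exists c : 'I_n -> k, x = \sum_i c i *: b i.
Proof.
elim=> [|c _ y [i ->] _ [d ->]].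
  by exists (fun=> 0); rewrite big1 // => i _; rewrite scale0r.
exists (fun j => (if j == i then c else 0) + d j).
under [RHS]eq_bigr do rewrite scalerDl.
rewrite big_split /=; congr (_ + _).
by rewrite (bigD1 i) //= eqxx big1 ?addr0 // => j /negPf ->; rewrite scale0r.
Qed.

Lemma lspan_closedE (P : V -> Prop) x :
  P 0 -> (forall c y z, P y -> P z -> P (c *: y + z)) -> lspan P x <-> P x.
Proof.
by move=> P0 PD; split=> [|Px]; [exact: lspan_closed | exact: lspan_gen].
Qed.

End Span.

(* A free algebra on x_0, x_1, x_2, given by its coefficient functionals. Working with
   an abstract one keeps unification away from the implementation of [tensor_alg]. *)
Record free_alg (k : fieldType) := FreeAlg {
  fa_sort :> algType k;
  fa_gen : 'I_3 -> fa_sort;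
  fa_coef : seq 'I_3 -> fa_sort -> k;
  fa_coef_linear : forall s c x y, fa_coef s (c *: x + y) = c * fa_coef s x + fa_coef s y;
  fa_coef_word : forall s t,
    fa_coef s (\prod_(i <- t) fa_gen i) = (t == s)%:R;
  fa_lspan : forall x, lspan (fun y => exists s, y = \prod_(i <- s) fa_gen i) x;
  fa_ext : forall x, (forall s, fa_coef s x = 0) -> x = 0;
  fa_lext : forall (V : lmodType k) (g : seq 'I_3 -> V),
    {h : {linear fa_sort -> V} | forall s, h (\prod_(i <- s) fa_gen i) = g s}
}.

(** * Words, coefficients and degree components in a free algebra *)

Section Words.
Context (k : fieldType) (T : free_alg k).
Implicit Types (s t : seq 'I_3) (x y : T).

Local Notation gen := (fa_gen T).
Local Notation coef := (@fa_coef k T).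

Definition word s : T := \prod_(i <- s) gen i.

Lemma word_nil : word [::] = 1.
Proof. exact: big_nil. Qed.

Lemma word_cat s t : word (s ++ t) = word s * word t.
Proof. exact: big_cat. Qed.

Lemma word1 (i : 'I_3) : word [:: i] = gen i.
Proof. exact: big_seq1. Qed.

Lemma word_cons i s : word (i :: s) = gen i * word s.
Proof. by rewrite -word1 -word_cat. Qed.

Lemma word_rcons i s : word (rcons s i) = word s * gen i.
Proof. by rewrite -word1 -word_cat cats1. Qed.

Lemma fcoef_word s t : coef s (word t) = (t == s)%:R.
Proof. exact: fa_coef_word. Qed.

Lemma fcoefP s c x y : coef s (c *: x + y) = c * coef s x + coef s y.
Proof. exact: fa_coef_linear. Qed.

Lemma fcoef0 s : coef s 0 = 0.
Proof. by have := fcoefP s (-1) 0 0; rewrite scaler0 addr0 mulN1r addNr. Qed.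

Lemma fcoefD s x y : coef s (x + y) = coef s x + coef s y.
Proof. by rewrite -[x]scale1r fcoefP mul1r scale1r. Qed.

Lemma fcoefZ s c x : coef s (c *: x) = c * coef s x.
Proof. by rewrite -[_ *: _]addr0 fcoefP fcoef0 addr0. Qed.

Lemma fcoefB s x y : coef s (x - y) = coef s x - coef s y.
Proof. by rewrite -scaleN1r fcoefD fcoefZ mulN1r. Qed.

Lemma fcoef_sum s (I : Type) (r : seq I) (P : pred I) (F : I -> T) :
  coef s (\sum_(i <- r | P i) F i) = \sum_(i <- r | P i) coef s (F i).
Proof. by apply: (big_morph (coef s)); [exact: fcoefD | exact: fcoef0]. Qed.

Lemma tensorP x y : (forall s, coef s x = coef s y) -> x = y.
Proof.
move=> H; apply/eqP; rewrite -subr_eq0; apply/eqP/fa_ext => s.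
by rewrite fcoefB H subrr.
Qed.

Lemma tensor_ind (P : T -> Prop) :
  P 0 -> (forall c s x, P x -> P (c *: word s + x)) -> forall x, P x.
Proof. by move=> P0 PS x; elim: (fa_lspan x) => // c _ y [s ->] _; apply: PS. Qed.

Definition lext (V : lmodType k) (g : seq 'I_3 -> V) : {linear T -> V} :=
  sval (fa_lext T g).

Lemma lext_word (V : lmodType k) (g : seq 'I_3 -> V) s : lext g (word s) = g s.
Proof. exact: svalP (fa_lext T g) s. Qed.

Lemma linear_word_eq (V : lmodType k) (g h : {linear T -> V}) :
  (forall s, g (word s) = h (word s)) -> g =1 h.
Proof.
move=> gh; elim/tensor_ind => [|c s x IH]; first by rewrite !linear0.
by rewrite !linearP IH gh.
Qed.

Definition fhomog n x : Prop := forall s, coef s x != 0 -> size s = n.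

Lemma homog0 n : fhomog n 0.
Proof. by move=> s; rewrite fcoef0 eqxx. Qed.

Lemma homogP n c x y : fhomog n x -> fhomog n y -> fhomog n (c *: x + y).
Proof.
move=> hx hy m; rewrite fcoefD fcoefZ.
have [/eqP->|/hx //] := boolP (coef m x == 0).
by rewrite mulr0 add0r; apply: hy.
Qed.

Lemma homogD n x y : fhomog n x -> fhomog n y -> fhomog n (x + y).
Proof. by move=> hx hy; rewrite -[x]scale1r; apply: homogP. Qed.

Lemma homogZ n c x : fhomog n x -> fhomog n (c *: x).
Proof. by move=> hx; rewrite -[_ *: _]addr0; apply: homogP => //; apply: homog0. Qed.

Lemma homogB n x y : fhomog n x -> fhomog n y -> fhomog n (x - y).
Proof. by move=> hx hy; rewrite -scaleN1r addrC; apply: homogP. Qed.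

Lemma homog_sum n (I : Type) (r : seq I) (P : pred I) (F : I -> T) :
  (forall i, P i -> fhomog n (F i)) -> fhomog n (\sum_(i <- r | P i) F i).
Proof. by move=> H; elim/big_ind: _ => //; [apply: homog0 | apply: homogD]. Qed.

Lemma homog_word s : fhomog (size s) (word s).
Proof. by move=> m; rewrite fcoef_word; case: (s =P m) => [->|_] //; rewrite eqxx. Qed.

Definition hcomp n : {linear T -> T} := lext (fun s => if size s == n then word s else 0).

Lemma comp_word n s : hcomp n (word s) = if size s == n then word s else 0.
Proof. exact: lext_word. Qed.

Lemma coef_comp n x s : coef s (hcomp n x) = if size s == n then coef s x else 0.
Proof.
elim/tensor_ind: x => [|c t x IH].
  by rewrite linear0 fcoef0; case: ifP.
rewrite linearP fcoefD fcoefZ IH comp_word fcoefD fcoefZ fcoef_word.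
case: (t =P s) => [->|/eqP/negPf ne].
  by case: ifP; rewrite ?fcoef_word ?fcoef0 ?eqxx ?mulr0 ?addr0.
by case: (size t == n); rewrite ?fcoef_word ?ne ?fcoef0 mulr0 !add0r.
Qed.

Lemma comp_homog n x : fhomog n (hcomp n x).
Proof. by move=> m; rewrite coef_comp; case: ifP => [/eqP //|_]; rewrite eqxx. Qed.

Lemma homog_comp n x : fhomog n x -> hcomp n x = x.
Proof.
move=> hx; apply: tensorP => s; rewrite coef_comp; case: ifP => // ne.
have [/eqP -> //|/hx e] := boolP (coef s x == 0).
by rewrite e eqxx in ne.
Qed.

Lemma homog_comp0 n m x : fhomog n x -> n != m -> hcomp m x = 0.
Proof.
move=> hx ne; apply: tensorP => s; rewrite coef_comp fcoef0; case: ifP => // /eqP sm.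
apply/eqP; apply: contraNT ne => /hx <-; exact/eqP.
Qed.

Lemma comp_sum x : exists n, x = \sum_(i < n) hcomp i x.
Proof.
elim/tensor_ind: x => [|c s x [n IH]].
  by exists 0%N; rewrite big_ord0.
exists (maxn n (size s).+1).
have widen m y : y = \sum_(i < n) hcomp i y -> (n <= m)%N -> y = \sum_(i < m) hcomp i y.
  move=> e le; rewrite -(subnKC le) big_split_ord /= -e big1 ?addr0 // => i _.
  rewrite e linear_sum big1 // => j _; apply: (homog_comp0 (n := j)).
    exact: comp_homog.
  by rewrite neq_ltn (leq_trans (ltn_ord j)) // leq_addr.
under eq_bigr do rewrite linearP.
rewrite big_split /= -(widen _ x) ?leq_maxl //; congr (_ + _).
have lt : (size s < maxn n (size s).+1)%N by rewrite leq_max ltnSn orbT.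
rewrite (bigD1 (Ordinal lt)) //= comp_word eqxx big1 ?addr0 // => i ne.
rewrite comp_word ifN ?scaler0 //; apply: contraNneq ne => e.
by apply/eqP/val_inj.
Qed.

(** A homogeneous element is its own component of degree [n]; ordinary induction on sums of words,
    carried through [hcomp n], then meets only words of length [n]. *)
Lemma homog_ind n (P : T -> Prop) :
  P 0 -> (forall c s x, size s = n -> fhomog n x -> P x -> P (c *: word s + x)) ->
  forall x, fhomog n x -> P x.
Proof.
move=> P0 PS x hx; rewrite -(homog_comp hx); elim/tensor_ind: {hx} x => [|c s x IH].
  by rewrite linear0.
rewrite linearP comp_word; case: eqP => [sn|_]; last by rewrite scaler0 add0r.
by apply: PS => //; apply: comp_homog.
Qed.

Lemma homogM n m x y : fhomog n x -> fhomog m y -> fhomog (n + m) (x * y).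
Proof.
move=> hx hy; elim/homog_ind: hx => [|c s {}x sn _ IH].
  by rewrite mul0r; apply: homog0.
rewrite mulrDl -scalerAl; apply: homogP => // {IH}.
elim/homog_ind: hy => [|d t {}y tm _ IH].
  by rewrite mulr0; apply: homog0.
rewrite mulrDr -scalerAr; apply: homogP => //.
by rewrite -word_cat -sn -tm -size_cat; apply: homog_word.
Qed.

Lemma homog_tgen i : fhomog 1 (gen i).
Proof. by rewrite -word1; apply: homog_word. Qed.

Lemma homog_1 : fhomog 0 1.
Proof. by rewrite -word_nil; apply: homog_word. Qed.

Lemma homog_lspan n x : fhomog n x ->
  lspan (fun y => exists s, size s = n /\ y = word s) x.
Proof.
elim/homog_ind=> [|c s y sn _ IH]; first exact: lspan0.
by apply: lspanS => //; exists s.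
Qed.

Lemma homog0E x : fhomog 0 x -> x = (coef [::] x) *: 1.
Proof.
move=> hx; apply: tensorP => s; rewrite fcoefZ -word_nil fcoef_word.
case: eqP => [<-|/eqP ne]; first by rewrite mulr1.
rewrite mulr0; apply/eqP; by apply: contraNT ne => /hx /size0nil <-.
Qed.

Lemma homog1E x : fhomog 1 x -> x = \sum_i coef [:: i] x *: gen i.
Proof.
elim/homog_ind=> [|c [|i [|//]] y // _ _ {1}->].
  by rewrite big1 // => i _; rewrite fcoef0 scale0r.
under [RHS]eq_bigr do rewrite fcoefD fcoefZ scalerDl fcoef_word.
rewrite big_split; congr (_ + _).
rewrite (bigD1 i) //= eqxx mulr1 big1 ?addr0 ?word1 // => j ne.
by rewrite eqseq_cons andbT eq_sym (negPf ne) mulr0 scale0r.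
Qed.

Lemma homog2E x : fhomog 2 x -> x = \sum_i \sum_j coef [:: i; j] x *: word [:: i; j].
Proof.
elim/homog_ind=> [|c [|i [|j [|//]]] y // _ _ {1}->].
  by rewrite big1 // => i _; rewrite big1 // => j _; rewrite fcoef0 scale0r.
under [RHS]eq_bigr do under eq_bigr do rewrite fcoefD fcoefZ scalerDl fcoef_word.
under [RHS]eq_bigr do rewrite big_split.
rewrite big_split; congr (_ + _).
rewrite (bigD1 i) //= (bigD1 j) //= eqxx mulr1 !big1 ?addr0 //.
  by move=> i' ne; rewrite big1 // => j' _; rewrite !eqseq_cons eq_sym (negPf ne) mulr0 scale0r.
by move=> j' ne; rewrite !eqseq_cons (eq_sym j) (negPf ne) andbF mulr0 scale0r.
Qed.

Lemma homog3E x : fhomog 3 x ->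
  x = \sum_i \sum_j \sum_l coef [:: i; j; l] x *: word [:: i; j; l].
Proof.
elim/homog_ind=> [|c [|i [|j [|l [|//]]]] y // _ _ {1}->].
  by do 3![rewrite big1 // => ? _]; rewrite fcoef0 scale0r.
under [RHS]eq_bigr do under eq_bigr do under eq_bigr do
  rewrite fcoefD fcoefZ scalerDl fcoef_word.
under [RHS]eq_bigr do under eq_bigr do rewrite big_split.
under [RHS]eq_bigr do rewrite big_split.
rewrite big_split; congr (_ + _).
rewrite (bigD1 i) //= (bigD1 j) //= (bigD1 l) //= eqxx mulr1 !big1 ?addr0 //.
- move=> i' ne; do 2![rewrite big1 // => ? _].
  by rewrite !eqseq_cons eq_sym (negPf ne) mulr0 scale0r.
- move=> j' ne; rewrite big1 // => ? _.
  by rewrite !eqseq_cons (eq_sym j) (negPf ne) andbF mulr0 scale0r.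
- by move=> l' ne; rewrite !eqseq_cons (eq_sym l) (negPf ne) !andbF mulr0 scale0r.
Qed.

End Words.

Arguments word {k T}.
Arguments hcomp {k T}.

(** * Homogeneous ideals, presentations and the induced grading *)

Lemma lspan_ideal (k : fieldType) (A : algType k) (G H : A -> Prop) x :
  (forall g, H g -> ideal_gen G g) -> lspan H x -> ideal_gen G x.
Proof.
move=> HG; elim=> [|c g y Hg _ IH]; first exact: ideal_gen0.
by apply: ideal_gen_add => //; rewrite -mulr_algl; apply/ideal_gen_mull/HG.
Qed.

Lemma ideal_gen_incl (k : fieldType) (A : algType k) (G : A -> Prop) g : G g -> ideal_gen G g.
Proof. by move=> Gg; rewrite -[g]mul1r -[1 * g]mulr1 -[_ * 1]addr0; apply: ideal_genD => //; apply: ideal_gen0. Qed.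

Lemma ideal_gen_closed (k : fieldType) (A : algType k) (G P : A -> Prop) x :
  P 0 -> (forall y z, P y -> P z -> P (y + z)) -> (forall a b g, G g -> P (a * g * b)) ->
  ideal_gen G x -> P x.
Proof. by move=> P0 PD PG; elim=> [|a g b y Gg _ IH] //; apply: PD => //; apply: PG. Qed.

Lemma ideal_gen_sub (k : fieldType) (A : algType k) (G H : A -> Prop) x :
  (forall g, G g -> ideal_gen H g) -> ideal_gen G x -> ideal_gen H x.
Proof.
move=> GH; apply: ideal_gen_closed => [|y z|a b g /GH Hg]; first exact: ideal_gen0.
  exact: ideal_gen_add.
exact/ideal_gen_mulr/ideal_gen_mull.
Qed.

(* [p] identifies [S] with [A / (G)]. *)
Definition presents (k : fieldType) (A S : algType k) (p : {lrmorphism A -> S})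
    (G : A -> Prop) :=
  (forall y, exists x, y = p x) /\ forall x, p x = 0 <-> ideal_gen G x.

(** Properness of the ideal rules out the default clause of [qideal], under which the quotient by
    the unit ideal is the algebra itself. *)
Lemma quot_presents (k : fieldType) (A : algType k) (G : A -> Prop) :
  ~ ideal_gen G 1 -> presents (@quot_pi k A G : {lrmorphism _ -> _}) G.
Proof.
move=> G1; split=> [|x]; first exact: quot_piP.
rewrite -(raddf0 (@quot_pi k A G)) quot_pi_eq subr0 /qideal; split=> [/asboolP|Gx].
  by case: asboolP.
by apply/asboolP; case: asboolP.
Qed.

Section Presented.
Context (k : fieldType) (T : free_alg k).
Implicit Types (G : T -> Prop).

(** Both cofactors are expanded into words. When the generators are homogeneous, this writes the
    ideal as a span of elements of known degree, from which its graded pieces are read off. *)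
Lemma ideal_lspan G x :
  ideal_gen G x -> lspan (fun y => exists s g t, G g /\ y = word s * g * word t) x.
Proof.
apply: ideal_gen_closed => [|y z|a b g Gg]; first exact: lspan0.
  exact: lspanD.
elim/tensor_ind: a => [|c s a IHa]; first by rewrite !mul0r; apply: lspan0.
rewrite !mulrDl -!scalerAl; apply: lspanD => //; apply: lspanZ => {IHa}.
elim/tensor_ind: b => [|d t b IHb]; first by rewrite mulr0; apply: lspan0.
rewrite mulrDr -scalerAr; apply: lspanD => //; apply/lspanZ/lspan_gen.
by exists s, g, t.
Qed.

Lemma ideal_comp G d n x : (forall g, G g -> fhomog d g) -> ideal_gen G x ->
  lspan (fun y => exists s g t, [/\ G g, (size s + size t + d = n)%N & y = word s * g * word t])
    (hcomp n x).
Proof.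
move=> Gd /ideal_lspan; elim=> [|c _ y [s [g [t [Gg ->]]]] _ IH].
  by rewrite linear0; apply: lspan0.
rewrite linearP; apply: lspanD => //; apply: lspanZ.
have h : fhomog (size s + d + size t) (word s * g * word t).
  by apply: homogM; [apply: homogM; [exact: homog_word | exact: Gd] | exact: homog_word].
have [e|ne] := eqVneq (size s + d + size t)%N n.
  rewrite homog_comp -?e //; apply: lspan_gen; exists s, g, t; split=> //.
  by rewrite addnAC.
by rewrite (homog_comp0 h) //; apply: lspan0.
Qed.

Lemma ideal_gen_comp G d n x : (forall g, G g -> fhomog d g) -> ideal_gen G x ->
  ideal_gen G (hcomp n x).
Proof.
move=> Gd /(ideal_comp n Gd); apply: lspan_ideal => _ [s [g [t [Gg _ ->]]]].
exact/ideal_gen_mulr/ideal_gen_mull/ideal_gen_incl.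
Qed.

Lemma ideal_small G d n x : (forall g, G g -> fhomog d g) -> (n < d)%N ->
  fhomog n x -> ideal_gen G x -> x = 0.
Proof.
move=> Gd lt /homog_comp {2}<- /(ideal_comp n Gd); elim=> [//|c g y [s [h [t [_ e _]]]]].
by rewrite -e ltnNge leq_addl in lt.
Qed.

Lemma ideal_deg G d x : (forall g, G g -> fhomog d g) ->
  fhomog d x -> ideal_gen G x -> lspan G x.
Proof.
move=> Gd /homog_comp {2}<- /(ideal_comp d Gd); apply: lspan_sub => _ [s [g [t [Gg e ->]]]].
have : (size s + size t == 0)%N by rewrite -(eqn_add2r d) e.
by rewrite addn_eq0 !size_eq0 => /andP[/eqP-> /eqP->]; rewrite word_nil mul1r mulr1; apply: lspan_gen.
Qed.

(** In degree [d.+1] one of the two words has a single letter and the other is empty. *)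
Lemma ideal_degS G d x : (forall g, G g -> fhomog d g) ->
  fhomog d.+1 x -> ideal_gen G x ->
  lspan (fun y => exists i g, G g /\ (y = fa_gen T i * g \/ y = g * fa_gen T i)) x.
Proof.
move=> Gd /homog_comp {2}<- /(ideal_comp d.+1 Gd); apply: lspan_sub => _ [s [g [t [Gg e ->]]]].
have : (size s + size t == 1)%N by rewrite -(eqn_add2r d) e.
case: s t {e} => [|i [|? ?]] [|j [|? ?]] // _; rewrite word_nil word1 ?mul1r ?mulr1; apply: lspan_gen.
  by exists j, g; split=> //; right.
by exists i, g; split=> //; left.
Qed.

Lemma ideal_no1 G d : (forall g, G g -> fhomog d.+1 g) -> ~ ideal_gen G 1.
Proof. by move=> Gd /(ideal_small Gd (ltn0Sn d) (@homog_1 _ T)) /eqP; rewrite oner_eq0. Qed.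

Section Grading.
Variables (S : algType k) (p : {lrmorphism T -> S}) (G : T -> Prop) (d : nat).
Hypotheses (pG : presents p G) (Gd : forall g, G g -> fhomog d.+1 g).

Definition pgr n (x : S) := exists t, fhomog n t /\ x = p t.

Lemma pgr0 n : pgr n 0.
Proof. by exists 0; rewrite linear0; split=> //; apply: homog0. Qed.

Lemma pgrP n a x y : pgr n x -> pgr n y -> pgr n (a *: x + y).
Proof.
move=> [s [hs ->]] [t [ht ->]]; exists (a *: s + t); rewrite linearP; split=> //.
exact: homogP.
Qed.

Lemma pgrM m n x y : pgr m x -> pgr n y -> pgr (m + n) (x * y).
Proof.
move=> [s [hs ->]] [t [ht ->]]; exists (s * t); rewrite rmorphM; split=> //.
exact: homogM.
Qed.

(** The ideal contains the components of its elements, so a vanishing sum of images vanishes term by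
    term. *)
Lemma presents_indep n (t : nat -> T) : (forall i, fhomog i (t i)) ->
  \sum_(i < n) p (t i) = 0 -> forall i, (i < n)%N -> p (t i) = 0.
Proof.
move=> ht; rewrite -linear_sum => /(proj2 pG) h i lt; apply/(proj2 pG).
have := ideal_gen_comp i Gd h; rewrite linear_sum (bigD1 (Ordinal lt)) //=.
rewrite homog_comp // big1 ?addr0 // => j ne; apply: (homog_comp0 (ht j)).
by apply: contraNneq ne => e; apply/eqP/val_inj.
Qed.

Lemma pgr_indep n (c : nat -> S) : (forall i, pgr i (c i)) ->
  \sum_(i < n) c i = 0 -> forall i, (i < n)%N -> c i = 0.
Proof.
move=> /choice[t ht]; under eq_bigr do rewrite (ht _).2.
by move=> h i lt; rewrite (ht i).2; apply: (presents_indep _ h) => // j; exact: (ht j).1.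
Qed.

Lemma pgr_dec x : exists n (c : nat -> S), (forall i, pgr i (c i)) /\ x = \sum_(i < n) c i.
Proof.
have [t ->] := proj1 pG x; have [n e] := comp_sum t.
exists n, (fun i => p (hcomp i t)); split=> [i|]; last by rewrite {1}e linear_sum.
by exists (hcomp i t); split=> //; apply: comp_homog.
Qed.

Lemma presents_connected : connected_graded pgr.
Proof.
split; [|exact: pgrM|exact: pgr_dec|exact: pgr_indep|].
  by move=> n; split; [exact: pgr0 | exact: pgrP].
move=> x; split=> [[t [/homog0E -> ->]]|[a ->]].
  by exists (fa_coef [::] t); rewrite linearZ rmorph1.
by exists a%:A; rewrite linearZ rmorph1; split=> //; apply/homogZ/homog_1.
Qed.

End Grading.

(** The second ideal lives in [S]. Its elements are lifted to [T] cofactor by cofactor, and two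
    lifts of the same element differ by the first ideal. *)
Lemma presents_comp (S A : algType k) (p : {lrmorphism T -> S}) (q : {lrmorphism S -> A})
    G f : presents p G -> presents q (fun y => y = p f) ->
  presents (q \o p : {lrmorphism T -> A}) (fun x => G x \/ x = f).
Proof.
move=> [ps pk] [qs qk]; split=> [y|x].
  by have [z ->] := qs y; have [x ->] := ps z; exists x.
rewrite /= qk; split=> [h|].
  suff [t [et ht]] : exists t, p t = p x /\ ideal_gen (fun z => G z \/ z = f) t.
    rewrite -[x](subrK t); apply: (ideal_gen_add _ ht).
    have : p (x - t) = 0 by rewrite linearB /= et subrr.
    by move/pk; apply: ideal_gen_sub => g Gg; apply: ideal_gen_incl; left.
  apply: (ideal_gen_closed (P := fun y => exists t, p t = y /\ _ t) _ _ _ h) => [|y z|a b _ ->].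
  - by exists 0; rewrite linear0; split=> //; apply: ideal_gen0.
  - move=> [s [<- hs]] [t [<- ht]]; exists (s + t); rewrite linearD; split=> //.
    exact: ideal_gen_add.
  have [a' ->] := ps a; have [b' ->] := ps b; exists (a' * f * b'); rewrite !rmorphM.
  by split=> //; apply/ideal_gen_mulr/ideal_gen_mull/ideal_gen_incl; right.
apply: (ideal_gen_closed (P := fun x => ideal_gen _ (p x))) => [|y z|a b g [Gg|->]].
- by rewrite linear0; apply: ideal_gen0.
- by rewrite linearD; apply: ideal_gen_add.
- have /pk pg : ideal_gen G g by apply: ideal_gen_incl.
  by rewrite !rmorphM /= pg mulr0 mul0r; apply: ideal_gen0.
by rewrite !rmorphM; apply/ideal_gen_mulr/ideal_gen_mull/ideal_gen_incl.
Qed.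

End Presented.

(** * The tensor algebra as an instance of a free algebra *)

Section TensorAlgebra.
Context (k : fieldType).
Local Notation T := (tensor_alg k).

Lemma tensor_word s : \prod_(i <- s) tgen k i = << FMonom s >> :> T.
Proof.
elim: s => [|i s IH]; first by rewrite big_nil -fmoneE.
rewrite big_cons IH /tgen fmuE.
apply: etrans (fgmulUU 1 1 (FMonom [:: i]) (FMonom s)) _.
by rewrite mulr1; congr (<< _ >>); apply/eqP; rewrite fmP fmM.
Qed.

Lemma tensor_coefU (s t : seq 'I_3) : (<< FMonom t >> : T)@_(FMonom s) = (t == s)%:R.
Proof. by rewrite mcoeffU1 fmP. Qed.

Fact tensor_coef_linear (s : seq 'I_3) c (x y : T) :
  (c *: x + y)@_(FMonom s) = c * x@_(FMonom s) + y@_(FMonom s).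
Proof. by rewrite (mcoeffD (FMonom s) (c *: x) y) (mcoeffZ c x). Qed.

Fact tensor_coef_word (s t : seq 'I_3) :
  (\prod_(i <- t) tgen k i : T)@_(FMonom s) = (t == s)%:R.
Proof. by rewrite tensor_word tensor_coefU. Qed.

Fact tensor_sum (x : T) : x = \sum_(m <- msupp x) x@_m *: (<< m >> : T).
Proof.
rewrite [LHS]monalgE; apply: eq_bigr => m _; apply/malgP => m'.
by rewrite mcoeffU (mcoeffZ x@_m << m >>) mcoeffU1 mulr_natr.
Qed.

Fact tensor_lspan (x : T) : lspan (fun y => exists s, y = \prod_(i <- s) tgen k i) x.
Proof.
rewrite (tensor_sum x); apply: lspan_sum => m _; apply/lspanZ/lspan_gen.
by exists m; rewrite tensor_word fmK.
Qed.

Fact tensor_ext (x : T) : (forall s, x@_(FMonom s) = 0) -> x = 0.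
Proof. by move=> H; apply/malgP => m; rewrite -(fmK m) H mcoeff0. Qed.

Section LinearExtension.
Context (V : lmodType k) (g : seq 'I_3 -> V).

Definition tensor_lext (x : T) : V := \sum_(m <- msupp x) x@_m *: g m.

Lemma tensor_lextEw (d : {fset {fmonom 'I_3}}) (x : T) : (msupp x `<=` d)%fset ->
  tensor_lext x = \sum_(m <- d) x@_m *: g m.
Proof.
move=> le; apply: big_fset_incl => // m _ /mcoeff_outdom ->.
by rewrite scale0r.
Qed.

Fact tensor_lext_linear : linear tensor_lext.
Proof.
move=> c x y; pose d := (msupp (c *: x + y) `|` (msupp x `|` msupp y))%fset.
rewrite !(@tensor_lextEw d) ?fsubsetUl // /d.
- rewrite scaler_sumr -big_split; apply: eq_bigr => m _.
  by rewrite -[m]fmK tensor_coef_linear scalerDl scalerA.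
- by apply: fsubsetU; rewrite fsubsetUr orbT.
- by apply: fsubsetU; rewrite fsubsetUl orbT.
Qed.

HB.instance Definition _ := GRing.isLinear.Build k T V *:%R tensor_lext tensor_lext_linear.

Fact tensor_lext_word : {h : {linear T -> V} | forall s, h (\prod_(i <- s) tgen k i) = g s}.
Proof.
exists tensor_lext => s; rewrite tensor_word /=.
rewrite (@tensor_lextEw [fset FMonom s]%fset) ?msuppU_le //.
by rewrite big_seq_fset1 tensor_coefU eqxx scale1r.
Qed.

End LinearExtension.

Definition tensor_free : free_alg k :=
  FreeAlg tensor_coef_linear tensor_coef_word tensor_lspan tensor_ext tensor_lext_word.

Lemma homog_tensor : @fhomog k tensor_free = @homog k.
Proof.
apply/funext => n; apply/funext => x; apply/propext; split=> h m; first by rewrite -(fmK m) => /h.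
by move=> /(h (FMonom m)).
Qed.

End TensorAlgebra.

(** * A Hilbert basis theorem for skew extensions *)

Section SkewHilbertBasis.
Context (R : nzRingType).
Implicit Types (A I : R -> Prop).

Record subring A : Prop := Subring {
  subring1 : A 1;
  subringB : forall x y, A x -> A y -> A (x - y);
  subringM : forall x y, A x -> A y -> A (x * y) }.

Lemma subring0 A : subring A -> A 0.
Proof. by case=> A1 AB _; rewrite -(subrr 1); apply: AB. Qed.

Lemma subringN A x : subring A -> A x -> A (- x).
Proof. by move=> sA Ax; rewrite -sub0r; apply: (subringB sA) => //; apply: subring0. Qed.

Lemma subringD A x y : subring A -> A x -> A y -> A (x + y).
Proof. by move=> sA Ax Ay; rewrite -[y]opprK; apply: (subringB sA) => //; apply: subringN. Qed.

Lemma subringX A x n : subring A -> A x -> A (x ^+ n).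
Proof.
move=> sA Ax; elim: n => [|n IH]; first exact: subring1.
by rewrite exprS; apply: (subringM sA).
Qed.

Inductive lcomb A (gs : seq R) : R -> Prop :=
| lcomb0 : lcomb A gs 0
| lcombS a g x : A a -> g \in gs -> lcomb A gs x -> lcomb A gs (a * g + x).

Lemma lcombD A gs x y : lcomb A gs x -> lcomb A gs y -> lcomb A gs (x + y).
Proof.
elim=> [|a g z Aa gg _ IH] hy; first by rewrite add0r.
by rewrite -addrA; apply: lcombS => //; apply: IH.
Qed.

Lemma lcomb_sub A A' gs gs' x : (forall a, A a -> A' a) -> {subset gs <= gs'} ->
  lcomb A gs x -> lcomb A' gs' x.
Proof.
move=> AA' gg'; elim=> [|a g y Aa gg _ IH]; first exact: lcomb0.
by apply: lcombS => //; [apply: AA' | apply: gg'].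
Qed.

(** Ideals of a subset [A] of a fixed ambient ring: iterated extensions stay inside one ring and
    need no new types. *)
Definition lideal A I : Prop :=
  [/\ forall x, I x -> A x, I 0 & forall a x y, A a -> I x -> I y -> I (a * x + y)].

Definition subnoetherian A : Prop := forall I, lideal A I ->
  exists gs : seq R, (forall g, g \in gs -> I g) /\ forall x, I x -> lcomb A gs x.

Lemma lideal_lcomb A I gs x : lideal A I -> (forall g, g \in gs -> I g) ->
  lcomb A gs x -> I x.
Proof. by case=> IA I0 IP hg; elim=> // a g y Aa /hg Ig _; apply: IP. Qed.

Lemma subnoetherian_field A : subring A ->
  (forall a, A a -> a != 0 -> exists2 b, A b & b * a = 1) -> subnoetherian A.
Proof.
move=> sA inv I [IA I0 IP].
have [[a [Ia a0]]|no] := pselect (exists a, I a /\ a != 0).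
  have [b Ab ba] := inv a (IA _ Ia) a0.
  exists [:: a]; split=> [g|x Ix]; first by rewrite inE => /eqP ->.
  rewrite -[x]mulr1 -ba mulrA -[_ * a]addr0; apply: lcombS; last exact: lcomb0.
    by apply: (subringM sA) => //; apply: IA.
  by rewrite inE.
exists [::]; split=> // x Ix; suff -> : x = 0 by apply: lcomb0.
by apply/eqP; apply: contrapT => /negP x0; apply: no; exists x.
Qed.

Section Step.
Variables (A : R -> Prop) (z : R).
Hypotheses (sA : subring A).
Hypothesis skew : forall a, A a -> exists a1 a2, [/\ A a1, A a2 & a * z = z * a1 + a2].
Hypothesis skew_surj : forall a1, A a1 -> exists a a2, [/\ A a, A a2 & a * z = z * a1 + a2].

(** These are the polynomials in [z] of degree less than [n], with coefficients on the right.
    Coefficients need not be unique: [z] is not assumed free over [A], and the twist is a relation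
    rather than a function. *)
Inductive below : nat -> R -> Prop :=
| below0 : below 0 0
| belowS n a x : A a -> below n x -> below n.+1 (z ^+ n * a + x).

Definition polys x := exists n, below n x.

Lemma below_zero n : below n 0.
Proof.
elim: n => [|n IH]; first exact: below0.
by rewrite -(addr0 0) -[X in X + _](mulr0 (z ^+ n)); apply: belowS => //; apply: subring0.
Qed.

Lemma belowW n x : below n x -> below n.+1 x.
Proof.
by move=> h; rewrite -[x]add0r -[0](mulr0 (z ^+ n)); apply: belowS => //; apply: subring0.
Qed.

Lemma below_le n m x : (n <= m)%N -> below n x -> below m x.
Proof.
move=> le h; rewrite -(subnKC le); elim: (m - n)%N => [|d IH]; first by rewrite addn0.
by rewrite addnS; apply: belowW.
Qed.

Lemma belowB n x y : below n x -> below n y -> below n (x - y).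
Proof.
move=> h; elim: h y => [y hy|m a x' Aa _ IH y hy].
  by inversion hy; rewrite subr0; apply: below0.
inversion hy as [|m' b y' Ab hy' e1 e2]; subst.
rewrite opprD addrACA -mulrBr; apply: belowS; first exact: (subringB sA).
exact: IH.
Qed.

Lemma belowD n x y : below n x -> below n y -> below n (x + y).
Proof.
move=> hx hy; rewrite -[y]opprK; apply: belowB => //; rewrite -sub0r.
by apply: belowB => //; apply: below_zero.
Qed.

Lemma below_mono n a : A a -> below n.+1 (z ^+ n * a).
Proof. by move=> Aa; rewrite -[_ * a]addr0; apply: belowS => //; apply: below_zero. Qed.

Lemma below_mulr n x a : A a -> below n x -> below n (x * a).
Proof.
move=> Aa; elim=> [|m b y Ab _ IH]; first by rewrite mul0r; apply: below0.
by rewrite mulrDl -mulrA; apply: belowS => //; apply: (subringM sA).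
Qed.

Lemma below_zl n x : below n x -> below n.+1 (z * x).
Proof.
elim=> [|m b y Ab _ IH]; first by rewrite mulr0; apply: below_zero.
by rewrite mulrDr mulrA -exprS; apply: belowS.
Qed.

Lemma below_zXl n m x : below n x -> below (m + n) (z ^+ m * x).
Proof.
move=> h; elim: m => [|m IH]; first by rewrite mul1r.
by rewrite exprS -mulrA addSn; apply: below_zl.
Qed.

Lemma below_zr n x : below n x -> below n.+1 (x * z).
Proof.
elim=> [|m b y Ab _ IH]; first by rewrite mul0r; apply: below_zero.
have [b1 [b2 [Ab1 Ab2 e]]] := skew Ab.
rewrite mulrDl -mulrA e mulrDr mulrA -exprSr -addrA; apply: belowS => //.
by apply: belowD => //; apply: below_mono.
Qed.

(** Moving a coefficient through [z ^+ n] twists it once per factor and otherwise produces only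
    terms of lower degree. *)
Lemma skewX a n : A a -> exists a1 r, [/\ A a1, below n r & a * z ^+ n = z ^+ n * a1 + r].
Proof.
move=> Aa; elim: n => [|n [a1 [r [Aa1 hr e]]]].
  by exists a, 0; split=> //; [apply: below0 | rewrite mulr1 mul1r addr0].
have [b1 [b2 [Ab1 Ab2 eb]]] := skew Aa1.
exists b1, (z ^+ n * b2 + r * z); split=> //.
  by apply: belowD; [apply: below_mono | apply: below_zr].
by rewrite exprSr mulrA e mulrDl -mulrA eb mulrDr !mulrA -exprSr addrA.
Qed.

Lemma skewX_surj a1 n : A a1 ->
  exists a r, [/\ A a, below n r & a * z ^+ n = z ^+ n * a1 + r].
Proof.
elim: n a1 => [|n IH] a1 Aa1.
  by exists a1, 0; split=> //; [apply: below0 | rewrite mulr1 mul1r addr0].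
have [b [b2 [Ab Ab2 eb]]] := skew_surj Aa1; have [a [r [Aa hr e]]] := IH _ Ab.
exists a, (z ^+ n * b2 + r * z); split=> //.
  by apply: belowD; [apply: below_mono | apply: below_zr].
by rewrite exprSr mulrA e mulrDl -mulrA eb mulrDr !mulrA -exprSr addrA.
Qed.

Lemma below_mull n x a : A a -> below n x -> below n (a * x).
Proof.
move=> Aa; elim=> [|m b y Ab _ IH]; first by rewrite mulr0; apply: below0.
have [a1 [r [Aa1 hr e]]] := skewX m Aa.
rewrite mulrDr mulrA e mulrDl -mulrA -addrA; apply: belowS.
  exact: (subringM sA).
by apply: belowD => //; apply: below_mulr.
Qed.

Lemma polysA a : A a -> polys a.
Proof. by move=> Aa; exists 1%N; rewrite -[a]mul1r -(expr0 z); apply: below_mono. Qed.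

Lemma polys_z : polys z.
Proof. by exists 2%N; rewrite -[z]mulr1 -{1}(expr1 z); apply: below_mono; apply: subring1. Qed.

Lemma polysM n x y : below n x -> polys y -> polys (x * y).
Proof.
move=> + [m hy]; elim=> {n x} [|n a x Aa _ [p IH]].
  by rewrite mul0r; exists 0%N; apply: below0.
exists (n + m + p)%N; rewrite mulrDl -mulrA; apply: belowD; last exact: below_le (leq_addl _ _) IH.
apply: below_le (leq_addr _ _) _; apply: below_zXl.
exact: below_mull.
Qed.

Lemma polys_subring : subring polys.
Proof.
split; first exact/polysA/(subring1 sA).
  move=> x y [n hx] [m hy]; exists (maxn n m); apply: belowB.
    exact: below_le (leq_maxl _ _) hx.
  exact: below_le (leq_maxr _ _) hy.
by move=> x y [n hx]; apply: polysM hx.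
Qed.

Section Ideal.
Variable I : R -> Prop.
Hypothesis idI : lideal polys I.

(** The leading coefficients of [I] in degree [n], zero included. Working up to [below n] avoids any
    choice of normal form. *)
Definition lead n a := A a /\ exists2 x, I x & below n (x - z ^+ n * a).

Lemma idealM a x : polys a -> I x -> I (a * x).
Proof. by case: idI => _ I0 IP pa Ix; rewrite -[_ * x]addr0; apply: IP. Qed.

Lemma idealD x y : I x -> I y -> I (x + y).
Proof.
case: idI => _ I0 IP Ix Iy; rewrite -[x]mul1r; apply: IP => //.
exact: (subring1 polys_subring).
Qed.

Lemma idealN x : I x -> I (- x).
Proof.
move=> Ix; rewrite -mulN1r; apply: idealM => //.
by apply: subringN; [exact: polys_subring | exact: subring1 polys_subring].
Qed.

Lemma leadS n a : lead n a -> lead n.+1 a.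
Proof.
case=> Aa [x Ix h]; split=> //; exists (z * x); first exact/idealM/Ix/polys_z.
by rewrite exprS -mulrA -mulrBr; apply: below_zl.
Qed.

Lemma lead_le n m a : (n <= m)%N -> lead n a -> lead m a.
Proof.
move=> le h; rewrite -(subnKC le); elim: (m - n)%N => [|d IH]; first by rewrite addn0.
by rewrite addnS; apply: leadS.
Qed.

(* Where surjectivity of the twist is used: the multiplier of the lift is a
   preimage of [c] under it. *)
Lemma lead_lift n c a x : A c -> A a -> I x -> below n (x - z ^+ n * a) ->
  exists2 b, A b & below n (b * x - z ^+ n * (c * a)).
Proof.
move=> Ac Aa Ix h; have [b [r [Ab hr e]]] := skewX_surj n Ac.
exists b => //; rewrite (_ : _ - _ = b * (x - z ^+ n * a) + r * a).
  by apply: belowD; [apply: below_mull | apply: below_mulr].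
by rewrite mulrBr !mulrA e mulrDl opprD !addrA subrK.
Qed.

Lemma lead_lideal n : lideal A (lead n).
Proof.
split; first by move=> x [].
  split; first exact: subring0.
  by exists 0; [case: idI | rewrite mulr0 subrr; apply: below_zero].
move=> c a b Ac [Aa [x Ix hx]] [Ab [y Iy hy]]; split.
  by apply: subringD => //; apply: (subringM sA).
have [d Ad hd] := lead_lift Ac Aa Ix hx.
exists (d * x + y).
  by apply: idealD => //; apply: idealM => //; apply: polysA.
by rewrite mulrDr opprD addrACA; apply: belowD.
Qed.

Lemma lead_union : lideal A (fun a => exists n, lead n a).
Proof.
split; first by move=> x [n []].
  by exists 0%N; case: (lead_lideal 0).
move=> c a b Ac [n ha] [m hb]; exists (maxn n m).
by case: (lead_lideal (maxn n m)) => _ _; apply=> //;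
  [exact: lead_le (leq_maxl _ _) ha | exact: lead_le (leq_maxr _ _) hb].
Qed.

Hypothesis nA : subnoetherian A.

(** The increasing union of the leading ideals is finitely generated, and each generator already
    occurs at a finite level; the largest of these levels works. *)
Lemma lead_bound : exists N, forall n a, lead n a -> lead N a.
Proof.
have [gs [hg hs]] := nA lead_union.
suff [N hN] : exists N, forall g, g \in gs -> lead N g.
  exists N => n a h; apply: (lideal_lcomb (lead_lideal N) hN).
  by apply: hs; exists n.
elim: gs hg {hs} => [|g gs IH] hg; first by exists 0%N.
have [N hN] := IH (fun x hx => hg x (mem_behead (s := g :: gs) hx)).
have [n hn] := hg g (mem_head _ _).
exists (maxn n N) => x; rewrite inE => /predU1P[->|/hN h].
  exact: lead_le (leq_maxl _ _) hn.
exact: lead_le (leq_maxr _ _) h.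
Qed.

(** It is enough to lift the generators of [lead n] to elements of [I]: by [lead_lift] their
    combinations lift as well. *)
Lemma lead_gens n : exists gs : seq R, (forall g, g \in gs -> I g) /\
  forall a, lead n a -> exists2 y, lcomb A gs y & below n (y - z ^+ n * a).
Proof.
have [gs [hg hs]] := nA (lead_lideal n).
suff [xs [hx hxs]] : exists xs : seq R, (forall x, x \in xs -> I x) /\
    forall g, g \in gs -> exists2 x, x \in xs & below n (x - z ^+ n * g).
  exists xs; split=> // a /hs; elim=> [|c g y Ac gg _ [y' hy' hb]].
    exists 0; first exact: lcomb0.
    by rewrite mulr0 subrr; apply: below_zero.
  have [x xx hxb] := hxs _ gg; have [Ag _] := hg _ gg.
  have [d Ad hd] := lead_lift Ac Ag (hx _ xx) hxb.
  exists (d * x + y'); first exact: lcombS.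
  by rewrite mulrDr opprD addrACA; apply: belowD.
elim: gs hg {hs} => [|g gs IH] hg; first by exists [::].
have [xs [hx hxs]] := IH (fun x hx => hg x (mem_behead (s := g :: gs) hx)).
have [Ag [x Ix hb]] := hg g (mem_head _ _).
exists (x :: xs); split=> [y|y]; first by rewrite inE => /predU1P[->|/hx].
rewrite inE => /predU1P[->|/hxs[w ww hw]]; first by exists x => //; apply: mem_head.
by exists w => //; rewrite inE ww orbT.
Qed.

Lemma ideal_gens : exists gs : seq R,
  (forall g, g \in gs -> I g) /\ forall x, I x -> lcomb polys gs x.
Proof.
have [N hN] := lead_bound.
(* One finite list serves the leading ideals of all degrees up to the stable level [N]. *)
have [gs [hg hgs]] : exists gs : seq R, (forall g, g \in gs -> I g) /\
    forall n a, (n <= N)%N -> lead n a -> exists2 y, lcomb A gs y & below n (y - z ^+ n * a).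
  elim: (N) => [|M [gs [hg hgs]]].
    have [gs [hg hgs]] := lead_gens 0; exists gs; split=> // n a.
    by rewrite leqn0 => /eqP ->; apply: hgs.
  have [gs' [hg' hgs']] := lead_gens M.+1; exists (gs ++ gs'); split=> [g|n a].
    by rewrite mem_cat => /orP[/hg|/hg'].
  rewrite leq_eqVlt => /predU1P[-> /hgs'|le /(hgs _ _ le)] [y hy hb]; exists y => //;
    by apply: lcomb_sub hy => // g gg; rewrite mem_cat gg ?orbT.
exists gs; split=> // x Ix; have [IB _ _] := idI; have [n hn] := IB _ Ix.
elim: n => [|n IH] in x Ix hn *; first by inversion hn; apply: lcomb0.
inversion hn as [|m a y Aa hy e1 e2]; subst.
have la : lead n a by split=> //; exists (z ^+ n * a + y) => //; rewrite addrAC subrr add0r.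
(* Division: subtracting a combination [u] of the generators removes the top term. *)
suff [u [hu hb]] : exists u, lcomb polys gs u /\ below n (u - z ^+ n * a).
  have Iu : I u by apply: (lideal_lcomb idI) hu.
  rewrite -[_ + y](subrK u) addrC; apply: lcombD => //; apply: IH.
    by apply: idealD => //; apply: idealN.
  by rewrite (_ : _ - u = y - (u - z ^+ n * a)); [apply: belowB | rewrite opprB addrCA addrA].
have [le|lt] := leqP n N.
  have [u hu hb] := hgs _ _ le la; exists u; split=> //.
  by apply: lcomb_sub hu => // b; apply: polysA.
(* Beyond [N] the leading coefficient already occurs at level [N]; the approximation found there is
   multiplied by [z ^+ (n - N)]. *)
have [u hu hb] := hgs _ _ (leqnn N) (hN _ _ la); exists (z ^+ (n - N) * u); split.
  elim: hu {hb} => [|b g w Ab gg _ IHu]; first by rewrite mulr0; apply: lcomb0.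
  rewrite mulrDr mulrA; apply: lcombS => //.
  apply: (subringM polys_subring); last exact: polysA.
  exact: (subringX _ polys_subring polys_z).
have -> : z ^+ n = z ^+ (n - N) * z ^+ N by rewrite -exprD subnK // ltnW.
rewrite -mulrA -mulrBr -{1}(subnK (ltnW lt)).
exact: below_zXl.
Qed.

End Ideal.

Lemma subnoetherian_polys : subnoetherian A -> subnoetherian polys.
Proof. by move=> nA I idI; apply: ideal_gens. Qed.

End Step.

Lemma lcomb_index A gs x : A 0 -> (forall a b, A a -> A b -> A (a + b)) -> lcomb A gs x ->
  exists c : 'I_(size gs) -> R, x = \sum_i c i * gs`_i.
Proof.
move=> A0 AD; elim=> [|a g y _ gg _ [c ->]].
  by exists (fun=> 0); rewrite big1 // => i _; rewrite mul0r.
move: gg; rewrite -index_mem => lt.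
exists (fun i => (if i == Ordinal lt then a else 0) + c i).
under [RHS]eq_bigr do rewrite mulrDl; rewrite big_split /=; congr (_ + _).
rewrite (bigD1 (Ordinal lt)) //= eqxx nth_index -?index_mem // big1 ?addr0 //.
by move=> i /negPf ->; rewrite mul0r.
Qed.

Lemma subnoetherian_left A : (forall x, A x) -> subnoetherian A -> left_noetherian R.
Proof.
move=> Aall nA I I0 IP; have idI : lideal A I by split=> // a x y _; apply: IP.
have [gs [hg hs]] := nA _ idI; exists (size gs), (fun i => gs`_i) => x; split.
  by move=> /hs; apply: lcomb_index.
move=> [c ->]; elim/big_rec: _ => // i y _ Iy; apply: IP => //.
exact/hg/mem_nth.
Qed.

Section ThreeSteps.
Variables (K : R -> Prop) (x y z al ga : R).
Hypotheses (sK : subring K) (Kinv : forall a, K a -> a != 0 -> exists2 b, K b & b * a = 1).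
Hypotheses (Kal : K al) (Kga : K ga) (Kcomm : forall a b, K a -> a * b = b * a).
Hypotheses (yx : y * x = - (x * y)) (zx : z * x = - (x * z) - ga * y ^+ 2)
  (zy : z * y = - (y * z) - al * x ^+ 2).
Hypothesis gen : forall P, subring P -> (forall a, K a -> P a) -> P x -> P y -> P z ->
  forall r, P r.

Let A1 := polys K x.
Let A2 := polys A1 y.
Let A3 := polys A2 z.

(** Both commutation requirements of one extension step, at a single element. The elements that
    satisfy them form a subring, so a step is checked on generators only. *)
Definition skew_at (A : R -> Prop) (t a : R) :=
  [/\ A a, exists a1 a2, [/\ A a1, A a2 & a * t = t * a1 + a2]
    & exists b a2, [/\ A b, A a2 & b * t = t * a + a2]].

Lemma skew_at_subring A t : subring A -> subring (skew_at A t).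
Proof.
move=> sA; have [A1' AB AM] := sA; have A0 := subring0 sA.
split.
- by split=> //; exists 1, 0; rewrite mulr1 mul1r addr0.
- move=> a b [Aa [a1 [a2 [h1 h2 e]]] [a' [a2' [h1' h2' e']]]].
  move=> [Ab [b1 [b2 [k1 k2 f]]] [b' [b2' [k1' k2' f']]]]; split; first exact: AB.
    exists (a1 - b1), (a2 - b2); split; try exact: AB.
    by rewrite mulrBl e f mulrBr opprD addrACA.
  exists (a' - b'), (a2' - b2'); split; try exact: AB.
  by rewrite mulrBl e' f' mulrBr opprD addrACA.
move=> a b [Aa [a1 [a2 [h1 h2 e]]] [a' [a2' [h1' h2' e']]]].
move=> [Ab [b1 [b2 [k1 k2 f]]] [b' [b2' [k1' k2' f']]]]; split; first exact: AM.
  exists (a1 * b1), (a2 * b1 + a * b2); split; [exact: AM | |].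
    by apply: (subringD sA); apply: AM.
  by rewrite -mulrA f mulrDr mulrA e mulrDl -!mulrA addrA.
exists (a' * b'), (a2' * b + a' * b2'); split; [exact: AM | |].
  by apply: (subringD sA); apply: AM.
by rewrite -mulrA f' mulrDr mulrA e' mulrDl -!mulrA addrA.
Qed.

Lemma skew_at_comm A t a : subring A -> A a -> a * t = t * a -> skew_at A t a.
Proof.
move=> sA Aa e; have A0 := subring0 sA.
by split=> //; exists a, 0; rewrite e addr0.
Qed.

(** The twist sends [a] to [- a]; being an involution, it also gives the surjectivity half. *)
Lemma skew_at_anti A t a b : subring A -> A a -> A b -> a * t = - (t * a) - b -> skew_at A t a.
Proof.
move=> sA Aa Ab e; split=> //.
  by exists (- a), (- b); rewrite mulrN; split=> //; apply: subringN.
exists (- a), b; split=> //; first exact: subringN.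
by rewrite mulNr e opprB opprK addrC.
Qed.

Lemma skew_atP A t : (forall a, A a -> skew_at A t a) ->
  (forall a, A a -> exists a1 a2, [/\ A a1, A a2 & a * t = t * a1 + a2]) /\
  (forall a1, A a1 -> exists a a2, [/\ A a, A a2 & a * t = t * a1 + a2]).
Proof. by move=> h; split=> a /h[]. Qed.

Lemma polys_ind A t P : subring A -> subring P -> (forall a, A a -> P a) -> P t ->
  forall a, polys A t a -> P a.
Proof.
move=> sA sP AP Pt a [n]; elim=> [|m b r /AP Pb _ Pr]; first exact: subring0.
by apply: subringD => //; apply: (subringM sP) => //; apply: subringX.
Qed.

(** The chain is K, K[x], K[x][y], K[x][y][z]. Each new variable anticommutes with the earlier
    generators up to an element of the subring built before it. *)
Lemma quantum_left_noetherian : left_noetherian R.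
Proof.
have [s1 s1'] := skew_atP (fun a Ka => skew_at_comm (t := x) sK Ka (Kcomm _ Ka)).
have sA1 : subring A1 by apply: polys_subring.
have K1 a : K a -> A1 a by move=> Ka; apply: polysA.
have A1x : A1 x by apply: polys_z.
have sk2 a : A1 a -> skew_at A1 y a.
  apply: polys_ind => //; first exact: skew_at_subring.
    by move=> b Kb; apply: skew_at_comm => //; [apply: K1 | apply: Kcomm].
  apply: (skew_at_anti (b := 0)) => //; first exact: subring0.
  by rewrite yx opprK subr0.
have [s2 s2'] := skew_atP sk2.
have sA2 : subring A2 by apply: polys_subring.
have K2 a : A1 a -> A2 a by move=> Ka; apply: polysA.
have A2y : A2 y by apply: polys_z.
have A2x : A2 x by apply: K2.
have K2' a : K a -> A2 a by move=> Ka; apply/K2/K1.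
have sk3 a : A2 a -> skew_at A2 z a.
  apply: polys_ind => //; first exact: skew_at_subring.
    apply: polys_ind => //; first exact: skew_at_subring.
      by move=> b Kb; apply: skew_at_comm => //; [apply: K2' | apply: Kcomm].
    apply: (skew_at_anti (b := ga * y ^+ 2)) => //.
      by apply: (subringM sA2); [apply: K2' | apply: subringX].
    by rewrite zx opprB opprK addrAC subrr add0r.
  apply: (skew_at_anti (b := al * x ^+ 2)) => //.
    by apply: (subringM sA2); [apply: K2' | apply: subringX].
  by rewrite zy opprB opprK addrAC subrr add0r.
have [s3 s3'] := skew_atP sk3.
have sA3 : subring A3 by apply: polys_subring.
have K3 a : A2 a -> A3 a by move=> Ka; apply: polysA.
apply: (@subnoetherian_left A3).
  apply: gen => //; try exact: K3; last exact: polys_z.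
  by move=> a Ka; apply/K3/K2'.
by do 3!apply: subnoetherian_polys => //; apply: subnoetherian_field.
Qed.

End ThreeSteps.

End SkewHilbertBasis.

(** * Free modules and bases of vector spaces *)

Section FreeModule.
Context (R : nzRingType) (B : choiceType) (N : lmodType R).
Local Notation F := {malg R[B]}.

Definition mext (g : B -> N) (x : F) : N := \sum_(b <- msupp x) x@_b *: g b.

Lemma mextEw (g : B -> N) (d : {fset B}) (x : F) : (msupp x `<=` d)%fset ->
  mext g x = \sum_(b <- d) x@_b *: g b.
Proof.
move=> le; apply: big_fset_incl => // m _ /mcoeff_outdom ->.
by rewrite scale0r.
Qed.

Fact mext_linear (g : B -> N) : linear (mext g).
Proof.
move=> c x y; pose d := (msupp (c *: x + y) `|` (msupp x `|` msupp y))%fset.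
rewrite !(@mextEw _ d) ?fsubsetUl // /d.
- rewrite scaler_sumr -big_split; apply: eq_bigr => m _.
  by rewrite mcoeffD mcoeffZ scalerDl scalerA.
- by apply: fsubsetU; rewrite fsubsetUr orbT.
- by apply: fsubsetU; rewrite fsubsetUl orbT.
Qed.

HB.instance Definition _ (g : B -> N) := GRing.isLinear.Build R F N *:%R (mext g) (mext_linear g).

Lemma mextU (g : B -> N) b : mext g << b >> = g b.
Proof.
rewrite (@mextEw _ [fset b]%fset) ?msuppU_le // big_seq_fset1.
by rewrite mcoeffUU scale1r.
Qed.

(* Opaque, so that failing unification problems do not unfold the sums. *)
Fact fext_exists (g : B -> N) : {h : {linear F -> N} | forall b, h << b >> = g b}.
Proof. by exists (mext g) => b; apply: mextU. Qed.

Definition fext (g : B -> N) : {linear F -> N} := sval (fext_exists g).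

Lemma fextU (g : B -> N) b : fext g << b >> = g b.
Proof. exact: (svalP (fext_exists g)). Qed.

Lemma malg_sum (x : F) : x = \sum_(b <- msupp x) x@_b *: << b >>.
Proof.
rewrite [LHS]monalgE; apply: eq_bigr => m _; apply/malgP => m'.
by rewrite mcoeffZ !mcoeffU mulr_natr mulrb -mulrb; case: eqP => // _; rewrite mulr1n.
Qed.

Lemma malg_ind (P : F -> Prop) :
  P 0 -> (forall x y, P x -> P y -> P (x + y)) -> (forall c b, P (c *: << b >>)) ->
  forall x, P x.
Proof. by move=> P0 PD PU x; rewrite (malg_sum x); elim/big_ind: _. Qed.

Lemma malg_ext (g h : {linear F -> N}) : (forall b, g << b >> = h << b >>) -> g =1 h.
Proof.
move=> gh; elim/malg_ind => [|x y Hx Hy|c b]; first by rewrite !linear0.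
  by rewrite !linearD Hx Hy.
by rewrite !linearZ gh.
Qed.

End FreeModule.

Lemma malg_projective (R : nzRingType) (B : choiceType) : @projective R {malg R[B]}.
Proof.
move=> M N g f gs; have [s hs] := choice (fun b : B => gs (f << b >>)).
exists (mext s) => x; apply: (malg_ext (g := g \o mext s)) => b.
by rewrite /= mextU hs.
Qed.

Section Basis.
Context (k : fieldType) (V : lmodType k).

(** Independence is expressed by finitely supported functions on all of [V], so that it can be
    tested along chains of subsets before an index type exists. *)
Let indep (P : V -> Prop) := forall f : {malg k[V]},
  (forall v, f@_v != 0 -> P v) -> mext id f = 0 -> f = 0.

Let indep_maximal : exists P, indep P /\
  forall v, ~ P v -> ~ indep (fun u => P u \/ u = v).
Proof.
have [F FP tF|P [iP mP]] := @classical_sets.Zorn_bigcup V indep.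
  move=> f hf f0.
  (* A finite support covered by a chain lies in a single member of it; the empty support has to be
     set apart because the chain may be empty. *)
  suff [[X [FX Xf]]|nof] : (exists X, F X /\ {in msupp f, forall v, X v}) \/
      (forall v, v \notin msupp f).
  - by apply: (FP X FX f _ f0) => v; rewrite mcoeff_neq0 => /Xf.
  - by apply/malgP => v; rewrite mcoeff0; apply: mcoeff_outdom.
  have : forall v, v \in (msupp f : seq V) -> exists2 X, F X & X v.
    by move=> v vf; have [|X FX Xv] := hf v; [rewrite mcoeff_neq0 | exists X].
  rewrite -[_ \/ _]/((exists X, F X /\ forall v, v \in (msupp f : seq V) -> X v) \/
     (forall v, v \notin (msupp f : seq V))).
  elim: (msupp f : seq V) => [|v s IH] hs; first by right.
  left; have [X FX Xv] := hs v (mem_head _ _).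
  case: IH => [u us|[Y [FY Ys]]|no]; first by apply: hs; rewrite inE us orbT.
    have [XY|YX] := tF _ _ FX FY.
      by exists Y; split=> // u; rewrite inE => /predU1P[->|/Ys //]; apply: XY.
    by exists X; split=> // u; rewrite inE => /predU1P[-> //|/Ys]; apply: YX.
  by exists X; split=> // u; rewrite inE => /predU1P[-> //|]; rewrite (negPf (no u)).
exists P; split=> // v nPv; apply: mP; split=> [u Pu|]; first by left.
by move=> /(_ v) h; apply/nPv/h; right.
Qed.

Lemma basis_exists : exists (B : choiceType) (e : B -> V) (c : V -> {malg k[B]}),
  [/\ linear c, forall v, mext e (c v) = v & forall b, c (e b) = << b >>].
Proof.
have [P [iP mP]] := indep_maximal.
pose B : choiceType := {v : V | `[< P v >]}.
pose e (b : B) : V := val b.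
(* Functions on the subtype [B] are transported to functions on [V], where the independence of [P]
   is stated. *)
pose up : {malg k[B]} -> {malg k[V]} := mext (fun b : B => << val b >>).
have up_coef f b : (up f)@_(val b) = f@_b.
  elim/malg_ind: f => [|x y Hx Hy|c b']; first by rewrite /up linear0 !mcoeff0.
    by rewrite /up linearD !mcoeffD -/up Hx Hy.
  by rewrite /up linearZ /= mextU !mcoeffZ !mcoeffU.
have up_supp f v : (up f)@_v != 0 -> P v.
  have [//|nPv] := pselect (P v); suff -> : (up f)@_v = 0 by rewrite eqxx.
  elim/malg_ind: f => [|x y Hx Hy|c b]; first by rewrite /up linear0 mcoeff0.
    by rewrite /up linearD mcoeffD -/up Hx Hy addr0.
  rewrite /up linearZ /= mextU mcoeffZ mcoeffU; case: eqP => [eb|_]; last by rewrite mulr0.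
  by case: nPv; rewrite -eb; apply/asboolP/(valP b).
have up_mext f : mext id (up f) = mext e f.
  apply: (malg_ext (g := mext id \o mext (fun b : B => << val b >>))) => b.
  by rewrite /= !mextU.
have inj f : mext e f = 0 -> f = 0.
  rewrite -up_mext => /(iP _ (@up_supp f)) f0; apply/malgP => b.
  by rewrite -up_coef f0 !mcoeff0.
(* If [v] were not a combination of [P], adjoining it would preserve independence, against
   maximality. *)
have surj v : exists f, mext e f = v.
  apply: contrapT => nv.
  have nPv : ~ P v.
    by move=> /asboolP Pv; apply: nv; exists << (exist _ v Pv : B) >>; rewrite mextU.
  apply: (mP v nPv) => f hf f0.
  have hg u : (f - f@_v *: << v >>)@_u != 0 -> P u.
    rewrite mcoeffB mcoeffZ mcoeffU; case: (v =P u) => [<-|ne].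
      by rewrite mulr1 subrr eqxx.
    by rewrite mulr0 subr0 => /hf[//|/esym].
  have img g : (forall u, g@_u != 0 -> P u) -> exists f, mext e f = mext id g.
    move=> hP; have : forall u, u \in (msupp g : seq V) -> P u.
      by move=> u; rewrite -mcoeff_neq0; apply: hP.
    rewrite /mext; elim: (msupp g : seq V) => [|u s IH] hs.
      by exists 0; rewrite big_nil; apply: (linear0 (mext e)).
    have [|h hE] := IH; first by move=> w ws; apply: hs; rewrite inE ws orbT.
    have /asboolP Pu := hs u (mem_head _ _).
    exists (g@_u *: << (exist _ u Pu : B) >> + h); rewrite big_cons -hE.
    by rewrite -/(mext e _) linearP /= mextU.
  have [h] := img _ hg; rewrite linearB linearZ /= f0 mextU sub0r => hE.
  have fv : f@_v = 0.
    apply: contrapT => /eqP fv0; apply: nv; exists (- (f@_v)^-1 *: h).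
    by rewrite linearZ /= hE scaleNr scalerN opprK scalerA mulVf ?scale1r.
  by apply: (iP f) => // u; have := hg u; rewrite fv scale0r subr0.
have [c hc] := choice surj.
exists B, e, c; split=> // [a u v|b]; apply/eqP; rewrite -subr_eq0; apply/eqP/inj.
  by rewrite linearB linearP /= !hc subrr.
by rewrite linearB /= hc mextU subrr.
Qed.

End Basis.

(** * The PBW basis of the explicit family *)

Definition i0 : 'I_3 := Ordinal (isT : (0 < 3)%N).
Definition i1 : 'I_3 := Ordinal (isT : (1 < 3)%N).
Definition i2 : 'I_3 := Ordinal (isT : (2 < 3)%N).

Lemma ord3P (P : 'I_3 -> Prop) : P i0 -> P i1 -> P i2 -> forall i, P i.
Proof.
move=> h0 h1 h2 [[|[|[|//]]] lt].
- by rewrite (_ : Ordinal lt = i0) //; apply: val_inj.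
- by rewrite (_ : Ordinal lt = i1) //; apply: val_inj.
- by rewrite (_ : Ordinal lt = i2) //; apply: val_inj.
Qed.

Lemma sum3 (V : nmodType) (F : 'I_3 -> V) : \sum_i F i = F i0 + F i1 + F i2.
Proof.
rewrite !big_ord_recr big_ord0 /= add0r.
by congr (F _ + F _ + F _); apply: val_inj.
Qed.

(* The right action of the generators x_0 = x, x_1 = y, x_2 = z on coefficients with
   respect to the monomials x^a y^b z^c, read off from yx = -xy,
   zx = -xz - ga y^2, zy = -yz - al x^2 and the centrality of z^2. *)
Section Action.
Context (k : fieldType) (al ga : k).
Implicit Types (p q : nat -> nat -> nat -> k).

Definition actz p a b c := if c is c'.+1 then p a b c' else 0.

(** z^c y equals y z^c for even c, and - y z^c - al x^2 z^(c-1) for odd c. Coefficients are read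
    backwards: the entry at exponent c receives the second term from c + 1, which is odd exactly
    when c is even. *)
Definition acty p a b c : k :=
  (if b is b'.+1 then (-1) ^+ c * p a b' c else 0) -
  (if a is a'.+2 then if odd c then 0 else al * p a' b c.+1 else 0).

Definition actx p a b c : k :=
  (if a is a'.+1 then (-1) ^+ (b + c) * p a' b c else 0) -
  (if b is b'.+2 then if odd c then 0 else ga * p a b' c.+1 else 0).

Definition act (i : 'I_3) : (nat -> nat -> nat -> k) -> nat -> nat -> nat -> k :=
  match val i with 0%N => actx | 1%N => acty | _ => actz end.

Lemma act_linear i d p q a b c :
  act i (fun a b c => d * p a b c + q a b c) a b c = d * act i p a b c + act i q a b c.
Proof.
case: i => [[|[|[|//]]] lt]; rewrite /act /=.
- by rewrite /actx; case: a => [|a]; case: b => [|[|b]]; case: (odd c) => /=; ring.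
- by rewrite /acty; case: a => [|[|a]]; case: b => [|b]; case: (odd c) => /=; ring.
by rewrite /actz; case: c => [|c]; ring.
Qed.

(** With the two lemmas that follow, this makes the defining relations act as zero, so the action
    descends to [S]. It takes the place of a confluence check for the PBW basis; away from small
    exponents only parities matter. *)
Lemma act_yx p a b c : actx (acty p) a b c + acty (actx p) a b c = 0.
Proof.
rewrite /actx /acty.
case: a => [|[|[|a]]]; case: b => [|[|[|b]]];
  rewrite /= ?addSn ?addnS ?add0n ?addn0 ?exprS ?exprD ?expr0;
  rewrite -?[(-1) ^+ c]signr_odd -?[(-1) ^+ b]signr_odd;
  try (case: (odd c) => /=); try (case: (odd b) => /=); ring.
Qed.

Lemma act_zx p a b c :
  actx (actz p) a b c + actz (actx p) a b c + ga * acty (acty p) a b c = 0.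
Proof.
rewrite /actx /acty /actz.
case: a => [|[|[|[|a]]]]; case: b => [|[|[|b]]]; case: c => [|c];
  rewrite /= ?addSn ?addnS ?add0n ?addn0 ?exprS ?exprD ?expr0;
  rewrite -?[(-1) ^+ c]signr_odd -?[(-1) ^+ b]signr_odd;
  try (case: (odd c) => /=); try (case: (odd b) => /=); ring.
Qed.

Lemma act_zy p a b c :
  acty (actz p) a b c + actz (acty p) a b c + al * actx (actx p) a b c = 0.
Proof.
rewrite /actx /acty /actz.
case: a => [|[|[|a]]]; case: b => [|[|[|[|b]]]]; case: c => [|c];
  rewrite /= ?addSn ?addnS ?add0n ?addn0 ?exprS ?exprD ?expr0;
  rewrite -?[(-1) ^+ c]signr_odd -?[(-1) ^+ b]signr_odd;
  try (case: (odd c) => /=); try (case: (odd b) => /=); ring.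
Qed.

Definition acts (s : seq 'I_3) p := foldl (fun q i => act i q) p s.

Lemma acts_linear s d p q a b c :
  acts s (fun a b c => d * p a b c + q a b c) a b c = d * acts s p a b c + acts s q a b c.
Proof.
elim: s p q => [//|i s IH] p q; rewrite /acts /= -!/(acts _ _).
rewrite -IH; congr (acts s _ a b c).
by do 3![apply/funext => ?]; rewrite act_linear.
Qed.

Lemma acts0 s a b c : acts s (fun _ _ _ => 0) a b c = 0.
Proof.
elim: s => [//|i s IH]; rewrite /acts /= -!/(acts _ _).
have -> // : act i (fun _ _ _ => 0) = fun _ _ _ => 0.
apply/funext => x; apply/funext => x0; apply/funext => x1.
case: i => [[|[|[|//]]] lt]; rewrite /act /= /actx /acty /actz ?mulr0.
- by case: x => [|x]; case: x0 => [|[|x0]]; rewrite ?if_same ?mulr0 ?if_same ?subr0.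
- by case: x => [|[|x]]; case: x0 => [|x0]; rewrite ?if_same ?mulr0 ?if_same ?subr0.
by case: x1.
Qed.

End Action.

Section Weights.
Context (k : fieldType) (al ga : k).

(* The superpotential: xyz symmetrized, plus al x^3 + ga y^3. *)
Definition clifW (i j l : 'I_3) : k :=
  if uniq [:: i; j; l] then 1
  else if (i == j) && (j == l) then (if i == i0 then al else if i == i1 then ga else 0)
  else 0.

Definition clif_rel (T : free_alg k) (i : 'I_3) : T :=
  \sum_j \sum_l clifW i j l *: (fa_gen T j * fa_gen T l).

Lemma clif_relE (T : free_alg k) :
  [/\ clif_rel T i0 = word [:: i1; i2] + word [:: i2; i1] + al *: word [:: i0; i0],
      clif_rel T i1 = word [:: i0; i2] + word [:: i2; i0] + ga *: word [:: i1; i1]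
    & clif_rel T i2 = word [:: i0; i1] + word [:: i1; i0]].
Proof.
rewrite /clif_rel !sum3 /clifW /= !scale0r !scale1r ?add0r ?addr0 !word_cons word_nil !mulr1.
by split=> //; [rewrite -addrA addrC | rewrite addrAC].
Qed.

Lemma clif_rel_homog (T : free_alg k) i : fhomog 2 (clif_rel T i).
Proof.
apply: homog_sum => j _; apply: homog_sum => l _; apply: homogZ.
by rewrite -!word1 -word_cat; apply: homog_word.
Qed.

End Weights.

Section PBW.
Context (k : fieldType) (al ga : k) (T : free_alg k) (S : algType k).
Context (p : {lrmorphism T -> S}).
Hypothesis pS : presents p (fun g => exists i, g = clif_rel al ga T i).

Definition sx := p (fa_gen T i0).
Definition sy := p (fa_gen T i1).
Definition sz := p (fa_gen T i2).

Lemma rel_zy : sz * sy = - (sy * sz) - al *: sx ^+ 2.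
Proof.
have /(proj2 pS) : ideal_gen (fun g => exists i, g = clif_rel al ga T i) (clif_rel al ga T i0).
  by apply: ideal_gen_incl; exists i0.
have [-> _ _] := clif_relE al ga T.
rewrite !linearD linearZ !word_cons word_nil !mulr1 !rmorphM /= -/sx -/sy -/sz => e.
by apply/eqP; rewrite -subr_eq0 opprB opprK addrC -addrA [X in X == _]addrC expr2 e.
Qed.

Lemma rel_zx : sz * sx = - (sx * sz) - ga *: sy ^+ 2.
Proof.
have /(proj2 pS) : ideal_gen (fun g => exists i, g = clif_rel al ga T i) (clif_rel al ga T i1).
  by apply: ideal_gen_incl; exists i1.
have [_ -> _] := clif_relE al ga T.
rewrite !linearD linearZ !word_cons word_nil !mulr1 !rmorphM /= -/sx -/sy -/sz => e.
by apply/eqP; rewrite -subr_eq0 opprB opprK addrC -addrA [X in X == _]addrC expr2 e.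
Qed.

Lemma rel_yx : sy * sx = - (sx * sy).
Proof.
have /(proj2 pS) : ideal_gen (fun g => exists i, g = clif_rel al ga T i) (clif_rel al ga T i2).
  by apply: ideal_gen_incl; exists i2.
have [_ _ ->] := clif_relE al ga T.
rewrite !linearD !word_cons word_nil !mulr1 !rmorphM /= -/sx -/sy => e.
by apply/eqP; rewrite -subr_eq0 opprK addrC e.
Qed.

Definition sv (i : 'I_3) := p (fa_gen T i).

Lemma S_ind (P : S -> Prop) : P 1 -> (forall c u v, P u -> P v -> P (c *: u + v)) ->
  (forall u i, P u -> P (u * sv i)) -> forall u, P u.
Proof.
move=> P1 PD PM u; have [t ->] := proj1 pS u.
have P0 : P 0 by rewrite -(subrr 1) addrC -scaleN1r; apply: PD.
elim/tensor_ind: t => [|c s t IH]; first by rewrite linear0.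
rewrite linearP; apply: PD => // {IH}.
elim/last_ind: s => [|s i IH]; first by rewrite word_nil rmorph1.
by rewrite word_rcons rmorphM; apply: PM.
Qed.

Definition delta3 a b c : k := ((a == 0%N) && (b == 0%N) && (c == 0%N))%:R.

(** A word acts on the coefficient array of 1. Coefficient extraction is thus available on [T]
    before the monomials are known to be independent in [S]. *)
Definition pbwT a b c : {linear T -> k^o} :=
  @lext k T k^o (fun s => acts al ga s delta3 a b c).

Lemma pbwT_rel u v (i : 'I_3) a b c : pbwT a b c (word u * clif_rel al ga T i * word v) = 0.
Proof.
have [e0 e1 e2] := clif_relE al ga T.
have cat3 s : word u * word s * word v = word (u ++ s ++ v) :> T by rewrite !word_cat mulrA.
(* The three relations share the shape s + t + d r; the last one has d = 0 and the empty word for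
   r. *)
have key s t d r : (forall p a b c,
    acts al ga s p a b c + acts al ga t p a b c + d * acts al ga r p a b c = 0) ->
    pbwT a b c (word u * (word s + word t + d *: word r) * word v) = 0.
  move=> h; rewrite !mulrDr !mulrDl -scalerAr -scalerAl !cat3 linearD linearZ linearD /= !lext_word.
  rewrite /acts !foldl_cat -!/(acts _ _ _ _); set q := acts _ _ u _.
  rewrite addrC -[in _ *: _]/(d * _) -[X in _ + (X + _)]mul1r -acts_linear -acts_linear.
  rewrite -[RHS](acts0 al ga v a b c); congr (acts _ _ v _ a b c).
  by do 3![apply/funext => ?]; rewrite mul1r addrC h.
move: i; apply: ord3P.
- by rewrite e0; apply: key => q a' b' c'; rewrite [X in X + _]addrC; apply: act_zy.
- by rewrite e1; apply: key => q a' b' c'; rewrite [X in X + _]addrC; apply: act_zx.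
rewrite e2 -[_ + _]addr0 -(scale0r (word [::])); apply: key => q a' b' c'.
by rewrite mul0r addr0 addrC; apply: act_yx.
Qed.

Lemma pbwT_ker a b c t : p t = 0 -> pbwT a b c t = 0.
Proof.
move=> /(proj2 pS) /ideal_lspan; elim=> [|d _ y [u [_ [v [[i ->] ->]]]] _ IH].
  by rewrite linear0.
by rewrite linearP /= pbwT_rel IH scaler0 addr0.
Qed.

Fact lift_exists : {f : S -> T & forall s, p (f s) = s}.
Proof. by apply: (@choice _ _ (fun s t => p t = s)) => s; have [t ->] := proj1 pS s; exists t. Qed.

Definition slift : S -> T := projT1 lift_exists.

Lemma sliftK s : p (slift s) = s.
Proof. exact: (projT2 lift_exists). Qed.

Definition pbw a b c (s : S) : k := pbwT a b c (slift s).

Lemma pbw_p a b c t : pbw a b c (p t) = pbwT a b c t.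
Proof.
apply/eqP; rewrite -subr_eq0 /pbw -linearB; apply/eqP/pbwT_ker.
by rewrite linearB /= sliftK subrr.
Qed.

Lemma pbwP a b c d u v : pbw a b c (d *: u + v) = d * pbw a b c u + pbw a b c v.
Proof. by rewrite -(sliftK u) -(sliftK v) -linearP !pbw_p linearP. Qed.

Lemma pbw0 a b c : pbw a b c 0 = 0.
Proof. by rewrite -(linear0 p) pbw_p linear0. Qed.

Lemma pbwD a b c u v : pbw a b c (u + v) = pbw a b c u + pbw a b c v.
Proof. by rewrite -[u]scale1r pbwP mul1r scale1r. Qed.

Lemma pbwZ a b c d u : pbw a b c (d *: u) = d * pbw a b c u.
Proof. by rewrite -[d *: u]addr0 pbwP pbw0 addr0. Qed.

Lemma pbw1 a b c : pbw a b c 1 = delta3 a b c.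
Proof. by rewrite -(rmorph1 p) pbw_p -word_nil lext_word. Qed.

Lemma pbw_act a b c u i :
  pbw a b c (u * sv i) = act al ga i (fun a b c => pbw a b c u) a b c.
Proof.
rewrite -(sliftK u) /sv -rmorphM pbw_p.
transitivity (act al ga i (fun a b c => pbwT a b c (slift u)) a b c); last first.
  by congr (act al ga i _ a b c); do 3![apply/funext => ?]; rewrite pbw_p.
elim/tensor_ind: (slift u) => [|d s t IH].
  rewrite mul0r linear0.
  have -> : (fun a b c => pbwT a b c 0) = fun _ _ _ => 0.
    by do 3![apply/funext => ?]; rewrite linear0.
  exact/esym/(acts0 al ga [:: i]).
rewrite mulrDl linearD /= IH -scalerAl -word_rcons linearZ /= lext_word.
rewrite /acts foldl_rcons -/(acts _ _ _ _) -[in _ *: _]/(d * _) -act_linear.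
congr (act al ga i _ a b c); do 3![apply/funext => ?].
by rewrite linearP /= lext_word.
Qed.

Definition mon a b c : S := sx ^+ a * sy ^+ b * sz ^+ c.

Lemma mon_z a b c : mon a b c * sz = mon a b c.+1.
Proof. by rewrite /mon -mulrA -exprSr. Qed.

(** The array of a monomial is built from that of 1 by x, then y, then z. In this order the
    correction terms of [actx] and [acty] meet only zero entries. *)
Lemma pbw_mon a b c a' b' c' :
  pbw a b c (mon a' b' c') = ((a == a') && (b == b') && (c == c'))%:R.
Proof.
elim: c' a b c => [|c' IHc] a b c; last first.
  rewrite -mon_z (pbw_act a b c _ i2) /act /= /actz; case: c => [|c]; first by rewrite andbF.
  by rewrite IHc.
rewrite /mon expr0 mulr1; elim: b' a b c => [|b' IHb] a b c; last first.
  rewrite exprSr mulrA (pbw_act a b c _ i1) /act /= /acty /=.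
  rewrite (_ : (if a is a'.+2 then _ else 0) = 0) ?subr0; last first.
    by case: a => [|[|a]] //; rewrite IHb andbF mulr0 if_same.
  case: b => [|b]; first by rewrite andbF.
  rewrite IHb eqSS; case: (altP (c =P 0%N)) => [->|_]; first by rewrite mul1r.
  by rewrite !andbF mulr0.
rewrite expr0 mulr1; elim: a' a b c => [|a' IHa] a b c; first by rewrite pbw1.
rewrite exprSr (pbw_act a b c _ i0) /act /= /actx /=.
rewrite (_ : (if b is b'.+2 then _ else 0) = 0) ?subr0; last first.
  by case: b => [|[|b]] //; rewrite IHa andbF mulr0 if_same.
case: a => [|a] //; rewrite IHa eqSS.
case: (altP (b =P 0%N)) => [->|]; rewrite ?andbF ?mulr0 //=.
by case: (altP (c =P 0%N)) => [->|]; rewrite ?andbF ?mulr0 ?mul1r.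
Qed.

Definition zspan n := lspan (fun u => exists a b c, (c <= n)%N /\ u = mon a b c).

Lemma zspan_le n m u : (n <= m)%N -> zspan n u -> zspan m u.
Proof.
move=> le; apply: lspan_sub => _ [a [b [c [h ->]]]]; apply: lspan_gen.
by exists a, b, c; rewrite (leq_trans h).
Qed.

Lemma zspan_mulr n m v u : (forall a b c, (c <= n)%N -> zspan m (mon a b c * v)) ->
  zspan n u -> zspan m (u * v).
Proof.
move=> h; elim=> [|d _ w [a [b [c [le ->]]]] _ IH]; first by rewrite mul0r; apply: lspan0.
by rewrite mulrDl -scalerAl; apply: lspanD => //; apply: lspanZ; apply: h.
Qed.

Lemma zspan_z n u : zspan n u -> zspan n.+1 (u * sz).
Proof.
apply: zspan_mulr => a b c le; rewrite mon_z; apply: lspan_gen.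
by exists a, b, c.+1.
Qed.

(** Carrying x or y to the left across z changes its sign and adds a multiple of the square of the
    other variable with one z fewer. The induction is on the exponent of z, and x and y have to be
    treated together. *)
Lemma zspan_xy n u : zspan n u -> zspan n (u * sx) /\ zspan n (u * sy).
Proof.
elim: n u => [|n IH] u hu; split; apply: zspan_mulr hu => a b [|c] le //.
- rewrite /mon mulr1 -mulrA; elim: b => [|b IHb].
    rewrite mul1r -exprSr; apply: lspan_gen; exists a.+1, 0%N, 0%N.
    by rewrite /mon !mulr1.
  rewrite exprS -!mulrA.
  have -> m : sy * (sy ^+ m * sx) = - (sy ^+ m * sx * sy).
    elim: m => [|m IHm]; first by rewrite !mul1r rel_yx.
    by rewrite exprS -!mulrA IHm mulrN !mulrA.
  rewrite -scaleN1r -scalerAr; apply: lspanZ; rewrite mulrA.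
  elim: IHb => [|d _ w [a' [b' [c' [h ->]]]] _ IHw]; first by rewrite mul0r; apply: lspan0.
  rewrite mulrDl -scalerAl; apply: lspanD => //; apply/lspanZ/lspan_gen.
  move: h; rewrite leqn0 => /eqP ->; exists a', b'.+1, 0%N; split=> //.
  by rewrite /mon !mulr1 -mulrA -exprSr.
- rewrite /mon mulr1 -mulrA -exprSr; apply: lspan_gen; exists a, b.+1, 0%N.
  by rewrite /mon mulr1.
- rewrite /mon mulr1 -mulrA; apply: (zspan_le (leq0n n.+1)).
  elim: b => [|b IHb].
    rewrite mul1r -exprSr; apply: lspan_gen; exists a.+1, 0%N, 0%N.
    by rewrite /mon !mulr1.
  rewrite exprS -!mulrA.
  have -> m : sy * (sy ^+ m * sx) = - (sy ^+ m * sx * sy).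
    elim: m => [|m IHm]; first by rewrite !mul1r rel_yx.
    by rewrite exprS -!mulrA IHm mulrN !mulrA.
  rewrite -scaleN1r -scalerAr; apply: lspanZ; rewrite mulrA.
  elim: IHb => [|d _ w [a' [b' [c' [h ->]]]] _ IHw]; first by rewrite mul0r; apply: lspan0.
  rewrite mulrDl -scalerAl; apply: lspanD => //; apply/lspanZ/lspan_gen.
  move: h; rewrite leqn0 => /eqP ->; exists a', b'.+1, 0%N; split=> //.
  by rewrite /mon !mulr1 -mulrA -exprSr.
- have hm : zspan n (mon a b c) by apply: lspan_gen; exists a, b, c.
  have [hx hy] := IH _ hm.
  rewrite -mon_z -mulrA rel_zx mulrBr mulrN mulrA -scalerAr expr2 mulrA.
  apply: lspanB; first by rewrite -scaleN1r; apply/lspanZ/zspan_z.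
  by apply/lspanZ/(zspan_le (leqnSn n)); case: (IH _ hy).
- rewrite /mon mulr1 -mulrA -exprSr; apply: lspan_gen; exists a, b.+1, 0%N.
  by rewrite /mon mulr1.
have hm : zspan n (mon a b c) by apply: lspan_gen; exists a, b, c.
have [hx hy] := IH _ hm.
rewrite -mon_z -mulrA rel_zy mulrBr mulrN mulrA -scalerAr expr2 mulrA.
apply: lspanB; first by rewrite -scaleN1r; apply/lspanZ/zspan_z.
by apply/lspanZ/(zspan_le (leqnSn n)); case: (IH _ hx).
Qed.

Lemma zspan_all u : exists n, zspan n u.
Proof.
elim/S_ind: u => [|c u v [n hu] [m hv]|u i [n hu]].
- by exists 0%N; apply: lspan_gen; exists 0%N, 0%N, 0%N; rewrite /mon !mulr1.
- exists (maxn n m); apply: lspanD; first by apply/lspanZ/(zspan_le (leq_maxl _ _)).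
  exact: (zspan_le (leq_maxr _ _)).
exists n.+1; move: i; apply: ord3P; last exact: zspan_z.
  by apply: (zspan_le (leqnSn n)); case: (zspan_xy hu).
by apply: (zspan_le (leqnSn n)); case: (zspan_xy hu).
Qed.

(** All sufficiently large cutoffs are allowed so that two expansions can be added. *)
Lemma pbw_recon u : exists N0, forall N, (N0 <= N)%N ->
  u = \sum_(a < N) \sum_(b < N) \sum_(c < N) pbw a b c u *: mon a b c.
Proof.
have [n] := zspan_all u; elim=> [|d _ v [a [b [c [_ ->]]]] _ [N0 IH]].
  exists 0%N => N _; rewrite big1 // => a _; rewrite big1 // => b _; rewrite big1 // => c _.
  by rewrite pbw0 scale0r.
exists (maxn N0 (maxn a (maxn b c)).+1) => N; rewrite geq_max => /andP[le].
rewrite !gtn_max => /and3P[la lb lc].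
under eq_bigr do under eq_bigr do under eq_bigr do rewrite pbwP scalerDl.
under eq_bigr do under eq_bigr do rewrite big_split.
under eq_bigr do rewrite big_split.
rewrite big_split /= -IH //; congr (_ + _).
rewrite (bigD1 (Ordinal la)) //= (bigD1 (Ordinal lb)) //= (bigD1 (Ordinal lc)) //=.
rewrite pbw_mon !eqxx mulr1 !big1 ?addr0 //.
- move=> a' ne; rewrite big1 // => b' _; rewrite big1 // => c' _.
  by rewrite pbw_mon (_ : (val a' == a) = false) ?mulr0 ?scale0r //; apply: negPf.
- move=> b' ne; rewrite big1 // => c' _.
  by rewrite pbw_mon (_ : (val b' == b) = false) ?andbF ?mulr0 ?scale0r //; apply: negPf.
move=> c' ne.
by rewrite pbw_mon (_ : (val c' == c) = false) ?andbF ?mulr0 ?scale0r //; apply: negPf.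
Qed.

Lemma pbw_inj u : (forall a b c, pbw a b c u = 0) -> u = 0.
Proof.
move=> h; have [N e] := pbw_recon u; rewrite (e N) ?leqnn //.
by do 3![rewrite big1 // => ? _]; rewrite h scale0r.
Qed.

End PBW.

(** * The Koszul complex of an arbitrary module *)

Section RestrictScalars.
Context (k : fieldType) (S : algType k) (M : lmodType S).

(** A copy of the carrier, so that the k-module structure does not compete with the S-module
    structure. *)
Definition restr : Type := M.
HB.instance Definition _ := GRing.Zmodule.on restr.

Definition restr_scale (a : k) (m : restr) : restr := (a%:A : S) *: (m : M).

Fact restr_scaleA a b m : restr_scale a (restr_scale b m) = restr_scale (a * b) m.
Proof. by rewrite /restr_scale scalerA -scalerAl mul1r scalerA. Qed.

Fact restr_scale1 : left_id 1 restr_scale.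
Proof. by move=> m; rewrite /restr_scale scale1r [LHS](scale1r (m : M)). Qed.

Fact restr_scaleDr : right_distributive restr_scale +%R.
Proof. by move=> a m n; rewrite /restr_scale; apply: (scalerDr (_ : S) (m : M)). Qed.

Fact restr_scaleDl m : {morph restr_scale^~ m : a b / a + b}.
Proof. by move=> a b; rewrite /restr_scale scalerDl; apply: (scalerDl (m : M)). Qed.

HB.instance Definition _ := GRing.Zmodule_isLmodule.Build k restr
  restr_scaleA restr_scale1 restr_scaleDr restr_scaleDl.

Lemma module_basis : exists (B : choiceType) (e : B -> M) (c : M -> {malg k[B]}),
  [/\ forall a u v, c (a%:A *: u + v) = a *: c u + c v,
      forall v, \sum_(b <- msupp (c v)) ((c v)@_b)%:A *: e b = v
    & forall b, c (e b) = << b >>].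
Proof.
have [B [e [c [cl ce ec]]]] := @basis_exists k restr.
by exists B, e, c; split=> // a u v; apply: cl.
Qed.

End RestrictScalars.

Lemma subrDACA (V : zmodType) (a b c d : V) : (a + b) - (c + d) = (a - c) + (b - d).
Proof. by rewrite opprD addrACA. Qed.

Lemma subr_sub (V : zmodType) (a b c : V) : a - (b + c) = a - b - c.
Proof. by rewrite opprD addrA. Qed.

Section Koszul.
Context (k : fieldType) (al ga : k) (T : free_alg k) (S : algType k).
Context (p : {lrmorphism T -> S}).
Hypothesis pS : presents p (fun g => exists i, g = clif_rel al ga T i).
Local Notation x := (sx p).
Local Notation y := (sy p).
Local Notation z := (sz p).
Local Notation mon := (mon p).
Local Notation pbw := (pbw pS).

Context (M : lmodType S) (B : choiceType) (e : B -> M) (c : M -> {malg k[B]}).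
Hypothesis cP : forall a u v, c (a%:A *: u + v) = a *: c u + c v.
Hypothesis ce : forall v, \sum_(b <- msupp (c v)) ((c v)@_b)%:A *: e b = v.
Hypothesis ec : forall b, c (e b) = << b >>.

Local Notation F := {malg S[B]}.
Implicit Types (f g h : F).

Fact iota_exists : {i : M -> F |
  forall m, i m = \sum_(b <- msupp (c m)) ((c m)@_b)%:A *: << b >>}.
Proof. by exists (fun m => \sum_(b <- msupp (c m)) ((c m)@_b)%:A *: << b >>). Qed.

(** With [F] read as S (x)_k M, this is the map m |-> 1 (x) m, which is linear over k only. *)
Definition basis_inj : M -> F := sval iota_exists.

Lemma iotaE m : basis_inj m = \sum_(b <- msupp (c m)) ((c m)@_b)%:A *: << b >>.
Proof. exact: (svalP iota_exists). Qed.

Lemma iota_coef m b : (basis_inj m)@_b = ((c m)@_b)%:A.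
Proof.
rewrite iotaE raddf_sum /=.
have h (s : seq B) : uniq s -> (\sum_(b0 <- s) (((c m)@_b0)%:A *: << b0 >> : F)@_b) =
    if b \in s then ((c m)@_b)%:A else 0.
  elim: s => [|b' s IH] /=; first by rewrite big_nil.
  case/andP=> nb us; rewrite big_cons IH // mcoeffZ mcoeffU inE eq_sym.
  case: eqP => [->|_]; first by rewrite (negPf nb) mulr1 addr0.
  by rewrite mulr0 add0r.
rewrite h ?fset_uniq //; case: ifP => // /negbT /mcoeff_outdom ->.
by rewrite scale0r.
Qed.

Lemma iotaP a (m n : M) : basis_inj (a%:A *: m + n) = a%:A *: basis_inj m + basis_inj n.
Proof.
apply/malgP => b; rewrite mcoeffD mcoeffZ !iota_coef cP mcoeffD mcoeffZ.
by rewrite scalerDl -scalerA -scalerAl mul1r.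
Qed.

Lemma iotaD (m n : M) : basis_inj (m + n) = basis_inj m + basis_inj n.
Proof. by have := iotaP 1 m n; rewrite !scale1r. Qed.

Lemma iota0 : basis_inj 0 = 0.
Proof. by apply: (addrI (basis_inj 0)); rewrite -iotaD !addr0. Qed.

Lemma iotaZ a m : basis_inj (a%:A *: m) = a%:A *: basis_inj m.
Proof. by have := iotaP a m 0; rewrite iota0 !addr0. Qed.

Lemma iota_sum (I : Type) (r : seq I) (G : I -> M) :
  basis_inj (\sum_(i <- r) G i) = \sum_(i <- r) basis_inj (G i).
Proof. exact: (big_morph basis_inj iotaD iota0). Qed.

Lemma iota_e b : basis_inj (e b) = << b >>.
Proof. by apply/malgP => b'; rewrite iota_coef ec !mcoeffU; case: eqP; rewrite ?scale1r ?scale0r. Qed.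

Definition aug : {linear F -> M} := fext e.

Lemma aug_iota m : aug (basis_inj m) = m.
Proof.
rewrite iotaE linear_sum /= -[RHS]ce; apply: eq_bigr => b _.
by rewrite linearZ /= fextU.
Qed.

(** On s (x) m, [rho v] gives sv (x) m and [lam v] gives s (x) vm. Both are linear for the outer
    left action of [S]. *)
Definition rho (v : S) : {linear F -> F} := fext (fun b => v *: << b >>).
Definition lam (v : S) : {linear F -> F} := fext (fun b => basis_inj (v *: e b)).

Lemma rho_coef v f b : (rho v f)@_b = f@_b * v.
Proof.
elim/malg_ind: f => [|f g Hf Hg|a b']; first by rewrite linear0 !mcoeff0 mul0r.
  by rewrite linearD !mcoeffD Hf Hg mulrDl.
rewrite linearZ /= fextU !mcoeffZ !mcoeffU.
by case: eqP; rewrite ?mulr0 ?mul0r // !mulr1.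
Qed.

Lemma rho_mul u v f : rho v (rho u f) = rho (u * v) f.
Proof. by apply/malgP => b; rewrite !rho_coef mulrA. Qed.

Lemma rhoD u v f : rho (u + v) f = rho u f + rho v f.
Proof. by apply/malgP => b; rewrite mcoeffD !rho_coef mulrDr. Qed.

Lemma rhoZ a v f : rho (a *: v) f = a%:A *: rho v f.
Proof. by apply/malgP => b; rewrite mcoeffZ !rho_coef -scalerAr -scalerAl mul1r. Qed.

Lemma rho0 f : rho 0 f = 0.
Proof. by apply/malgP => b; rewrite mcoeff0 !rho_coef mulr0. Qed.

Lemma lam_iota v m : lam v (basis_inj m) = basis_inj (v *: m).
Proof.
rewrite iotaE linear_sum /= -[in RHS](ce m) scaler_sumr iota_sum.
apply: eq_bigr => b _; rewrite linearZ /= fextU -iotaZ !scalerA; congr basis_inj.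
by rewrite -scalerAr -scalerAl mul1r mulr1.
Qed.

Lemma lam_mul u v f : lam u (lam v f) = lam (u * v) f.
Proof.
apply: (malg_ext (g := lam u \o lam v)) => b.
by rewrite /= /lam !fextU lam_iota scalerA.
Qed.

Lemma lamD u v f : lam (u + v) f = lam u f + lam v f.
Proof.
elim/malg_ind: f => [|f g Hf Hg|a b]; first by rewrite !linear0 addr0.
  by rewrite !linearD Hf Hg addrACA.
by rewrite !linearZ -scalerDr /lam /= !fextU scalerDl iotaD.
Qed.

Lemma lamZ a v f : lam (a *: v) f = a%:A *: lam v f.
Proof.
elim/malg_ind: f => [|f g Hf Hg|d b]; first by rewrite !linear0 scaler0.
  by rewrite !linearD Hf Hg scalerDr.
rewrite !linearZ /= !fextU scalerA.
have -> : (a *: v) *: e b = a%:A *: (v *: e b) by rewrite scalerA -scalerAl mul1r.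
by rewrite iotaZ scalerA -scalerAr mulr1 -scalerAl mul1r.
Qed.

Lemma lam0 f : lam 0 f = 0.
Proof.
apply: (addrI (lam 0 f)); rewrite -lamD addr0 addr0 //.
Qed.

Lemma rho_iota_lam u v f : rho u (lam v f) = lam v (rho u f).
Proof.
apply: (malg_ext (g := rho u \o lam v) (h := lam v \o rho u)) => b.
rewrite /= /lam /rho !fextU linearZ /= fextU.
rewrite iotaE linear_sum scaler_sumr; apply: eq_bigr => b' _.
rewrite linearZ /= fextU !scalerA; congr (_ *: _).
by rewrite -scalerAl mul1r -scalerAr mulr1.
Qed.

(** The bimodule Koszul differentials, tensored with M, are built from [Lop] in the first and third
    step and from [Rop] in the second. *)
Definition Lop v f := rho v f - lam v f.
Definition Rop v f := rho v f + lam v f.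

Lemma Lop_linear v : linear (Lop v).
Proof. by move=> a f g; rewrite /Lop !linearP /= scalerDr addrACA. Qed.

Lemma Rop_linear v : linear (Rop v).
Proof. by move=> a f g; rewrite /Rop !linearP scalerDr addrACA. Qed.

HB.instance Definition _ v := GRing.isLinear.Build S F F *:%R (Lop v) (Lop_linear v).
HB.instance Definition _ v := GRing.isLinear.Build S F F *:%R (Rop v) (Rop_linear v).

Lemma LopD v f g : Lop v (f + g) = Lop v f + Lop v g.
Proof. exact: (linearD (Lop v)). Qed.
Lemma RopD v f g : Rop v (f + g) = Rop v f + Rop v g.
Proof. exact: (linearD (Rop v)). Qed.
Lemma LopB v f g : Lop v (f - g) = Lop v f - Lop v g.
Proof. exact: (linearB (Lop v)). Qed.
Lemma RopB v f g : Rop v (f - g) = Rop v f - Rop v g.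
Proof. exact: (linearB (Rop v)). Qed.
Lemma Lop0 v : Lop v 0 = 0.
Proof. exact: (linear0 (Lop v)). Qed.
Lemma Rop0 v : Rop v 0 = 0.
Proof. exact: (linear0 (Rop v)). Qed.
Lemma LopZ v a f : Lop v (a *: f) = a *: Lop v f.
Proof. exact: (linearZZ (Lop v)). Qed.
Lemma RopZ v a f : Rop v (a *: f) = a *: Rop v f.
Proof. exact: (linearZZ (Rop v)). Qed.

(** [rho] and [lam] commute, so the mixed terms of the two composites cancel and only u v + v u
    acts, on either side. A relation of [S] therefore makes consecutive differentials compose to
    zero. *)
Lemma Lop_Rop u v f : Lop u (Rop v f) + Lop v (Rop u f) =
  rho (u * v + v * u) f - lam (u * v + v * u) f.
Proof.
rewrite /Lop /Rop !linearD !rho_iota_lam !rho_mul !lam_mul rhoD lamD.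
rewrite !(rho_iota_lam, linearD) /=.
set r1 := rho (u * v) f; set r2 := rho (v * u) f.
set l1 := lam (u * v) f; set l2 := lam (v * u) f.
set c1 := lam v (rho u f); set c2 := lam u (rho v f).
by rewrite addrACA (addrACA r2) (addrACA (- c2)) -(opprD c2) (addrC c2) [LHS]addrA addrK (addrC r2).
Qed.

Lemma Rop_Lop u v f : Rop u (Lop v f) + Rop v (Lop u f) =
  rho (u * v + v * u) f - lam (u * v + v * u) f.
Proof.
rewrite /Lop /Rop !linearB !rho_iota_lam !rho_mul !lam_mul rhoD lamD.
set r1 := rho (u * v) f; set r2 := rho (v * u) f.
set l1 := lam (u * v) f; set l2 := lam (v * u) f.
set c1 := lam v (rho u f); set c2 := lam u (rho v f).
by rewrite addrACA (addrACA r2) (addrACA c2) -!opprD (addrC c1) [LHS]addrA subrK (addrC r2).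
Qed.

Lemma rho_siota v s m : rho v (s *: basis_inj m) = (s * v) *: basis_inj m.
Proof.
apply/malgP => b; rewrite rho_coef !mcoeffZ iota_coef.
by rewrite -!scalerAr -!scalerAl !mulr1.
Qed.

Lemma lam_siota v s m : lam v (s *: basis_inj m) = s *: basis_inj (v *: m).
Proof. by rewrite linearZ /= lam_iota. Qed.

Lemma aug_Lop v f : aug (Lop v f) = 0.
Proof.
elim/malg_ind: f => [|f g hf hg|s b]; first by rewrite Lop0 linear0.
  by rewrite LopD linearD hf hg addr0.
rewrite -iota_e /Lop rho_siota lam_siota linearB !linearZ /= !aug_iota.
by rewrite scalerN scalerA subrr.
Qed.

Definition vanish f a b d := forall b0, pbw a b d (f@_b0) = 0.

Lemma vanishP a b d s f g : vanish f a b d -> vanish g a b d -> vanish (s%:A *: f + g) a b d.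
Proof.
move=> hf hg b0; rewrite mcoeffD mcoeffZ pbwD hg addr0.
by rewrite -scalerAl mul1r pbwZ hf mulr0.
Qed.

Lemma vanishD a b d f g : vanish f a b d -> vanish g a b d -> vanish (f + g) a b d.
Proof. by move=> hf hg b0; rewrite mcoeffD pbwD hf hg addr0. Qed.

Lemma vanishZ a b d s f : vanish f a b d -> vanish (s%:A *: f) a b d.
Proof. by move=> hf; rewrite -[_ *: f]addr0; apply: vanishP => // b0; rewrite mcoeff0 pbw0. Qed.

Lemma vanishB a b d f g : vanish f a b d -> vanish g a b d -> vanish (f - g) a b d.
Proof.
move=> hf hg; rewrite -scaleN1r addrC (_ : -1 = (-1 : k)%:A); first exact: vanishP.
by rewrite scaleN1r.
Qed.

Lemma vanish_lam v f a b d : vanish f a b d -> vanish (lam v f) a b d.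
Proof.
move=> hf b0; rewrite (malg_sum f) linear_sum raddf_sum /=.
elim/big_rec: _ => [|b1 s _ IH]; first by rewrite pbw0.
rewrite pbwD IH addr0 linearZ /= fextU mcoeffZ iota_coef -scalerAr mulr1 pbwZ hf.
by rewrite mulr0.
Qed.

Lemma rho_pbw i f b0 a b d :
  pbw a b d ((rho (sv p i) f)@_b0) = act al ga i (fun a b d => pbw a b d (f@_b0)) a b d.
Proof. by rewrite rho_coef pbw_act. Qed.

(** Exponents are measured in the left tensor factor. The conditions are nested: [ylt] forbids z and
    bounds y, and [xlt] forbids z and y and bounds x. *)
Definition zlt n f := forall a b d, (n <= d)%N -> vanish f a b d.
Definition ylt n f := zlt 1 f /\ forall a b, (n <= b)%N -> vanish f a b 0.
Definition xlt n f := ylt 1 f /\ forall a, (n <= a)%N -> vanish f a 0 0.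

Lemma zltD n f g : zlt n f -> zlt n g -> zlt n (f + g).
Proof. by move=> hf hg a b d le; apply: vanishD; [apply: hf | apply: hg]. Qed.
Lemma zltB n f g : zlt n f -> zlt n g -> zlt n (f - g).
Proof. by move=> hf hg a b d le; apply: vanishB; [apply: hf | apply: hg]. Qed.
Lemma zltZ n s f : zlt n f -> zlt n (s%:A *: f).
Proof. by move=> hf a b d le; apply/vanishZ/hf. Qed.
Lemma zlt_le n m f : (n <= m)%N -> zlt n f -> zlt m f.
Proof. by move=> le hf a b d h; apply/hf/(leq_trans le). Qed.
Lemma zlt_lam n v f : zlt n f -> zlt n (lam v f).
Proof. by move=> hf a b d le; apply/vanish_lam/hf. Qed.
Lemma zlt_rhox n f : zlt n f -> zlt n (rho x f).
Proof.
move=> hf a b d le b0; rewrite (rho_pbw i0) /act /= /actx.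
case: a => [|a]; case: b => [|[|b]]; rewrite ?(hf a _ _ le b0) ?(hf _ _ d.+1 (leqW le) b0);
  by rewrite ?mulr0 ?if_same ?subr0.
Qed.
Lemma zlt_rhoy n f : zlt n f -> zlt n (rho y f).
Proof.
move=> hf a b d le b0; rewrite (rho_pbw i1) /act /= /acty.
case: b => [|b]; case: a => [|[|a]]; rewrite ?(hf _ b _ le b0) ?(hf _ _ d.+1 (leqW le) b0);
  by rewrite ?mulr0 ?if_same ?subr0.
Qed.
Lemma zlt_Lx n f : zlt n f -> zlt n (Lop x f).
Proof. by move=> hf; apply: zltB; [apply: zlt_rhox | apply: zlt_lam]. Qed.
Lemma zlt_Ly n f : zlt n f -> zlt n (Lop y f).
Proof. by move=> hf; apply: zltB; [apply: zlt_rhoy | apply: zlt_lam]. Qed.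
Lemma zlt_Rx n f : zlt n f -> zlt n (Rop x f).
Proof. by move=> hf; apply: zltD; [apply: zlt_rhox | apply: zlt_lam]. Qed.
Lemma zlt_Ry n f : zlt n f -> zlt n (Rop y f).
Proof. by move=> hf; apply: zltD; [apply: zlt_rhoy | apply: zlt_lam]. Qed.

Lemma zlt0 f : zlt 0 f -> f = 0.
Proof. by move=> hf; apply/malgP => b; rewrite mcoeff0; apply: (pbw_inj (pS := pS)) => a b' d; apply: hf. Qed.
Lemma ylt0 f : ylt 0 f -> f = 0.
Proof. by case=> hz hy; apply: zlt0 => a b [|d] _; [apply: hy | apply: hz]. Qed.
Lemma xlt0 f : xlt 0 f -> f = 0.
Proof. by case=> [[hz hy] hx]; apply: ylt0; split=> // a [|b] _; [apply: hx | apply: hy]. Qed.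

Lemma vanish_bound f : exists N, forall a b d,
  (N <= a)%N || (N <= b)%N || (N <= d)%N -> vanish f a b d.
Proof.
elim/malg_ind: f => [|f g [N hf] [N' hg]|s b1].
- by exists 0%N => a b d _ b0; rewrite mcoeff0 pbw0.
- exists (maxn N N') => a b d; rewrite !geq_max => h; apply: vanishD.
    by apply: hf; case/orP: h => [/orP[]|] /andP[-> _]; rewrite ?orbT.
  by apply: hg; case/orP: h => [/orP[]|] /andP[_ ->]; rewrite ?orbT.
have [N hN] := pbw_recon pS s; exists N => a b d le b0.
rewrite mcoeffZ mcoeffU; case: eqP => _; last by rewrite mulr0 pbw0.
rewrite mulr1 (hN N (leqnn N)); elim/big_rec: _ => [|a' s1 _ IH1]; first exact: pbw0.
rewrite pbwD IH1 addr0; elim/big_rec: _ => [|b' s2 _ IH2]; first exact: pbw0.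
rewrite pbwD IH2 addr0; elim/big_rec: _ => [|d' s3 _ IH3]; first exact: pbw0.
rewrite pbwD IH3 addr0 pbwZ pbw_mon.
case: (a =P a') => [ea|_]; last by rewrite mulr0.
case: (b =P b') => [eb|_]; last by rewrite mulr0.
case: (d =P d') => [ed|_]; last by rewrite mulr0.
by exfalso; case/orP: le => [/orP[]|]; rewrite ?ea ?eb ?ed leqNgt ltn_ord.
Qed.

(** Right multiplication by z shifts the exponent of z by exactly one, so the top coefficients of
    [f] reappear in [rho z f]. *)
Lemma ztop n f : zlt n.+1 f -> (forall a b, vanish (rho z f) a b n.+1) -> zlt n f.
Proof.
move=> hf h a b d; rewrite leq_eqVlt => /predU1P[<-|/hf//] b0.
by have := h a b b0; rewrite (rho_pbw i2) /act /= /actz.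
Qed.

Lemma ytop n f : ylt n.+1 f -> (forall a, vanish (rho y f) a n.+1 0) -> ylt n f.
Proof.
move=> [hz hf] h; split=> // a b; rewrite leq_eqVlt => /predU1P[<-|/hf//] b0.
have := h a b0; rewrite (rho_pbw i1) /act /= /acty mul1r.
by case: a => [|[|a]]; rewrite ?(hz _ _ 1%N (leqnn _) b0) ?mulr0 subr0.
Qed.

Lemma xtop n f : xlt n.+1 f -> vanish (rho x f) n.+1 0 0 -> xlt n f.
Proof.
move=> [hz hf] h; split=> // a; rewrite leq_eqVlt => /predU1P[<-|/hf//] b0.
by have := h b0; rewrite (rho_pbw i0) /act /= /actx mul1r subr0.
Qed.

Lemma ylt_rhox n f : ylt n f -> forall a b, (n <= b)%N -> vanish (rho x f) a b 0.
Proof.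
move=> [hz hf] a b le b0; rewrite (rho_pbw i0) /act /= /actx.
case: a => [|a]; case: b le => [|[|b]] le; rewrite ?(hf _ _ le b0) ?(hz _ _ 1%N (leqnn _) b0);
  by rewrite ?mulr0 ?subr0.
Qed.

Lemma zlt_zero f : (forall n, zlt n.+1 f -> zlt n f) -> f = 0.
Proof.
move=> h; have [N hN] := vanish_bound f.
have: zlt N f by move=> a b d le; apply: hN; rewrite le orbT.
by elim: N {hN} => [/zlt0//|N IH /h].
Qed.

Lemma ylt_zero f : zlt 1 f -> (forall n, ylt n.+1 f -> ylt n f) -> f = 0.
Proof.
move=> hz h; have [N hN] := vanish_bound f.
have: ylt N f by split=> // a b le; apply: hN; rewrite le orbT.
by elim: N {hN} => [/ylt0//|N IH /h].
Qed.

Lemma xlt_zero f : ylt 1 f -> (forall n, xlt n.+1 f -> xlt n f) -> f = 0.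
Proof.
move=> hz h; have [N hN] := vanish_bound f.
have: xlt N f by split=> // a le; apply: hN; rewrite le.
by elim: N {hN} => [/xlt0//|N IH /h].
Qed.

(** [D2] is the symmetric matrix of second derivatives of the superpotential, with [Rop] applied to
    its linear entries. The last differential is h |-> (Lop x h, Lop y h, Lop z h). *)
Definition D1 f g h := Lop x f + Lop y g + Lop z h.
Definition D2x f g h := al%:A *: Rop x f + Rop z g + Rop y h.
Definition D2y f g h := Rop z f + ga%:A *: Rop y g + Rop x h.
Definition D2z f g := Rop y f + Rop x g.

(** [rho z] raises the exponent of z and [lam z] does not, so their agreement on [h] kills the top
    coefficients of [h] one level at a time. *)
Lemma D3_inj h : Lop z h = 0 -> h = 0.
Proof.
move=> /eqP; rewrite subr_eq0 => /eqP e0; apply: zlt_zero => n hn; apply: ztop => // a b.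
by rewrite e0; exact: (@zlt_lam n.+1 z h hn a b n.+1 (leqnn _)).
Qed.

(** The normalization of [h] costs nothing for exactness, since [D3_red] reaches it modulo the image
    of the preceding map. *)
Lemma D2_inj f g h : zlt 1 h -> D2x f g h = 0 -> D2y f g h = 0 -> [/\ f = 0, g = 0 & h = 0].
Proof.
move=> hh ex ey.
(* The second equation controls [rho z f] and the first [rho z g], each in terms of both unknowns;
   the exponents of z of [f] and [g] have to drop simultaneously. *)
have key n : zlt n.+1 f /\ zlt n.+1 g -> zlt n f /\ zlt n g.
  move=> [hf hg]; have hh' : zlt n.+1 h by apply: zlt_le hh.
  split; apply: ztop => // a b.
    have -> : rho z f = - (lam z f + ga%:A *: Rop y g + Rop x h).
      by apply/eqP; rewrite -subr_eq0 opprK -[X in _ == X]ey /D2y {2}/Rop !addrA.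
    rewrite -sub0r; apply: vanishB; first by move=> b0; rewrite mcoeff0 pbw0.
    have {}hf : zlt n.+1 (lam z f + ga%:A *: Rop y g + Rop x h).
      apply: zltD; last exact: zlt_Rx.
      by apply: zltD; [apply: zlt_lam | apply/zltZ/zlt_Ry].
    exact: (hf a b n.+1 (leqnn _)).
  have -> : rho z g = - (al%:A *: Rop x f + lam z g + Rop y h).
    apply/eqP; rewrite -subr_eq0 opprK -[X in _ == X]ex /D2x.
    by rewrite -[Rop z g]/(rho z g + lam z g) !addrA [_ + rho z g]addrC.
  rewrite -sub0r; apply: vanishB; first by move=> b0; rewrite mcoeff0 pbw0.
  have {}hg : zlt n.+1 (al%:A *: Rop x f + lam z g + Rop y h).
    apply: zltD; last exact: zlt_Ry.
    by apply: zltD; [apply/zltZ/zlt_Rx | apply: zlt_lam].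
  exact: (hg a b n.+1 (leqnn _)).
have [f0 g0] : f = 0 /\ g = 0.
  have [N hf] := vanish_bound f; have [N' hg] := vanish_bound g.
  have : zlt (maxn N N') f /\ zlt (maxn N N') g.
    by split=> a b d; rewrite geq_max => /andP[l1 l2]; [apply: hf | apply: hg];
      rewrite ?l1 ?l2 orbT.
  by elim: (maxn N N') => [[/zlt0-> /zlt0->]|n IH /key].
split=> //; apply: ylt_zero => // n hn; apply: ytop => // a.
move: ex; rewrite /D2x f0 g0 !Rop0 scaler0 !add0r => /eqP; rewrite addr_eq0 => /eqP ->.
rewrite -sub0r; apply: vanishB; first by move=> b0; rewrite mcoeff0 pbw0.
by apply: vanish_lam; apply: hn.2.
Qed.

(** [f] involves only x and [g] no z, so comparing exponents of z kills [h], then those of y kill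
    [g], and finally those of x kill [f]. *)
Lemma D1_inj f g h : ylt 1 f -> zlt 1 g -> D1 f g h = 0 -> [/\ f = 0, g = 0 & h = 0].
Proof.
move=> hf hg e1.
have h0 : h = 0.
  apply: zlt_zero => n hn; apply: ztop => // a b.
  have -> : rho z h = lam z h - (Lop x f + Lop y g).
    apply/eqP; rewrite -subr_eq0 opprB addrC -[X in _ == X]e1 /D1 /Lop.
    by rewrite addrAC -addrA.
  have {}hf : zlt n.+1 (lam z h - (Lop x f + Lop y g)).
    apply: zltB; first exact: zlt_lam.
    by apply: (@zlt_le 1) => //; apply: zltD; [apply: zlt_Lx; case: hf | apply: zlt_Ly].
  exact: (hf a b n.+1 (leqnn _)).
have g0 : g = 0.
  apply: ylt_zero => // n hn; apply: ytop => // a.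
  have -> : rho y g = lam y g - Lop x f.
    apply/eqP; rewrite -subr_eq0 opprB addrC -[X in _ == X]e1 /D1 h0 Lop0 addr0 /Lop.
    by rewrite addrAC -addrA.
  apply: vanishB; first by apply: vanish_lam; apply: hn.2.
  have hf' : ylt n.+1 f by case: hf => hz hf; split=> // a' b lt; apply: hf; apply: leq_trans lt.
  apply: vanishB; first exact: (ylt_rhox hf').
  by apply: vanish_lam; apply: hf'.2.
split=> //; apply: xlt_zero => // n hn; apply: xtop => //.
move: e1; rewrite /D1 h0 g0 !Lop0 !addr0 => /eqP; rewrite subr_eq0 => /eqP ->.
by apply: vanish_lam; apply: hn.2.
Qed.

Lemma F_ind n (P : F -> Prop) : P 0 -> (forall f g, P f -> P g -> P (f + g)) ->
  (forall a b d m, (d < n)%N -> P (mon a b d *: basis_inj m)) -> forall f, zlt n f -> P f.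
Proof.
move=> P0 PD PM f hf; rewrite (malg_sum f); elim/big_rec: _ => // b1 g _; apply: (PD).
have [N hN] := pbw_recon pS f@_b1; rewrite (hN N (leqnn N)).
rewrite scaler_suml; apply: (big_ind P P0 PD) => a _.
rewrite scaler_suml; apply: (big_ind P P0 PD) => b _.
rewrite scaler_suml; apply: (big_ind P P0 PD) => d _.
have [lt|le] := ltnP d n; last by rewrite hf // !scale0r.
rewrite -iota_e -[_ *: mon _ _ _]mulr1 -scalerAl scalerAr -scalerA -iotaZ.
exact: PM.
Qed.

Lemma F_ind_all (P : F -> Prop) : P 0 -> (forall f g, P f -> P g -> P (f + g)) ->
  (forall a b d m, P (mon a b d *: basis_inj m)) -> forall f, P f.
Proof.
move=> P0 PD PM f; have [N hN] := vanish_bound f.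
apply: (F_ind (n := N)) => // a b d le; apply: hN; rewrite le orbT //.
Qed.

Lemma vanish_mon a b d a' b' d' m :
  ((a == a') && (b == b') && (d == d')) = false -> vanish (mon a' b' d' *: basis_inj m) a b d.
Proof.
by move=> ne b0; rewrite mcoeffZ iota_coef -scalerAr mulr1 pbwZ pbw_mon ne mulr0.
Qed.

Lemma zlt_mon a b d m : zlt d.+1 (mon a b d *: basis_inj m).
Proof. by move=> a' b' d' lt; apply: vanish_mon; rewrite (gtn_eqF lt) andbF. Qed.

Lemma Lop_siota v s m : Lop v (s *: basis_inj m) = (s * v) *: basis_inj m - s *: basis_inj (v *: m).
Proof. by rewrite /Lop rho_siota lam_siota. Qed.

Lemma Rop_siota v s m : Rop v (s *: basis_inj m) = (s * v) *: basis_inj m + s *: basis_inj (v *: m).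
Proof. by rewrite /Rop rho_siota lam_siota. Qed.

Lemma D3_red f : exists h, zlt 1 (f - Lop z h).
Proof.
elim/F_ind_all: f => [|f g [h hf] [h' hg]|a b d m].
- exists 0; rewrite Lop0 subr0 => a b d _ b0; rewrite mcoeff0 pbw0 //.
- by exists (h + h'); rewrite LopD opprD addrACA; apply: zltD.
elim: d m => [|d IH] m.
  by exists 0; rewrite Lop0 subr0; apply: zlt_mon.
have [h hh] := IH (z *: m); exists (mon a b d *: basis_inj m + h).
by rewrite LopD Lop_siota mon_z opprD opprB addrA addrCA subrr addr0.
Qed.

(** The normal form required by [D1_inj]; the third component stays free because [D1_inj] imposes
    nothing on it. *)
Definition D2_ok f g := exists u v w, ylt 1 (f - D2x u v w) /\ zlt 1 (g - D2y u v w).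

Lemma yltD n f g : ylt n f -> ylt n g -> ylt n (f + g).
Proof.
move=> [hz hf] [kz hg]; split; first exact: zltD.
by move=> a b le; apply: vanishD; [apply: hf | apply: hg].
Qed.

Lemma D2xD f g h f' g' h' : D2x (f + f') (g + g') (h + h') = D2x f g h + D2x f' g' h'.
Proof. by rewrite /D2x !RopD scalerDr [X in X + _ = _]addrACA [LHS]addrACA. Qed.

Lemma D2yD f g h f' g' h' : D2y (f + f') (g + g') (h + h') = D2y f g h + D2y f' g' h'.
Proof. by rewrite /D2y !RopD scalerDr [X in X + _ = _]addrACA [LHS]addrACA. Qed.

Lemma D2_okD f g f' g' : D2_ok f g -> D2_ok f' g' -> D2_ok (f + f') (g + g').
Proof.
move=> [u [v [w [hf hg]]]] [u' [v' [w' [hf' hg']]]]; exists (u + u'), (v + v'), (w + w').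
by rewrite D2xD D2yD !subrDACA; split; [apply: yltD | apply: zltD].
Qed.

Lemma D2_ok_sub f g u v w : D2_ok (f - D2x u v w) (g - D2y u v w) -> D2_ok f g.
Proof.
move=> [u' [v' [w' [hf hg]]]]; exists (u + u'), (v + v'), (w + w').
by rewrite D2xD D2yD (subr_sub f) (subr_sub g).
Qed.

Lemma zlt_0 n : zlt n 0.
Proof. by move=> a b d _ b0; rewrite mcoeff0 pbw0. Qed.

Lemma ylt_0 n : ylt n 0.
Proof. by split=> a b *; move=> b0; rewrite mcoeff0 pbw0. Qed.

Lemma D2_ok_y g : zlt 1 g -> D2_ok 0 g.
Proof.
move=> hg; exists 0, 0, 0; rewrite /D2x /D2y !Rop0 !scaler0 !addr0 !subr0.
split; [exact: (ylt_0 1) | exact: hg].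
Qed.

Lemma D2_ok_zlt n f : zlt n.+1 f -> D2_ok f 0 /\ D2_ok 0 f.
Proof.
(* In the absence of z, a factor y is removed through the third argument of [D2]; what this adds to
   the second component still has no z. *)
have z1 f0 : zlt 1 f0 -> D2_ok f0 0.
  move: f0; apply: (@F_ind 1 (fun f0 => D2_ok f0 0)) => [|f0 g hf hg|a b [|//] m _]; first by apply/D2_ok_y/zlt_0.
    by rewrite -(addr0 0); apply: D2_okD.
  elim: b m => [|b IH] m.
    exists 0, 0, 0; rewrite /D2x /D2y !Rop0 !scaler0 !addr0 !subr0; split.
      split; first exact: zlt_mon.
      by move=> a' b' lt; apply: vanish_mon; rewrite (gtn_eqF lt) andbF.
    by case: (ylt_0 1).
  apply: (@D2_ok_sub _ _ 0 0 (mon a b 0 *: basis_inj m)).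
  rewrite /D2x /D2y !Rop0 !scaler0 !add0r Rop_siota.
  have -> : mon a b 0 * y = mon a b.+1 0 by rewrite /mon !mulr1 -mulrA -exprSr.
  rewrite opprD addrA subrr !sub0r -[X in D2_ok X _]addr0 -[X in D2_ok _ X]add0r.
  apply: D2_okD; last first.
    apply: D2_ok_y; rewrite -sub0r; apply: zltB; first exact: zlt_0.
    by apply: zlt_Rx; apply: zlt_mon.
  have -> : - (mon a b 0 *: basis_inj (y *: m)) = mon a b 0 *: basis_inj ((-1)%:A *: (y *: m)).
    by rewrite iotaZ !scaleN1r scalerN.
  exact: IH.
elim: n f => [|n IH] f hf; first by split; [apply: z1 | apply: D2_ok_y].
move: f hf; apply: (@F_ind n.+2 (fun f => D2_ok f 0 /\ D2_ok 0 f)) => [|f g [h1 h2] [h3 h4]|a b d m lt].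
- by split; apply/D2_ok_y/zlt_0.
- by split; rewrite -(addr0 0); apply: D2_okD.
case: d lt => [|d] lt; first by apply: IH; apply: (@zlt_le 1) => //; apply: zlt_mon.
rewrite -mon_z; set s := mon a b d; have hs m' : zlt n.+1 (s *: basis_inj m').
  by apply: (@zlt_le d.+1) => //; apply: zlt_mon.
have fold0 v w : zlt n.+1 v -> zlt n.+1 w -> D2_ok v w.
  by move=> hv hw; rewrite -[v]addr0 -[w]add0r; apply: D2_okD; [case: (IH _ hv) | case: (IH _ hw)].
(* A factor z is removed from the first component through the second argument and from the second
   component through the first; the errors have a smaller exponent of z. *)
split.
  apply: (@D2_ok_sub _ _ 0 (s *: basis_inj m) 0).
  rewrite /D2x /D2y !Rop0 !scaler0 !add0r !addr0 Rop_siota subr_sub subrr.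
  apply: fold0; first by apply: zltB; [apply: zlt_0 | apply: hs].
  by rewrite -sub0r; apply: zltB; [apply: zlt_0 | apply/zltZ/zlt_Ry/hs].
apply: (@D2_ok_sub _ _ (s *: basis_inj m) 0 0).
rewrite /D2x /D2y !Rop0 !scaler0 !addr0 (Rop_siota z) subr_sub subrr.
apply: fold0; first by apply: zltB; [apply: zlt_0 | apply/zltZ/zlt_Rx/hs].
by apply: zltB; [apply: zlt_0 | apply: hs].
Qed.

Lemma D2_red f g : D2_ok f g.
Proof.
have [N hf] := vanish_bound f; have [N' hg] := vanish_bound g.
rewrite -[f]addr0 -[g]add0r; apply: D2_okD.
  have h : zlt N.+1 f by move=> a b d le; apply: hf; rewrite (ltnW le) orbT.
  by case: (D2_ok_zlt h).
have h : zlt N'.+1 g by move=> a b d le; apply: hg; rewrite (ltnW le) orbT.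
by case: (D2_ok_zlt h).
Qed.

Lemma relA_zx : z * x + x * z = - (ga *: (y * y)).
Proof. by rewrite (rel_zx pS) addrAC addNr sub0r. Qed.

Lemma relA_zy : z * y + y * z = - (al *: (x * x)).
Proof. by rewrite (rel_zy pS) addrAC addNr sub0r. Qed.

Lemma relA_yx : y * x + x * y = 0.
Proof. by rewrite (rel_yx pS) addNr. Qed.

Lemma Lop_Rop1 v f : Lop v (Rop v f) = rho (v * v) f - lam (v * v) f.
Proof.
rewrite /Lop /Rop !linearD !rho_mul !lam_mul -rho_iota_lam.
by rewrite addrA addrK.
Qed.

Lemma Rop_Lop1 v f : Rop v (Lop v f) = rho (v * v) f - lam (v * v) f.
Proof.
rewrite /Lop /Rop !linearB !rho_mul !lam_mul -rho_iota_lam /=.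
by rewrite addrA subrK.
Qed.

Lemma LopD3 v f g h : Lop v (f + g + h) = Lop v f + Lop v g + Lop v h.
Proof. exact: etrans (LopD v (f + g) h) (congr1 (+%R^~ _) (LopD v f g)). Qed.

Lemma D1_D2 f g h : D1 (D2x f g h) (D2y f g h) (D2z f g) = 0.
Proof.
have ex : Lop x (D2x f g h) = al%:A *: Lop x (Rop x f) + Lop x (Rop z g) + Lop x (Rop y h).
  by rewrite -LopZ; exact: LopD3.
have ey : Lop y (D2y f g h) = Lop y (Rop z f) + ga%:A *: Lop y (Rop y g) + Lop y (Rop x h).
  by rewrite -LopZ; exact: LopD3.
have ez : Lop z (D2z f g) = Lop z (Rop y f) + Lop z (Rop x g) by exact: LopD.
apply: etrans (congr2 +%R (congr2 +%R ex ey) ez) _.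
have ef : al%:A *: Lop x (Rop x f) + (Lop z (Rop y f) + Lop y (Rop z f)) = 0.
  rewrite Lop_Rop Lop_Rop1 relA_zy -scaleNr rhoZ lamZ -scalerBr -scalerDl.
  by rewrite scaleNr addrN scale0r.
have eg : ga%:A *: Lop y (Rop y g) + (Lop z (Rop x g) + Lop x (Rop z g)) = 0.
  rewrite Lop_Rop Lop_Rop1 relA_zx -scaleNr rhoZ lamZ -scalerBr -scalerDl.
  by rewrite scaleNr addrN scale0r.
have eh : Lop y (Rop x h) + Lop x (Rop y h) = 0.
  by rewrite Lop_Rop relA_yx rho0 lam0 subrr.
transitivity ((al%:A *: Lop x (Rop x f) + (Lop z (Rop y f) + Lop y (Rop z f)))
  + (ga%:A *: Lop y (Rop y g) + (Lop z (Rop x g) + Lop x (Rop z g)))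
  + (Lop y (Rop x h) + Lop x (Rop y h))); last by rewrite ef eg eh !addr0.
by rewrite [LHS](AC (3*3*2) ((1*(7*4))*(5*(8*2))*(6*3))).
Qed.

Lemma D2_D3 h : [/\ D2x (Lop x h) (Lop y h) (Lop z h) = 0,
  D2y (Lop x h) (Lop y h) (Lop z h) = 0 & D2z (Lop x h) (Lop y h) = 0].
Proof.
rewrite /D2x /D2y /D2z; split.
- rewrite -addrA (addrC (Rop z _)) [Rop y _ + _]addrC Rop_Lop Rop_Lop1 relA_zy -scaleNr.
  by rewrite rhoZ lamZ -scalerBr -scalerDl scaleNr addrN scale0r.
- rewrite addrAC Rop_Lop Rop_Lop1 relA_zx -scaleNr.
  by rewrite rhoZ lamZ -scalerBr -scalerDl scaleNr addNr scale0r.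
by rewrite Rop_Lop relA_yx rho0 lam0 subrr.
Qed.

Lemma koszul_exact0 f : aug f = 0 <-> exists u v w, f = D1 u v w.
Proof.
have aD1 u v w : aug (D1 u v w) = 0 by rewrite /D1 (linearD aug) (linearD aug) !aug_Lop !addr0.
split=> [|[u [v [w ->]]] //].
(* Modulo the image of [D1] every generator can be pushed across the tensor sign, until only 1 (x) m
   remains. *)
suff [u [v [w [m ->]]]] : exists u v w m, f = D1 u v w + basis_inj m.
  by rewrite linearD aD1 aug_iota add0r => ->; exists u, v, w; rewrite iota0 addr0.
have D1D u v w u' v' w' : D1 (u + u') (v + v') (w + w') = D1 u v w + D1 u' v' w'.
  by rewrite /D1 !LopD [X in X + _ = _]addrACA [LHS]addrACA.
have D1Z s u v w : D1 (s *: u) (s *: v) (s *: w) = s *: D1 u v w.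
  by rewrite /D1 !LopZ !scalerDr.
elim/malg_ind: f => [|f g [u [v [w [m ->]]]] [u' [v' [w' [m' ->]]]]|s b].
- by exists 0, 0, 0, 0; rewrite /D1 !Lop0 iota0 !addr0.
- by exists (u + u'), (v + v'), (w + w'), (m + m'); rewrite D1D iotaD addrACA.
rewrite -iota_e; move: (e b) => m; elim/(S_ind pS): s m => [m|a s t IHs IHt m|s i IH m].
- by exists 0, 0, 0, m; rewrite /D1 !Lop0 !add0r scale1r.
- have [u [v [w [m1 e1]]]] := IHs m; have [u' [v' [w' [m2 e2]]]] := IHt m.
  exists (a%:A *: u + u'), (a%:A *: v + v'), (a%:A *: w + w'), (a%:A *: m1 + m2).
  rewrite D1D D1Z iotaP addrACA -scalerDr -e1 -e2 scalerDl scalerA.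
  by rewrite -scalerAl mul1r.
have [u [v [w [m1 e1]]]] := IH (sv p i *: m).
have e2 : (s * sv p i) *: basis_inj m = Lop (sv p i) (s *: basis_inj m) + (D1 u v w + basis_inj m1).
  by rewrite -e1 Lop_siota subrK.
move: i e2 {e1 IH}; apply: ord3P => e2.
- exists (s *: basis_inj m + u), (0 + v), (0 + w), m1; rewrite D1D -addrA.
  have -> : D1 (s *: basis_inj m) 0 0 = Lop x (s *: basis_inj m) by rewrite /D1 !Lop0 !addr0.
  exact: e2.
- exists (0 + u), (s *: basis_inj m + v), (0 + w), m1; rewrite D1D -addrA.
  have -> : D1 0 (s *: basis_inj m) 0 = Lop y (s *: basis_inj m) by rewrite /D1 !Lop0 addr0 add0r.
  exact: e2.
exists (0 + u), (0 + v), (s *: basis_inj m + w), m1; rewrite D1D -addrA.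
have -> : D1 0 0 (s *: basis_inj m) = Lop z (s *: basis_inj m) by rewrite /D1 !Lop0 !add0r.
exact: e2.
Qed.

Lemma D1B f g h f' g' h' : D1 (f - f') (g - g') (h - h') = D1 f g h - D1 f' g' h'.
Proof.
apply: etrans (congr2 +%R (congr2 +%R (LopB x f f') (LopB y g g')) (LopB z h h')) _.
by rewrite -(subrDACA (Lop x f)) -(subrDACA (Lop x f + Lop y g)).
Qed.

Lemma D2xB f g h f' g' h' : D2x (f - f') (g - g') (h - h') = D2x f g h - D2x f' g' h'.
Proof.
apply: etrans (congr2 +%R (congr2 +%R (congr1 _ (RopB x f f')) (RopB z g g')) (RopB y h h')) _.
by rewrite scalerBr -(subrDACA (al%:A *: Rop x f)) -(subrDACA (al%:A *: Rop x f + Rop z g)).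
Qed.

Lemma D2yB f g h f' g' h' : D2y (f - f') (g - g') (h - h') = D2y f g h - D2y f' g' h'.
Proof.
apply: etrans (congr2 +%R (congr2 +%R (RopB z f f') (congr1 _ (RopB y g g'))) (RopB x h h')) _.
by rewrite scalerBr -(subrDACA (Rop z f)) -(subrDACA (Rop z f + ga%:A *: Rop y g)).
Qed.

(** An image is subtracted to reach the normal form, on which the differential is injective.
    [koszul_exact2] repeats the pattern with [D3_red] and [D2_inj]. *)
Lemma koszul_exact1 f g h : D1 f g h = 0 <->
  exists u v w, [/\ f = D2x u v w, g = D2y u v w & h = D2z u v].
Proof.
split=> [e1|[u [v [w [-> -> ->]]]]]; last exact: D1_D2.
have [u [v [w [hf hg]]]] := D2_red f g; exists u, v, w.
have e2 : D1 (f - D2x u v w) (g - D2y u v w) (h - D2z u v) = 0.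
  by rewrite D1B D1_D2 e1 subr0.
have [/eqP + /eqP + /eqP] := D1_inj hf hg e2.
by rewrite !subr_eq0 => /eqP ? /eqP ? /eqP ?.
Qed.

Lemma koszul_exact2 f g h : [/\ D2x f g h = 0, D2y f g h = 0 & D2z f g = 0] <->
  exists u, [/\ f = Lop x u, g = Lop y u & h = Lop z u].
Proof.
split=> [[ex ey ez]|[u [-> -> ->]]]; last exact: D2_D3.
have [u hu] := D3_red h; exists u; have [fx fy _] := D2_D3 u.
have [/eqP + /eqP + /eqP] : [/\ f - Lop x u = 0, g - Lop y u = 0 & h - Lop z u = 0].
  apply: D2_inj => //.
    by rewrite D2xB ex fx subrr.
  by rewrite D2yB ey fy subrr.
by rewrite !subr_eq0 => /eqP ? /eqP ? /eqP ?.
Qed.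

Lemma koszul_exact3 h : [/\ Lop x h = 0, Lop y h = 0 & Lop z h = 0] -> h = 0.
Proof. by case=> _ _; apply: D3_inj. Qed.

End Koszul.

(** * Noetherianity, augmentation and Hilbert series of the family *)

Lemma cubeB (R : comNzRingType) (u : R) : (1 - u) ^+ 3 = 1 - u *+ 3 + u ^+ 2 *+ 3 - u ^+ 3.
Proof. ring. Qed.

Section CliffordAlgebra.
Context (k : fieldType) (al ga : k) (T : free_alg k) (S : algType k).
Context (p : {lrmorphism T -> S}).
Hypothesis pS : presents p (fun g => exists i, g = clif_rel al ga T i).
Local Notation x := (sx p).
Local Notation y := (sy p).
Local Notation z := (sz p).
Local Notation mon := (mon p).
Local Notation pbw := (pbw pS).

Lemma clif_left_noetherian : left_noetherian S.
Proof.
pose K (s : S) := exists a : k, s = a%:A.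
have Kcomm a b : K a -> a * b = b * a.
  by move=> [d ->]; rewrite -scalerAl mul1r -scalerAr mulr1.
apply: (@quantum_left_noetherian S K x y z al%:A ga%:A) => //.
- split; first by exists 1; rewrite scale1r.
    by move=> _ _ [a ->] [b ->]; exists (a - b); rewrite scalerBl.
  by move=> _ _ [a ->] [b ->]; exists (a * b); rewrite -scalerAl mul1r scalerA.
- move=> _ [a ->] a0; exists a^-1%:A; first by exists a^-1.
  rewrite -scalerAl mul1r scalerA mulVf ?scale1r //.
  by apply: contraNneq a0 => ->; rewrite scale0r.
- by exists al.
- by exists ga.
- exact: rel_yx pS.
- by rewrite -scalerAl mul1r; apply: rel_zx pS.
- by rewrite -scalerAl mul1r; apply: rel_zy pS.
move=> P sP PK Px Py Pz; apply: (S_ind pS) => [|c u v Pu Pv|u i Pu].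
- exact: subring1.
- apply: subringD => //; rewrite -mulr_algl; apply: (subringM sP) => //.
  by apply: PK; exists c.
by apply: (subringM sP) => //; move: i; apply: ord3P.
Qed.

(** The relations are invariant under reversal of words, so the opposite ring satisfies the same
    hypotheses with the same x, y, z. *)
Lemma clif_right_noetherian : left_noetherian S^c.
Proof.
pose K (s : S^c) := exists a : k, s = (a%:A : S).
have Kcomm (a b : S^c) : K a -> a * b = b * a.
  move=> [d ->]; rewrite -[LHS]/((b : S) * d%:A) -[RHS]/(d%:A * (b : S)).
  by rewrite -scalerAl mul1r -scalerAr mulr1.
have anti (u v r : S) : u * v = - (v * u) - r -> v * u = - (u * v) - r.
  by move=> ->; rewrite opprB opprK addrAC subrr add0r.
apply: (@quantum_left_noetherian S^c K (x : S) (y : S) (z : S) (al%:A : S) (ga%:A : S)) => //.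
- split; first by exists 1; rewrite scale1r.
    by move=> _ _ [a ->] [b ->]; exists (a - b); rewrite scalerBl.
  move=> _ _ [a ->] [b ->]; exists (b * a).
  by rewrite -[LHS]/((b%:A : S) * a%:A) -scalerAl mul1r scalerA.
- move=> _ [a ->] a0; exists (a^-1%:A : S); first by exists a^-1.
  rewrite -[LHS]/((a%:A : S) * a^-1%:A) -scalerAl mul1r scalerA divff ?scale1r //.
  by apply: contraNneq a0 => ->; rewrite scale0r.
- by exists al.
- by exists ga.
- rewrite -[LHS]/((x : S) * y) -[X in - X]/((y : S) * x).
  by rewrite (rel_yx pS) opprK.
- rewrite -[LHS]/((x : S) * z) -[X in - X - _]/((z : S) * x).
  rewrite -[X in _ - X]/(((y : S) ^+ 2) * ga%:A) -scalerAr mulr1.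
  exact/anti/(rel_zx pS).
- rewrite -[LHS]/((y : S) * z) -[X in - X - _]/((z : S) * y).
  rewrite -[X in _ - X]/(((x : S) ^+ 2) * al%:A) -scalerAr mulr1.
  exact/anti/(rel_zy pS).
move=> P sP PK Px Py Pz; apply: (S_ind pS) => [|c u v Pu Pv|u i Pu].
- exact: (subring1 sP).
- apply: (subringD sP) => //; rewrite -mulr_algr; apply: (subringM sP _ Pu).
  by apply: PK; exists c.
by apply: (subringM sP _ Pu); move: i; apply: ord3P.
Qed.

Definition revT : {linear T -> T} := lext T (fun s => word (rev s)).

Lemma revT_word s : revT (word s) = word (rev s).
Proof. exact: lext_word. Qed.

Lemma revT_mul s t : revT (s * t) = revT t * revT s.
Proof.
elim/tensor_ind: s => [|c u s IH]; first by rewrite mul0r linear0 mulr0.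
rewrite mulrDl linearD IH !linearP /= mulrDr; congr (_ + _) => {IH s}.
rewrite -scalerAl linearZ /= -scalerAr; congr (_ *: _).
elim/tensor_ind: t => [|d v t IH]; first by rewrite mulr0 linear0 mul0r.
rewrite mulrDr linearD IH linearP /= mulrDl; congr (_ + _).
by rewrite -scalerAr linearZ /= -scalerAl !revT_word -!word_cat revT_word rev_cat.
Qed.

Lemma revT_rel i : revT (clif_rel al ga T i) = clif_rel al ga T i.
Proof.
have [e0 e1 e2] := clif_relE al ga T; move: i; apply: ord3P; rewrite ?e0 ?e1 ?e2.
- by rewrite !linearD linearZ /= !revT_word [_ + word [:: i1; i2]]addrC.
- by rewrite !linearD linearZ /= !revT_word [_ + word [:: i0; i2]]addrC.
by rewrite linearD /= !revT_word addrC.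
Qed.

Lemma revT_ker t : p t = 0 -> p (revT t) = 0.
Proof.
move=> /(proj2 pS) /ideal_lspan; elim=> [|d _ u [s [_ [r [[i ->] ->]]]] _ IH].
  by rewrite !linear0.
rewrite !linearP /= IH addr0 !revT_mul revT_rel !rmorphM /=.
have -> : p (clif_rel al ga T i) = 0 by apply/(proj2 pS)/ideal_gen_incl; exists i.
by rewrite mul0r mulr0 scaler0.
Qed.

(** The anti-automorphism fixing the generators. It exchanges left and right multiplication, which
    is how the dual of the Koszul complex is compared with the complex itself. *)
Definition tau (s : S) : S := p (revT (slift pS s)).

Lemma tau_p t : tau (p t) = p (revT t).
Proof.
apply/eqP; rewrite -subr_eq0 /tau -!linearB; apply/eqP/revT_ker.
by rewrite linearB /= sliftK subrr.
Qed.

Lemma tauP a u v : tau (a *: u + v) = a *: tau u + tau v.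
Proof. by rewrite -(sliftK pS u) -(sliftK pS v) -linearP !tau_p !linearP. Qed.

Lemma tauD u v : tau (u + v) = tau u + tau v.
Proof. by rewrite -[u]scale1r tauP !scale1r. Qed.

Lemma tau0 : tau 0 = 0.
Proof. by rewrite -(linear0 p) tau_p !linear0. Qed.

Lemma tauZ a u : tau (a *: u) = a *: tau u.
Proof. by rewrite -[a *: u]addr0 tauP tau0 addr0. Qed.

Lemma tauM u v : tau (u * v) = tau v * tau u.
Proof. by rewrite -(sliftK pS u) -(sliftK pS v) -rmorphM !tau_p revT_mul rmorphM. Qed.

Lemma tauK : involutive tau.
Proof.
move=> s; rewrite -(sliftK pS s) !tau_p.
suff -> : revT (revT (slift pS s)) = slift pS s by [].
elim/tensor_ind: (slift pS s) => [|c u t IH]; first by rewrite !linear0.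
by rewrite !linearP /= IH !revT_word revK.
Qed.

Lemma tau_sv i : tau (sv p i) = sv p i.
Proof. by rewrite /sv -word1 tau_p revT_word. Qed.

Lemma tau_eq0 s : tau s = 0 -> s = 0.
Proof. by move=> h; rewrite -(tauK s) h tau0. Qed.

Definition eps (s : S) : k := pbw 0 0 0 s.

Lemma epsP a u v : eps (a *: u + v) = a * eps u + eps v.
Proof. exact: pbwP. Qed.

Lemma eps1 : eps 1 = 1.
Proof. exact: pbw1. Qed.

Lemma eps0 : eps 0 = 0.
Proof. exact: pbw0. Qed.

Lemma epsD u v : eps (u + v) = eps u + eps v.
Proof. by rewrite -[u]scale1r epsP mul1r scale1r. Qed.

Lemma eps_svr u i : eps (u * sv p i) = 0.
Proof.
rewrite /eps pbw_act; move: i; apply: ord3P; rewrite /act //=.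
  by rewrite /actx subr0.
by rewrite /acty subr0.
Qed.

Lemma epsM u v : eps (u * v) = eps u * eps v.
Proof.
elim/(S_ind pS): v => [|c v w IHv IHw|v i IH]; first by rewrite mulr1 eps1 mulr1.
  by rewrite mulrDr -scalerAr !epsP IHv IHw mulrDr mulrCA.
by rewrite mulrA !eps_svr mulr0.
Qed.

Lemma eps_sv i : eps (sv p i) = 0.
Proof. by rewrite -[sv p i]mul1r eps_svr. Qed.

Lemma eps_dec s : exists c g0 g1 g2, s = c%:A + (x * g0 + y * g1 + z * g2).
Proof.
elim/(S_ind pS): s => [|a u v [c [g0 [g1 [g2 ->]]]] [d [h0 [h1 [h2 ->]]]]|u i].
- by exists 1, 0, 0, 0; rewrite !mulr0 !addr0 scale1r.
- exists (a * c + d), (a *: g0 + h0), (a *: g1 + h1), (a *: g2 + h2).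
  rewrite !mulrDr -!scalerAr scalerDl !scalerDr scalerA.
  by rewrite [LHS]addrACA; congr (_ + _); rewrite [LHS]addrACA [X in X + _ = _]addrACA.
move=> [c [g0 [g1 [g2 ->]]]].
have e g : (c%:A + (x * g0 + y * g1 + z * g2)) * g = c *: g + (x * (g0 * g) + y * (g1 * g) + z * (g2 * g)).
  by rewrite !mulrDl -scalerAl mul1r !mulrA.
move: i; apply: ord3P; rewrite e.
- exists 0, (g0 * sv p i0 + c%:A), (g1 * sv p i0), (g2 * sv p i0).
  by rewrite scale0r add0r mulrDr -scalerAr mulr1 [LHS](AC (1*3) (2*1*3*4)).
- exists 0, (g0 * sv p i1), (g1 * sv p i1 + c%:A), (g2 * sv p i1).
  by rewrite scale0r add0r mulrDr -scalerAr mulr1 [LHS](AC (1*3) (2*(3*1)*4)).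
exists 0, (g0 * sv p i2), (g1 * sv p i2), (g2 * sv p i2 + c%:A).
by rewrite scale0r add0r mulrDr -scalerAr mulr1 [LHS](AC (1*3) (2*3*(4*1))).
Qed.

(* The argument makes the S-module structure below recoverable by unification. *)
Definition triv_of of presents p (fun g => exists i, g = clif_rel al ga T i) : Type := k^o.
Local Notation triv := (triv_of pS).
HB.instance Definition _ := GRing.Zmodule.on triv.

Definition triv_scale (s : S) (a : triv) : triv := eps s * (a : k).

Fact triv_scaleA u v a : triv_scale u (triv_scale v a) = triv_scale (u * v) a.
Proof. by rewrite /triv_scale epsM mulrA. Qed.

Fact triv_scale1 : left_id 1 triv_scale.
Proof. by move=> a; rewrite /triv_scale eps1 mul1r. Qed.

Fact triv_scaleDr : right_distributive triv_scale +%R.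
Proof. by move=> s a b; rewrite /triv_scale -mulrDr. Qed.

Fact triv_scaleDl a : {morph triv_scale^~ a : u v / u + v}.
Proof. by move=> u v; rewrite /triv_scale -[u]scale1r epsP mul1r scale1r -mulrDl. Qed.

HB.instance Definition _ := GRing.Zmodule_isLmodule.Build S triv
  triv_scaleA triv_scale1 triv_scaleDr triv_scaleDl.

Lemma triv_sv i (a : triv) : sv p i *: a = 0.
Proof. by rewrite /GRing.scale /= /triv_scale eps_sv mul0r. Qed.

Fact eps_linear : linear (eps : S^o -> triv).
Proof.
move=> s u v; rewrite /GRing.scale /= /triv_scale -epsM.
by rewrite -[s * u]scale1r epsP mul1r scale1r.
Qed.

HB.instance Definition _ := GRing.isLinear.Build S S^o triv *:%R (eps : S^o -> triv) eps_linear.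

Lemma triv_trivial : trivial_module (pgr p) triv.
Proof.
exists (eps : S^o -> triv); split=> [a|s].
  by exists (a *: 1 : S); rewrite /= -[a *: 1]addr0 epsP eps1 eps0 mulr1 addr0.
split=> [|].
  have [c [g0 [g1 [g2 ->]]]] := eps_dec s.
  have e g i : eps (sv p i * g) = 0 by rewrite epsM eps_sv mul0r.
  rewrite /= epsP eps1 mulr1 !epsD !e !addr0 => ->.
  rewrite scale0r add0r.
  have gi i g : ideal_gen (fun u => exists n, (0 < n)%N /\ pgr p n u) (sv p i * g).
    apply/ideal_gen_mulr/ideal_gen_incl; exists 1%N; split=> //.
    by exists (fa_gen T i); split=> //; apply: homog_tgen.
  by apply: ideal_gen_add; [apply: ideal_gen_add|]; apply: gi.
apply: (ideal_gen_closed (P := fun s => eps s = 0)) => [|u v eu ev|a b g [n [n0 [t [ht ->]]]]].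
- exact: eps0.
- by rewrite -[u]scale1r epsP eu ev mulr0 addr0.
rewrite !epsM; suff -> : eps (p t) = 0 by rewrite mulr0 mul0r.
elim/homog_ind: ht => [|c w u sw _ IH]; first by rewrite linear0 eps0.
rewrite linearP epsP IH addr0; case/lastP: w sw n0 => [<-//|w i _ _].
by rewrite word_rcons rmorphM eps_svr mulr0.
Qed.

Lemma acts_degree s a b c : (a + b + c)%N != size s -> acts al ga s (delta3 k) a b c = 0.
Proof.
elim/last_ind: s a b c => [|s i IH] a b c.
  by rewrite /acts /= /delta3; case: a => [|a] //; case: b => [|b] //; case: c.
rewrite size_rcons /acts foldl_rcons -/(acts _ _ _ _).
move: i; apply: ord3P; rewrite /act /= => ne.
- rewrite /actx; case: a ne => [|a] ne; case: b ne => [|[|b]] ne; rewrite ?IH ?mulr0 ?if_same ?subr0 //;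
    by apply: contraNneq ne; rewrite ?addn0 ?addnS ?addSn ?add0n // => ->.
- rewrite /acty; case: b ne => [|b] ne; case: a ne => [|[|a]] ne; rewrite ?IH ?mulr0 ?if_same ?subr0 //;
    by apply: contraNneq ne; rewrite ?addn0 ?addnS ?addSn ?add0n // => ->.
rewrite /actz; case: c ne => [|c] ne //; rewrite IH //.
by apply: contraNneq ne; rewrite addnS => ->.
Qed.

Lemma pbw_degree n u a b c : pgr p n u -> (a + b + c)%N != n -> pbw a b c u = 0.
Proof.
move=> [t [ht ->]] ne; rewrite pbw_p; elim/homog_ind: ht => [|d s v sn _ IH].
  by rewrite linear0.
by rewrite linearP /= IH addr0 lext_word acts_degree ?scaler0 // sn.
Qed.

Lemma mon_pgr a b c : pgr p (a + b + c) (mon a b c).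
Proof.
exists (word (nseq a i0 ++ nseq b i1 ++ nseq c i2)); split.
  rewrite -[X in fhomog X _](_ : size (nseq a i0 ++ nseq b i1 ++ nseq c i2) = _).
    exact: homog_word.
  by rewrite !size_cat !size_nseq addnA.
have e i m : p (word (nseq m i)) = sv p i ^+ m.
  elim: m => [|m IH]; first by rewrite word_nil rmorph1.
  by rewrite /= word_cons rmorphM /= IH exprS.
by rewrite !word_cat !rmorphM /= !e mulrA.
Qed.

(** The third exponent is [n - (a + b)], so pairs are enough to index the monomials of degree
    [n]. *)
Definition triples n : seq (nat * nat) :=
  [seq (a, b) | a <- iota 0 n.+1, b <- iota 0 (n - a).+1].

Lemma mem_triples n a b : ((a, b) \in triples n) = (a + b <= n)%N.
Proof.
apply/allpairsPdep/idP => [[a' [b' []]]|le].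
  by rewrite !mem_iota => h1 h2 [-> ->]; lia.
by exists a, b; rewrite !mem_iota; split=> //; lia.
Qed.

Lemma triples_uniq n : uniq (triples n).
Proof.
apply: allpairs_uniq_dep; rewrite ?iota_uniq //; first by move=> a _; apply: iota_uniq.
by move=> [a b] [a' b'] _ _ [-> ->].
Qed.

(** The doubled count keeps (n + 1)(n + 2)/2 free of division. *)
Lemma size_triples n : (size (triples n)).*2 = (n.+1 * n.+2)%N.
Proof.
rewrite size_allpairs_dep sumnE big_map.
have -> : (\sum_(j <- iota 0 n.+1) size (iota 0 (n - j).+1) = \sum_(0 <= j < n.+1) (n - j).+1)%N.
  by rewrite /index_iota subn0; apply: eq_bigr => j _; rewrite size_iota.
elim: n => [|n IH]; first by rewrite big_nat1.
rewrite big_nat_recl // subn0 doubleD; under eq_bigr do rewrite subSS.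
by rewrite IH; lia.
Qed.

Lemma clif_dim n : has_dim (pgr p n) (size (triples n)).
Proof.
pose tr (i : 'I_(size (triples n))) := nth (0, 0)%N (triples n) i.
have trP i : ((tr i).1 + (tr i).2 <= n)%N.
  by rewrite -mem_triples -surjective_pairing; apply: mem_nth.
pose b i : S := mon (tr i).1 (tr i).2 (n - ((tr i).1 + (tr i).2)).
have bc i j : pbw (tr i).1 (tr i).2 (n - ((tr i).1 + (tr i).2)) (b j) = (i == j)%:R.
  rewrite pbw_mon; case: (i =P j) => [->|/eqP ne]; first by rewrite !eqxx.
  have : tr i != tr j by rewrite nth_uniq ?triples_uniq.
  rewrite [tr i]surjective_pairing [tr j]surjective_pairing xpair_eqE /=.
  by case: eqP => //= _; case: eqP.
have bS c a1 a2 a3 : pbw a1 a2 a3 (\sum_i c i *: b i) = \sum_i c i * pbw a1 a2 a3 (b i).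
  elim/big_ind2: _ => [|u1 u2 v1 v2 h1 h2|i _]; first exact: pbw0.
    by rewrite pbwD h1 h2.
  exact: pbwZ.
have bE c j : pbw (tr j).1 (tr j).2 (n - ((tr j).1 + (tr j).2)) (\sum_i c i *: b i) = c j.
  rewrite bS (bigD1 j) //= bc eqxx mulr1 big1 ?addr0 // => i ne.
  by rewrite bc eq_sym (negPf ne) mulr0.
exists b; split=> [i|s hs].
  by rewrite /b -{1}(subnKC (trP i)); apply: mon_pgr.
pose d : 'rV[k]_(size (triples n)) :=
  \row_i pbw (tr i).1 (tr i).2 (n - ((tr i).1 + (tr i).2)) s.
exists d; split=> [|c sE]; last by apply/rowP => j; rewrite mxE sE bE.
apply/eqP; rewrite -subr_eq0; apply/eqP/(pbw_inj (pS := pS)) => a1 a2 a3.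
rewrite -scaleN1r addrC pbwP mulN1r addrC; apply/eqP; rewrite subr_eq0; apply/eqP.
have [e|ne] := eqVneq (a1 + a2 + a3)%N n; last first.
  rewrite (pbw_degree hs ne) bS big1 // => i _; rewrite /b pbw_mon.
  rewrite (_ : _ && _ = false) ?mulr0 //; apply: contraNF ne => /andP[/andP[/eqP-> /eqP->] /eqP->].
  by rewrite subnKC.
have lt : (index (a1, a2) (triples n) < size (triples n))%N.
  by rewrite index_mem mem_triples -e leq_addr.
have trE : tr (Ordinal lt) = (a1, a2) by rewrite /tr nth_index // -index_mem.
have -> : a3 = (n - (a1 + a2))%N by rewrite -e addKn.
by have := bE (fun i => d 0 i) (Ordinal lt); rewrite trE /= => ->; rewrite mxE trE.
Qed.

Lemma clif_hilbert : hilbert_series_inv_cube (pgr p).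
Proof.
exists (fun n => size (triples n)); split; first exact: clif_dim.
have cE i : ((1 - 'X) ^+ 3 : {poly int})`_i =
    (i == 0)%N%:Z - 3%:Z * (i == 1)%N%:Z + 3%:Z * (i == 2)%N%:Z - (i == 3)%N%:Z.
  rewrite cubeB !(coefB, coefD, coefMn, coefXn, coefX, coef1).
  by case: i => [|[|[|[|i]]]].
(* Only the doubled count of [h] is used, so the list is abstracted and integer arithmetic
   remains. *)
suff key (h : nat -> nat) : (forall n, (h n).*2 = n.+1 * n.+2)%N -> forall n,
    \sum_(i < n.+1) ((1 - 'X) ^+ 3 : {poly int})`_i * (h (n - i)%N)%:Z = (n == 0%N)%:Z.
  exact: key size_triples.
move=> h2; have h0 := h2 0%N; have h1 := h2 1%N.
move=> [|[|[|n]]].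
- by rewrite big_ord1 cE /= subn0; lia.
- by rewrite !big_ord_recr big_ord0 !cE /= subn0 subnn; lia.
- rewrite !big_ord_recr big_ord0 !cE /= -[(2 - 0)%N]/2%N -[(2 - 1)%N]/1%N -[(2 - 2)%N]/0%N.
  by have h2' := h2 2%N; lia.
rewrite !big_ord_recl big1 ?addr0.
  rewrite !cE /= /bump /= !subn0 !subSS !subn0.
  have e0 := h2 n; have e1 := h2 n.+1; have e2 := h2 n.+2; have e3 := h2 n.+3.
  by lia.
by move=> i _; rewrite cE /= /bump /= !add1n /= !mulr0 !subr0 mul0r.
Qed.

End CliffordAlgebra.

(** * Projective resolutions, Ext and global dimension *)

Definition mklin (R : nzRingType) (U V : lmodType R) (f : U -> V) (lf : linear f) :
  {linear U -> V} := HB.pack f (GRing.isLinear.Build R U V *:%R f lf).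

Section Projectives.
Context (R : nzRingType).

Lemma ffun_projective n (P : lmodType R) : projective P -> projective {ffun 'I_n -> P}.
Proof.
move=> hP M N g f gs.
have single_linear (i : 'I_n) : linear (fun u : P => [ffun j => if j == i then u else 0] : {ffun 'I_n -> P}).
  move=> a u v; apply/ffunP => j; rewrite !ffunE; case: eqP => // _.
  by rewrite scaler0 addr0.
pose fi i : {linear P -> N} := f \o mklin (single_linear i).
have [h hh] : exists h : 'I_n -> {linear P -> M}, forall i u, g (h i u) = fi i u.
  have := fun i => hP _ _ g (fi i) gs; move=> /choice[h hh]; exists h => i; exact: hh.
have lh : linear (fun u : {ffun 'I_n -> P} => \sum_i h i (u i)).
  move=> a u v; rewrite scaler_sumr -big_split; apply: eq_bigr => i _.
  by rewrite !ffunE linearP.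
exists (mklin lh) => u; rewrite /= linear_sum /=.
under eq_bigr do rewrite hh /=; rewrite -linear_sum; congr (f _).
apply/ffunP => j; rewrite sum_ffunE (bigD1 j) //= ffunE eqxx big1 ?addr0 // => i ne.
by rewrite ffunE eq_sym (negPf ne).
Qed.

(* A projective module is a summand of a free one, so a map from it lifts as soon as
   its values do. *)
Lemma projective_lift (P A B : lmodType R) (g : {linear B -> A}) (f : {linear P -> A}) :
  projective P -> (forall u, exists v, g v = f u) ->
  exists h : {linear P -> B}, forall u, g (h u) = f u.
Proof.
move=> hP lifts; pose pi : {linear {malg R[P]} -> P} := fext (fun u : P => u).
have [|s hs] := hP _ _ pi (idfun : {linear P -> P}).
  by move=> u; exists << u >>; rewrite /pi fextU.
have [b hb] := choice lifts.
exists (fext b \o s : {linear P -> B}) => u /=.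
have -> : g (fext b (s u)) = f (pi (s u)).
  by apply: (malg_ext (g := g \o fext b) (h := f \o pi)) => v; rewrite /= /pi !fextU hb.
by rewrite hs.
Qed.

(* Comparing a resolution with one of length at most two shows that its third
   differential is split. *)
Lemma resolution_split (M : lmodType R) (r r' : resolution M) :
  (forall u : res_mod r' 3, u = 0) -> (forall u, res_d r 2 u = 0 -> u = 0) ->
  exists h : {linear res_mod r 2 -> res_mod r 3}, forall u, h (res_d r 2 u) = u.
Proof.
move=> r'0 inj.
have dd (q : resolution M) i u : res_d q i (res_d q i.+1 u) = 0.
  by apply/(res_exact (r := q)); exists u.
have ad (q : resolution M) u : res_aug q (res_d q 0 u) = 0.
  by apply/(res_exact0 (r := q)); exists u.
have lift0 (q q' : resolution M) : exists h : {linear res_mod q 0 -> res_mod q' 0},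
    forall u, res_aug q' (h u) = res_aug q u.
  by apply: projective_lift; [exact: res_projective | move=> u; exact: res_aug_surj].
have lift1 (q q' : resolution M) (h : {linear res_mod q 0 -> res_mod q' 0}) :
    (forall u, res_aug q' (h u) = res_aug q u) ->
    exists h1 : {linear res_mod q 1 -> res_mod q' 1},
      forall u, res_d q' 0 (h1 u) = h (res_d q 0 u).
  move=> hh; apply: (projective_lift (f := h \o res_d q 0)); first exact: res_projective.
  by move=> u; apply/(res_exact0 (r := q')); rewrite /= hh ad.
have liftS i (q q' : resolution M) (h : {linear res_mod q i -> res_mod q' i})
    (h1 : {linear res_mod q i.+1 -> res_mod q' i.+1}) :
    (forall u, res_d q' i (h1 u) = h (res_d q i u)) ->
    exists h2 : {linear res_mod q i.+2 -> res_mod q' i.+2},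
      forall u, res_d q' i.+1 (h2 u) = h1 (res_d q i.+1 u).
  move=> hh; apply: (projective_lift (f := h1 \o res_d q i.+1)); first exact: res_projective.
  by move=> u; apply/(res_exact (r := q')); rewrite /= hh dd linear0.
have [f0 hf0] := lift0 r r'; have [f1 hf1] := lift1 _ _ _ hf0.
have [f2 hf2] := liftS _ _ _ _ _ hf1.
have [g0 hg0] := lift0 r' r; have [g1 hg1] := lift1 _ _ _ hg0.
have [g2 hg2] := liftS _ _ _ _ _ hg1.
have lin_sub (U V : lmodType R) (a b : {linear U -> V}) : linear (fun u => a u - b u).
  by move=> s u v; rewrite !linearP /= scalerDr addrACA.
(* A homotopy between the identity and the composite of the two comparison maps, built up to degree
   two. *)
pose k0 : {linear _ -> _} := mklin (lin_sub _ _ idfun (g0 \o f0 : {linear _ -> _})).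
have [h0 hh0] : exists h : {linear res_mod r 0 -> res_mod r 1},
    forall u, res_d r 0 (h u) = k0 u.
  apply: projective_lift; first exact: res_projective.
  by move=> u; apply/(res_exact0 (r := r)); rewrite /= linearB /= hg0 hf0 subrr.
pose k1 : {linear _ -> _} := mklin (lin_sub _ _
  (mklin (lin_sub _ _ idfun (g1 \o f1 : {linear _ -> _})))
  (h0 \o res_d r 0 : {linear res_mod r 1 -> res_mod r 1})).
have [h1 hh1] : exists h : {linear res_mod r 1 -> res_mod r 2},
    forall u, res_d r 1 (h u) = k1 u.
  apply: projective_lift; first exact: res_projective.
  move=> u; apply/(res_exact (r := r)); rewrite /= !linearB /= hh0 /= hg1 hf1.
  by rewrite subrr.
pose k2 : {linear _ -> _} := mklin (lin_sub _ _
  (mklin (lin_sub _ _ idfun (g2 \o f2 : {linear _ -> _})))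
  (h1 \o res_d r 1 : {linear res_mod r 2 -> res_mod r 2})).
have [h2 hh2] : exists h : {linear res_mod r 2 -> res_mod r 3},
    forall u, res_d r 2 (h u) = k2 u.
  apply: projective_lift; first exact: res_projective.
  move=> u; apply/(res_exact (r := r)); rewrite /= !linearB /= hh1 /= hg2 hf2 dd.
  by rewrite linear0 subr0 subrr.
exists h2 => u; apply/eqP; rewrite -subr_eq0; apply/eqP/inj.
(* [r'] vanishes in degree three, so the comparison map kills the image of the third differential of
   [r]; on that image the homotopy alone gives the identity. *)
have f2d : f2 (res_d r 2 u) = 0.
  have : res_d r' 1 (f2 (res_d r 2 u)) = 0 by rewrite hf2 dd linear0.
  move=> /(res_exact (r := r'))[v <-]; rewrite (r'0 v) linear0 //.
by rewrite linearB hh2 /= f2d dd (linear0 g2) (linear0 h1) !subr0 subrr.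
Qed.

End Projectives.

Section Resolution.
Context (k : fieldType) (al ga : k) (T : free_alg k) (S : algType k).
Context (p : {lrmorphism T -> S}).
Hypothesis pS : presents p (fun g => exists i, g = clif_rel al ga T i).
Local Notation x := (sx p).
Local Notation y := (sy p).
Local Notation z := (sz p).

Context (M : lmodType S) (B : choiceType) (e : B -> M) (c : M -> {malg k[B]}).
Hypothesis cP : forall a u v, c (a%:A *: u + v) = a *: c u + c v.
Hypothesis ce : forall v, \sum_(b <- msupp (c v)) ((c v)@_b)%:A *: e b = v.
Hypothesis ec : forall b, c (e b) = << b >>.

Local Notation F := {malg S[B]}.
Local Notation Lop := (Lop e c).
Local Notation Rop := (Rop e c).

Definition kn i := match i with 0 => 1 | 1 => 3 | 2 => 3 | 3 => 1 | _ => 0 end%N.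
Definition kmod i : lmodType S := {ffun 'I_(kn i) -> F}.

Definition kd0 (f : {ffun 'I_3 -> F}) : {ffun 'I_1 -> F} :=
  [ffun _ => D1 p e c (f i0) (f i1) (f i2)].

Definition kd1 (f : {ffun 'I_3 -> F}) : {ffun 'I_3 -> F} :=
  [ffun j : 'I_3 => if j == i0 then D2x al p e c (f i0) (f i1) (f i2)
    else if j == i1 then D2y ga p e c (f i0) (f i1) (f i2) else D2z p e c (f i0) (f i1)].

Definition kd2 (f : {ffun 'I_1 -> F}) : {ffun 'I_3 -> F} :=
  [ffun j => Lop (sv p j) (f ord0)].

Fact kd0_linear : linear kd0.
Proof.
move=> a f g; apply/ffunP => j; rewrite !ffunE /D1 !LopD !LopZ !scalerDr.
exact: etrans (congr1 (+%R^~ _) (addrACA _ _ _ _)) (addrACA _ _ _ _).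
Qed.

Fact kd1_linear : linear kd1.
Proof.
move=> a f g; apply/ffunP => j; rewrite !ffunE.
have sc (s : S) (h : F) (b : k) : b%:A *: (s *: h) = s *: (b%:A *: h).
  by rewrite !scalerA -scalerAl mul1r -scalerAr mulr1.
have xZ u v w : D2x al p e c (a *: u) (a *: v) (a *: w) = a *: D2x al p e c u v w.
  apply: etrans (congr2 +%R (congr2 +%R (congr1 _ (RopZ e c x a u)) (RopZ e c z a v))
    (RopZ e c y a w)) _.
  rewrite (sc a (Rop x u) al).
  exact: esym (etrans (scalerDr a (al%:A *: Rop x u + Rop z v) _)
    (congr1 (+%R^~ _) (scalerDr a (al%:A *: Rop x u) _))).
have yZ u v w : D2y ga p e c (a *: u) (a *: v) (a *: w) = a *: D2y ga p e c u v w.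
  apply: etrans (congr2 +%R (congr2 +%R (RopZ e c z a u) (congr1 _ (RopZ e c y a v)))
    (RopZ e c x a w)) _.
  rewrite (sc a (Rop y v) ga).
  exact: esym (etrans (scalerDr a (Rop z u + ga%:A *: Rop y v) _)
    (congr1 (+%R^~ _) (scalerDr a (Rop z u) _))).
case: ifP => _; first by rewrite D2xD xZ.
case: ifP => _; first by rewrite D2yD yZ.
apply: etrans (congr2 +%R (etrans (RopD e c y (a *: f i0) (g i0)) (congr1 (+%R^~ _) (RopZ e c y a (f i0))))
  (etrans (RopD e c x (a *: f i1) (g i1)) (congr1 (+%R^~ _) (RopZ e c x a (f i1))))) _.
exact: etrans (addrACA _ _ _ _) (congr1 (+%R^~ _) (esym (scalerDr a (Rop y (f i0)) _))).
Qed.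

Fact kd2_linear : linear kd2.
Proof. by move=> a f g; apply/ffunP => j; rewrite !ffunE LopD LopZ. Qed.

Fact zero_linear (U V : lmodType S) : linear (fun _ : U => 0 : V).
Proof. by move=> a u v; rewrite scaler0 addr0. Qed.

Definition kd i : {linear kmod i.+1 -> kmod i} :=
  match i return {linear kmod i.+1 -> kmod i} with
  | 0%N => mklin kd0_linear
  | 1%N => mklin kd1_linear
  | 2%N => mklin kd2_linear
  | _ => mklin (@zero_linear _ _)
  end.

Fact kaug_linear : linear (fun f : kmod 0 => aug e (f ord0)).
Proof. by move=> a f g; rewrite !ffunE linearP. Qed.

Definition kaug : {linear kmod 0 -> M} := mklin kaug_linear.

Lemma kmod_projective i : projective (kmod i).
Proof. exact/ffun_projective/malg_projective. Qed.

Lemma kmod_eq0 i (u : kmod i) : (3 < i)%N -> u = 0.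
Proof.
move=> lt; apply/ffunP => -[j h]; exfalso.
by case: i u lt j h => [|[|[|[|i]]]].
Qed.

Definition triple (f g h : F) : {ffun 'I_3 -> F} :=
  [ffun j : 'I_3 => if j == i0 then f else if j == i1 then g else h].

Lemma tripleE f g h :
  [/\ triple f g h i0 = f, triple f g h i1 = g & triple f g h i2 = h].
Proof. by split; rewrite ffunE. Qed.

Lemma ffun3P (u v : {ffun 'I_3 -> F}) : u i0 = v i0 -> u i1 = v i1 -> u i2 = v i2 -> u = v.
Proof. by move=> h0 h1 h2; apply/ffunP; apply: ord3P. Qed.

Lemma kaug_surj m : exists u, kaug u = m.
Proof. by exists [ffun _ => basis_inj c m]; rewrite /= ffunE aug_iota. Qed.

Lemma kexact0 u : kaug u = 0 <-> exists v, kd 0 v = u.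
Proof.
rewrite /kaug /=; split=> [/(koszul_exact0 pS cP ce ec)[f [g [h eq]]]|[v <-]].
  exists (triple f g h); apply/ffunP => j; rewrite ffunE (ord1 j) eq.
  by have [-> -> ->] := tripleE f g h.
by rewrite ffunE; apply/(koszul_exact0 pS cP ce ec); do 3![eexists].
Qed.

Lemma kexact i u : kd i u = 0 <-> exists v, kd i.+1 v = u.
Proof.
case: i u => [|[|[|i]]] u.
- split=> [/ffunP/(_ ord0)|[v <-]].
    rewrite !ffunE => /(koszul_exact1 pS cP ce ec)[f [g [h [e0 e1 e2]]]].
    exists (triple f g h); have [t0 t1 t2] := tripleE f g h.
    by apply: ffun3P; rewrite ffunE t0 t1 ?t2.
  apply/ffunP => j; rewrite !ffunE; apply/(koszul_exact1 pS cP ce ec).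
  by exists (v i0), (v i1), (v i2).
- split=> [/ffunP h|[v <-]].
    have [w [e0 e1 e2]] : exists w, [/\ u i0 = Lop x w, u i1 = Lop y w & u i2 = Lop z w].
      apply/(koszul_exact2 pS cP ce ec).
      by split; [have := h i0 | have := h i1 | have := h i2]; rewrite !ffunE.
    by exists [ffun _ => w]; apply: ffun3P; rewrite !ffunE.
  have [h0 h1 h2] : [/\ D2x al p e c (kd2 v i0) (kd2 v i1) (kd2 v i2) = 0,
     D2y ga p e c (kd2 v i0) (kd2 v i1) (kd2 v i2) = 0 & D2z p e c (kd2 v i0) (kd2 v i1) = 0].
    by apply/(koszul_exact2 pS cP ce ec); exists (v ord0); rewrite !ffunE.
  by apply: ffun3P; rewrite [LHS]ffunE [RHS]ffunE; [exact: h0 | exact: h1 | exact: h2].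
- split=> [/ffunP h|[v <-]]; last exact: linear0.
  exists 0; apply/ffunP => j; rewrite linear0 ffunE (ord1 j); apply: esym.
  apply: (koszul_exact3 pS (e := e) (c := c)).
  by split; [have := h i0 | have := h i1 | have := h i2]; rewrite !ffunE.
by split=> [_|_]; [exists 0; rewrite linear0 [u]kmod_eq0 | rewrite [u]kmod_eq0 ?linear0].
Qed.

Definition kres : resolution M :=
  Resolution kmod_projective kaug_surj kexact0 kexact.

End Resolution.

Section TrivialExt.
Context (k : fieldType) (al ga : k) (T : free_alg k) (S : algType k).
Context (p : {lrmorphism T -> S}).
Hypothesis pS : presents p (fun g => exists i, g = clif_rel al ga T i).
Local Notation x := (sx p).
Local Notation y := (sy p).
Local Notation z := (sz p).
Local Notation M := (triv_of pS).
Local Notation tau := (tau pS).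
Local Notation eps := (eps pS).

Context (B : choiceType) (e : B -> M) (c : M -> {malg k[B]}).
Hypothesis cP : forall a u v, c (a%:A *: u + v) = a *: c u + c v.
Hypothesis ce : forall v, \sum_(b <- msupp (c v)) ((c v)@_b)%:A *: e b = v.
Hypothesis ec : forall b, c (e b) = << b >>.

Local Notation F := {malg S[B]}.
Local Notation Lop := (Lop e c).
Local Notation Rop := (Rop e c).
Local Notation kd := (kd al ga p e c).

Definition one_triv : M := (1 : k).
Local Notation io := (basis_inj c one_triv).

(** The trivial module is one-dimensional, but its chosen basis need not consist of the vector 1.
    [kap] reads coefficients with respect to 1 (x) 1 and identifies [F] with [S]. *)
Definition kap : {linear F -> S^o} := fext (fun b => (e b : k)%:A : S^o).

Lemma kapE (h : F) : h = (kap h : S) *: io.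
Proof.
elim/malg_ind: h => [|f g {1}-> {1}->|s b].
- by rewrite linear0 scale0r.
- by rewrite linearD scalerDl.
have -> : kap (s *: << b >>) = s * (e b : k)%:A :> S by rewrite linearZ /= fextU.
rewrite -scalerA; congr (_ *: _).
rewrite -(iotaZ cP) -(iota_e ec); congr (basis_inj c _).
by rewrite /GRing.scale /= /triv_scale -[X in eps X]addr0 epsP eps1 eps0 addr0 !mulr1.
Qed.

Lemma siota_eq0 (s : S) : s *: io = 0 -> s = 0.
Proof.
move=> h; have [b hb] : exists b, (c one_triv)@_b != 0.
  apply: contrapT => no; have : one_triv = 0.
    rewrite -(ce one_triv) big1 // => b _.
    have [->|ne] := eqVneq (c one_triv)@_b 0; first by rewrite !scale0r.
    by case: no; exists b.
  by move/eqP; rewrite oner_eq0.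
have : (s *: io)@_b = 0 by rewrite h mcoeff0.
rewrite mcoeffZ iota_coef -scalerAr mulr1 => /eqP.
rewrite scaler_eq0 (negPf hb) => /eqP //.
Qed.

Lemma kap_siota (s : S) : kap (s *: io) = s.
Proof.
have k1 : kap io = 1.
  apply/eqP; rewrite -subr_eq0; apply/eqP/siota_eq0.
  by rewrite scalerBl -kapE scale1r subrr.
by rewrite linearZ /= k1 -[_ *: _]/(s * 1) mulr1.
Qed.

Lemma kap_io : kap io = 1.
Proof. by rewrite -[io]scale1r kap_siota. Qed.

Lemma kap_0 : kap 0 = 0.
Proof. exact: linear0. Qed.

(** The generators kill the trivial module, so only right multiplication survives. *)
Lemma Lop_io i (s : S) : Lop (sv p i) (s *: io) = (s * sv p i) *: io.
Proof. by rewrite (Lop_siota cP ce) triv_sv (iota0 cP) scaler0 subr0. Qed.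

Lemma Rop_io i (s : S) : Rop (sv p i) (s *: io) = (s * sv p i) *: io.
Proof. by rewrite (Rop_siota cP ce) triv_sv (iota0 cP) scaler0 addr0. Qed.

Lemma D1_io (s t u : S) : D1 p e c (s *: io) (t *: io) (u *: io) = (s * x + t * y + u * z) *: io.
Proof.
rewrite /D1 (Lop_io i0) (Lop_io i1) (Lop_io i2) !scalerDl //.
Qed.

Lemma D2x_io (s t u : S) :
  D2x al p e c (s *: io) (t *: io) (u *: io) = (al *: (s * x) + t * z + u * y) *: io.
Proof.
rewrite /D2x (Rop_io i0) (Rop_io i1) (Rop_io i2) !scalerDl scalerA.
by rewrite -scalerAl mul1r.
Qed.

Lemma D2y_io (s t u : S) :
  D2y ga p e c (s *: io) (t *: io) (u *: io) = (s * z + ga *: (t * y) + u * x) *: io.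
Proof.
rewrite /D2y (Rop_io i0) (Rop_io i1) (Rop_io i2) !scalerDl scalerA.
by rewrite -scalerAl mul1r.
Qed.

Lemma D2z_io (s t : S) : D2z p e c (s *: io) (t *: io) = (s * y + t * x) *: io.
Proof. by rewrite /D2z (Rop_io i0) (Rop_io i1) !scalerDl. Qed.

(* The Koszul complex of S, obtained by stripping the generator [io]; the dual complex
   is carried to it by [tau]. *)
Lemma strip_exact1 (s t u : S) : s * x + t * y + u * z = 0 -> exists a b d,
  [/\ s = al *: (a * x) + b * z + d * y, t = a * z + ga *: (b * y) + d * x & u = a * y + b * x].
Proof.
move=> h; have : D1 p e c (s *: io) (t *: io) (u *: io) = 0 by rewrite D1_io h scale0r.
move=> /(koszul_exact1 pS cP ce ec)[f [g [w []]]].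
rewrite (kapE f) (kapE g) (kapE w) D2x_io D2y_io D2z_io.
move=> /(congr1 kap) e0 /(congr1 kap) e1 /(congr1 kap) e2.
by exists (kap f), (kap g), (kap w); rewrite !kap_siota in e0 e1 e2.
Qed.

Lemma strip_exact2 (s t u : S) : al *: (s * x) + t * z + u * y = 0 ->
  s * z + ga *: (t * y) + u * x = 0 -> s * y + t * x = 0 ->
  exists a, [/\ s = a * x, t = a * y & u = a * z].
Proof.
move=> h0 h1 h2.
have [] : [/\ D2x al p e c (s *: io) (t *: io) (u *: io) = 0,
   D2y ga p e c (s *: io) (t *: io) (u *: io) = 0 & D2z p e c (s *: io) (t *: io) = 0].
  by rewrite D2x_io D2y_io D2z_io h0 h1 h2 !scale0r.
move=> g0 g1 g2; have /(koszul_exact2 pS cP ce ec)[w] := And3 g0 g1 g2.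
rewrite (kapE w) (Lop_io i0) (Lop_io i1) (Lop_io i2).
case=> /(congr1 kap) e0 /(congr1 kap) e1 /(congr1 kap) e2.
by exists (kap w); rewrite !kap_siota in e0 e1 e2.
Qed.

Lemma strip_exact3 (s : S) : s * z = 0 -> s = 0.
Proof.
move=> h; apply: siota_eq0; apply: (D3_inj pS (e := e) (c := c)).
by rewrite (Lop_io i2) h scale0r.
Qed.

Definition single n (j : 'I_n) (u : F) : {ffun 'I_n -> F} := [ffun i => if i == j then u else 0].

Lemma singleE n (f : {linear {ffun 'I_n -> F} -> S^o}) u :
  f u = \sum_j (kap (u j) : S) * f (single j io) :> S.
Proof.
have {1}-> : u = \sum_j (kap (u j) : S) *: single j io.
  apply/ffunP => j; rewrite sum_ffunE (bigD1 j) //= !ffunE eqxx -kapE big1 ?addr0 // => i ne.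
  by rewrite !ffunE eq_sym (negPf ne) scaler0.
by rewrite linear_sum; apply: eq_bigr => j _; rewrite linearZ.
Qed.

Lemma mkcochain n (s : 'I_n -> S) :
  exists f : {linear {ffun 'I_n -> F} -> S^o}, forall u, f u = \sum_j (kap (u j) : S) * s j.
Proof.
have lf : linear (fun u : {ffun 'I_n -> F} => \sum_j (kap (u j) : S) * s j : S^o).
  move=> a u v; rewrite scaler_sumr -big_split; apply: eq_bigr => j _.
  by rewrite !ffunE linearP mulrDl; congr (_ + _); exact: esym (mulrA _ _ _).
by exists (mklin lf).
Qed.

Lemma kap_D1 f g h : kap (D1 p e c f g h) = kap f * x + kap g * y + kap h * z :> S.
Proof. by rewrite {1}(kapE f) {1}(kapE g) {1}(kapE h) D1_io kap_siota. Qed.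

Lemma kap_D2x f g h : kap (D2x al p e c f g h) = al *: (kap f * x) + kap g * z + kap h * y :> S.
Proof. by rewrite {1}(kapE f) {1}(kapE g) {1}(kapE h) D2x_io kap_siota. Qed.

Lemma kap_D2y f g h : kap (D2y ga p e c f g h) = kap f * z + ga *: (kap g * y) + kap h * x :> S.
Proof. by rewrite {1}(kapE f) {1}(kapE g) {1}(kapE h) D2y_io kap_siota. Qed.

Lemma kap_D2z f g : kap (D2z p e c f g) = kap f * y + kap g * x :> S.
Proof. by rewrite {1}(kapE f) {1}(kapE g) D2z_io kap_siota. Qed.

Lemma kap_Lop i f : kap (Lop (sv p i) f) = kap f * sv p i :> S.
Proof. by rewrite {1}(kapE f) Lop_io kap_siota. Qed.

Let r : resolution M := kres pS cP ce ec.

Lemma kap_single n (j i : 'I_n) : kap (single j io i) = (i == j)%:R :> S.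
Proof.
rewrite ffunE; case: eqP => _; last exact: linear0.
by rewrite -[io]scale1r kap_siota.
Qed.

(** A cochain is the tuple of its values on the elements [single j io], and the cocycle conditions
    are Koszul conditions with multiplication on the left. [tau] turns them into those of the
    [strip_exact] lemmas. *)
Lemma triv_ext i : ext_dim M (S^o : lmodType S) i (i == 3%N).
Proof.
exists r; case: i => [|[|[|[|i]]]].
- exists (fun j : 'I_0 => mklin (@zero_linear _ _ _ _)); split=> [[]//|f hf].
  exists 0; split=> [u|d _]; last by apply/rowP => -[].
  rewrite big_ord0 subr0 singleE big_ord1.
  suff -> : f (single ord0 io) = 0 by rewrite mulr0.
  have hv (j : 'I_3) : sv p j * (f (single ord0 io) : S) = 0.
    have : f (kd 0 (single j io)) = 0 by apply: hf.
    rewrite singleE big_ord1 /= ffunE kap_D1 !kap_single => <-; congr (_ * _).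
    by move: j; apply: ord3P; rewrite /= !mul0r mul1r ?add0r ?addr0.
  apply: (tau_eq0 (pS := pS)); apply: strip_exact3.
  by rewrite -[z](tau_sv pS i2) -(tauM pS) hv tau0.
- exists (fun j : 'I_0 => mklin (@zero_linear _ _ _ _)); split=> [[]//|f hf].
  exists 0; split=> [|d _]; last by apply/rowP => -[].
  pose s j : S := f (single j io).
  have hs (j : 'I_3) : f (kd 1 (single j io)) = 0 by apply: hf.
  have [a [e0 e1 e2]] : exists a, [/\ tau (s i0) = a * x, tau (s i1) = a * y & tau (s i2) = a * z].
    have tv i (u : S) : tau u * sv p i = tau (sv p i * u) by rewrite tauM tau_sv.
    apply: strip_exact2.
    + have := hs i0; rewrite singleE sum3 /= !ffunE /= kap_D2x kap_D2y kap_D2z !(kap_io, kap_0).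
      rewrite !mul0r !mul1r scaler0 ?addr0 ?add0r -scalerAl => h.
      rewrite !(tv i0) !(tv i1) !(tv i2) -tauZ -!tauD.
      by rewrite [X in tau X](_ : _ = 0) ?tau0.
    + have := hs i1; rewrite singleE sum3 /= !ffunE /= kap_D2x kap_D2y kap_D2z !(kap_io, kap_0).
      rewrite !mul0r !mul1r scaler0 ?addr0 ?add0r -scalerAl => h.
      rewrite !(tv i0) !(tv i1) !(tv i2) -tauZ -!tauD.
      by rewrite [X in tau X](_ : _ = 0) ?tau0.
    have := hs i2; rewrite singleE sum3 /= !ffunE /= kap_D2x kap_D2y kap_D2z !(kap_io, kap_0).
    rewrite !mul0r !mul1r !scaler0 ?addr0 ?add0r mul0r addr0 => h.
    rewrite !(tv i0) !(tv i1) -!tauD.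
    by rewrite [X in tau X](_ : _ = 0) ?tau0.
  have [g hg] := mkcochain (fun _ : 'I_1 => tau a); exists g => u.
  rewrite big_ord0 subr0 singleE sum3 hg big_ord1 /= ffunE kap_D1 !mulrDl -!mulrA.
  have inv (t : S) i : tau t = a * sv p i -> t = sv p i * tau a.
    by move=> h; rewrite -[t](tauK pS) h tauM tau_sv.
  by rewrite -/(s i0) -/(s i1) -/(s i2) (inv _ _ e0) (inv _ _ e1) (inv _ _ e2).
- exists (fun j : 'I_0 => mklin (@zero_linear _ _ _ _)); split=> [[]//|f hf].
  exists 0; split=> [|d _]; last by apply/rowP => -[].
  pose s j : S := f (single j io).
  have tv i (u : S) : tau u * sv p i = tau (sv p i * u) by rewrite tauM tau_sv.
  have [|a [b [d [e0 e1 e2]]]] := @strip_exact1 (tau (s i0)) (tau (s i1)) (tau (s i2)).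
    have : f (kd 2 (single ord0 io)) = 0 by apply: hf.
    rewrite singleE sum3 /= !ffunE /= !kap_Lop !kap_io !mul1r => h.
    rewrite (tv i0) (tv i1) (tv i2) -!tauD [X in tau X](_ : _ = 0) ?tau0 //.
    have vt i (u : S) : tau (u * sv p i) = sv p i * tau u by rewrite tauM tau_sv.
  have h0 := congr1 tau e0; have h1 := congr1 tau e1; have h2 := congr1 tau e2.
  have [g hg] := mkcochain (fun j : 'I_3 => if j == i0 then tau a else if j == i1 then tau b else tau d).
  exists g => u.
  rewrite big_ord0 subr0 singleE sum3 hg sum3 /= !ffunE /= kap_D2x kap_D2y kap_D2z.
  rewrite !tauK !tauD !tauZ !(vt i0) !(vt i1) !(vt i2) in h0 h1 h2.
  rewrite -/(s i0) -/(s i1) -/(s i2) h0 h1 h2 !mulrDr !mulrDl -!scalerAl -!scalerAr !mulrA.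
  by rewrite [LHS](AC (3*3*2) ((1*4*7)*(2*5*8)*(3*6))).
(* In degree three every map is a cocycle and the coboundaries have values x g0 + y g1 + z g2; the
   class of a map is the augmentation of its value, hence one dimension. *)
- have [zz hz] := mkcochain (fun _ : 'I_1 => 1 : S).
  exists (fun _ => zz); split=> [_ u|f _]; first by rewrite /= linear0.
  pose s : S := f (single ord0 io).
  have cob (d : 'rV[k]_1) : (exists g : {linear kmod S B 2 -> S^o}, forall u : kmod S B 3,
      f u - \sum_(j < 1) (d 0 j)%:A *: zz u = g (kd 2 u)) <->
      exists g0 g1 g2, s = (d 0 ord0)%:A + (x * g0 + y * g1 + z * g2).
    split=> [[g hg]|[g0 [g1 [g2 es]]]].
      exists (g (single i0 io)), (g (single i1 io)), (g (single i2 io)).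
      have := hg (single ord0 io); rewrite big_ord1 hz big_ord1 kap_single eqxx mulr1.
      rewrite [RHS]singleE sum3 /= !ffunE /= !kap_Lop !kap_io !mul1r.
      by rewrite -[_ *: _]/(_ * _) mulr1 -/s => <-; rewrite addrC subrK.
    have [g hg] := mkcochain (fun j : 'I_3 => if j == i0 then g0 else if j == i1 then g1 else g2).
    exists g => u; rewrite big_ord1 hz big_ord1 mulr1 singleE big_ord1 -/s es.
    rewrite hg sum3 /= !ffunE /= !kap_Lop mulrDr -[_%:A *: _]/(_ * _).
    rewrite -scalerAr mulr1 -scalerAl mul1r [LHS]addrC [LHS]addrA addNr add0r.
    by rewrite !mulrDr !mulrA.
  have [a [g0 [g1 [g2 es]]]] := eps_dec pS s.
  have su d0 h0 h1 h2 : s = d0%:A + (x * h0 + y * h1 + z * h2) -> eps s = d0.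
    move=> ->; rewrite epsP eps1 mulr1 !epsD !epsM -[x]/(sv p i0) -[y]/(sv p i1) -[z]/(sv p i2).
    by rewrite !eps_sv !mul0r !addr0.
  exists (const_mx a); split=> [|d hd].
    by apply/(cob (const_mx a)); exists g0, g1, g2; rewrite mxE.
  have /cob[h0 [h1 [h2 es']]] := hd.
  by apply/rowP => j; rewrite mxE (ord1 j) -(su _ _ _ _ es) (su _ _ _ _ es').
exists (fun j : 'I_0 => mklin (@zero_linear _ _ _ _)); split=> [[]//|f hf].
exists 0; split=> [|d _]; last by apply/rowP => -[].
exists (mklin (@zero_linear _ _ _ _)) => u.
by rewrite big_ord0 subr0 [u]kmod_eq0 // linear0.
Qed.

(** A resolution ending before degree three would split the last Koszul differential, whose entries
    are x, y, z; then 1 would lie in the kernel of the augmentation. *)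
Lemma triv_pd m : proj_dim_le M m -> (3 <= m)%N.
Proof.
case=> r' hr'; rewrite leqNgt; apply/negP => lt.
have inj (u : res_mod r 3) : res_d r 2 u = 0 -> u = 0.
  by move=> /(res_exact (r := r))[v <-].
have [h hh] := resolution_split (hr' 3%N lt) inj.
have eq1 : h (kd 2 (single ord0 io)) = single ord0 io := hh _.
have [g hg] := mkcochain (fun _ : 'I_1 => 1 : S).
have := congr1 g eq1; rewrite [RHS]hg big_ord1 kap_single mulr1 eqxx.
pose gh : {linear {ffun 'I_3 -> F} -> S^o} := g \o h.
rewrite -[LHS]/(gh _) singleE sum3 /= !ffunE /= !kap_Lop !kap_io !mul1r.
move/(congr1 eps); rewrite eps1 !epsD !epsM !eps_sv !mul0r !addr0 => /eqP.
by rewrite eq_sym oner_eq0.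
Qed.

End TrivialExt.

Section Regularity.
Context (k : fieldType) (al ga : k) (T : free_alg k) (S : algType k).
Context (p : {lrmorphism T -> S}).
Hypothesis pS : presents p (fun g => exists i, g = clif_rel al ga T i).

Lemma clif_proj_dim (M : lmodType S) m : (3 <= m)%N -> proj_dim_le M m.
Proof.
move=> le; have [B [e [c [cP ce ec]]]] := module_basis M.
exists (kres pS cP ce ec) => i lt u; apply: kmod_eq0; exact: leq_ltn_trans lt.
Qed.

Lemma clif_quantum_polynomial : quantum_polynomial3 (pgr p).
Proof.
have [B [e [c [cP ce ec]]]] := module_basis (triv_of pS : lmodType S).
split.
- apply: (presents_connected (d := 1) pS) => g [i ->]; exact: clif_rel_homog.
- by split; [exact: clif_left_noetherian pS | exact: clif_right_noetherian pS].
- move=> m; split=> [h|le M]; last exact: clif_proj_dim.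
  exact: (triv_pd cP ce ec (h _)).
- exists (triv_of pS : lmodType S); split; first exact: triv_trivial.
  by move=> i; apply: (triv_ext cP ce ec).
exact: (clif_hilbert pS).
Qed.

End Regularity.

(** * Finite-dimensional linear algebra *)

Section LinearAlgebra.
Context (k : fieldType).

Lemma surjective_ker_dim (U V : vectType k) (f : {linear U -> V}) :
  (forall v, exists u, f u = v) -> (\dim (lker (linfun f)) + dim V = dim U)%N.
Proof.
move=> fs; have := limg_ker_dim (linfun f) fullv; rewrite capfv.
have -> : limg (linfun f) = fullv.
  apply/vspaceP => v; rewrite memvf.
  by have [u <-] := fs v; rewrite -[f u]lfunE memv_img ?memvf.
by rewrite !dimvf.
Qed.

Lemma surjective_injective (U V : vectType k) (f : {linear U -> V}) u :
  (forall v, exists u, f u = v) -> dim U = dim V -> f u = 0 -> u = 0.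
Proof.
move=> fs eq fu; have := surjective_ker_dim fs; rewrite eq -[RHS]add0n => /addIn/eqP.
rewrite dimv_eq0 => /eqP l0; apply/eqP; rewrite -memv0 -l0 memv_ker lfunE /= fu //.
Qed.

Lemma surjective_ker1 (U V : vectType k) (f : {linear U -> V}) u u' :
  (forall v, exists u, f u = v) -> dim U = (dim V).+1 -> f u = 0 -> f u' = 0 -> u != 0 ->
  exists c, u' = c *: u.
Proof.
move=> fs eq fu fu' u0; have := surjective_ker_dim fs; rewrite eq -add1n => /addIn d1.
have /eqP lu : (<[u]> == lker (linfun f))%VS.
  by rewrite eqEdim d1 dim_vline u0 andbT -memvE memv_ker lfunE /= fu.
by apply/vlineP; rewrite lu memv_ker lfunE /= fu'.
Qed.

(** Among the subspaces contained in [P] one of largest dimension is taken; a vector of [P] outside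
    it could be adjoined. *)
Lemma closed_vspace (V : vectType k) (P : V -> Prop) :
  P 0 -> (forall c u v, P u -> P v -> P (c *: u + v)) ->
  exists U : {vspace V}, forall v, v \in U <-> P v.
Proof.
move=> P0 PD.
pose Q n := `[< exists U : {vspace V}, (forall v, v \in U -> P v) /\ \dim U = n >].
have Q0 : exists n, Q n.
  by exists 0%N; apply/asboolP; exists 0%VS; split; [move=> v; rewrite memv0 => /eqP -> | rewrite dimv0].
have Qb n : Q n -> (n <= dim V)%N.
  by move=> /asboolP[U [_ <-]]; rewrite -dimvf; apply/dimvS/subvf.
case: (ex_maxnP Q0 Qb) => n /asboolP[U [UP dU]] nmax.
exists U => v; split; first exact: UP.
move=> Pv; apply: contrapT => /negP vU.
have : Q (\dim (U + <[v]>)).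
  apply/asboolP; exists (U + <[v]>)%VS; split=> // w /memv_addP[u /UP Pu [_ /vlineP[c ->] ->]].
  by rewrite addrC; apply: PD.
move=> /nmax; apply/negP; rewrite -ltnNge -dU.
by rewrite (ltn_leqif (dimv_leqif_sup (addvSl _ _))) subv_add subvv /= -memvE.
Qed.

(** The remainder of [v] after projection onto the subspace has a nonzero coordinate; taking this
    coordinate of the remainder is the functional. *)
Lemma separation (V : vectType k) (P : V -> Prop) v :
  P 0 -> (forall c u v, P u -> P v -> P (c *: u + v)) -> ~ P v ->
  exists phi : {linear V -> k^o}, (forall u, P u -> phi u = 0) /\ phi v != 0.
Proof.
move=> P0 PD nPv; have [U UP] := closed_vspace P0 PD.
have : v - projv U v != 0.
  apply/eqP => /eqP; rewrite subr_eq0 => /eqP e; apply/nPv/UP; rewrite e.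
  exact: memv_proj.
set d := _ - _ => d0; pose X := vbasis {:V}.
have [i di] : exists i, coord X i d != 0.
  apply: contrapT => no; case/eqP: d0; rewrite (coord_vbasis (memvf d)) big1 // => i _.
  by have [->|ne] := eqVneq (coord X i d) 0; [rewrite scale0r | case: no; exists i].
have lphi : linear (fun u => coord X i (u - projv U u) : k^o).
  move=> c u w; rewrite (_ : c *: u + w - _ = c *: (u - projv U u) + (w - projv U w)).
    by rewrite linearP.
  by rewrite (linearP (projv U)) scalerBr opprD addrACA.
exists (mklin lphi); split=> // u /UP Uu.
by rewrite /= projv_id // subrr linear0.
Qed.

Lemma dual_vectors (V : vectType k) n (X : 'I_n -> V) (a : 'I_n -> k) :
  (forall c : 'I_n -> k, \sum_i c i *: X i = 0 -> forall i, c i = 0) ->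
  exists phi : {linear V -> k^o}, forall i, phi (X i) = a i.
Proof.
move=> indep; pose Y := [tuple X i | i < n].
have Yf : free Y.
  apply/freeP => c h i; apply: indep; rewrite -[RHS]h; apply: eq_bigr => j _.
  by rewrite nth_mktuple.
have lphi : linear (fun v => \sum_i a i * coord Y i v : k^o).
  move=> c u v; rewrite scaler_sumr -big_split; apply: eq_bigr => i _.
  by rewrite linearP mulrDr mulrCA.
exists (mklin lphi) => i /=; rewrite (bigD1 i) //= big1 ?addr0 => [|j ne].
  by rewrite -[X i](nth_mktuple _ 0) coord_free // eqxx mulr1.
by rewrite -[X i](nth_mktuple _ 0) coord_free // eq_sym (negPf ne) mulr0.
Qed.

Lemma dependent_vectors m n (A : 'M[k]_(m, n)) : (n < m)%N ->
  exists2 u : 'rV[k]_m, u != 0 & u *m A = 0.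
Proof.
move=> lt; have : kermx A != 0.
  by rewrite kermx_eq0 -row_leq_rank -ltnNge (leq_ltn_trans (rank_leq_col A)).
by move=> /rowV0Pn[u /sub_kermxP uA u0]; exists u.
Qed.

End LinearAlgebra.

(** * Relations and syzygies in degrees two and three *)

Section Converse.
Context (k : fieldType) (T : free_alg k).
Hypothesis two0 : (2%:R : k) != 0.
Variable W : 'I_3 -> 'I_3 -> 'I_3 -> k.
Hypotheses (Wcyc : forall a b c, W a b c = W b c a) (Wsw : forall a b c, W a b c = W a c b).
Local Notation gen := (fa_gen T).
Local Notation coef := (@fa_coef k T).

Definition wrel (i : 'I_3) : T := \sum_j \sum_l W i j l *: (gen j * gen l).

Lemma word2 i j : word [:: i; j] = gen i * gen j :> T.
Proof. by rewrite word_cons word1. Qed.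

Lemma word3 i j l : word [:: i; j; l] = gen i * gen j * gen l :> T.
Proof. by rewrite word_cons word2 mulrA. Qed.

Lemma wrelE i : wrel i = \sum_j \sum_l W i j l *: word [:: j; l].
Proof. by do 2![apply: eq_bigr => ? _]; rewrite word2. Qed.

Lemma wrel_homog i : fhomog 2 (wrel i).
Proof.
rewrite wrelE; apply: homog_sum => j _; apply: homog_sum => l _.
by apply/homogZ; apply: homog_word.
Qed.

Lemma coef_sum2 (c : 'I_3 -> 'I_3 -> k) a b :
  coef [:: a; b] (\sum_j \sum_l c j l *: word [:: j; l]) = c a b.
Proof.
rewrite fcoef_sum (bigD1 a) //= fcoef_sum (bigD1 b) //= fcoefZ fcoef_word eqxx mulr1.
rewrite !big1 ?addr0 // => [i ne|i ne].
  rewrite fcoef_sum big1 // => j _; rewrite fcoefZ fcoef_word !eqseq_cons (negPf ne).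
  by rewrite mulr0.
by rewrite fcoefZ fcoef_word !eqseq_cons (negPf ne) andbF mulr0.
Qed.

Lemma coef_wrel i a b : coef [:: a; b] (wrel i) = W i a b.
Proof. by rewrite wrelE coef_sum2. Qed.

Lemma coef_gen_l i x a s : coef (a :: s) (gen i * x) = (i == a)%:R * coef s x.
Proof.
elim/tensor_ind: x => [|d t x IH]; first by rewrite mulr0 !fcoef0 mulr0.
rewrite mulrDr -scalerAr -word_cons !fcoefP IH !fcoef_word eqseq_cons mulrDr.
by congr (_ + _); case: eqP; rewrite ?mul1r ?mul0r ?mulr0.
Qed.

Lemma coef_gen_r i x a s : coef (rcons s a) (x * gen i) = coef s x * (i == a)%:R.
Proof.
elim/tensor_ind: x => [|d t x IH]; first by rewrite mul0r !fcoef0 mul0r.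
rewrite mulrDl -scalerAl -word_rcons !fcoefP IH !fcoef_word eqseq_rcons mulrDl.
by congr (_ + _); case: (i =P a); rewrite ?andbT ?andbF ?mulr1 ?mulr0.
Qed.

Lemma homog2P x y : fhomog 2 x -> fhomog 2 y ->
  (forall i j, coef [:: i; j] x = coef [:: i; j] y) -> x = y.
Proof.
move=> hx hy h; rewrite (homog2E hx) (homog2E hy).
by do 2![apply: eq_bigr => ? _]; rewrite h.
Qed.

Lemma homog3P x y : fhomog 3 x -> fhomog 3 y ->
  (forall i j l, coef [:: i; j; l] x = coef [:: i; j; l] y) -> x = y.
Proof.
move=> hx hy h; rewrite (homog3E hx) (homog3E hy).
by do 3![apply: eq_bigr => ? _]; rewrite h.
Qed.

Fact V2_linear : linear (fun x : T => \matrix_(i, j) coef [:: i; j] x).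
Proof. by move=> c x y; apply/matrixP => i j; rewrite !mxE fcoefP. Qed.

(** Degree two is read as a matrix space, and below degree three as triples of matrices, so that
    dimensions can be counted. *)
Definition V2 : {linear T -> 'M[k]_3} := mklin V2_linear.

Lemma V2E x i j : V2 x i j = coef [:: i; j] x.
Proof. by rewrite /= mxE. Qed.

Lemma V2_surj m : exists2 x, fhomog 2 x & V2 x = m.
Proof.
exists (\sum_i \sum_j m i j *: word [:: i; j]).
  by apply: homog_sum => i _; apply: homog_sum => j _; apply/homogZ; apply: homog_word.
by apply/matrixP => i j; rewrite V2E coef_sum2.
Qed.

Fact V3_linear : linear (fun x : T =>
  [ffun i => \matrix_(j, l) coef [:: i; j; l] x] : {ffun 'I_3 -> 'M[k]_3}).
Proof. by move=> c x y; apply/ffunP => i; apply/matrixP => j l; rewrite !(ffunE, mxE) fcoefP. Qed.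

Definition V3 : {linear T -> {ffun 'I_3 -> 'M[k]_3}} := mklin V3_linear.

Lemma V3E x i j l : V3 x i j l = coef [:: i; j; l] x.
Proof. by rewrite /= ffunE mxE. Qed.

Lemma coef_sum3 (c : 'I_3 -> 'I_3 -> 'I_3 -> k) a b d :
  coef [:: a; b; d] (\sum_i \sum_j \sum_l c i j l *: word [:: i; j; l]) = c a b d.
Proof.
rewrite (_ : \sum_i _ = \sum_i gen i * \sum_j \sum_l c i j l *: word [:: j; l]).
  rewrite fcoef_sum (bigD1 a) //= coef_gen_l eqxx mul1r coef_sum2 big1 ?addr0 // => i ne.
  by rewrite coef_gen_l (negPf ne) mul0r.
apply: eq_bigr => i _; rewrite mulr_sumr; apply: eq_bigr => j _.
by rewrite mulr_sumr; apply: eq_bigr => l _; rewrite word_cons scalerAr.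
Qed.

Lemma V3_surj m : exists2 x, fhomog 3 x & V3 x = m.
Proof.
exists (\sum_i \sum_j \sum_l m i j l *: word [:: i; j; l]).
  by do 3![apply: homog_sum => ? _]; apply/homogZ; apply: homog_word.
by apply/ffunP => i; apply/matrixP => j l; rewrite V3E coef_sum3.
Qed.

Section WithS.
Context (S : algType k) (p : {lrmorphism T -> S}).
Hypothesis pS : presents p (fun g => exists i, g = wrel i).
Hypotheses (dim2 : has_dim (pgr p 2) 6) (dim3 : has_dim (pgr p 3) 10).

Let G := fun g => exists i, g = wrel i.

Lemma G_homog g : G g -> fhomog 2 g.
Proof. by case=> i ->; apply: wrel_homog. Qed.

Lemma lift_basis n h : has_dim (pgr p n) h -> exists t : 'I_h -> T,
  (forall i, fhomog n (t i)) /\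
  forall x, fhomog n x -> exists c : 'rV[k]_h, p (x - \sum_i c 0 i *: t i) = 0.
Proof.
case=> b [hb hspan]; have [t ht] := choice hb; exists t; split=> [i|x hx].
  by case: (ht i).
have [|c [hc _]] := hspan (p x); first by exists x.
exists c; rewrite linearB linear_sum /= hc; apply/eqP; rewrite subr_eq0; apply/eqP.
by apply: eq_bigr => i _; rewrite linearZ; case: (ht i) => _ ->.
Qed.

Lemma ker2 x : fhomog 2 x -> p x = 0 -> exists c : 'I_3 -> k, x = \sum_i c i *: wrel i.
Proof.
move=> hx /(proj2 pS) hI; apply: lspan_fin.
exact: (ideal_deg G_homog hx hI).
Qed.

(** Degree two of [T] has dimension 9 = 6 + 3, where 6 belongs to [S]; three relations that fill the
    difference are independent. *)
Lemma wrel_indep (c : 'I_3 -> k) : \sum_i c i *: wrel i = 0 -> forall i, c i = 0.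
Proof.
have [t [ht hs]] := lift_basis dim2.
have lf : linear (fun u : 'rV[k]_6 * 'rV[k]_3 =>
    V2 (\sum_i u.1 0 i *: t i) + V2 (\sum_i u.2 0 i *: wrel i)).
  move=> a u v; rewrite scalerDr addrACA -!linearP; congr (V2 _ + V2 _);
    by rewrite scaler_sumr -big_split; apply: eq_bigr => i _; rewrite !mxE scalerDl scalerA.
have surj m : exists u, mklin lf u = m.
  have [x hx <-] := V2_surj m; have [d hd] := hs x hx.
  have [|e he] := ker2 _ hd.
    by apply: homogB => //; apply: homog_sum => i _; apply: homogZ.
  exists (d, \row_i e i); apply: etrans (esym (linearD V2 _ _)) _; congr (V2 _).
  under [X in _ + X]eq_bigr do rewrite mxE.
  by rewrite -he addrC subrK.
move=> h; have : mklin lf (0, \row_i c i) = 0.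
  apply: etrans (esym (linearD V2 _ _)) _; rewrite -[RHS](linear0 V2); congr (V2 _).
  rewrite big1 ?add0r => [|i _]; last by rewrite mxE scale0r.
  by rewrite -[RHS]h; apply: eq_bigr => i _; rewrite mxE.
have eqd : dim ('rV[k]_6 * 'rV[k]_3)%type = dim 'M[k]_3.
  by rewrite -[LHS]/(dim 'rV[k]_6 + dim 'rV[k]_3)%N !dim_matrix.
move=> /(surjective_injective surj eqd)[/rowP c0] i.
by have := c0 i; rewrite !mxE.
Qed.

Lemma W_indep (c : 'I_3 -> k) : (forall j l, \sum_i c i * W i j l = 0) -> forall i, c i = 0.
Proof.
move=> h; apply: wrel_indep; apply: homog2P; [|exact: homog0|].
  by apply: homog_sum => i _; apply/homogZ/wrel_homog.
move=> a b; rewrite fcoef_sum fcoef0 -[RHS](h a b).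
by apply: eq_bigr => i _; rewrite fcoefZ coef_wrel.
Qed.

Lemma ker3 x : fhomog 3 x -> p x = 0 -> exists a b : 'I_3 -> 'I_3 -> k,
  x = \sum_i \sum_j (a i j *: (gen i * wrel j) + b i j *: (wrel j * gen i)).
Proof.
move=> hx /(proj2 pS) hI; have := ideal_degS G_homog hx hI.
elim=> [|d g y [i [g0 [[j ->] eg]]] _ [a [b ->]]].
  exists (fun _ _ => 0), (fun _ _ => 0); rewrite big1 // => i _; rewrite big1 // => j _.
  by rewrite !scale0r addr0.
have one (c : 'I_3 -> 'I_3 -> T) : \sum_i' \sum_j' (if (i' == i) && (j' == j) then d else 0) *: c i' j' = d *: c i j.
  rewrite (bigD1 i) //= (bigD1 j) //= !eqxx !big1 ?addr0 // => [i' ne|j' ne].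
    by rewrite big1 // => j' _; rewrite (negPf ne) scale0r.
  by rewrite (negPf ne) scale0r.
case: eg => ->.
  exists (fun i' j' => (if (i' == i) && (j' == j) then d else 0) + a i' j'), b.
  rewrite -(one (fun i' j' => gen i' * wrel j')) -big_split; apply: eq_bigr => i' _; rewrite -big_split; apply: eq_bigr => j' _.
  by rewrite /= scalerDl addrA.
exists a, (fun i' j' => (if (i' == i) && (j' == j) then d else 0) + b i' j').
rewrite -(one (fun i' j' => wrel j' * gen i')) -big_split; apply: eq_bigr => i' _; rewrite -big_split; apply: eq_bigr => j' _.
by rewrite /= scalerDl addrCA.
Qed.

Lemma W_neq0 : exists a b c, W a b c != 0.
Proof.
apply: contrapT => no; have h := @W_indep (fun=> 1) _ i0.
have : (1 : k) = 0.
  apply: h => j l; rewrite big1 // => i _.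
  by have [->|ne] := eqVneq (W i j l) 0; [rewrite mulr0 | case: no; exists i, j, l].
by move/eqP; rewrite oner_eq0.
Qed.

(* There is one linear relation between the x_i w_j and the w_j x_i, namely
   \sum x_i w_i = \sum w_i x_i. *)
Lemma W_syzygy (a b : 'I_3 -> 'I_3 -> k) :
  (forall u v r, \sum_j a u j * W j v r + \sum_j b r j * W j u v = 0) ->
  exists c, (forall i j, a i j = c * (i == j)%:R) /\ (forall i j, b i j = - c * (i == j)%:R).
Proof.
have [t [ht hs]] := lift_basis dim3.
pose comb (m n : 'M[k]_3) : T :=
  \sum_i \sum_j (m i j *: (gen i * wrel j) + n i j *: (wrel j * gen i)).
have lf : linear (fun u : 'rV[k]_10 * ('M[k]_3 * 'M[k]_3) =>
    V3 (\sum_i u.1 0 i *: t i) + V3 (comb u.2.1 u.2.2)).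
  move=> e u v; rewrite scalerDr addrACA -!linearP; congr (V3 _ + V3 _).
    by rewrite scaler_sumr -big_split; apply: eq_bigr => i _; rewrite !mxE scalerDl scalerA.
  rewrite scaler_sumr -big_split; apply: eq_bigr => i _.
  rewrite scaler_sumr -big_split; apply: eq_bigr => j _.
  by rewrite !mxE !scalerDl scalerDr !scalerA addrACA.
have comb_homog m n : fhomog 3 (comb m n).
  apply: homog_sum => i _; apply: homog_sum => j _; apply: homogD; apply: homogZ.
    by apply: (homogM (n := 1) (m := 2)); [apply: homog_tgen | apply: wrel_homog].
  by apply: (homogM (n := 2) (m := 1)); [apply: wrel_homog | apply: homog_tgen].
have surj m : exists u, mklin lf u = m.
  have [x hx <-] := V3_surj m; have [d hd] := hs x hx.
  have [|e [e' he]] := ker3 _ hd.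
    by apply: homogB => //; apply: homog_sum => i _; apply: homogZ.
  exists (d, (\matrix_(i, j) e i j, \matrix_(i, j) e' i j)); apply: etrans (esym (linearD V3 _ _)) _; congr (V3 _).
  rewrite /comb; under [X in _ + X]eq_bigr do under eq_bigr do rewrite !mxE.
  by rewrite -he addrC subrK.
have comb_coef m n u v r : coef [:: u; v; r] (comb m n) =
    \sum_j m u j * W j v r + \sum_j n r j * W j u v.
  rewrite /comb; under eq_bigr do rewrite big_split.
  rewrite big_split fcoefD; congr (_ + _); rewrite fcoef_sum.
    rewrite (bigD1 u) //= [X in _ + X]big1 ?addr0 => [|i ne]; last first.
      by rewrite fcoef_sum big1 // => j _; rewrite fcoefZ coef_gen_l (negPf ne) mul0r mulr0.
    by rewrite fcoef_sum; apply: eq_bigr => j _; rewrite fcoefZ coef_gen_l eqxx mul1r coef_wrel.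
  rewrite (bigD1 r) //= [X in _ + X]big1 ?addr0 => [|i ne]; last first.
    rewrite fcoef_sum big1 // => j _.
    by rewrite fcoefZ (coef_gen_r _ _ r [:: u; v]) (negPf ne) !mulr0.
  rewrite fcoef_sum; apply: eq_bigr => j _.
  by rewrite fcoefZ (coef_gen_r _ _ r [:: u; v]) eqxx mulr1 coef_wrel.
have lf0 (m n : 'M[k]_3) : (forall u v r, \sum_j m u j * W j v r + \sum_j n r j * W j u v = 0) ->
    mklin lf (0, (m, n)) = 0.
  move=> h; apply: etrans (esym (linearD V3 _ _)) _; rewrite -[RHS](linear0 V3); congr (V3 _).
  rewrite big1 ?add0r => [|i _]; last by rewrite mxE scale0r.
  by apply: homog3P; [|exact: homog0|] => // u v r; rewrite comb_coef fcoef0.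
(* 10 + 18 = 27 + 1: lifts of a basis of degree three of [S], with the 18 products of generators and
   relations, map onto the span of the 27 words, so the kernel is a line. *)
have eqd : dim ('rV[k]_10 * ('M[k]_3 * 'M[k]_3))%type = (dim {ffun 'I_3 -> 'M[k]_3}).+1.
  rewrite -[LHS]/(dim 'rV[k]_10 + (dim 'M[k]_3 + dim 'M[k]_3))%N.
  by rewrite -[dim {ffun _ -> _}]/(#|'I_3| * dim 'M[k]_3)%N !dim_matrix card_ord.
move=> h.
(* Cyclic invariance provides a nonzero element of this line. *)
have h1 : mklin lf (0, (1%:M, - 1%:M)) = 0.
  apply: lf0 => u v r; rewrite (bigD1 u) //= big1 => [|j ne]; last first.
    by rewrite mxE eq_sym (negPf ne) mul0r.
  rewrite [X in _ + X](bigD1 r) //= big1 => [|j ne]; last first.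
    by rewrite !mxE eq_sym (negPf ne) oppr0 mul0r.
  by rewrite !mxE !eqxx !addr0 mul1r mulN1r (Wcyc r u v) subrr.
have h2 : mklin lf (0, (\matrix_(i, j) a i j, \matrix_(i, j) b i j)) = 0.
  apply: lf0 => u v r; rewrite -[RHS](h u v r).
  by congr (_ + _); apply: eq_bigr => j _; rewrite mxE.
have ne : (0, (1%:M, - 1%:M)) != 0 :> 'rV[k]_10 * ('M[k]_3 * 'M[k]_3).
  apply/eqP => -[/matrixP/(_ i0 i0)]; rewrite !mxE => /eqP; by rewrite oner_eq0.
have [c [_ /matrixP ea /matrixP eb]] := surjective_ker1 surj eqd h1 h2 ne.
exists c; split=> i j; first by have := ea i j; rewrite !mxE.
by have := eb i j; rewrite !mxE mulNr -mulrN.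
Qed.

End WithS.
End Converse.

Section Pairing.
Context (k : fieldType) (T : free_alg k).
Local Notation gen := (fa_gen T).
Local Notation coef := (@fa_coef k T).

Definition pair2 (g r : T) : k := \sum_i \sum_j coef [:: i; j] g * coef [:: i; j] r.

Lemma pair2P g c r s : pair2 g (c *: r + s) = c * pair2 g r + pair2 g s.
Proof.
rewrite /pair2 mulr_sumr -big_split; apply: eq_bigr => i _.
rewrite mulr_sumr -big_split; apply: eq_bigr => j _.
by rewrite fcoefP mulrDr mulrCA.
Qed.

Lemma pair2C g r : pair2 g r = pair2 r g.
Proof. by do 2![apply: eq_bigr => ? _]; rewrite mulrC. Qed.

Lemma pair2_0 g : pair2 g 0 = 0.
Proof. by rewrite /pair2 big1 // => i _; rewrite big1 // => j _; rewrite fcoef0 mulr0. Qed.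

Lemma pair2_sum g (I : finType) (c : I -> k) (X : I -> T) :
  pair2 g (\sum_i c i *: X i) = \sum_i c i * pair2 g (X i).
Proof.
elim/big_rec2: _ => [|i y1 y2 _ <-]; first exact: pair2_0.
by rewrite pair2P.
Qed.

Lemma pair2_word i j r : pair2 (word [:: i; j]) r = coef [:: i; j] r.
Proof.
rewrite /pair2 (bigD1 i) //= (bigD1 j) //= fcoef_word eqxx mul1r !big1 ?addr0 // => [a ne|b ne].
  by rewrite big1 // => b _; rewrite fcoef_word !eqseq_cons eq_sym (negPf ne) mul0r.
by rewrite fcoef_word !eqseq_cons (eq_sym j) (negPf ne) andbF mul0r.
Qed.

Lemma functional_elt (phi : {linear 'M[k]_3 -> k^o}) :
  exists2 g, fhomog 2 g & forall x, pair2 g x = phi (V2 T x).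
Proof.
exists (\sum_i \sum_j phi (delta_mx i j) *: (word [:: i; j] : T)).
  by do 2![apply: homog_sum => ? _]; apply/homogZ; apply: homog_word.
move=> x; rewrite [V2 T x]matrix_sum_delta linear_sum; apply: eq_bigr => i _.
rewrite linear_sum; apply: eq_bigr => j _.
by rewrite linearZ coef_sum2 /= mxE mulrC.
Qed.

Lemma dual_elt n (X : 'I_n -> T) (a : 'I_n -> k) : (forall i, fhomog 2 (X i)) ->
  (forall c : 'I_n -> k, \sum_i c i *: X i = 0 -> forall i, c i = 0) ->
  exists2 g, fhomog 2 g & forall i, pair2 g (X i) = a i.
Proof.
move=> hX indep; have [|phi hphi] := @dual_vectors _ _ n (fun i => V2 T (X i)) a.
  move=> c h; apply: indep; apply: homog2P; [|exact: homog0|].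
    by apply: homog_sum => i _; apply: homogZ.
  move=> u v; have h' : V2 T (\sum_i c i *: X i) = 0.
    by rewrite linear_sum -[RHS]h; apply: eq_bigr => i _; rewrite linearZ.
  by rewrite -V2E h' fcoef0 mxE.
have [g hg hp] := functional_elt phi; exists g => // i.
by rewrite hp hphi.
Qed.

End Pairing.

Section ConverseConic.
Context (k : fieldType) (T : free_alg k).
Hypothesis two0 : (2%:R : k) != 0.
Variable W : 'I_3 -> 'I_3 -> 'I_3 -> k.
Hypotheses (Wcyc : forall a b c, W a b c = W b c a) (Wsw : forall a b c, W a b c = W a c b).
Local Notation gen := (fa_gen T).
Local Notation coef := (@fa_coef k T).
Local Notation wrel := (wrel T W).
Local Notation V2 := (V2 T).
Local Notation V3 := (V3 T).

Context (S : algType k) (p : {lrmorphism T -> S}).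
Hypothesis pS : presents p (fun g => exists i, g = wrel i).
Hypotheses (dim2 : has_dim (pgr p 2) 6) (dim3 : has_dim (pgr p 3) 10).

Let p_wrel i : p (wrel i) = 0.
Proof. by apply/(proj2 pS)/ideal_gen_incl; exists i. Qed.

Section Central.
Variable ft : T.
Hypotheses (hft : fhomog 2 ft) (cft : central (p ft)).
Local Notation phi i j := (coef [:: i; j] ft).

Let anti i j := phi i j - phi j i.

(** Centrality puts x_l f - f x_l into the ideal. Symmetrizing in the outer indices isolates the
    antisymmetric part of f, and a cyclic sum then expresses the product of x_l with row [q] of that
    part by relations. *)
Lemma anti_in_R l q : exists c : 'I_3 -> k, forall u r,
  (l == u)%:R * anti q r + (l == r)%:R * anti q u = \sum_j c j * W j u r.
Proof.
have hx : fhomog 3 (gen l * ft - ft * gen l).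
  apply: homogB; first by apply: (homogM (n := 1) (m := 2)); [apply: homog_tgen|].
  by apply: (homogM (n := 2) (m := 1)) => //; apply: homog_tgen.
have px : p (gen l * ft - ft * gen l) = 0.
  by rewrite linearB !rmorphM /= cft subrr.
have [c [d e]] := ker3 pS hx px.
have te u v r : (l == u)%:R * phi v r - phi u v * (l == r)%:R =
    \sum_j c u j * W j v r + \sum_j d r j * W j u v.
  rewrite -coef_gen_l -(coef_gen_r _ _ r [:: u; v]) -fcoefB e.
  under eq_bigr do rewrite big_split.
  rewrite big_split fcoefD; congr (_ + _); rewrite fcoef_sum.
    rewrite (bigD1 u) //= [X in _ + X]big1 ?addr0 => [|i ne]; last first.
      by rewrite fcoef_sum big1 // => j _; rewrite fcoefZ coef_gen_l (negPf ne) mul0r mulr0.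
    by rewrite fcoef_sum; apply: eq_bigr => j _; rewrite fcoefZ coef_gen_l eqxx mul1r coef_wrel.
  rewrite (bigD1 r) //= [X in _ + X]big1 ?addr0 => [|i ne]; last first.
    rewrite fcoef_sum big1 // => j _.
    by rewrite fcoefZ (coef_gen_r _ _ r [:: u; v]) (negPf ne) !mulr0.
  rewrite fcoef_sum; apply: eq_bigr => j _.
  by rewrite fcoefZ (coef_gen_r _ _ r [:: u; v]) eqxx mulr1 coef_wrel.
pose m i j := c i j + d i j.
(* Adding the identity with [u] and [r] exchanged leaves only the antisymmetric part of [ft]. *)
have tm u v r : (l == u)%:R * anti v r - (l == r)%:R * anti u v =
    \sum_j m u j * W j v r + \sum_j m r j * W j u v.
  transitivity (((l == u)%:R * phi v r - phi u v * (l == r)%:R) +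
                ((l == r)%:R * phi v u - phi r v * (l == u)%:R)).
    by rewrite /anti; ring.
  have md s f : \sum_j m s j * f j = \sum_j c s j * f j + \sum_j d s j * f j.
    by rewrite -big_split; apply: eq_bigr => j _; rewrite mulrDl.
  rewrite !te !md.
  have sw x y z : \sum_j x j * W j y z = \sum_j x j * W j z y.
    by apply: eq_bigr => j _; rewrite Wsw.
  by rewrite (sw (c r)) (sw (d u)) [LHS](AC (2*2) ((1*4)*(3*2))).
exists (fun j => - m q j) => u r.
(* Over the cyclic rotations of (u, q, r) the left sides of [tm] cancel, and each sum on the right
   occurs twice. *)
have e2 : 2%:R * (\sum_j m u j * W j q r + \sum_j m q j * W j u r + \sum_j m r j * W j u q) = 0.
  transitivity (((l == u)%:R * anti q r - (l == r)%:R * anti u q) +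
     ((l == q)%:R * anti r u - (l == u)%:R * anti q r) +
     ((l == r)%:R * anti u q - (l == q)%:R * anti r u)); last by ring.
  rewrite !tm.
  have sw x y z : \sum_j x j * W j y z = \sum_j x j * W j z y.
    by apply: eq_bigr => j _; rewrite Wsw.
  by rewrite (sw (m q) u r); ring.
have {}e2 : \sum_j m u j * W j q r + \sum_j m q j * W j u r + \sum_j m r j * W j u q = 0.
  by apply/eqP; move/eqP: e2; rewrite mulf_eq0 (negPf two0).
under eq_bigr do rewrite mulNr; rewrite sumrN.
have aN i j : anti i j = - anti j i by rewrite /anti opprB.
rewrite (aN q u) mulrN tm; apply/eqP; rewrite -addr_eq0 -[X in _ == X]e2.
by apply/eqP; rewrite -!addrA; congr (_ + _); rewrite addrC.
Qed.

(* The six products of a generator with a row of the antisymmetric part of [ft] span a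
   space of dimension 5 unless that part vanishes, but they all lie in R. *)
Lemma central_symmetric i j : coef [:: i; j] ft = coef [:: j; i] ft.
Proof.
apply/eqP; rewrite -subr_eq0 -/(anti i j); apply/negPn/negP => aij.
have a0 u : anti u u = 0 by rewrite /anti subrr.
have aN u v : anti u v = - anti v u by rewrite /anti opprB.
(* Four of the products are used: those of row [i] with the three generators, and x_i with row [j].
   They lie in the span of three relations, hence are dependent; the entries (i, i), (j, j) and (u,
   j) show in turn that the dependence is trivial. *)
have [c hc] := choice (fun l => anti_in_R l i).
have [d hd] := anti_in_R i j.
pose A : 'M[k]_(3 + 1, 3) := col_mx (\matrix_(l, s) c l s) (\row_s d s).
have [w w0 wA] := dependent_vectors A isT.
pose wl := lsubmx w; pose wr := rsubmx w.
have wE u r : \sum_l wl 0 l * ((l == u)%:R * anti i r + (l == r)%:R * anti i u) +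
    wr 0 0 * ((i == u)%:R * anti j r + (i == r)%:R * anti j u) = 0.
  under eq_bigr do rewrite hc mulr_sumr; rewrite hd exchange_big /= mulr_sumr -big_split /=.
  rewrite big1 // => s _; under eq_bigr do rewrite mulrA; rewrite -mulr_suml mulrA -mulrDl.
  move/rowP/(_ s): wA; rewrite /A -[w in w *m _]hsubmxK mul_row_col !mxE => h.
  rewrite (_ : _ + _ = 0) ?mul0r // -[RHS]h; congr (_ + _).
    by apply: eq_bigr => l _; rewrite !mxE.
  by rewrite big_ord1 !mxE.
have sum_pick (F : 'I_3 -> k) u r : \sum_l F l * ((l == u)%:R * anti i r + (l == r)%:R * anti i u) =
    F u * anti i r + F r * anti i u.
  under eq_bigr do rewrite mulrDr !mulrA; rewrite big_split /=; congr (_ + _).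
    rewrite (bigD1 u) //= eqxx mulr1 big1 ?addr0 // => l ne.
    by rewrite (negPf ne) mulr0 mul0r.
  rewrite (bigD1 r) //= eqxx mulr1 big1 ?addr0 // => l ne.
  by rewrite (negPf ne) mulr0 mul0r.
have wr0 : wr 0 0 = 0.
  have := wE i i; rewrite sum_pick a0 !mulr0 !add0r !eqxx !mul1r aN.
  rewrite -mulr2n mulNrn => /eqP; rewrite mulf_eq0 => /orP[/eqP //|].
  by rewrite oppr_eq0 -mulr_natl mulf_eq0 (negPf two0) (negPf aij).
have wl0 u : wl 0 u = 0.
  have wj : wl 0 j = 0.
    have := wE j j; rewrite sum_pick wr0 mul0r addr0 -mulr2n => /eqP.
    by rewrite -mulr_natl !mulf_eq0 (negPf two0) (negPf aij) orbF => /eqP.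
  have := wE u j; rewrite sum_pick wr0 wj !mul0r !addr0 => /eqP.
  by rewrite mulf_eq0 (negPf aij) orbF => /eqP.
case/eqP: w0; apply/rowP => u; case: (split_ordP (m := 3) (n := 1) u) => v ->.
  by have := wl0 v; rewrite /wl !mxE.
by move: wr0; rewrite (ord1 v) /wr !mxE.
Qed.

End Central.

End ConverseConic.

(** * Nilpotents and local idempotents *)

Section Nilpotent.
Context (k : fieldType) (E : algType k).
Hypothesis mulC : forall x y : E, x * y = y * x.

(** For an idempotent [e] this says that the corner eE is local with residue field k, without
    forming the corner: every element is a scalar plus a nilpotent there. *)
Definition local_at (e : E) := forall a, exists c n, e * (a - c%:A) ^+ n = 0.

Definition nilpotent (x : E) := exists n, x ^+ n = 0.

Lemma nilpotentD x y : nilpotent x -> nilpotent y -> nilpotent (x + y).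
Proof.
move=> [n xn] [m ym]; exists (n + m)%N; rewrite exprDn_comm; last exact: mulC.
rewrite big1 // => i _; have [le|lt] := leqP m i.
  by rewrite -(subnK le) exprD ym !(mulr0, mul0rn).
rewrite (_ : n + m - i = (m - i) + n)%N; last by lia.
by rewrite exprD xn !(mulr0, mul0r, mul0rn).
Qed.

Lemma nilpotentMl x y : nilpotent y -> nilpotent (x * y).
Proof. by move=> [n yn]; exists n; rewrite exprMn_comm ?yn ?mulr0 //; apply: mulC. Qed.

Lemma nilpotent_sum (I : finType) (F : I -> E) :
  (forall i, nilpotent (F i)) -> nilpotent (\sum_i F i).
Proof.
move=> h; elim/big_ind: _ => //; first by exists 1%N; rewrite expr1.
exact: nilpotentD.
Qed.

Lemma nilpotent_idem e : e * e = e -> nilpotent e -> e = 0.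
Proof.
move=> ee [n en]; have h m : e ^+ m.+1 = e by elim: m => [|m IH]; rewrite ?expr1 // exprS IH.
by rewrite -(h n) exprS en mulr0.
Qed.

Lemma shift_expansion (a : E) (d : k) n : exists q : E, (a + d%:A) ^+ n = (d ^+ n)%:A + a * q.
Proof.
elim: n => [|n [q IH]]; first by exists 0; rewrite !expr0 scale1r mulr0 addr0.
exists ((a + d%:A) ^+ n + d *: q).
rewrite exprS mulrDl mulrDr addrCA; congr (_ + _); rewrite IH.
by rewrite -scalerAl mul1r scalerDr scalerA -exprS scalerAr.
Qed.

(** The scalar part c of [a] is nonzero, and isolating the constant term (- c)^n in e (a - c)^n = 0
    exhibits the inverse. *)
Lemma local_unit e a : local_at e -> ~ nilpotent (e * a) -> exists b, e * a * b = e.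
Proof.
move=> el na; have [c [n h]] := el a.
have c0 : c != 0.
  apply: contra_notN na => /eqP c0; exists n.+1; move: h; rewrite c0 scale0r subr0 => h.
  rewrite exprMn_comm; last exact: mulC.
  by rewrite exprSr -mulrA exprSr (mulrA e) h mul0r mulr0.
have [q eq] := shift_expansion a (- c) n; rewrite scaleNr in eq.
have d0 : (- c) ^+ n != 0 by rewrite expf_neq0 // oppr_eq0.
exists (- ((- c) ^+ n)^-1 *: q); rewrite -scalerAr scaleNr -scalerN -mulrA.
rewrite (_ : - (e * (a * q)) = (- c) ^+ n *: e) ?scalerA ?mulVf ?scale1r //.
move: h; rewrite eq mulrDr -scalerAr mulr1 => /eqP; rewrite addrC addr_eq0 => /eqP ->.
by rewrite opprK.
Qed.

Lemma dependent n (dimE : has_dim (fun _ : E => True) n) m (x : 'I_m -> E) : (n < m)%N ->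
  exists2 u : 'rV[k]_m, u != 0 & \sum_i u 0 i *: x i = 0.
Proof.
move=> lt; have [b [_ hb]] := dimE.
have /choice[c hc] : forall i : 'I_m, exists c : 'rV[k]_n, x i = \sum_j c 0 j *: b j.
  by move=> i; have [c [hc _]] := hb (x i) I; exists c.
have [u u0 uA] := dependent_vectors (\matrix_(i, j) c i 0 j) lt; exists u => //.
under eq_bigr do rewrite hc scaler_sumr.
rewrite exchange_big big1 //= => j _; under eq_bigr do rewrite scalerA.
rewrite -scaler_suml; move/rowP/(_ j): uA; rewrite !mxE => h.
rewrite (_ : \sum_i _ = 0) ?scale0r // -[RHS]h; apply: eq_bigr => i _.
by rewrite mxE.
Qed.

End Nilpotent.

Section Idempotents.
Context (k : closedFieldType) (E : algType k).
Hypothesis mulC : forall x y : E, x * y = y * x.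

Section Splitting.
Variable e : E.
Hypotheses (ee : e * e = e) (e0 : e != 0).


(** Write p = (X - c)^m q at a root c, with q coprime to X - c. The Bezout identity cuts [e] into
    two orthogonal pieces. If the first is zero, then e (a - c)^m = 0, which is excluded; if the
    second is zero, then q annihilates as well and has smaller degree. *)
Lemma split_poly a (p : {poly k}) : (forall c n, e * (a - c%:A) ^+ n <> 0) ->
  p != 0 -> e * horner_alg a p = 0 ->
  exists e1 e2, [/\ e1 != 0 /\ e2 != 0, e1 * e2 = 0, e1 + e2 = e, e1 * e = e1 & e2 * e = e2].
Proof.
move=> nl; have [n] := ubnP (size p); elim: n p => // n IH p lt p0 ep.
have [sp1|sp1] := boolP (size p == 1%N).
  move: sp1 ep => /size_poly1P[c c0 ->]; rewrite horner_algC -scalerAr mulr1 => /eqP.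
  by rewrite scaler_eq0 (negPf c0) (negPf e0).
have [c rc] := closed_rootP p sp1.
have [m [q]] := multiplicity_XsubC p c; rewrite p0 /= => nrq pE.
have cop : coprimep (('X - c%:P) ^+ m) q.
  by rewrite coprimep_expl // coprimep_sym coprimep_XsubC.
have m0 : (0 < m)%N.
  by case: m pE {cop} => // pE; move: rc; rewrite pE expr0 mulr1 (negPf nrq).
have [[u v] /= uv] := Bezout_eq1_coprimepP _ _ cop.
have hx : horner_alg a ('X - c%:P) = a - c%:A.
  by rewrite rmorphB /= horner_algX horner_algC.
have hxm : horner_alg a (('X - c%:P) ^+ m) = (a - c%:A) ^+ m by rewrite rmorphXn /= hx.
pose e1 := e * horner_alg a (u * ('X - c%:P) ^+ m); pose e2 := e * horner_alg a (v * q).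
have e12 : e1 + e2 = e by rewrite /e1 /e2 -mulrDr -rmorphD uv rmorph1 mulr1.
have [/eqP z1|n1] := boolP (e1 == 0).
  case: (nl c m); rewrite -[in LHS]e12 z1 add0r /e2 -hxm -mulrA -rmorphM.
  rewrite (_ : v * q * _ = p * v) ?rmorphM ?mulrA ?ep ?mul0r //.
  by rewrite pE; ring.
have [/eqP z2|n2] := boolP (e2 == 0).
  apply: (IH q); last first.
  - rewrite -[in LHS]e12 z2 addr0 /e1 -mulrA -rmorphM.
    rewrite (_ : u * _ * q = p * u) ?rmorphM ?mulrA ?ep ?mul0r //.
    by rewrite pE; ring.
  - by apply: contraNneq nrq => ->; rewrite root0.
  apply: (@leq_trans (size p)); last by [].
  rewrite pE size_Mmonic ?monicXn ?monic_exp ?monicXsubC //; last first.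
    by apply: contraNneq nrq => ->; rewrite root0.
  by rewrite size_exp_XsubC; lia.
exists e1, e2; split=> //; last first.
- by rewrite /e2 -mulrA (mulC _ e) mulrA ee.
- by rewrite /e1 -mulrA (mulC _ e) mulrA ee.
rewrite /e1 /e2 -mulrA (mulrA _ e) (mulC _ e) -mulrA mulrA ee -rmorphM.
rewrite (_ : _ * (v * q) = p * (u * v)) ?rmorphM ?mulrA ?ep ?mul0r //.
by rewrite pE; ring.
Qed.

End Splitting.

Section Dimension.
Context (n : nat) (dimE : has_dim (fun _ : E => True) n).

Lemma algebraic (a : E) : exists2 p : {poly k}, p != 0 & horner_alg a p = 0.
Proof.
have [u u0 uA] := dependent dimE (fun i : 'I_n.+1 => a ^+ i) (ltnSn n).
exists (\sum_i u 0 i *: 'X^i).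
  apply: contraNneq u0 => h; apply/eqP/rowP => i; rewrite mxE.
  have := congr1 (fun p : {poly k} => p`_i) h; rewrite coef0 coef_sum (bigD1 i) //=.
  rewrite coefZ coefXn eqxx mulr1 big1 ?addr0 // => j ne; rewrite coefZ coefXn.
  by rewrite eq_sym (_ : (j == i :> nat) = false) ?mulr0 //; apply: negPf.
rewrite -[RHS]uA; apply: etrans (linear_sum _ _ _ _) _; apply: eq_bigr => i _.
by rewrite linearZ /= mulr_algl rmorphXn /= horner_algX.
Qed.

Definition orthogonal_idempotents r (e : 'I_r -> E) :=
  [/\ forall i, e i != 0, forall i j, e i * e j = if i == j then e i else 0 & \sum_i e i = 1].

Lemma orthogonal_bound r (e : 'I_r -> E) : orthogonal_idempotents e -> (r <= n)%N.
Proof.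
move=> [e0 eo _]; rewrite leqNgt; apply/negP => lt.
have [u u0 ue] := dependent dimE e lt.
case/eqP: u0; apply/rowP => i; rewrite mxE.
have := congr1 (fun x => x * e i) ue; rewrite mul0r mulr_suml (bigD1 i) //=.
rewrite -scalerAl eo eqxx big1 ?addr0 => [/eqP|j ne]; last first.
  by rewrite -scalerAl eo (negPf ne) scaler0.
by rewrite scaler_eq0 (negPf (e0 i)) orbF => /eqP.
Qed.

(** Splitting a non-local idempotent must stop, because nonzero orthogonal idempotents are linearly
    independent. *)
Lemma local_decomposition : exists r (e : 'I_r -> E),
  orthogonal_idempotents e /\ forall i, local_at (e i).
Proof.
suff main d r (e : 'I_r -> E) : orthogonal_idempotents e -> (n - r < d)%N ->
    exists r (e : 'I_r -> E), orthogonal_idempotents e /\ forall i, local_at (e i).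
  apply: (main (n - 1).+1 1%N (fun=> 1)) => //; split=> [i|i j|].
  - exact: oner_neq0.
  - by rewrite !ord1 eqxx mulr1.
  - by rewrite big_ord1.
elim: d r e => // d IH r e he lt.
have [hl|] := pselect (forall i, local_at (e i)); first by exists r, e.
move=> /existsNP[i0] /existsNP[a] /forallNP ha.
have [e0 eo es] := he.
have nl c m : e i0 * (a - c%:A) ^+ m <> 0 by move=> h; apply: (ha c); exists m.
have [p p0 pa] := algebraic a.
have ei : e i0 * e i0 = e i0 by rewrite eo eqxx.
have [|e1 [e2 [[n1 n2] o12 s12 i1 i2]]] := split_poly ei (e0 i0) nl p0; first by rewrite pa mulr0.
have o1 j : j != i0 -> e1 * e j = 0.
  by move=> ne; rewrite -i1 -mulrA eo eq_sym (negPf ne) mulr0.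
have o2 j : j != i0 -> e2 * e j = 0.
  by move=> ne; rewrite -i2 -mulrA eo eq_sym (negPf ne) mulr0.
have e11 : e1 * e1 = e1 by rewrite -[RHS]i1 -s12 mulrDr o12 addr0.
have e22 : e2 * e2 = e2 by rewrite -[RHS]i2 -s12 mulrDr [e2 * e1]mulC o12 add0r.
(* The new index 0 carries [e2], and [e1] takes the place of the idempotent that was split. *)
pose f (x : 'I_r.+1) := if unlift ord0 x is Some y then if y == i0 then e1 else e y else e2.
have f0 : f ord0 = e2 by rewrite /f unlift_none.
have fl y : f (lift ord0 y) = if y == i0 then e1 else e y by rewrite /f liftK.
have hf : orthogonal_idempotents f; last first.
  by apply: (IH _ f hf); have := orthogonal_bound hf; lia.
split=> [x|x y|].
- by case: (unliftP ord0 x) => [u|] ->; rewrite ?f0 ?fl //; case: ifP.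
- case: (unliftP ord0 x) => [u|] ->; case: (unliftP ord0 y) => [v|] ->; rewrite ?f0 ?fl //.
  + rewrite (inj_eq lift_inj); have [eu|nu] := eqVneq u i0; have [ev|nv] := eqVneq v i0; rewrite ?eu ?ev.
    * by rewrite eqxx.
    * by rewrite eq_sym (negPf nv) o1.
    * by rewrite mulC o1 // (negPf nu).
    * by rewrite eo.
  + by rewrite mulC; case: eqP => [_|/eqP ne]; rewrite ?[e2 * e1]mulC ?o12 ?o2.
  + by case: eqP => [_|/eqP ne]; rewrite ?[e2 * e1]mulC ?o12 ?o2.
rewrite big_ord_recl f0 (bigD1 i0) //= fl eqxx addrA (addrC e2) s12.
rewrite -es [RHS](bigD1 i0) //=; congr (_ + _); apply: eq_bigr => i ne.
by rewrite fl (negPf ne).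
Qed.


End Dimension.

End Idempotents.

(** * The quadratic duals of S and of the conic *)

Lemma presents_comm (k : fieldType) (T : free_alg k) (B : algType k) (p : {lrmorphism T -> B}) :
  (forall y, exists x, y = p x) ->
  (forall i j, p (fa_gen T i * fa_gen T j) = p (fa_gen T j * fa_gen T i)) ->
  forall x y : B, x * y = y * x.
Proof.
move=> ps pC'; have pC i j : p (fa_gen T i) * p (fa_gen T j) = p (fa_gen T j) * p (fa_gen T i).
  by rewrite -!rmorphM; apply: pC'.
have gw i s : p (fa_gen T i) * p (word s) = p (word s) * p (fa_gen T i).
  elim: s => [|a s IH]; first by rewrite word_nil rmorph1 mul1r mulr1.
  by rewrite word_cons rmorphM mulrA pC -mulrA IH mulrA.
have ww s s' : p (word s) * p (word s') = p (word s') * p (word s).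
  elim: s => [|a s IH]; first by rewrite word_nil rmorph1 mul1r mulr1.
  by rewrite word_cons rmorphM -mulrA IH mulrA gw mulrA.
move=> x y; have [t ->] := ps x; have [t' ->] := ps y.
elim/tensor_ind: t => [|c s t IH]; first by rewrite linear0 mul0r mulr0.
rewrite linearP /= mulrDl mulrDr IH; congr (_ + _).
rewrite -scalerAl -scalerAr; congr (_ *: _).
elim/tensor_ind: t' {IH} => [|d s' t' IH]; first by rewrite linear0 mul0r mulr0.
by rewrite linearP /= mulrDl mulrDr IH -scalerAl -scalerAr ww.
Qed.

Section FreeAlg.
Context (k : fieldType) (T : free_alg k).

Lemma hcompM d n (x y : T) : fhomog d x -> hcomp (d + n) (x * y) = x * hcomp n y.
Proof.
move=> hx; elim/tensor_ind: y => [|c s y IH]; first by rewrite mulr0 !linear0 mulr0.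
rewrite mulrDr -scalerAr !linearP /= IH mulrDr -scalerAr; congr (_ *: _ + _).
rewrite comp_word; case: eqP => [<-|/eqP ne].
  by apply: homog_comp; apply: homogM => //; apply: homog_word.
rewrite mulr0; apply: (@homog_comp0 _ _ (d + size s)); last by rewrite eqn_add2l.
by apply: homogM => //; apply: homog_word.
Qed.

Lemma pair2Bl (x y r : T) : pair2 (x - y) r = pair2 x r - pair2 y r.
Proof. by rewrite addrC -scaleN1r pair2C pair2P !(pair2C r) mulN1r addrC. Qed.

Lemma pair2Pl c (x y r : T) : pair2 (c *: x + y) r = c * pair2 x r + pair2 y r.
Proof. by rewrite pair2C pair2P !(pair2C r). Qed.

End FreeAlg.

Section Converse.
Context (k : fieldType) (T : free_alg k).
Hypothesis two0 : (2%:R : k) != 0.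
Variable W : 'I_3 -> 'I_3 -> 'I_3 -> k.
Hypotheses (Wcyc : forall a b c, W a b c = W b c a) (Wsw : forall a b c, W a b c = W a c b).
Local Notation gen := (fa_gen T).
Local Notation coef := (@fa_coef k T).
Local Notation wrel := (wrel T W).

Context (S : algType k) (p : {lrmorphism T -> S}).
Hypothesis pS : presents p (fun g => exists i, g = wrel i).
Hypotheses (dim2 : has_dim (pgr p 2) 6) (dim3 : has_dim (pgr p 3) 10).

Section Dual.
Context (D : algType k) (pD : {lrmorphism T -> D}).
Let GD g := fhomog 2 g /\ forall r, fhomog 2 r -> p r = 0 -> pair2 g r = 0.
Hypothesis pDD : presents pD GD.

Let p_wrel i : p (wrel i) = 0.
Proof. by apply/(proj2 pS)/ideal_gen_incl; exists i. Qed.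

Lemma GD_wrel g : fhomog 2 g -> (forall i, pair2 g (wrel i) = 0) -> GD g.
Proof.
move=> hg h; split=> // r hr /(ker2 pS hr)[c ->].
by rewrite pair2_sum big1 // => i _; rewrite h mulr0.
Qed.

Lemma dual_ker2 g : fhomog 2 g -> (forall i, pair2 g (wrel i) = 0) -> pD g = 0.
Proof. by move=> hg h; apply/(proj2 pDD)/ideal_gen_incl; apply: GD_wrel. Qed.

(** The functional <t, w> of degree three, set to zero on words of other lengths. *)
Definition Phi : {linear T -> k^o} :=
  lext T (fun s => if s is [:: a; b; c] then W a b c : k^o else 0).

Lemma Phi_word a b c : Phi (word [:: a; b; c]) = W a b c.
Proof. exact: lext_word. Qed.

Lemma Phi_gen_l i g : fhomog 2 g -> Phi (gen i * g) = pair2 g (wrel i).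
Proof.
elim/homog_ind=> [|c [|a [|b [|//]]] y // _ _ IH]; first by rewrite mulr0 linear0 pair2C pair2_0.
rewrite mulrDr -scalerAr -word_cons linearP pair2Pl IH Phi_word; congr (_ * _ + _).
by rewrite pair2_word coef_wrel.
Qed.

Lemma Phi_gen_r i g : fhomog 2 g -> Phi (g * gen i) = pair2 g (wrel i).
Proof.
elim/homog_ind=> [|c [|a [|b [|//]]] y // _ _ IH]; first by rewrite mul0r linear0 pair2C pair2_0.
rewrite mulrDl -scalerAl -word_rcons linearP pair2Pl IH Phi_word; congr (_ * _ + _).
by rewrite pair2_word coef_wrel Wcyc.
Qed.

Lemma dual_Phi t : fhomog 3 t -> pD t = 0 -> Phi t = 0.
Proof.
move=> ht /(proj2 pDD) h; have GDh g : GD g -> fhomog 2 g by case.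
apply: (lspan_closed (P := fun t => Phi t = 0) _ _ _ (ideal_degS GDh ht h)); first exact: linear0.
  by move=> c y y' py py'; rewrite linearP py py' addr0 scaler0.
move=> _ [i [g [[hg gr] [->|->]]]]; rewrite (Phi_gen_l, Phi_gen_r) ?gr //; exact: wrel_homog.
Qed.

(** The span of the relations is its own double orthogonal: a functional separating [m] from it
    would be a relation of the dual with nonzero pairing. *)
Lemma biorthogonal (m : 'M[k]_3) :
  (forall g, GD g -> \sum_i \sum_j coef [:: i; j] g * m i j = 0) ->
  exists c : 'I_3 -> k, forall i j, m i j = \sum_l c l * W l i j.
Proof.
move=> h; pose P v := exists c : 'I_3 -> k, v = V2 T (\sum_i c i *: wrel i).
have [[c mc]|nP] := pselect (P m).
  exists c => i j; rewrite mc V2E fcoef_sum; apply: eq_bigr => l _.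
  by rewrite fcoefZ coef_wrel.
have [||phi [phiP phim]] := separation _ _ nP.
- by exists (fun=> 0); rewrite big1 ?linear0 // => i _; rewrite scale0r.
- move=> c u v [a ->] [b ->]; exists (fun i => c * a i + b i); rewrite -linearP; congr (V2 T _).
  by rewrite scaler_sumr -big_split; apply: eq_bigr => i _; rewrite scalerDl scalerA.
have [g hg hgr] := functional_elt T phi.
have [x hx xm] := V2_surj T m; case/eqP: phim; rewrite -xm -hgr.
rewrite /pair2 -[RHS](h g); first by do 2![apply: eq_bigr => ? _]; rewrite -xm V2E.
apply: GD_wrel => // i; rewrite hgr; apply: phiP; exists (fun j => (j == i)%:R).
rewrite (bigD1 i) //= eqxx scale1r big1 ?addr0 // => j ne.
by rewrite (negPf ne) scale0r.
Qed.

(** A functional on degree three that kills the ideal is a tensor in both V (x) R and R (x) V. By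
    [W_syzygy] this intersection is spanned by the superpotential, so the functional is a multiple
    of [Phi]. *)
Lemma dual_ker3 t : fhomog 3 t -> Phi t = 0 -> pD t = 0.
Proof.
move=> ht Pt; pose P v := exists s, [/\ fhomog 3 s, pD s = 0 & v = V3 T s].
have [[s [hs ps e]]|nP] := pselect (P (V3 T t)).
  rewrite (_ : t = s) //; apply: homog3P => // i j l; rewrite -!V3E.
  by rewrite e.
have [||phi [phiP phit]] := separation _ _ nP.
- by exists 0; rewrite !linear0; split=> //; apply: homog0.
- move=> c u v [s [hs ps ->]] [s' [hs' ps' ->]]; exists (c *: s + s').
  by split; [exact: homogP | rewrite linearP /= ps ps' scaler0 addr0 | rewrite linearP].
pose tau a b c := phi (V3 T (word [:: a; b; c])).
have GD_l g i : GD g -> phi (V3 T (gen i * g)) = 0.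
  move=> Gg; apply: phiP; exists (gen i * g); split=> //.
    by apply: (homogM (n := 1) (m := 2)); [apply: homog_tgen | case: Gg].
  by rewrite rmorphM /= (_ : pD g = 0) ?mulr0 //; apply/(proj2 pDD)/ideal_gen_incl.
have GD_r g i : GD g -> phi (V3 T (g * gen i)) = 0.
  move=> Gg; apply: phiP; exists (g * gen i); split=> //.
    by apply: (homogM (n := 2) (m := 1)); [case: Gg | apply: homog_tgen].
  by rewrite rmorphM /= (_ : pD g = 0) ?mul0r //; apply/(proj2 pDD)/ideal_gen_incl.
have phi_l i g : fhomog 2 g ->
    phi (V3 T (gen i * g)) = \sum_a \sum_b coef [:: a; b] g * tau i a b.
  move=> hg; rewrite {1}(homog2E hg) mulr_sumr !linear_sum; apply: eq_bigr => a _.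
  rewrite mulr_sumr !linear_sum; apply: eq_bigr => b _.
  by rewrite -scalerAr -word_cons !linearZ.
have phi_r i g : fhomog 2 g ->
    phi (V3 T (g * gen i)) = \sum_a \sum_b coef [:: a; b] g * tau a b i.
  move=> hg; rewrite {1}(homog2E hg) mulr_suml !linear_sum; apply: eq_bigr => a _.
  rewrite mulr_suml !linear_sum; apply: eq_bigr => b _.
  by rewrite -scalerAl -word_rcons !linearZ.
have /choice[a ha] u : exists c : 'I_3 -> k, forall v r, tau u v r = \sum_l c l * W l v r.
  have [|c hc] := @biorthogonal (\matrix_(v, r) tau u v r).
    move=> g Gg; rewrite -[RHS](GD_l g u Gg) phi_l; last by case: Gg.
    by do 2![apply: eq_bigr => ? _]; rewrite mxE.
  by exists c => v r; rewrite -hc mxE.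
have /choice[b hb] r : exists c : 'I_3 -> k, forall u v, tau u v r = \sum_l c l * W l u v.
  have [|c hc] := @biorthogonal (\matrix_(u, v) tau u v r).
    move=> g Gg; rewrite -[RHS](GD_r g r Gg) phi_r; last by case: Gg.
    by do 2![apply: eq_bigr => ? _]; rewrite mxE.
  by exists c => u v; rewrite -hc mxE.
have [|c [ac _]] := W_syzygy Wcyc pS dim3 (a := a) (b := fun i j => - b i j).
  move=> u v r; rewrite -ha; under [X in _ + X]eq_bigr do rewrite mulNr.
  by rewrite sumrN -hb subrr.
case/eqP: phit; rewrite (_ : phi (V3 T t) = c *: Phi t); first by rewrite Pt scaler0.
elim/homog_ind: ht {Pt nP} => [|d [|x [|y [|w [|//]]]] t' // _ _ IH].
  by rewrite !linear0.
rewrite linearP [phi _]linearP IH linearP scalerDr; congr (_ + _); rewrite Phi_word.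
rewrite -[phi _]/(tau x y w) ha (bigD1 x) //= ac eqxx mulr1 big1 ?addr0 => [|j ne].
  by rewrite !scalerA mulrC.
by rewrite ac eq_sym (negPf ne) mulr0 mul0r.
Qed.

Lemma dual_comm (x y : D) : x * y = y * x.
Proof.
apply: (presents_comm (proj1 pDD)) => i j; apply/eqP; rewrite -subr_eq0 -linearB; apply/eqP.
apply: dual_ker2 => [|l]; rewrite -!word2; first by apply: homogB; apply: homog_word.
by rewrite pair2Bl !pair2_word !coef_wrel Wsw subrr.
Qed.

Lemma Phi_surj : exists2 t, fhomog 3 t & Phi t = 1.
Proof.
have [a [b [c nz]]] := W_neq0 pS dim2; exists ((W a b c)^-1 *: word [:: a; b; c]).
  by apply/homogZ; apply: homog_word.
by rewrite linearZ Phi_word; apply: mulVf.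
Qed.

(** A word of length four is a multiple of [delta] at its first letter and, by commutativity, of
    [delta] at its last. A nonzero [delta] would make two slices of [W] proportional, against their
    independence. *)
Lemma dual_ker4 n t : fhomog (4 + n) t -> pD t = 0.
Proof.
have [tau htau tau1] := Phi_surj.
pose delta i := pD (gen i * tau).
have d3 a b c : pD (word [:: a; b; c]) = W a b c *: pD tau.
  apply/eqP; rewrite -subr_eq0 -linearZ -linearB; apply/eqP/dual_ker3.
    by apply: homogB; [apply: homog_word | apply: homogZ].
  by rewrite linearB linearZ tau1 Phi_word; apply/eqP; rewrite subr_eq0 eq_sym; apply/eqP; apply: mulr1.
have dl a b c d : pD (word [:: a; b; c; d]) = W b c d *: delta a.
  by rewrite word_cons rmorphM /= d3 -scalerAr -rmorphM.
have dr a b c d : pD (word [:: a; b; c; d]) = W a b c *: delta d.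
  rewrite (_ : [:: a; b; c; d] = rcons [:: a; b; c] d) // word_rcons rmorphM /= d3 -scalerAl.
  by rewrite dual_comm -rmorphM.
have key x y s r : W r x y *: delta s = W s x y *: delta r by rewrite (Wcyc r) -dl dr.
have W_slice r : exists b c, W r b c != 0.
  apply: contrapT => no; have h := W_indep pS dim2 (c := fun i => (i == r)%:R) _ r.
  have /eqP : (1 : k) = 0; last by rewrite oner_eq0.
  rewrite -[RHS]h ?eqxx // => j l; rewrite (bigD1 r) //= eqxx mul1r big1 ?addr0 => [|i /negPf ->].
    by apply/eqP/negPn/negP => nz; apply: no; exists j, l.
  by rewrite mul0r.
have d0 s r : s != r -> delta s = 0.
  move=> ne; apply/eqP/negPn/negP => ds; have [b [c nz]] := W_slice r.
  pose x := W s b c / W r b c.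
  have sx : delta s = x *: delta r.
    by rewrite /x mulrC -scalerA -key scalerA mulVf ?scale1r.
  have dr0 : delta r != 0 by apply: contraNneq ds => d0; rewrite sx d0 scaler0.
  have h := W_indep pS dim2 (c := fun i => (i == s)%:R - x * (i == r)%:R) _ s.
  have /eqP : (1 : k) = 0; last by rewrite oner_eq0.
  rewrite -[RHS]h ?eqxx ?(negPf ne) ?mulr0 ?subr0 // => j l.
  under eq_bigr do rewrite mulrBl; rewrite sumrB (bigD1 s) //= eqxx mul1r big1 ?addr0; last first.
    by move=> i /negPf ->; rewrite mul0r.
  rewrite (bigD1 r) //= eqxx mulr1 big1 ?addr0; last first.
    by move=> i /negPf ->; rewrite mulr0 mul0r.
  apply/eqP; have := key j l s r; rewrite sx scalerA => /eqP; rewrite -subr_eq0 -scalerBl.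
  by rewrite scaler_eq0 (negPf dr0) orbF -oppr_eq0 opprB mulrC.
have {}d0 s : delta s = 0.
  by have [->|ne] := eqVneq s i0; [apply: (@d0 i0 i1) | apply: (@d0 s i0)].
elim/homog_ind=> [|d [|x [|y [|z [|w s]]]] y' // _ _ IH]; first exact: linear0.
rewrite linearP /= IH addr0 (_ : _ :: _ = [:: x; y; z; w] ++ s) // word_cat rmorphM /= dl d0.
by rewrite scaler0 mul0r scaler0.
Qed.


End Dual.
End Converse.

Section ConicDual.
Context (k : fieldType) (T : free_alg k).
Hypothesis two0 : (2%:R : k) != 0.
Variable W : 'I_3 -> 'I_3 -> 'I_3 -> k.
Hypotheses (Wcyc : forall a b c, W a b c = W b c a) (Wsw : forall a b c, W a b c = W a c b).
Local Notation gen := (fa_gen T).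
Local Notation coef := (@fa_coef k T).
Local Notation wrel := (wrel T W).
Local Notation Phi := (Phi T W).

Context (S : algType k) (p : {lrmorphism T -> S}).
Hypothesis pS : presents p (fun g => exists i, g = wrel i).
Hypotheses (dim2 : has_dim (pgr p 2) 6) (dim3 : has_dim (pgr p 3) 10).
Variable ft : T.
Hypotheses (hft : fhomog 2 ft) (cft : central (p ft)) (rft : regular_elt (p ft)).
Context (A : algType k) (q : {lrmorphism S -> A}).
Hypothesis qA : presents q (fun y => y = p ft).
Context (B D : algType k) (pB : {lrmorphism T -> B}) (pD : {lrmorphism T -> D}).
Let GB g := fhomog 2 g /\ forall r, fhomog 2 r -> q (p r) = 0 -> pair2 g r = 0.
Hypothesis pBB : presents pB GB.
Hypothesis pDD : presents pD
  (fun g => fhomog 2 g /\ forall r, fhomog 2 r -> p r = 0 -> pair2 g r = 0).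
Variable z : B.
Hypotheses (gz : pgr pB 2 z) (cz : central z) (rz : regular_elt z).
Hypothesis hz : forall t, pD t = 0 <-> ideal_gen (fun x => x = z) (pB t).

Let p_wrel i : p (wrel i) = 0.
Proof. by apply/(proj2 pS)/ideal_gen_incl; exists i. Qed.

Let q_ft : q (p ft) = 0.
Proof. by apply/(proj2 qA)/ideal_gen_incl. Qed.

Let GB_homog g : GB g -> fhomog 2 g. Proof. by case. Qed.

Lemma conic_rel r : fhomog 2 r -> q (p r) = 0 ->
  exists (c : 'I_3 -> k) d, r = \sum_i c i *: wrel i + d *: ft.
Proof.
move=> hr qr; have := presents_comp pS qA; case=> _ /(_ r) [/(_ qr) h _].
have Gh g : (exists i, g = wrel i) \/ g = ft -> fhomog 2 g.
  by case=> [[i ->]|->] //; apply: wrel_homog.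
elim: (ideal_deg Gh hr h) => [|c g y [[i ->]|->] _ [a [d ->]]].
- by exists (fun=> 0), 0; rewrite scale0r addr0 big1 // => i _; rewrite scale0r.
- exists (fun l => c * (l == i)%:R + a l), d; rewrite addrA; congr (_ + _).
  transitivity (\sum_l ((c * (l == i)%:R) *: wrel l + a l *: wrel l)); last first.
    by apply: eq_bigr => l _; rewrite scalerDl.
  rewrite big_split /=; congr (_ + _).
  rewrite (bigD1 i) //= eqxx mulr1 big1 ?addr0 // => l /negPf ->.
  by rewrite mulr0 scale0r.
- by exists a, (c + d); rewrite scalerDl addrCA.
Qed.

Lemma conic_ker2 g : fhomog 2 g -> (forall i, pair2 g (wrel i) = 0) -> pair2 g ft = 0 -> pB g = 0.
Proof.
move=> hg h hf; apply/(proj2 pBB)/ideal_gen_incl; split=> // r hr qr.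
have [c [d ->]] := conic_rel hr qr.
by rewrite addrC pair2P hf mulr0 add0r pair2_sum big1 // => i _; rewrite h mulr0.
Qed.

Lemma conic_ker2P g : fhomog 2 g -> pB g = 0 -> (forall i, pair2 g (wrel i) = 0) /\ pair2 g ft = 0.
Proof.
move=> hg /(proj2 pBB) h.
pose P g := (forall i, pair2 g (wrel i) = 0) /\ pair2 g ft = 0.
apply: (lspan_closed (P := P) _ _ _ (ideal_deg GB_homog hg h)).
- by split=> [i|]; rewrite pair2C pair2_0.
- move=> c x y [xw xf] [yw yf]; split=> [i|]; rewrite pair2Pl; first by rewrite xw yw mulr0 addr0.
  by rewrite xf yf mulr0 addr0.
- move=> x [hx xr]; split=> [i|]; apply: xr => //; first exact: wrel_homog.
  by rewrite p_wrel linear0.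
Qed.

Lemma conic_dual_comm (x y : B) : x * y = y * x.
Proof.
apply: (presents_comm (proj1 pBB)) => i j; apply/eqP; rewrite -subr_eq0 -linearB; apply/eqP.
apply: conic_ker2 => [|l|]; rewrite -!word2; first by apply: homogB; apply: homog_word.
  by rewrite pair2Bl !pair2_word !coef_wrel Wsw subrr.
by rewrite pair2Bl !pair2_word (central_symmetric two0 Wsw pS hft cft i j) subrr.
Qed.

Lemma conic_dual_ker t : pB t = 0 -> pD t = 0.
Proof. by move=> h; apply/hz; rewrite h; apply: ideal_gen0. Qed.

Lemma conic_Phi t : fhomog 3 t -> pB t = 0 -> Phi t = 0.
Proof. by move=> ht /conic_dual_ker; apply: dual_Phi pDD _ ht. Qed.

(** The kernel of the map to the dual of [S] is generated by z. The cofactor may be replaced by its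
    component of degree [n], because the ideal of [B] is homogeneous. *)
Lemma conic_divide n t : fhomog n.+2 t -> pD t = 0 ->
  exists2 s, fhomog n s & pB t = z * pB s.
Proof.
move=> ht /hz h; have [zeta [hzeta ez]] := gz.
have [b eb] : exists b, pB t = z * b.
  elim: h => [|a _ c y -> _ [b ->]]; first by exists 0; rewrite mulr0.
  by exists (a * c + b); rewrite mulrDr mulrA (cz a).
have [s es] := proj1 pBB b; exists (hcomp n s); first exact: comp_homog.
have : pB (t - zeta * s) = 0 by rewrite linearB rmorphM /= -ez -es eb subrr.
move=> /(proj2 pBB)/(ideal_gen_comp n.+2 GB_homog)/(proj2 pBB).
have hM : hcomp n.+2 (zeta * s) = zeta * hcomp n s by exact: (@hcompM _ _ 2).
rewrite linearB /= (homog_comp ht) hM linearB rmorphM /= -ez.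
by move=> /eqP; rewrite subr_eq0 => /eqP.
Qed.

(** From degree four on the dual of [S] vanishes, so z can be divided out until degree two is
    reached. *)
Lemma conic_even n t : fhomog (2 * n.+1) t -> exists2 s, fhomog 2 s & pB t = pB s * z ^+ n.
Proof.
elim: n t => [|n IH] t ht; first by exists t => //; rewrite mulr1.
rewrite (_ : 2 * n.+2 = (2 * n.+1).+2)%N in ht; last by lia.
have [|s hs ->] := conic_divide ht.
  apply: (@dual_ker4 _ _ _ Wcyc Wsw _ _ pS dim2 dim3 _ _ pDD (2 * n)).
  by rewrite (_ : 4 + 2 * n = (2 * n.+1).+2)%N //; lia.
have [r hr ->] := IH s hs; exists r => //.
by rewrite cz exprSr mulrA.
Qed.

Section Localization.
Context (E L : algType k) (iota : {lrmorphism B -> L}) (j : {lrmorphism E -> L}).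
Hypotheses (loc : localization z iota) (jinj : injective j).
Hypothesis jP : forall l, (exists e, j e = l) <->
  exists n b, pgr pB (2 * n) b /\ l * iota z ^+ n = iota b.
Local Notation Z := (iota z).

Lemma loc_cancel x y : x * Z = y * Z -> x = y.
Proof.
have [[u [_ zu]] _ _] := loc => h.
by rewrite -[x]mulr1 -[y]mulr1 -zu !mulrA h.
Qed.

Lemma loc_cancelX n x y : x * Z ^+ n = y * Z ^+ n -> x = y.
Proof. by elim: n => [|n IH]; rewrite ?mulr1 // !exprSr !mulrA => /loc_cancel. Qed.

Lemma loc_inj b : iota b = 0 -> b = 0.
Proof.
have [_ _ h] := loc => /h[n]; elim: n => [|n IH]; first by rewrite mulr1.
by rewrite exprSr mulrA => /(proj2 rz).
Qed.

Lemma loc_comm (x y : L) : x * y = y * x.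
Proof.
have [_ fr _] := loc.
have ZC l : l * Z = Z * l.
  have [n [b e]] := fr l; apply: (@loc_cancelX n).
  rewrite -[LHS]mulrA -exprS exprSr mulrA e -[RHS]mulrA e -!rmorphM; congr (iota _).
  exact: conic_dual_comm.
have ZX l n : l * Z ^+ n = Z ^+ n * l.
  by elim: n => [|n IH]; rewrite ?mulr1 ?mul1r // exprSr mulrA IH -mulrA ZC mulrA.
have XX a b n m : a * b * Z ^+ (n + m) = a * Z ^+ n * (b * Z ^+ m).
  by rewrite exprD !mulrA -[a * b * _]mulrA (ZX b) mulrA.
have [n [b e]] := fr x; have [m [c f]] := fr y; apply: (@loc_cancelX (n + m)).
by rewrite XX addnC XX e f -!rmorphM conic_dual_comm.
Qed.


Lemma C_comm (x y : E) : x * y = y * x.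
Proof. by apply: jinj; rewrite !rmorphM loc_comm. Qed.

Definition frac (e : E) (t : T) := fhomog 2 t /\ j e * Z = iota (pB t).

(** One z in the denominator always suffices. A fraction without denominator is a scalar, and is
    written with a representative of z as numerator. *)
Lemma frac_num e : exists t, frac e t.
Proof.
have [n [b [[t [ht ->]] h]]] : exists n b, pgr pB (2 * n) b /\ j e * Z ^+ n = iota b.
  by apply/jP; exists e.
case: n ht h => [|n] ht h.
  have [s [hs ez]] := gz; exists (coef [::] t *: s); split; first exact: homogZ.
  move: h; rewrite {1}(homog0E ht) mulr1 => ->.
  by rewrite !linearZ /= !rmorph1 -ez -scalerAl mul1r.
have [s hs es] := conic_even ht; exists s; split=> //.
apply: (@loc_cancelX n); rewrite -mulrA -exprS h es rmorphM rmorphXn /=.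
by [].
Qed.

Lemma frac_ex t : fhomog 2 t -> exists e, frac e t.
Proof.
move=> ht; have [[u [uz zu]] _ _] := loc.
have [|e he] := proj2 (jP (iota (pB t) * u)).
  by exists 1%N, (pB t); rewrite expr1 -mulrA uz mulr1; split=> //; exists t.
by exists e; split=> //; rewrite he -mulrA uz mulr1.
Qed.

Lemma frac0 t : frac 0 t -> pB t = 0.
Proof. by case=> _; rewrite linear0 mul0r => /esym/loc_inj. Qed.

Lemma fracP c x y s t : frac x s -> frac y t -> frac (c *: x + y) (c *: s + t).
Proof.
move=> [hs es] [ht et]; split; first exact: homogP.
by rewrite (linearP j) (linearP pB) (linearP iota) mulrDl -scalerAl es et.
Qed.

Lemma frac_eq0 e t : frac e t -> pB t = 0 -> e = 0.
Proof.
move=> [_ h] pt; apply: jinj; rewrite linear0; apply: loc_cancel.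
by rewrite h pt linear0 mul0r.
Qed.

(** Numerators of degree two count modulo those orthogonal to [ft] and to the three relations, so
    [E] is dual to the span of these four tensors. *)
Lemma C_dim4 : has_dim (fun _ : E => True) 4.
Proof.
pose X (i : 'I_4) := if unlift ord0 i is Some l then wrel l else ft.
have X0 : X ord0 = ft by rewrite /X unlift_none.
have Xl l : X (lift ord0 l) = wrel l by rewrite /X liftK.
have hX i : fhomog 2 (X i).
  by rewrite /X; case: unlift => [l|//]; apply: wrel_homog.
have indep (c : 'I_4 -> k) : \sum_i c i *: X i = 0 -> forall i, c i = 0.
  rewrite big_ord_recl X0; under eq_bigr do rewrite Xl; move=> h.
  (* Regularity makes [ft] nonzero in [S], hence independent of the relations. *)
  have c0 : c ord0 = 0.
    apply/eqP/negPn/negP => nz; have pf : p ft = 0.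
      apply/eqP; have /eqP := congr1 p h; rewrite linearD linear_sum linearZ /= big1 ?addr0.
        by rewrite linear0 scaler_eq0 (negPf nz).
      by move=> i _; rewrite linearZ /= p_wrel scaler0.
    have /eqP : (1 : S) = 0 by apply: (proj1 rft); rewrite pf mul0r.
    by rewrite oner_eq0.
  move: h; rewrite c0 scale0r add0r => /(wrel_indep pS dim2) h i.
  by case: (unliftP ord0 i) => [l|] ->.
have /choice[g hg] i : exists g, fhomog 2 g /\ forall l, pair2 g (X l) = (i == l)%:R.
  by have [g hg gX] := dual_elt (fun l => (i == l)%:R) hX indep; exists g.
have /choice[b hb] i := frac_ex (proj1 (hg i)).
have lin (c : 'rV[k]_4) : frac (\sum_i c 0 i *: b i) (\sum_i c 0 i *: g i).
  have h0 : frac 0 0 by split; [exact: homog0 | rewrite !linear0 mul0r].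
  by elim/big_rec2: _ => [//|i y1 y2 _]; apply: fracP.
have pX (c : 'rV[k]_4) l : pair2 (\sum_i c 0 i *: g i) (X l) = c 0 l.
  rewrite pair2C pair2_sum (bigD1 l) //= pair2C (proj2 (hg l)) eqxx mulr1.
  by rewrite big1 ?addr0 // => i ne; rewrite pair2C (proj2 (hg i)) (negPf ne) mulr0.
exists b; split=> // x _; have [t xt] := frac_num x.
exists (\row_i pair2 t (X i)); set c := \row_i _; split.
  apply/eqP; rewrite -subr_eq0; apply/eqP.
  have fd := fracP (-1) (lin c) xt; rewrite !scaleN1r ![- _ + _]addrC in fd.
  apply: (frac_eq0 fd); apply: conic_ker2 => [|i|]; first by case: fd.
    by rewrite -Xl pair2Bl pX mxE subrr.
  by rewrite -X0 pair2Bl pX mxE subrr.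
move=> d xd; apply/rowP => i; rewrite mxE -(pX d); apply/eqP; rewrite -subr_eq0 -pair2Bl; apply/eqP.
have fd := fracP (-1) (lin d) xt; rewrite !scaleN1r ![- _ + _]addrC {1}xd subrr in fd.
have [h h'] := conic_ker2P (proj1 fd) (frac0 fd).
by case: (unliftP ord0 i) => [l|] ->; rewrite ?Xl ?X0.
Qed.


Lemma frac_uniq x y t : frac x t -> frac y t -> x = y.
Proof.
move=> fx fy; apply/eqP; rewrite -subr_eq0 addrC -scaleN1r; apply/eqP.
apply: (frac_eq0 (fracP (-1) fy fx)); by rewrite scaleN1r addNr linear0.
Qed.

(** Both sides are x_a x_b x_c / z. *)
Lemma frac_gen_exchange a b c x x' : frac x (word [:: a; c]) -> frac x' (word [:: a; b]) ->
  j x * iota (pB (gen b)) = j x' * iota (pB (gen c)).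
Proof.
move=> [_ ex] [_ ex']; apply: loc_cancel.
rewrite -[LHS]mulrA -[RHS]mulrA ![_ * Z]loc_comm ![Z * _]loc_comm.
rewrite [iota (pB (gen b)) * Z]loc_comm [iota (pB (gen c)) * Z]loc_comm !mulrA ex ex'.
rewrite !word2 !rmorphM /= -!mulrA; congr (_ * _).
exact: loc_comm.
Qed.

(** This isolates what the local decomposition and [local_unit] provide over an algebraically closed
    field. *)
Hypothesis dec : exists r (e : 'I_r -> E), [/\ forall i, e i != 0,
    forall i l, e i * e l = if i == l then e i else 0, \sum_i e i = 1 &
    forall i a, ~ nilpotent (e i * a) -> exists b, e i * a * b = e i].

(* The degree one part of the localization is E-free on the invertible element m below,
   so that multiplication by m turns the functional [Phi] into a Frobenius form on E. *)
Lemma C_frobenius : frobenius E.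
Proof.
have /choice[eps0 heps0] (ab : 'I_3 * 'I_3) : exists e, frac e (word [:: ab.1; ab.2]).
  by apply: frac_ex; apply: homog_word.
(* These are the fractions x_a x_b / z. *)
pose eps a b := eps0 (a, b).
have heps a b : frac (eps a b) (word [:: a; b]) by apply: heps0.
pose y a := iota (pB (gen a)).
have epsE a b : j (eps a b) * Z = y a * y b by rewrite (proj2 (heps a b)) word2 !rmorphM.
have [r [e [e0 eo es einv]]] := dec.
have frac_lin (c : 'I_3 -> 'I_3 -> k) :
    frac (\sum_a \sum_b c a b *: eps a b) (\sum_a \sum_b c a b *: word [:: a; b]).
  have h0 : frac 0 0 by split; [exact: homog0 | rewrite !linear0 mul0r].
  have hD x x' t t' : frac x t -> frac x' t' -> frac (x + x') (t + t').
    by move=> f f'; rewrite -[x]scale1r -[t]scale1r; apply: fracP.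
  have hI b0 : frac (\sum_b c b0 b *: eps b0 b) (\sum_b c b0 b *: word [:: b0; b]).
    by elim/big_rec2: _ => [//|b y1 y2 _]; apply: fracP.
  by elim/big_rec2: _ => [//|b y1 y2 _]; apply: hD.
have [zeta [hzeta ez]] := gz.
have frac1 : frac 1 zeta by split=> //; rewrite rmorph1 mul1r ez.
have one_span : exists c : 'I_3 -> 'I_3 -> k, 1 = \sum_a \sum_b c a b *: eps a b.
  exists (fun a b => coef [:: a; b] zeta); apply: (frac_uniq frac1).
  by have := frac_lin (fun a b => coef [:: a; b] zeta); rewrite -(homog2E hzeta).
have eps_sq a b : eps a b * eps a b = eps a a * eps b b.
  apply: jinj; apply: (@loc_cancelX 2).
  have jm x x' : j (x * x') * Z ^+ 2 = (j x * Z) * (j x' * Z).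
    rewrite rmorphM expr2 !mulrA; congr (_ * _).
    by rewrite -!mulrA; congr (_ * _); apply: loc_comm.
  rewrite !jm !epsE -!mulrA; congr (_ * _); rewrite !mulrA; congr (_ * _).
  exact: loc_comm.
have mC := C_comm.
(* If all x_a^2 / z were nilpotent at [e i], so would be all x_a x_b / z, whose squares are products
   of two of them; but 1 is a combination of these fractions. *)
have nn i : exists a, ~ nilpotent (e i * eps a a).
  apply: contrapT => no; have nil a : nilpotent (e i * eps a a).
    by apply: contrapT => h; apply: no; exists a.
  have nilb a b : nilpotent (e i * eps a b).
    have [n hn] := nilpotentMl mC (e i * eps a a) (nil b).
    exists (2 * n)%N; rewrite exprM (_ : _ ^+ 2 = e i * eps a a * (e i * eps b b)) //.
    rewrite expr2 -!mulrA; congr (_ * _); rewrite [eps a b * _]mC [eps a a * _]mC -!mulrA.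
    by congr (_ * _); rewrite eps_sq mC.
  have [c c1] := one_span.
  case/eqP: (e0 i); apply: nilpotent_idem; first by rewrite eo eqxx.
  rewrite -[e i]mulr1 c1 mulr_sumr; apply: nilpotent_sum => // a.
  rewrite mulr_sumr; apply: nilpotent_sum => // b.
  by rewrite -scalerAr -mulr_algl; apply: nilpotentMl.
have /choice[a ha] := nn.
have /choice[b hb] i : exists b, e i * eps (a i) (a i) * b = e i by apply: einv.
pose m := \sum_i j (e i) * y (a i).
have em x i : j (x * e i) * m = j (x * e i) * y (a i).
  rewrite /m mulr_sumr (bigD1 i) //= big1 ?addr0 => [|l ne].
    by rewrite mulrA -rmorphM -mulrA eo eqxx.
  by rewrite mulrA -rmorphM -mulrA eo eq_sym (negPf ne) mulr0 rmorph0 mul0r.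
(* [f c] is the quotient of x_c by [m], computed on each local piece. *)
pose f c := \sum_i eps (a i) c * b i * e i.
have fm c : j (f c) * m = y c.
  rewrite /f rmorph_sum mulr_suml /= -[RHS]mul1r -(rmorph1 j) -es rmorph_sum mulr_suml.
  apply: eq_bigr => i _; rewrite em -[in RHS](hb i).
  rewrite (_ : eps (a i) c * b i * e i = b i * e i * eps (a i) c); last by rewrite -mulrA mC.
  rewrite (_ : e i * eps (a i) (a i) * b i = b i * e i * eps (a i) (a i)); last first.
    by rewrite mC mulrA.
  rewrite !(rmorphM j (b i * e i)) /= -!mulrA; congr (_ * _).
  exact: (frac_gen_exchange (a := a i)).
(* The product of x and [m] is a fraction with denominator z and numerator of degree three, where
   [Phi] can be evaluated. *)
have /choice[t3 ht3] x : exists t, fhomog 3 t /\ j x * m * Z = iota (pB t).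
  have /choice[t ht] i := frac_num (x * e i).
  exists (\sum_i t i * gen (a i)); split.
    apply: homog_sum => i _; apply: (homogM (n := 2) (m := 1)); first by case: (ht i).
    exact: homog_tgen.
  have ex : x = \sum_i x * e i by rewrite -mulr_sumr es mulr1.
  rewrite [in LHS]ex (rmorph_sum j) !mulr_suml (linear_sum pB) (linear_sum iota).
  apply: eq_bigr => i _.
  rewrite /= em -[LHS]mulrA [y _ * _]loc_comm mulrA (proj2 (ht i)).
  by rewrite (rmorphM pB) (rmorphM iota).
have uniq x t : fhomog 3 t -> j x * m * Z = iota (pB t) -> Phi (t3 x) = Phi t.
  move=> h3 h; have [h3' h'] := ht3 x; apply/eqP; rewrite -subr_eq0 -linearB; apply/eqP.
  apply: conic_Phi; first exact: homogB.
  by apply: loc_inj; rewrite (linearB pB) (linearB iota) /= -h -h' subrr.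
have key x c t : frac x t -> Phi (t3 (x * f c)) = pair2 t (wrel c).
  move=> [h2 h]; rewrite -(Phi_gen_r Wcyc _ h2); apply: uniq.
    by apply: (homogM (n := 2) (m := 1)) => //; apply: homog_tgen.
  rewrite rmorphM -[_ * _ * m]mulrA fm -mulrA [y c * Z]loc_comm mulrA h.
  by rewrite (rmorphM pB) (rmorphM iota).
have phiP c x x' : Phi (t3 (c *: x + x')) = c * Phi (t3 x) + Phi (t3 x').
  have [h3 h] := ht3 x; have [h3' h'] := ht3 x'.
  rewrite -[RHS](linearP Phi); apply: uniq; first exact: homogP.
  by rewrite (linearP j) (linearP pB) (linearP iota) !mulrDl -!scalerAl h h'.
(* An [x] in the radical of the form has a numerator orthogonal to all relations, hence divisible by
   z, so [x] is a scalar; a nonzero entry of [W] forces this scalar to vanish. *)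
have nondeg x : (forall x', Phi (t3 (x * x')) = 0) -> x = 0.
  move=> h; have [t ft2] := frac_num x.
  have [|s hs es'] := @conic_divide 0 t (proj1 ft2).
    by apply: (dual_ker2 pS pDD (proj1 ft2)) => c; rewrite -(key _ _ _ ft2).
  pose g := coef [::] s; have fx : frac x (g *: zeta).
    split; first exact: homogZ.
    rewrite (proj2 ft2) es' (homog0E hs) -/g !linearZ /= rmorph1 -scalerAr mulr1.
    by rewrite -ez linearZ.
  have xg : x = g *: 1.
    apply: (frac_uniq fx); have := fracP g frac1 (t := 0) (y := 0).
    by rewrite !addr0; apply; split; [exact: homog0 | rewrite !linear0 mul0r].
  have [u [v [w nz]]] := W_neq0 pS dim2.
  have fg : frac (g *: eps v w) (g *: word [:: v; w]).
    have := fracP g (heps v w) (t := 0) (y := 0).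
    by rewrite !addr0; apply; split; [exact: homog0 | rewrite !linear0 mul0r].
  have := key _ u _ fg; rewrite -[_ *: eps v w]mulr_algl -xg -mulrA h.
  rewrite -[_ *: word _]addr0 pair2Pl pair2_word coef_wrel pair2C pair2_0 addr0 => /esym/eqP.
  by rewrite mulf_eq0 (negPf nz) orbF xg => /eqP ->; rewrite scale0r.
split; first by exists 4%N; apply: C_dim4.
exists (fun x x' => Phi (t3 (x * x'))); split.
- by move=> c x x' w; rewrite mulrDl -scalerAl phiP.
- by move=> c x x' w; rewrite mulrDr -scalerAr phiP.
- by move=> x x' w; rewrite mulrA.
- exact: nondeg.
- by move=> x h; apply: nondeg => x'; rewrite mC.
Qed.


End Localization.

End ConicDual.

(** * Algebras with basis 1, u, v, uv and two quadratic equations *)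

Section Quad.
Context (k : fieldType).

Definition comb (E : algType k) (u v : E) a b c d : E :=
  a *: 1 + b *: u + c *: v + d *: (u * v).

Definition quad (al be ga de : k) (E : algType k) :=
  (forall x y : E, x * y = y * x) /\ exists u v : E,
  [/\ u * u = al *: v + be *: 1, v * v = ga *: u + de *: 1,
      forall x, exists a b c d, x = comb u v a b c d &
      forall a b c d, comb u v a b c d = 0 -> [/\ a = 0, b = 0, c = 0 & d = 0]].

Section Comb.
Context (E : algType k) (u v : E).

Lemma combP e a b c d a' b' c' d' : e *: comb u v a b c d + comb u v a' b' c' d' =
  comb u v (e * a + a') (e * b + b') (e * c + c') (e * d + d').
Proof.
rewrite /comb !scalerDr !scalerA !scalerDl.
by rewrite [LHS](AC (4*4) ((1*5)*(2*6)*(3*7)*(4*8))).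
Qed.

Lemma comb_mul_u (uC : u * v = v * u) al be ga de a b c d :
  u * u = al *: v + be *: 1 -> v * v = ga *: u + de *: 1 ->
  u * comb u v a b c d =
  comb u v (b * be + d * (al * de)) (a + d * (al * ga)) (b * al + d * be) c.
Proof.
move=> hu hv; have huv : u * (u * v) = (al * ga) *: u + (al * de) *: 1 + be *: v.
  by rewrite mulrA hu mulrDl -!scalerAl hv scalerDr !scalerA mul1r.
rewrite /comb !mulrDr -!scalerAr hu huv mulr1 !scalerDr !scalerA !scalerDl.
by rewrite [LHS](AC (1*2*1*3) ((3*6)*(1*5)*(2*7)*4)).
Qed.

End Comb.

Lemma comb_swap (E : algType k) (u v : E) a b c d : u * v = v * u ->
  comb u v a b c d = comb v u a c b d.
Proof. by rewrite /comb => ->; rewrite [LHS](AC (4) ((1*3)*2*4)). Qed.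

(** The coordinate map commutes with multiplication by u and, after exchanging the two generators,
    by v, because [comb_mul_u] involves only the parameters; u and v generate. *)
Lemma quad_iso al be ga de (E F : algType k) :
  quad al be ga de E -> quad al be ga de F -> alg_iso E F.
Proof.
move=> [EC [u [v [hu hv sp ind]]]] [FC [u' [v' [hu' hv' sp' ind']]]].
have /choice[X hX] x : exists X : k * k * k * k, x = comb u v X.1.1.1 X.1.1.2 X.1.2 X.2.
  by have [a [b [c [d ->]]]] := sp x; exists (a, b, c, d).
pose f0 x := comb u' v' (X x).1.1.1 (X x).1.1.2 (X x).1.2 (X x).2.
have f0E a b c d : f0 (comb u v a b c d) = comb u' v' a b c d.
  have h := combP u v (-1) a b c d (X (comb u v a b c d)).1.1.1 (X (comb u v a b c d)).1.1.2
    (X (comb u v a b c d)).1.2 (X (comb u v a b c d)).2.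
  rewrite -hX scaleN1r addNr in h; have [ha hb hc hd] := ind _ _ _ _ (esym h).
  apply/eqP; rewrite -subr_eq0 addrC -scaleN1r combP ha hb hc hd.
  by rewrite /comb !scale0r !addr0.
have f0E' a b c d : f0 (comb v u a b c d) = comb v' u' a b c d.
  by rewrite comb_swap // f0E comb_swap.
have f0l : linear f0.
  move=> e x y; have [a [b [c [d ->]]]] := sp x; have [a' [b' [c' [d' ->]]]] := sp y.
  by rewrite combP !f0E combP.
have f0u x : f0 (u * x) = u' * f0 x.
  have [a [b [c [d ->]]]] := sp x.
  by rewrite (comb_mul_u (EC u v) _ _ _ _ hu hv) !f0E (comb_mul_u (FC u' v') _ _ _ _ hu' hv').
have f0v x : f0 (v * x) = v' * f0 x.
  have [a [b [c [d ->]]]] := sp x.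
  rewrite comb_swap // (comb_mul_u (EC v u) _ _ _ _ hv hu) !f0E'.
  by rewrite (comb_mul_u (FC v' u') _ _ _ _ hv' hu').
pose f1 := mklin f0l; have f1E x : f1 x = f0 x by [].
have f01 : f0 1 = 1.
  by have := f0E 1 0 0 0; rewrite /comb !scale0r !addr0 !scale1r.
have f0M x y : f0 (x * y) = f0 x * f0 y.
  have [a [b [c [d ->]]]] := sp x; rewrite f0E /comb !mulrDl -!scalerAl -!f1E !linearD !linearZ /=.
  by rewrite ?f1E mul1r f0u f0v -mulrA f0u f0v mul1r mulrA.
pose M := GRing.isLinear.Build k E F *:%R f0 f0l.
pose MM := GRing.isMonoidMorphism.Build E F f0 (f01, f0M).
pose f : {lrmorphism E -> F} := HB.pack f0 M MM.
exists f.
have inj x : f0 x = 0 -> x = 0.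
  have [a [b [c [d ->]]]] := sp x; rewrite f0E => /ind'[-> -> -> ->].
  by rewrite /comb !scale0r !addr0.
have /choice[h hh] y : exists x, f0 x = y.
  by have [a [b [c [d ->]]]] := sp' y; exists (comb u v a b c d).
exists h => x /=; last exact: hh.
apply/eqP; rewrite -subr_eq0; apply/eqP/inj.
by rewrite -f1E linearB !f1E hh subrr.
Qed.

Lemma quad_transfer al be ga de (E F : algType k) :
  alg_iso E F -> quad al be ga de F -> quad al be ga de E.
Proof.
move=> [f [g fK gK]] [FC [u [v [hu hv sp ind]]]].
have inj : injective f := can_inj fK.
split=> [x y|]; first by apply: inj; rewrite !rmorphM FC.
have fc a b c d : f (comb (g u) (g v) a b c d) = comb u v a b c d.
  by rewrite /comb !linearD !linearZ /= rmorphM rmorph1 /= !gK.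
exists (g u), (g v); split.
- by apply: inj; rewrite rmorphM linearD !linearZ /= rmorph1 !gK.
- by apply: inj; rewrite rmorphM linearD !linearZ /= rmorph1 !gK.
- move=> x; have [a [b [c [d h]]]] := sp (f x); exists a, b, c, d.
  by apply: inj; rewrite fc.
- by move=> a b c d h; apply: ind; rewrite -fc h linear0.
Qed.

End Quad.

(** * Truncated polynomial pieces and the numerical types *)

Section Jets.
Context (k : fieldType) (E : algType k).
Local Notation ev := (@horner_alg _ E).

(** The corner of [e] contains a copy of k[X]/(X^d) with unit [e] and generator [x]. For d = 1 the
    generator is 0. *)
Definition jet (d : nat) (e x : E) :=
  [/\ e * e = e, e * x = x, (0 < d)%N, e * x ^+ d = 0 & e * x ^+ d.-1 != 0].

Lemma horner_algE (x : E) (p : {poly k}) n : (size p <= n)%N ->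
  horner_alg x p = \sum_(i < n) p`_i *: x ^+ i.
Proof.
move=> le; have pE : p = \sum_(i < n) p`_i *: 'X^i.
  apply/polyP => i; rewrite -[in LHS](coefK p) poly_def.
  rewrite (big_ord_widen _ (fun i => p`_i *: 'X^i) le) big_mkcond /=.
  rewrite !coef_sum; apply: eq_bigr => j _; case: ltnP => // le'.
  by rewrite [p`_j]nth_default // scale0r coef0.
rewrite {1}pE; apply: etrans (linear_sum _ _ _ _) _; apply: eq_bigr => i _.
by rewrite linearZ /= mulr_algl rmorphXn /= horner_algX.
Qed.

Lemma jet_coef d e x (p : {poly k}) : jet d e x -> e * horner_alg x p = 0 ->
  forall i, (i < d)%N -> p`_i = 0.
Proof.
move=> [_ _ d0 ed ed1] h i; have [n] := ubnP i; elim: n i => // n IH i lin lid.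
have [le|lt] := leqP (size p) i; first exact: nth_default.
(* This factor isolates coefficient [i]: lower coefficients vanish by induction, and higher powers
   reach [d]. *)
have := congr1 (fun y => y * x ^+ (d.-1 - i)) h; rewrite mul0r (@horner_algE _ _ (size p)) //.
rewrite -mulrA mulr_suml mulr_sumr (bigD1 (Ordinal lt)) //= big1 ?addr0 => [|[j ltj] ne].
  rewrite -scalerAl -scalerAr -exprD subnKC; last by lia.
  by move/eqP; rewrite scaler_eq0 (negPf ed1) orbF => /eqP.
rewrite -scalerAl -scalerAr -exprD /=; have {ne} ne : j != i by [].
have [lji|lij] := ltnP j i; first by rewrite (IH j) ?scale0r //; lia.
rewrite (_ : j + (d.-1 - i) = d + (j - i).-1)%N; last by lia.
by rewrite exprD mulrA ed mul0r scaler0.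
Qed.

Definition jets r (d : 'I_r -> nat) (e x : 'I_r -> E) :=
  [/\ forall i, jet (d i) (e i) (x i), forall i j, i != j -> e i * e j = 0 & \sum_i e i = 1].

Lemma quad_indep (dim4 : has_dim (fun _ : E => True) 4) (mulC : forall x y : E, x * y = y * x)
    al be ga de (u v : E) :
  u * u = al *: v + be *: 1 -> v * v = ga *: u + de *: 1 ->
  (forall a b c d, comb u v a b c d = 0 -> [/\ a = 0, b = 0, c = 0 & d = 0]) ->
  quad al be ga de E.
Proof.
move=> hu hv ind; split=> //; exists u, v; split=> // x.
have [w w0 hw] := dependent dim4 (fun i : 'I_5 => nth 0 [:: 1; u; v; u * v; x] i) isT.
move: hw; rewrite !big_ord_recl big_ord0 addr0 /=.
set w0' := w 0 _; set w1' := w 0 _; set w2' := w 0 _; set w3' := w 0 _; set w4' := w 0 _.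
rewrite !addrA -[_ + _ + w2' *: _ + _]/(comb u v w0' w1' w2' w3') => h.
have [z4|n4] := boolP (w4' == 0).
  move: h; rewrite (eqP z4) scale0r addr0 => /ind[e0 e1 e2 e3].
  case/eqP: w0; apply/rowP => -[[|[|[|[|[|//]]]]] lt]; rewrite mxE.
  - by rewrite -[RHS]e0; congr (w _ _); apply: val_inj.
  - by rewrite -[RHS]e1; congr (w _ _); apply: val_inj.
  - by rewrite -[RHS]e2; congr (w _ _); apply: val_inj.
  - by rewrite -[RHS]e3; congr (w _ _); apply: val_inj.
  - by rewrite -[RHS](eqP z4); congr (w _ _); apply: val_inj.
pose s y := - w4'^-1 * y; exists (s w0'), (s w1'), (s w2'), (s w3').
have -> : comb u v (s w0') (s w1') (s w2') (s w3') = (- w4'^-1) *: comb u v w0' w1' w2' w3'.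
  by rewrite /comb !scalerDr !scalerA.
move/eqP: h; rewrite addr_eq0 => /eqP ->.
by rewrite scaleNr scalerN opprK scalerA mulVf ?scale1r.
Qed.

Section JetsQuad.
Variables (r : nat) (d : 'I_r -> nat) (e x : 'I_r -> E).
Hypotheses (mulC : forall x y : E, x * y = y * x) (J : jets d e x).

Definition jet_elt (P : 'I_r -> {poly k}) : E := \sum_i e i * horner_alg (x i) (P i).

Lemma jet_eltM P Q : jet_elt P * jet_elt Q = jet_elt (fun i => P i * Q i).
Proof.
have [hj ho _] := J; rewrite /jet_elt mulr_suml; apply: eq_bigr => i _.
rewrite mulr_sumr (bigD1 i) //= big1 ?addr0 => [|l ne].
  rewrite rmorphM /= -mulrA (mulrA _ (e i)) (mulC _ (e i)) -mulrA mulrA.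
  by have [-> _ _ _ _] := hj i.
rewrite -mulrA (mulrA _ (e l)) (mulC _ (e l)) -mulrA mulrA ho 1?eq_sym //.
by rewrite mul0r.
Qed.

Lemma jet_eltD P Q : jet_elt P + jet_elt Q = jet_elt (fun i => P i + Q i).
Proof. by rewrite -big_split; apply: eq_bigr => i _; rewrite rmorphD mulrDr. Qed.

Lemma jet_eltZ c P : c *: jet_elt P = jet_elt (fun i => c *: P i).
Proof.
rewrite scaler_sumr; apply: eq_bigr => i _.
by rewrite linearZ /= mulr_algl scalerAr.
Qed.

Lemma jet_elt1 : 1 = jet_elt (fun=> 1).
Proof.
by have [_ _ <-] := J; apply: eq_bigr => i _; rewrite rmorph1 mulr1.
Qed.

Lemma jet_eltX q : jet_elt (fun i => q i * 'X^(d i)) = 0.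
Proof.
rewrite /jet_elt big1 // => i _; have [hj _ _] := J; have [_ _ _ ex _] := hj i.
by rewrite rmorphM rmorphXn /= horner_algX mulC -mulrA (mulC _ (e i)) ex mulr0.
Qed.

Lemma jet_elt_coef P : jet_elt P = 0 -> forall i j, (j < d i)%N -> (P i)`_j = 0.
Proof.
move=> h i; have [hj ho _] := J; apply: (jet_coef (hj i)).
have := congr1 (fun y => e i * y) h; rewrite mulr0 mulr_sumr (bigD1 i) //= big1 ?addr0.
  by rewrite mulrA; have [-> _ _ _ _] := hj i.
by move=> l ne; rewrite mulrA ho 1?eq_sym // mul0r.
Qed.

(** As in the Chinese remainder theorem, u and v are given by one polynomial per piece; [q] and [q']
    witness the equations modulo ['X^(d i)]. *)
Lemma jets_quad (dim4 : has_dim (fun _ : E => True) 4) al be ga de (U V q q' : 'I_r -> {poly k}) :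
  (forall i, U i * U i = al *: V i + be *: 1 + q i * 'X^(d i)) ->
  (forall i, V i * V i = ga *: U i + de *: 1 + q' i * 'X^(d i)) ->
  (forall a b c f, (forall i j, (j < d i)%N ->
    (a *: 1 + b *: U i + c *: V i + f *: (U i * V i))`_j = 0) ->
    [/\ a = 0, b = 0, c = 0 & f = 0]) ->
  quad al be ga de E.
Proof.
move=> hU hV ind; apply: (quad_indep dim4 mulC (u := jet_elt U) (v := jet_elt V)).
- rewrite jet_eltM [X in be *: X]jet_elt1 !jet_eltZ jet_eltD -[RHS]addr0 -(jet_eltX q) jet_eltD.
  by apply: eq_bigr => i _; rewrite hU.
- rewrite jet_eltM [X in de *: X]jet_elt1 !jet_eltZ jet_eltD -[RHS]addr0 -(jet_eltX q') jet_eltD.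
  by apply: eq_bigr => i _; rewrite hV.
move=> a b c f; rewrite /comb jet_eltM [X in a *: X]jet_elt1 !jet_eltZ !jet_eltD => /jet_elt_coef h.
exact: ind.
Qed.

End JetsQuad.

(** Only a family of pieces is asked for; it exhausts the algebra once the dimension equals the sum
    of [s]. *)
Definition is_type (s : seq nat) := exists e x : 'I_(size s) -> E, jets (fun i => nth 0%N s i) e x.

Section Types.
Hypothesis char0 : forall n, n.+1%:R != 0 :> k.
Hypotheses (mulC : forall x y : E, x * y = y * x) (dim4 : has_dim (fun _ : E => True) 4).

Lemma nat_cancel n (x : k) : n.+1%:R * x = 0 -> x = 0.
Proof. by move/eqP; rewrite mulf_eq0 (negPf (char0 n)) => /eqP. Qed.

(** k^4 is the group algebra of the Klein four-group: (u, v) runs through the four sign patterns,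
    and independence is the orthogonality of characters, whence the factor 4. *)
Lemma type1111_quad : is_type [:: 1; 1; 1; 1]%N -> quad 0 1 0 1 E.
Proof.
move=> [e [x J]].
pose U (i : 'I_4) : {poly k} := nth 0 [:: 1%:P; (-1)%:P; 1%:P; (-1)%:P] i.
pose V (i : 'I_4) : {poly k} := nth 0 [:: 1%:P; 1%:P; (-1)%:P; (-1)%:P] i.
apply: (jets_quad mulC J dim4 (U := U) (V := V) (q := fun=> 0) (q' := fun=> 0)).
- by case=> [[|[|[|[|//]]]] ?]; rewrite /U /V /= -!mul_polyC; ring.
- by case=> [[|[|[|[|//]]]] ?]; rewrite /U /V /= -!mul_polyC; ring.
move=> a b c f h.
have := h (@Ordinal 4 0 isT) 0%N isT; have := h (@Ordinal 4 1 isT) 0%N isT.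
have := h (@Ordinal 4 2 isT) 0%N isT; have := h (@Ordinal 4 3 isT) 0%N isT.
rewrite /U /V /= !(coefD, coefZ, coef0M, coefC) /= ?(oppr0, subr0, mulr0, mul0r, addr0, add0r) => h3 h2 h1 h0.
split; apply: (@nat_cancel 3).
- by transitivity (0 + 0 + 0 + 0 : k); [rewrite -{1}h0 -{1}h1 -{1}h2 -{1}h3|]; ring.
- by transitivity (0 - 0 + 0 - 0 : k); [rewrite -{1}h0 -{1}h1 -{1}h2 -{1}h3|]; ring.
- by transitivity (0 + 0 - 0 - 0 : k); [rewrite -{1}h0 -{1}h1 -{1}h2 -{1}h3|]; ring.
- by transitivity (0 - 0 - 0 + 0 : k); [rewrite -{1}h0 -{1}h1 -{1}h2 -{1}h3|]; ring.
Qed.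

(** The equation v^2 = 4 gives v = 2 or v = - 2. Over v = 2 the equation u^2 = v + 2 has the two
    simple roots 2 and - 2; over v = - 2 it becomes u^2 = 0, the double point. *)
Lemma type211_quad : is_type [:: 2; 1; 1]%N -> quad 1 2 0 4 E.
Proof.
move=> [e [x J]].
pose U (i : 'I_3) : {poly k} := nth 0 [:: 'X; 2%:P; (-2)%:P] i.
pose V (i : 'I_3) : {poly k} := nth 0 [:: (-2)%:P; 2%:P; 2%:P] i.
pose q (i : 'I_3) : {poly k} := nth 0 [:: 1; 0; 0] i.
apply: (jets_quad mulC J dim4 (U := U) (V := V) (q := q) (q' := fun=> 0)).
- by case=> [[|[|[|//]]] ?]; rewrite /U /V /q /= -!mul_polyC; ring.
- by case=> [[|[|[|//]]] ?]; rewrite /U /V /= -!mul_polyC; ring.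
move=> a b c f h.
have := h (@Ordinal 3 0 isT) 0%N isT; have := h (@Ordinal 3 0 isT) 1%N isT.
have := h (@Ordinal 3 1 isT) 0%N isT; have := h (@Ordinal 3 2 isT) 0%N isT.
rewrite /U /V /= !(coefD, coefZ, coef0M, coefC, coefX, coefMC) /= ?(oppr0, subr0, mulr0, mul0r, addr0, add0r) => h2 h1 h01 h00.
have f0 : f = 0.
  apply: (@nat_cancel 15).
  by transitivity (0 - 0 - 4 * 0 : k); [rewrite -{1}h1 -{1}h2 -{1}h01|]; ring.
have c0 : c = 0.
  apply: (@nat_cancel 7).
  by transitivity (0 + 0 - 2 * 0 : k); [rewrite -{1}h1 -{1}h2 -{1}h00|]; ring.
split=> //.
- by transitivity (0 + 2 * 0 : k); [rewrite -{1}h00 -c0|]; ring.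
- by transitivity (0 + 2 * 0 : k); [rewrite -{1}h01 -f0|]; ring.
Qed.

(** u^2 = 1 separates the two points, and v is the square-zero element at both. *)
Lemma type22_quad : is_type [:: 2; 2]%N -> quad 0 1 0 0 E.
Proof.
move=> [e [x J]].
pose U (i : 'I_2) : {poly k} := nth 0 [:: 1%:P; (-1)%:P] i.
pose V (i : 'I_2) : {poly k} := 'X.
apply: (jets_quad mulC J dim4 (U := U) (V := V) (q := fun=> 0) (q' := fun=> 1)).
- by case=> [[|[|//]] ?]; rewrite /U /V /= -!mul_polyC; ring.
- by case=> [[|[|//]] ?]; rewrite /U /V /= -!mul_polyC; ring.
move=> a b c f h.
have := h (@Ordinal 2 0 isT) 0%N isT; have := h (@Ordinal 2 0 isT) 1%N isT.
have := h (@Ordinal 2 1 isT) 0%N isT; have := h (@Ordinal 2 1 isT) 1%N isT.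
rewrite /U /V /= !(coefD, coefZ, coefC, coefX, coefCM) /= ?(oppr0, subr0, mulr0, mul0r, addr0, add0r) => h11 h10 h01 h00.
split; apply: (@nat_cancel 1).
- by transitivity (0 + 0 : k); [rewrite -{1}h00 -{1}h10|]; ring.
- by transitivity (0 - 0 : k); [rewrite -{1}h00 -{1}h10|]; ring.
- by transitivity (0 + 0 : k); [rewrite -{1}h01 -{1}h11|]; ring.
- by transitivity (0 - 0 : k); [rewrite -{1}h01 -{1}h11|]; ring.
Qed.

(** Eliminating v = u^2 - 3 leaves u^4 - 6 u^2 + 8 u - 3 = (u - 1)^3 (u + 3). A quartic obtained in
    this way has no cubic term, which forces the simple root to be - 3 times the triple one. *)
Lemma type31_quad : is_type [:: 3; 1]%N -> quad 1 3 (- 8) 12 E.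
Proof.
move=> [e [x J]].
pose U (i : 'I_2) : {poly k} := nth 0 [:: 1%:P + 'X; (-3)%:P] i.
pose V (i : 'I_2) : {poly k} := nth 0 [:: 'X^2 + 2 * 'X - 2%:P; 6%:P] i.
pose q (i : 'I_2) : {poly k} := nth 0 [:: 'X + 4%:P; 0] i.
apply: (jets_quad mulC J dim4 (U := U) (V := V) (q := fun=> 0) (q' := q)).
- by case=> [[|[|//]] ?]; rewrite /U /V /= -!mul_polyC; ring.
- by case=> [[|[|//]] ?]; rewrite /U /V /q /= -!mul_polyC; ring.
move=> a b c f h.
have := h (@Ordinal 2 0 isT) 0%N isT; have := h (@Ordinal 2 0 isT) 1%N isT.
have := h (@Ordinal 2 0 isT) 2%N isT; have := h (@Ordinal 2 1 isT) 0%N isT.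
rewrite /U /V /= (_ : (1%:P + 'X) * _ = 'X * 'X^2 + 3%:P * 'X^2 - 2%:P :> {poly k}); last by ring.
rewrite (_ : 2 * 'X = 2%:P * 'X :> {poly k}); last by ring.
rewrite !(coefD, coefN, coefZ, coefC, coefX, coefXn, coefCM, coefXM) /= ?(oppr0, subr0, mulr0, mul0r, addr0, add0r) => h10 h02 h01 h00.
have f0 : f = 0.
  (* The combination is a cubic in u with leading coefficient [f]. Its Taylor expansion at the
     triple root 1, evaluated at - 3, contains f times (- 4)^3, whence 64. *)
  apply: (@nat_cancel 63).
  transitivity (0 - 4 * 0 + 16 * 0 - 0 : k); last by ring.
  rewrite -{1}h00 -{1}h01 -{1}h02 -{1}h10; ring.
have c0 : c = 0 by transitivity (0 - 3 * 0 : k); [rewrite -{1}h02 -f0|]; ring.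
have b0 : b = 0 by transitivity (0 - 2 * 0 : k); [rewrite -{1}h01 -c0|]; ring.
split=> //.
by transitivity (0 - 0 + 2 * 0 + 2 * 0 : k); [rewrite -{1}h00 -{1}b0 -{1}c0 -f0|]; ring.
Qed.

(** Here v is u^2, and v^2 = 0 says that u^4 = 0. *)
Lemma type4_quad : is_type [:: 4]%N -> quad 1 0 0 0 E.
Proof.
move=> [e [x J]].
apply: (jets_quad mulC J dim4 (U := fun=> 'X) (V := fun=> 'X^2) (q := fun=> 0) (q' := fun=> 1)).
- by case=> [[|//] ?]; rewrite /= -!mul_polyC; ring.
- by case=> [[|//] ?]; rewrite /= -!mul_polyC; ring.
move=> a b c f h.
have := h (@Ordinal 1 0 isT) 0%N isT; have := h (@Ordinal 1 0 isT) 1%N isT.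
have := h (@Ordinal 1 0 isT) 2%N isT; have := h (@Ordinal 1 0 isT) 3%N isT.
rewrite !(coefD, coefZ, coef1, coefX, coefXn, coefXM) /=.
by rewrite !(mulr0, mulr1, addr0, add0r) => -> -> -> ->.
Qed.

End Types.
End Jets.

(** * Types and dimensions of the listed algebras *)

Section Products.
Context (k : fieldType) (E F : algType k).
Local Notation EF := (E * F)%type.

Lemma pair_expn (x : E) (y : F) n : ((x, y) : EF) ^+ n = (x ^+ n, y ^+ n).
Proof. by elim: n => [//|n IH]; rewrite !exprS IH. Qed.

Lemma jet_inl d (e x : E) : jet d e x -> jet d ((e, 0) : EF) (x, 0).
Proof.
case=> ee ex d0 ed ed1; split=> //.
- by congr (_, _); rewrite ?mulr0.
- by congr (_, _); rewrite ?mulr0.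
- by rewrite pair_expn; congr (_, _); rewrite ?mul0r.
- by rewrite pair_expn; apply: contraNneq ed1 => -[->].
Qed.

Lemma jet_inr d (e x : F) : jet d e x -> jet d ((0, e) : EF) (0, x).
Proof.
case=> ee ex d0 ed ed1; split=> //.
- by congr (_, _); rewrite ?mulr0.
- by congr (_, _); rewrite ?mulr0.
- by rewrite pair_expn; congr (_, _); rewrite ?mul0r.
- by rewrite pair_expn; apply: contraNneq ed1 => -[_ ->].
Qed.

(** There are two versions, one for each side of the single piece, to fit both bracketings among the
    listed products; the new piece always heads the list. *)
Lemma is_type_prodl d s : is_type E [:: d] -> is_type F s -> is_type EF (d :: s).
Proof.
move=> [e [x [hj _ s1]]] [e' [x' [hj' ho' s1']]]; rewrite big_ord1 in s1.
exists (fun i : 'I_(size s).+1 => if unlift ord0 i is Some l then (0, e' l) else (e ord0, 0)).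
exists (fun i : 'I_(size s).+1 => if unlift ord0 i is Some l then (0, x' l) else (x ord0, 0)).
split=> [i|i l|].
- case: (unliftP ord0 i) => [l|] ->; rewrite ?unlift_none ?liftK.
    by rewrite lift0; apply/jet_inr/hj'.
  by apply/jet_inl/(hj ord0).
- case: (unliftP ord0 i) => [a|] ->; case: (unliftP ord0 l) => [b|] -> ne; rewrite ?unlift_none ?liftK.
  + by rewrite (inj_eq lift_inj) in ne; congr (_, _); rewrite ?mulr0 ?ho'.
  + by congr (_, _); rewrite ?mulr0 ?mul0r.
  + by congr (_, _); rewrite ?mulr0 ?mul0r.
  + by rewrite eqxx in ne.
rewrite big_ord_recl unlift_none s1; under eq_bigr do rewrite liftK.
rewrite [X in _ + X](_ : _ = (0, 1)); first by congr (_, _); rewrite ?addr0 ?add0r.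
apply: injective_projections; first by rewrite (raddf_sum fst) big1.
by rewrite (raddf_sum snd) /= s1'.
Qed.

Lemma is_type_prodr d s : is_type E s -> is_type F [:: d] -> is_type EF (d :: s).
Proof.
move=> [e' [x' [hj' ho' s1']]] [e [x [hj _ s1]]]; rewrite big_ord1 in s1.
exists (fun i : 'I_(size s).+1 => if unlift ord0 i is Some l then (e' l, 0) else (0, e ord0)).
exists (fun i : 'I_(size s).+1 => if unlift ord0 i is Some l then (x' l, 0) else (0, x ord0)).
split=> [i|i l|].
- case: (unliftP ord0 i) => [l|] ->; rewrite ?unlift_none ?liftK.
    by rewrite lift0; apply/jet_inl/hj'.
  by apply/jet_inr/(hj ord0).
- case: (unliftP ord0 i) => [a|] ->; case: (unliftP ord0 l) => [b|] -> ne; rewrite ?unlift_none ?liftK.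
  + by rewrite (inj_eq lift_inj) in ne; congr (_, _); rewrite ?mulr0 ?ho'.
  + by congr (_, _); rewrite ?mulr0 ?mul0r.
  + by congr (_, _); rewrite ?mulr0 ?mul0r.
  + by rewrite eqxx in ne.
rewrite big_ord_recl unlift_none s1; under eq_bigr do rewrite liftK.
rewrite [X in _ + X](_ : _ = (1, 0)); first by congr (_, _); rewrite ?addr0 ?add0r.
apply: injective_projections; last by rewrite (raddf_sum snd) big1.
by rewrite (raddf_sum fst) /= s1'.
Qed.

Lemma has_dim_prod m n : has_dim (fun _ : E => True) m -> has_dim (fun _ : F => True) n ->
  has_dim (fun _ : EF => True) (m + n).
Proof.
move=> [b [_ hb]] [b' [_ hb']].
pose g (i : 'I_(m + n)) : EF := match split i with inl l => (b l, 0) | inr l => (0, b' l) end.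
have gl l : g (lshift n l) = (b l, 0) by rewrite /g (unsplitK (inl l)).
have gr l : g (rshift m l) = (0, b' l) by rewrite /g (unsplitK (inr l)).
have gE (c : 'rV[k]_(m + n)) : \sum_i c 0 i *: g i =
    (\sum_i lsubmx c 0 i *: b i, \sum_i rsubmx c 0 i *: b' i).
  apply: injective_projections.
    rewrite (raddf_sum fst) big_split_ord /= [X in _ + X]big1 ?addr0 => [|l _].
      by apply: eq_bigr => l _; rewrite gl mxE.
    by rewrite gr /= scaler0.
  rewrite (raddf_sum snd) big_split_ord /= [X in X + _]big1 ?add0r => [|l _].
    by apply: eq_bigr => l _; rewrite gr mxE.
  by rewrite gl /= scaler0.
exists g; split=> // -[x y] _; have [c [hc uc]] := hb x I; have [c' [hc' uc']] := hb' y I.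
exists (row_mx c c'); split; first by rewrite gE row_mxKl row_mxKr -hc -hc'.
by move=> f; rewrite gE => -[/uc -> /uc' ->]; rewrite hsubmxK.
Qed.

End Products.

Lemma presented_functional (k : fieldType) (A S : algType k) (p : {lrmorphism A -> S})
    (G : A -> Prop) (phi : {linear A -> k^o}) : presents p G ->
  (forall x, ideal_gen G x -> phi x = 0) ->
  exists psi : {linear S -> k^o}, forall t, psi (p t) = phi t.
Proof.
move=> [/choice[l hl] pk] h; have ker t t' : p t = p t' -> phi t = phi t'.
  move=> e; apply/eqP; rewrite -subr_eq0 -linearB; apply/eqP/h/pk.
  by rewrite linearB /= e subrr.
have lin : linear (fun y => phi (l y)).
  move=> c x y; rewrite -linearP; apply: ker.
  by rewrite -hl linearP /= -!hl.
by exists (mklin lin) => t; apply: ker; rewrite -hl.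
Qed.

(** By commutativity a generator times a monomial is a monomial with an exponent of at least two,
    where [phi] vanishes. *)
Lemma square_ideal (k : fieldType) (A : algType k) (U : 'I_2 -> A) :
  (forall x y : A, x * y = y * x) ->
  (forall x, lspan (fun y => exists i j, y = U ord0 ^+ i * U ord_max ^+ j) x) ->
  forall phi : {linear A -> k^o},
  (forall i j, (1 < i)%N || (1 < j)%N -> phi (U ord0 ^+ i * U ord_max ^+ j) = 0) ->
  forall x, ideal_gen (fun x : A => exists i, x = U i ^+ 2) x -> phi x = 0.
Proof.
move=> AC sp phi h x; elim=> [|a g b y [i ->] _ IH]; first exact: linear0.
rewrite linearD IH addr0 -mulrA [U i ^+ 2 * b]AC mulrA.
elim: (sp (a * b)) => [|c _ t [i' [j' ->]] _ IH']; first by rewrite mul0r linear0.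
rewrite mulrDl linearD IH' addr0 -scalerAl linearZ (_ : phi _ = 0); first exact: mulr0.
clear IH'; have [->|->] : i = ord0 \/ i = ord_max.
- by case: i => [[|[|//]] lt]; [left|right]; apply: val_inj.
- by rewrite -mulrA [_ * U ord0 ^+ 2]AC mulrA -exprD; apply: h; rewrite addn2.
- by rewrite -mulrA -exprD; apply: h; rewrite addn2 orbT.
Qed.

Lemma rmorph_mon (k : fieldType) (A B : algType k) (f : {lrmorphism A -> B}) x y i j :
  f x ^+ i * f y ^+ j = f (x ^+ i * y ^+ j).
Proof. by rewrite rmorphM !rmorphXn. Qed.

Lemma square_zero_quad (k : fieldType) (F : algType k) (X Y : F) :
  (forall x y : F, x * y = y * x) -> X * X = 0 -> Y * Y = 0 ->
  (forall x, lspan (fun y => exists i j, y = X ^+ i * Y ^+ j) x) ->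
  (forall a b, (a < 2)%N -> (b < 2)%N -> exists phi : {linear F -> k^o},
    forall i j, phi (X ^+ i * Y ^+ j) = ((i == a) && (j == b))%:R) ->
  quad 0 0 0 0 F.
Proof.
move=> FC XX YY sp fn; split=> //; exists X, Y; split.
- by rewrite !scale0r addr0.
- by rewrite !scale0r addr0.
- move=> x; elim: (sp x) => [|c _ y [i [j ->]] _ [a' [b' [c' [d' ->]]]]].
    by exists 0, 0, 0, 0; rewrite /comb !scale0r !addr0.
  suff [a [b [c2 [d ->]]]] : exists a b c d, X ^+ i * Y ^+ j = comb X Y a b c d.
    by rewrite combP; do 4 eexists.
  case: i => [|[|i]]; last first.
  + by exists 0, 0, 0, 0; rewrite !exprS !mulrA XX !mul0r /comb !scale0r !addr0.
  + case: j => [|[|j]]; rewrite ?expr1 ?expr0 ?mulr1.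
    * by exists 0, 1, 0, 0; rewrite /comb !scale0r !addr0 add0r scale1r.
    * by exists 0, 0, 0, 1; rewrite /comb !scale0r !addr0 add0r scale1r.
    * by exists 0, 0, 0, 0; rewrite !exprS (mulrA Y) YY mul0r mulr0 /comb !scale0r !addr0.
  + case: j => [|[|j]]; rewrite ?expr1 ?expr0 ?mul1r.
    * by exists 1, 0, 0, 0; rewrite /comb !scale0r !addr0 scale1r.
    * by exists 0, 0, 1, 0; rewrite /comb !scale0r !addr0 add0r scale1r.
    * by exists 0, 0, 0, 0; rewrite !exprS !mulrA YY mul0r /comb !scale0r !addr0.
move=> a b c d h.
have val i j : (i < 2)%N -> (j < 2)%N -> a * ((0 == i) && (0 == j))%:R + b * ((1 == i) && (0 == j))%:R +
    c * ((0 == i) && (1 == j))%:R + d * ((1 == i) && (1 == j))%:R = 0.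
  move=> li lj; have [phi hphi] := fn i j li lj; rewrite -[RHS](linear0 phi) -h /comb.
  rewrite !linearD !linearZ /=.
  have := hphi 0%N 0%N; have := hphi 1%N 0%N; have := hphi 0%N 1%N; have := hphi 1%N 1%N.
  by rewrite !expr0 !expr1 !mulr1 !mul1r => -> -> -> ->.
have := val 0%N 0%N isT isT; have := val 1%N 0%N isT isT.
have := val 0%N 1%N isT isT; have := val 1%N 1%N isT isT.
by rewrite /= !(mulr1, mulr0, addr0, add0r).
Qed.

Lemma mp_coef_vanish (k : fieldType) a b i j : (a < 2)%N -> (b < 2)%N -> (1 < i)%N || (1 < j)%N ->
  ((i == a) && (j == b))%:R = 0 :> k.
Proof.
by move=> la lb; case: eqP => [->|//]; case: eqP => [->|//]; rewrite !ltnNge -ltnS la -ltnS lb.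
Qed.

Section Truncated.
Context (k : fieldType).

Lemma has_dim_regular : has_dim (fun _ : k^o => True) 1.
Proof.
exists (fun=> 1); split=> // x _; exists (const_mx x); split.
  by rewrite big_ord1 mxE; apply: esym (mulr1 _).
by move=> c; rewrite big_ord1 => ->; apply/rowP => i; rewrite mxE (ord1 i); apply: mulr1.
Qed.

Lemma is_type_regular : is_type (k^o : algType k) [:: 1]%N.
Proof.
exists (fun=> 1), (fun=> 0); split=> [i|i j|]; last by rewrite big_ord1.
  by rewrite ord1 /=; split; rewrite ?mulr1 ?mulr0 ?expr1 ?mulr0 ?expr0 ?mulr1 ?oner_eq0.
by rewrite !ord1 eqxx.
Qed.

Section Poly.
Variable d : nat.
Local Notation F := (trunc_poly k d.+1).
Local Notation G := (fun x : {poly k} => x = 'X^(d.+1)).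
Let pi : {lrmorphism {poly k} -> F} := @quot_pi k {poly k} G.

Lemma ideal_polyXn (p : {poly k}) : ideal_gen G p <-> ('X^(d.+1) %| p)%R.
Proof.
split=> [|/dvdpP[q ->]]; last by apply/ideal_gen_mull/ideal_gen_incl.
elim=> [|a g b x -> _ IH]; first exact: dvdp0.
by rewrite dvdp_addr // mulrAC dvdp_mull.
Qed.

Lemma trunc_presents : presents pi G.
Proof.
apply: quot_presents => /ideal_polyXn; rewrite dvdp1 size_polyXn.
by [].
Qed.

Lemma trunc_poly_comm (x y : F) : x * y = y * x.
Proof.
have [p ->] := proj1 trunc_presents x; have [q ->] := proj1 trunc_presents y.
by rewrite -!rmorphM mulrC.
Qed.

Lemma trunc_jet : jet d.+1 (1 : F) (pi 'X).
Proof.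
split; rewrite ?mul1r //.
  by rewrite -rmorphXn; apply/(proj2 trunc_presents)/ideal_gen_incl.
apply/eqP; rewrite -rmorphXn => /(proj2 trunc_presents)/ideal_polyXn.
by rewrite dvdp_Pexp2l ?size_polyX // ltnn.
Qed.

Lemma is_type_trunc : is_type F [:: d.+1].
Proof.
exists (fun=> 1), (fun=> pi 'X); split=> [i|i j|]; last by rewrite big_ord1.
  by rewrite ord1; apply: trunc_jet.
by rewrite !ord1 eqxx.
Qed.

Lemma has_dim_trunc : has_dim (fun _ : F => True) d.+1.
Proof.
exists (fun i => pi 'X ^+ i); split=> // y _; have [p ->] := proj1 trunc_presents y.
have hE (q : {poly k}) : (size q <= d.+1)%N -> pi q = \sum_(i < d.+1) q`_i *: pi 'X ^+ i.
  move=> le; have {1}-> : q = \sum_(i < d.+1) q`_i *: 'X^i.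
    rewrite -[LHS](coefK q) poly_def (big_ord_widen _ (fun i => q`_i *: 'X^i) le) big_mkcond /=.
    by apply: eq_bigr => j _; case: ltnP => // le'; rewrite [q`_j]nth_default // scale0r.
  by rewrite linear_sum; apply: eq_bigr => i _; rewrite linearZ /= rmorphXn.
have pE : pi p = pi (take_poly d.+1 p).
  rewrite -{1}(poly_take_drop d.+1 p) linearD /= [X in _ + X](_ : _ = 0) ?addr0 //.
  by apply/(proj2 trunc_presents)/ideal_gen_mull/ideal_gen_incl.
exists (\row_i (take_poly d.+1 p)`_i); split.
  by rewrite pE hE ?size_take_poly //; apply: eq_bigr => i _; rewrite mxE.
move=> c h; apply/rowP => i; rewrite mxE.
pose q := \poly_(i < d.+1) (if insub i is Some j then c 0 j else 0).
have qE (j : 'I_d.+1) : q`_j = c 0 j by rewrite coef_poly ltn_ord valK.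
rewrite -qE; apply/eqP; rewrite -subr_eq0 -coefB; apply/eqP.
have : pi (take_poly d.+1 p - q) = 0.
  have qS : pi q = \sum_(i < d.+1) c 0 i *: pi 'X ^+ i.
    by rewrite hE ?size_poly //; apply: eq_bigr => j _; rewrite qE.
  by rewrite linearB /= -pE h qS subrr.
move=> /(proj2 trunc_presents)/ideal_polyXn hd; set r := _ - q in hd *.
have [->|r0] := eqVneq r 0; first by rewrite coef0.
have := dvdp_leq r0 hd; rewrite size_polyXn ltnNge.
by rewrite (leq_trans (size_polyD _ _)) // size_polyN geq_max size_take_poly size_poly.
Qed.

End Poly.

Lemma comm_pair (E F : algType k) : (forall x y : E, x * y = y * x) ->
  (forall x y : F, x * y = y * x) -> forall x y : E * F, x * y = y * x.
Proof. by move=> hE hF [x y] [x' y']; congr (_, _); [apply: hE | apply: hF]. Qed.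

Section Poly2.
Local Notation Mp := ({mpoly k[2]}).
Local Notation U i := (<< ucm i >> : Mp).
Local Notation i0 := (ord0 : 'I_2).
Local Notation i1 := (ord_max : 'I_2).

Lemma mpU_mul (m1 m2 : {cmonom 'I_2}) : (<< m1 >> * << m2 >> : Mp) = << mmul m1 m2 >>.
Proof. by rewrite malgM_def fgmulUU mulr1. Qed.

Lemma mp_pow (i : 'I_2) n : exists m : {cmonom 'I_2},
  U i ^+ n = << m >> /\ forall l, m l = ((i == l) * n)%N.
Proof.
elim: n => [|n [m [e h]]].
  by exists mone; split=> [|l]; rewrite ?expr0 ?muln0 ?cm1.
exists (mmul (ucm i) m); split=> [|l]; first exact: etrans (exprS _ _) (etrans (congr2 *%R erefl e) (mpU_mul _ _)).
by rewrite cmM h cmU; case: eqP; lia.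
Qed.

Lemma mp_pow2 a b : exists m : {cmonom 'I_2},
  [/\ U i0 ^+ a * U i1 ^+ b = << m >>, m i0 = a & m i1 = b].
Proof.
have [m [em hm]] := mp_pow i0 a; have [m' [em' hm']] := mp_pow i1 b.
exists (mmul m m'); split; first exact: etrans (congr2 *%R em em') (mpU_mul _ _).
  by rewrite cmM hm hm' /=; lia.
by rewrite cmM hm hm' /=; lia.
Qed.

Lemma mp_mon (m : {cmonom 'I_2}) : (<< m >> : Mp) = U i0 ^+ m i0 * U i1 ^+ m i1.
Proof.
have [m' [-> h0 h1]] := mp_pow2 (m i0) (m i1); congr (<< _ >>).
apply/eqP/cmP => -[[|[|//]] lt].
  by rewrite (_ : Ordinal lt = i0) ?h0 //; apply: val_inj.
by rewrite (_ : Ordinal lt = i1) ?h1 //; apply: val_inj.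
Qed.

Lemma mp_coef a b : exists phi : {linear Mp -> k^o},
  forall i j, phi (U i0 ^+ i * U i1 ^+ j) = ((i == a) && (j == b))%:R.
Proof.
have [m [_ ha hb]] := mp_pow2 a b.
have lin : linear (fun x : Mp => x@_m : k^o).
  by move=> c x y; rewrite mcoeffD mcoeffZ.
exists (mklin lin) => i j; have [m' [-> hi hj]] := mp_pow2 i j.
rewrite /= mcoeffU1; congr (_%:R); congr nat_of_bool.
apply/eqP/andP => [em|[/eqP ei /eqP ej]]; first by rewrite -hi -hj em ha hb !eqxx.
apply/eqP/cmP => -[[|[|//]] lt].
  by rewrite (_ : Ordinal lt = i0) ?hi ?ha //; apply: val_inj.
by rewrite (_ : Ordinal lt = i1) ?hj ?hb //; apply: val_inj.
Qed.

Lemma mp_span (x : Mp) : lspan (fun y => exists i j, y = U i0 ^+ i * U i1 ^+ j) x.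
Proof.
move: x; apply: malg_ind => [|u v hu hv|c m]; [exact: lspan0 | exact: lspanD hu hv |].
by apply/lspanZ/lspan_gen; exists (m i0), (m i1); exact: mp_mon.
Qed.

Lemma mp_coef_ideal (phi : {linear Mp -> k^o}) :
  (forall i j, (1 < i)%N || (1 < j)%N -> phi (U i0 ^+ i * U i1 ^+ j) = 0) ->
  forall x, ideal_gen (fun x : Mp => exists i : 'I_2, x = << ucm i >> ^+ 2) x -> phi x = 0.
Proof.
exact: (@square_ideal k Mp (fun i => << ucm i >>) (@mulrC _) mp_span phi).
Qed.

Local Notation F := (trunc_poly2 k).
Local Notation G := (fun x : Mp => exists i : 'I_2, x = << ucm i >> ^+ 2).
Let pi : {lrmorphism Mp -> F} := @quot_pi k Mp G.

(** The constant coefficient vanishes on the ideal but not at 1, so the ideal is proper. *)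
Lemma trunc2_presents : presents pi G.
Proof.
apply: quot_presents => h; have [phi hphi] := mp_coef 0 0.
have h1 : phi 1 = 0.
  by apply: mp_coef_ideal h => i j hij; rewrite hphi; apply: mp_coef_vanish hij.
have e1 : U i0 ^+ 0 * U i1 ^+ 0 = 1.
  exact: etrans (congr2 *%R (expr0 _) (expr0 _)) (mulr1 _).
by have := hphi 0%N 0%N; rewrite e1 h1 => /esym/eqP; rewrite oner_eq0.
Qed.

Lemma trunc_poly2_quad : quad 0 0 0 0 F.
Proof.
apply: (@square_zero_quad k F (pi (U i0)) (pi (U i1))).
- move=> x y; have [p ->] := proj1 trunc2_presents x; have [q ->] := proj1 trunc2_presents y.
  by rewrite -!(rmorphM pi) (mulrC p q).
- rewrite -(rmorphM pi); apply/(proj2 trunc2_presents)/ideal_gen_incl; exists i0; exact: esym (expr2 _).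
- rewrite -(rmorphM pi); apply/(proj2 trunc2_presents)/ideal_gen_incl; exists i1; exact: esym (expr2 _).
- move=> x; have [p ->] := proj1 trunc2_presents x.
  elim: (mp_span p) => [|c _ t [i [j ->]] _ IH]; first by rewrite (linear0 pi); apply: lspan0.
  rewrite (linearP pi); apply: lspanS => //; exists i, j.
  by rewrite (rmorphM pi) !(rmorphXn pi).
move=> a b la lb; have [phi hphi] := mp_coef a b.
have [psi hpsi] := presented_functional trunc2_presents (mp_coef_ideal (phi := phi) (fun i j h =>
  etrans (hphi i j) (mp_coef_vanish k la lb h))).
exists psi => i j.
exact: etrans (congr1 psi (rmorph_mon pi _ _ _ _)) (etrans (hpsi _) (hphi _ _)).
Qed.

End Poly2.

End Truncated.

(** * Classification of commutative Frobenius algebras of dimension four *)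

Section JetFamilies.
Context (k : fieldType) (E : algType k).
Hypothesis mulC : forall x y : E, x * y = y * x.

Lemma jet_trunc d (e x : E) (p : {poly k}) : jet d e x ->
  e * horner_alg x p = \sum_(j < d) p`_j *: (e * x ^+ j).
Proof.
move=> [_ _ _ ex _]; rewrite -{1}(poly_take_drop d p) rmorphD mulrDr rmorphM rmorphXn /= horner_algX.
rewrite [_ * x ^+ d]mulC (mulrA e) ex mul0r addr0 (@horner_algE _ _ _ _ d) ?size_take_poly //.
rewrite mulr_sumr; apply: eq_bigr => j _.
by rewrite coef_take_poly ltn_ord scalerAr.
Qed.

Section Family.
Context (r : nat) (d : 'I_r -> nat) (e x : 'I_r -> E).
Hypothesis J : jets d e x.
Let I := {i : 'I_r & 'I_(d i)}.
Local Notation ix s := (nat_of_ord (tagged (s : {i : 'I_r & 'I_(d i)}) : 'I_(d (tag s)))).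
Let v (s : I) := e (tag s) * x (tag s) ^+ ix s.

Lemma jet_elt_sum (P : 'I_r -> {poly k}) : jet_elt e x P = \sum_(s : I) (P (tag s))`_(ix s) *: v s.
Proof.
have [hj _ _] := J; transitivity (\sum_i \sum_(j < d i) (P i)`_j *: (e i * x i ^+ j)).
  by apply: eq_bigr => i _; apply: jet_trunc.
by rewrite sig_big_dep.
Qed.

Lemma card_jets : #|{: I}| = (\sum_i d i)%N.
Proof.
rewrite -sum1_card -(@sig_big_dep _ _ addn _ _ xpredT (fun=> xpredT) (fun=> fun=> 1%N)) /=.
by apply: eq_bigr => i _; rewrite sum1_card card_ord.
Qed.

Lemma jets_indep (c : I -> k) : \sum_(s : I) c s *: v s = 0 -> forall s, c s = 0.
Proof.
move=> h; pose P := (fun i : 'I_r =>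
  \poly_(j < d i) oapp (fun j' : 'I_(d i) => c (existT _ i j')) 0 (insub j)) : 'I_r -> {poly k}.
have PE (s : I) : (P (tag s))`_(ix s) = c s.
  by case: s => i j; rewrite coef_poly ltn_ord valK.
have /(jet_elt_coef J) hP : jet_elt e x P = 0.
  by rewrite jet_elt_sum -[RHS]h; apply: eq_bigr => s _; rewrite PE.
by move=> s; rewrite -PE hP.
Qed.

(** The elements e_i x_i^j with j < d_i are independent and, by hypothesis, spanning, so there are
    four of them. *)
Lemma jets_count (dim4 : has_dim (fun _ : E => True) 4) :
  (forall y, exists P, y = jet_elt e x P) -> (\sum_i d i)%N = 4%N.
Proof.
move=> sp; rewrite -card_jets; apply/eqP; rewrite eqn_leq; apply/andP; split.
  rewrite leqNgt; apply/negP => lt.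
  have [u u0 hu] := dependent dim4 (fun i : 'I_#|{: I}| => v (enum_val i)) lt.
  case/eqP: u0; apply/rowP => i; rewrite mxE -(enum_valK i).
  apply: (jets_indep (c := fun s => u 0 (enum_rank s))).
  rewrite -[RHS]hu (reindex (@enum_val I predT)) /=; last first.
    by apply: onW_bij; apply: enum_val_bij.
  by apply: eq_bigr => l _; rewrite enum_valK.
rewrite leqNgt; apply/negP => lt; have [b [_ hb]] := dim4.
have /choice[P hP] j := sp (b j).
pose A : 'M[k]_(4, #|{: I}|) :=
  \matrix_(j, t) (P j (tag (enum_val t)))`_(ix (enum_val t)).
have [u u0 uA] := dependent_vectors A lt; case/eqP: u0.
have [c [_ hc]] := hb 0 Logic.I; rewrite -(hc u) ?(hc 0) //.
  by rewrite big1 // => j _; rewrite mxE scale0r.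
under eq_bigr do rewrite hP jet_elt_sum scaler_sumr.
rewrite exchange_big big1 //= => s _; under eq_bigr do rewrite scalerA.
rewrite -scaler_suml; move/rowP/(_ (enum_rank s)): uA; rewrite !mxE => h.
rewrite (_ : \sum_i _ = 0) ?scale0r // -[RHS]h; apply: eq_bigr => j _.
by rewrite mxE enum_rankK.
Qed.



Lemma jets_perm (sg : {perm 'I_r}) : jets (fun i => d (sg i)) (fun i => e (sg i)) (fun i => x (sg i)).
Proof.
have [hj ho hs] := J; split=> [i|i j ne|]; first exact: hj.
  by apply: ho; rewrite (inj_eq perm_inj).
by rewrite -[RHS]hs [RHS](reindex_inj (@perm_inj _ sg)).
Qed.

End Family.

Lemma jets_type s (d : 'I_(size s) -> nat) (e x : 'I_(size s) -> E) (sg : {perm 'I_(size s)}) :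
  jets d e x -> (forall i, d (sg i) = nth 0%N s i) -> is_type E s.
Proof.
move=> J h; have [hj ho hs] := jets_perm J sg.
exists (fun i => e (sg i)), (fun i => x (sg i)); split=> // i.
by rewrite -h; apply: hj.
Qed.

(** Positive orders with sum 4, brought into decreasing order by a permutation, form one of the five
    partitions of 4. *)
Lemma jets_cases r (d : 'I_r -> nat) (e x : 'I_r -> E) : jets d e x -> (\sum_i d i)%N = 4%N ->
  [\/ is_type E [:: 1; 1; 1; 1]%N, is_type E [:: 2; 1; 1]%N, is_type E [:: 2; 2]%N |
   is_type E [:: 3; 1]%N \/ is_type E [:: 4]%N].
Proof.
move=> J hs; have d0 i : (0 < d i)%N by have [hj _ _] := J; have [] := hj i.
have r4 : (r <= 4)%N by rewrite -hs -{1}(card_ord r) -sum1_card; apply: leq_sum => i _; apply: d0.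
move: hs; case: r d e x J d0 r4 => [|[|[|[|[|r]]]]] d e x J d0 r4 //; rewrite ?big_ord0 ?big_ord_recl ?big_ord0 //.
- rewrite addn0 => s; constructor 4; right.
  apply: (jets_type (s := [:: 4]%N) (sg := 1) J) => i; rewrite perm1 /=.
  by rewrite (ord1 i).
- set a : 'I_2 := ord0; set b : 'I_2 := lift ord0 ord0; rewrite addn0 => s.
  have vb : b = 1%N :> nat by [].
  have := d0 a; have := d0 b => hb ha.
  have [e2|ne] := eqVneq (d a) 2%N.
    constructor 3; apply: (jets_type (s := [:: 2; 2]%N) (sg := 1) J) => i; rewrite perm1.
    case: (unliftP a i) => [j ->|->]; last by rewrite e2.
    by rewrite (ord1 j) -/b /=; lia.
  constructor 4; left; have [e3|ne3] := eqVneq (d a) 3%N.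
    apply: (jets_type (s := [:: 3; 1]%N) (sg := 1) J) => i; rewrite perm1.
    case: (unliftP a i) => [j ->|->]; last by rewrite e3.
    by rewrite (ord1 j) -/b /=; lia.
  apply: (jets_type (s := [:: 3; 1]%N) (sg := tperm a b) J) => i.
  case: (unliftP a i) => [j ->|->]; last by rewrite tpermL /=; lia.
  by rewrite (ord1 j) -/b tpermR /=; lia.
- set a : 'I_3 := ord0; set b : 'I_3 := lift ord0 ord0; set c : 'I_3 := lift ord0 (lift ord0 ord0).
  rewrite addn0 => s.
  have := d0 a; have := d0 b; have := d0 c => hc hb ha; constructor 2.
  have sp (i : 'I_3) : [\/ i = a, i = b | i = c].
    by case: i => [[|[|[|//]]] lt]; [constructor 1|constructor 2|constructor 3]; apply: val_inj.
  have [ea|na] := eqVneq (d a) 2%N.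
    apply: (jets_type (s := [:: 2; 1; 1]%N) (sg := 1) J) => i; rewrite perm1.
    by case: (sp i) => -> /=; lia.
  have [eb|nb] := eqVneq (d b) 2%N.
    apply: (jets_type (s := [:: 2; 1; 1]%N) (sg := tperm a b) J) => i.
    by case: (sp i) => ->; rewrite ?tpermL ?tpermR ?tpermD //=; lia.
  apply: (jets_type (s := [:: 2; 1; 1]%N) (sg := tperm a c) J) => i.
  by case: (sp i) => ->; rewrite ?tpermL ?tpermR ?tpermD //=; lia.
- set a : 'I_4 := ord0; set b : 'I_4 := lift ord0 ord0; set c : 'I_4 := lift ord0 (lift ord0 ord0).
  set f : 'I_4 := lift ord0 (lift ord0 (lift ord0 ord0)); rewrite addn0 => s.
  have := d0 a; have := d0 b; have := d0 c; have := d0 f => hf hc hb ha; constructor 1.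
  have sp (i : 'I_4) : [\/ i = a, i = b, i = c | i = f].
    by case: i => [[|[|[|[|//]]]] lt]; [constructor 1|constructor 2|constructor 3|constructor 4];
      apply: val_inj.
  apply: (jets_type (s := [:: 1; 1; 1; 1]%N) (sg := 1) J) => i; rewrite perm1.
  by case: (sp i) => -> /=; lia.
Qed.

End JetFamilies.

Section Classification.
Context (k : closedFieldType) (E : algType k).
Hypothesis char0 : forall n, n.+1%:R != 0 :> k.
Hypotheses (mulC : forall x y : E, x * y = y * x) (dim4 : has_dim (fun _ : E => True) 4).
Variable phi : {linear E -> k^o}.
Hypothesis phi_nd : forall x, (forall y, phi (x * y) = 0) -> x = 0.

Section Local.
Variable e : E.
Hypotheses (ee : e * e = e) (e0 : e != 0) (el : local_at e).

Definition rad (y : E) := e * y = y /\ nilpotent y.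

Lemma rad_dec y : exists c, rad (e * y - c *: e).
Proof.
have [c [n h]] := el y; exists c; split; first by rewrite mulrBr mulrA ee -scalerAr ee.
exists n.+1; rewrite (_ : _ - _ = e * (y - c%:A)); last by rewrite mulrBr -scalerAr mulr1.
rewrite exprMn_comm; last exact: mulC.
by rewrite exprSr -mulrA exprSr (mulrA e) h mul0r mulr0.
Qed.

Lemma radP c x y : rad x -> rad y -> rad (c *: x + y).
Proof.
move=> [ex nx] [ey ny]; split; first by rewrite mulrDr -scalerAr ex ey.
apply: (nilpotentD mulC) => //; rewrite -mulr_algl; exact: nilpotentMl.
Qed.

Lemma radM x y : rad x -> rad (x * y).
Proof.
by move=> [ex nx]; split; rewrite ?mulrA ?ex // mulC; apply: nilpotentMl.
Qed.

Definition socle (s : E) := e * s = s /\ forall n, rad n -> n * s = 0.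

(** Multiplying a socle element by [y] only sees the residue of [y]. The ideal of [s] is therefore
    contained in the line through [s], and nondegeneracy forbids [phi] to vanish there unless [s] is
    zero. *)
Lemma socle_phi s : socle s -> phi s = 0 -> s = 0.
Proof.
move=> [es sn] ps; apply: phi_nd => y; have [c rc] := rad_dec y.
have -> : s * y = c *: s.
  have := sn _ rc; rewrite mulrBl -scalerAl es => /eqP; rewrite subr_eq0 => /eqP <-.
  by rewrite mulC -[in LHS]es mulrA [y * e]mulC.
by rewrite linearZ ps; apply: mulr0.
Qed.

(** By [socle_phi], [phi] embeds the socle into k. *)
Lemma socle_line s t : socle s -> socle t -> t != 0 -> exists c, s = c *: t.
Proof.
move=> hs ht t0; have pt : phi t != 0 by apply: contraNneq t0 => /(socle_phi ht) ->.
exists (phi s / phi t); apply/eqP; rewrite -subr_eq0; apply/eqP; apply: socle_phi.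
  case: hs ht => [es sn] [et tn]; split; first by rewrite mulrBr -scalerAr es et.
  by move=> n hn; rewrite mulrBr -scalerAr sn // tn // scaler0 subrr.
by rewrite linearB linearZ; apply/eqP; rewrite subr_eq0; apply/eqP; symmetry; apply: divfK.
Qed.

Lemma jet_rad d x : jet d e x -> rad x /\ x ^+ d = 0.
Proof.
move=> [_ ex d0 exd _]; suff xd : x ^+ d = 0 by split=> //; split=> //; exists d.
by move: exd; rewrite -(prednK d0) exprS mulrA ex.
Qed.

Lemma rad_jet d y : rad y -> y ^+ d != 0 -> exists2 d', (d < d')%N & jet d' e y.
Proof.
move=> [ey [n yn]] yd; have ex : exists n, y ^+ n == 0 by exists n; apply/eqP.
case: (ex_minnP ex) => m /eqP ym min.
have lt : (d < m)%N.
  by rewrite ltnNge; apply: contraNN yd => le; rewrite -(subnK le) exprD ym mulr0.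
exists m => //; split=> //; [exact: leq_ltn_trans lt | by rewrite ym mulr0 |].
case: m {min} (min m.-1) lt ym => [//|[|m]] /= h lt ym; first by rewrite expr0 mulr1.
by rewrite exprS mulrA ey -exprS; apply/negP => /h; rewrite ltnn.
Qed.

Section Square.
Variables (d : nat) (x n : E).
Hypotheses (J : jet d e x) (maxd : forall d' x', jet d' e x' -> (d' <= d)%N).
Hypotheses (nr : rad n) (nP : forall p, n <> e * horner_alg x p).

Lemma rad_expd y : rad y -> y ^+ d = 0.
Proof.
move=> ry; apply/eqP/negPn/negP => yd; have [d' lt jd] := rad_jet ry yd.
by have := maxd jd; rewrite leqNgt lt.
Qed.

Lemma square_indep p c : e * horner_alg x p + c *: n = 0 ->
  c = 0 /\ forall i, (i < d)%N -> p`_i = 0.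
Proof.
move=> h; have c0 : c = 0.
  apply/eqP/negPn/negP => cn; case: (nP (p := (- c^-1) *: p)).
  rewrite linearZ /= mulr_algl -scalerAr; move/eqP: h; rewrite addr_eq0 => /eqP ->.
  by rewrite scaleNr scalerN opprK scalerA mulVf ?scale1r.
by split=> //; apply: (jet_coef J); rewrite c0 scale0r addr0 in h.
Qed.

(** Order 1 forces [n] to be 0. Order 2 makes all products in the radical vanish by polarization, so
    x and [n] lie in the same socle line. Order at least 4 gives five independent elements e, x,
    x^2, x^3, n in dimension four. *)
Lemma square_d3 : d = 3%N.
Proof.
have [_ ex d0 _ ex1] := J; have [rx xd] := jet_rad J.
have [d1|/eqP n1] := boolP (d == 1%N).
  have := rad_expd nr; rewrite (eqP d1) expr1 => n0; case: (nP (p := 0)).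
  by rewrite n0 linear0 mulr0.
have [d2|n2] := eqVneq d 2%N.
  have sq y : rad y -> y * y = 0 by move/rad_expd; rewrite d2 expr2.
  have pr y y' : rad y -> rad y' -> y * y' = 0.
    move=> ry ry'; have := sq _ (radP 1 ry ry'); rewrite scale1r mulrDl !mulrDr (sq _ ry) (sq _ ry').
    rewrite add0r addr0 [y' * y]mulC -mulr2n -scaler_nat => /eqP; rewrite scaler_eq0.
    by rewrite (negPf (char0 1)) => /eqP.
  have x0 : x != 0 by apply: contraNneq ex1; rewrite d2 expr1 => ->; rewrite mulr0.
  have [||c hc] := @socle_line n x _ _ x0.
  - by case: nr => en _; split=> // y ry; apply: pr.
  - by split=> // y ry; apply: pr.
  case: (nP (p := c *: 'X)); rewrite linearZ /= mulr_algl horner_algX -scalerAr ex.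
  exact: hc.
have [//|n3] := eqVneq d 3%N.
have d4 : (4 <= d)%N by lia.
have [w w0 hw] := dependent dim4
  (fun i : 'I_5 => nth 0 [:: e; e * x; e * x ^+ 2; e * x ^+ 3; n] i) isT.
case/eqP: w0; move: hw; rewrite !big_ord_recl big_ord0 addr0 /=.
set w0' := w 0 _; set w1' := w 0 _; set w2' := w 0 _; set w3' := w 0 _; set w4' := w 0 _ => h.
pose p := w0' *: 1 + w1' *: 'X + w2' *: 'X^2 + w3' *: 'X^3 : {poly k}.
have [|h4 hp] := @square_indep p w4'.
  rewrite /p !linearD !linearZ /= !mulr_algl rmorph1 !rmorphXn /= horner_algX.
  by rewrite !mulrDr -!scalerAr mulr1 -!addrA.
have hp' i : (i < 4)%N -> p`_i = 0 by move=> h'; apply: hp; apply: leq_trans h' d4.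
have := hp' 0%N isT; have := hp' 1%N isT; have := hp' 2%N isT; have := hp' 3%N isT.
rewrite /p !(coefD, coefZ, coef1, coefX, coefXn) /= !(mulr0, mulr1, addr0, add0r) => h3 h2 h1 h0.
apply/rowP => -[[|[|[|[|[|//]]]]] lt]; rewrite mxE.
- by rewrite -[RHS]h0; congr (w _ _); apply: val_inj.
- by rewrite -[RHS]h1; congr (w _ _); apply: val_inj.
- by rewrite -[RHS]h2; congr (w _ _); apply: val_inj.
- by rewrite -[RHS]h3; congr (w _ _); apply: val_inj.
- by rewrite -[RHS]h4; congr (w _ _); apply: val_inj.
Qed.

(** Cubes vanish on the radical. Polarizing at y and at - y and adding isolates 6 y^2 z, and a
    second polarization reaches arbitrary products. *)
Lemma rad_cube u v w : rad u -> rad v -> rad w -> u * v * w = 0.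
Proof.
have cube y : rad y -> y * y * y = 0.
  by move/rad_expd; rewrite square_d3 exprS expr2 mulrA.
have half (y : E) m : y *+ m.+1 = 0 -> y = 0.
  by rewrite -scaler_nat => /eqP; rewrite scaler_eq0 (negPf (char0 m)) => /eqP.
have q y z : rad y -> rad z -> y * y * z = 0.
  move=> ry rz; have cubeX (s : E) : rad s -> s ^+ 3 = 0.
    by move/cube; rewrite exprS expr2 mulrA.
  have h (s : E) : rad s -> (s ^+ 2 * z) *+ 3 + (s * z ^+ 2) *+ 3 = 0.
    move=> rs; have := cubeX _ (radP 1 rs rz); rewrite scale1r exprDn_comm; last exact: mulC.
    rewrite !big_ord_recr big_ord0 /= !(binn, bin0, bin1) !cubeX //.
    by rewrite mul0r mulr0 !mul0rn !addr0 !add0r expr1.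
  have r0 : rad 0 by split; [rewrite mulr0 | exists 1%N; rewrite expr1].
  have h1 := h _ ry; have := h _ (radP (-1) ry r0).
  rewrite addr0 scaleN1r sqrrN mulNr mulNrn => h2.
  apply: (half _ 5); rewrite (mulrnA _ 3 2) mulr2n -expr2.
  by rewrite -[LHS]addr0 -[X in _ + X](subrr ((y * z ^+ 2) *+ 3)) addrACA h1 h2 addr0.
move=> ru rv rw; have := q _ _ (radP 1 ru rv) rw.
rewrite scale1r !mulrDl !mulrDr !mulrDl (q _ _ ru rw) (q _ _ rv rw) add0r addr0 [v * u]mulC.
by rewrite -mulr2n => /half.
Qed.


Lemma square_indep4 a b c f : a *: e + b *: x + c *: (x * x) + f *: n = 0 ->
  [/\ a = 0, b = 0, c = 0 & f = 0].
Proof.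
have [_ ex _ _ _] := J => h; pose p : {poly k} := a *: 1 + b *: 'X + c *: 'X^2.
have [|f0 hp] := @square_indep p f.
  rewrite -[RHS]h /p !linearD !linearZ /= !mulr_algl rmorph1 rmorphXn /= horner_algX.
  by rewrite !mulrDr -!scalerAr mulr1 ex expr2 (mulrA e) ex.
have hp' i : (i < 3)%N -> p`_i = 0 by move=> h'; apply: hp; rewrite square_d3.
have := hp' 0%N isT; have := hp' 1%N isT; have := hp' 2%N isT.
by rewrite /p !(coefD, coefZ, coef1, coefX, coefXn) /= !(mulr0, mulr1, addr0, add0r) => -> -> ->.
Qed.

Lemma square_span y : exists a b c f, y = a *: e + b *: x + c *: (x * x) + f *: n.
Proof.
have [w w0 hw] := dependent dim4 (fun i : 'I_5 => nth 0 [:: e; x; x * x; n; y] i) isT.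
move: hw; rewrite !big_ord_recl big_ord0 addr0 /=.
set w0' := w 0 _; set w1' := w 0 _; set w2' := w 0 _; set w3' := w 0 _; set w4' := w 0 _.
rewrite !addrA => h; have [z4|n4] := boolP (w4' == 0).
  move: h; rewrite (eqP z4) scale0r addr0 => /square_indep4[h0 h1 h2 h3].
  case/eqP: w0; apply/rowP => -[[|[|[|[|[|//]]]]] lt]; rewrite mxE.
  - by rewrite -[RHS]h0; congr (w _ _); apply: val_inj.
  - by rewrite -[RHS]h1; congr (w _ _); apply: val_inj.
  - by rewrite -[RHS]h2; congr (w _ _); apply: val_inj.
  - by rewrite -[RHS]h3; congr (w _ _); apply: val_inj.
  - by rewrite -[RHS](eqP z4); congr (w _ _); apply: val_inj.
pose s t := - w4'^-1 * t; exists (s w0'), (s w1'), (s w2'), (s w3').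
rewrite /s -!scalerA -!scalerDr; move/eqP: h; rewrite addr_eq0 => /eqP ->.
by rewrite scaleNr scalerN opprK scalerA mulVf ?scale1r.
Qed.

Lemma square_unit : e = 1.
Proof.
have [_ ex _ _ _] := J; have [en _] := nr; have [a [b [c [f h]]]] := square_span 1.
rewrite -[LHS]mulr1 [in LHS]h !mulrDr -!scalerAr ee ex mulrA ex en.
exact: esym h.
Qed.

(** Multiplication is a symmetric bilinear form on the radical modulo the socle, with values in the
    line of x^2. It is nondegenerate because the socle is a line; over an algebraically closed field
    it has two isotropic lines, and u, v are chosen on them. *)
Lemma square_quad : quad 0 0 0 0 E.
Proof.
have [rx _] := jet_rad J; have [_ ex _ _ x2] := J; have [en _] := nr.
have sxx : socle (x * x).
  by split=> [|y ry]; [rewrite mulrA ex | rewrite mulC; apply: rad_cube].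
have xx0 : x * x != 0 by move: x2; rewrite square_d3 /= expr2 mulrA ex.
have [|a ha] := @socle_line (n * x) _ _ sxx xx0.
  by split=> [|y ry]; [rewrite mulrA en | rewrite mulC; apply: rad_cube].
have [|b hb] := @socle_line (n * n) _ _ sxx xx0.
  by split=> [|y ry]; [rewrite mulrA en | rewrite mulC; apply: rad_cube].
(* [w] is the part of [n] orthogonal to x, and [g] is its norm in units of x^2. *)
pose w := n - a *: x; pose g := b - a * a.
have xw : x * w = 0 by rewrite /w mulrBr -scalerAr [x * n]mulC ha subrr.
have nw : n * w = g *: (x * x).
  by rewrite /w mulrBr -scalerAr ha hb scalerA -scalerBl.
have ww : w * w = g *: (x * x).
  by rewrite {1}/w mulrBl -scalerAl xw scaler0 subr0 nw.
have ew : e * w = w by rewrite /w mulrBr -scalerAr ex en.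
(* Otherwise [w] would be annihilated by the radical and hence be a multiple of x^2, against
   independence. *)
have g0 : g != 0.
  apply/negP => /eqP g0; have sw : socle w.
    split=> // y [_ [m ym]]; have [a' [b' [c' [f' yE]]]] := square_span y.
    have yw : y * w = a' *: w.
      rewrite yE !mulrDl -!scalerAl ew -mulrA xw mulr0 nw g0 scale0r !scaler0.
      by rewrite !addr0.
    have ywm l : y ^+ l * w = a' ^+ l *: w.
      elim: l => [|l IH]; first by rewrite !expr0 mul1r scale1r.
      by rewrite exprSr -mulrA yw -scalerAr IH scalerA -exprS.
    have := ywm m; rewrite ym mul0r => /esym/eqP; rewrite scaler_eq0 expf_eq0.
    by rewrite yw => /orP[/andP[_ /eqP ->]|/eqP ->]; rewrite ?scale0r ?scaler0.
  have [c hc] := socle_line sw sxx xx0.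
  have [] := @square_indep4 0 (- a) (- c) 1; last by move=> _ _ _ /eqP; rewrite oner_eq0.
  by rewrite scale0r add0r scale1r !scaleNr addrC addrA -/w hc subrr.
(* With this [r] the square of [r *: w] is - x^2, so that u and v square to zero. *)
have [r rr] : exists r : k, r * r = - g^-1.
  have /closed_rootP[r] : size ('X^2 - (- g^-1)%:P) != 1%N by rewrite size_XnsubC.
  rewrite rootE !hornerE => /eqP/eqP; rewrite subr_eq0 => /eqP.
  by rewrite expr2; exists r.
pose u := x + r *: w; pose v := x - r *: w.
have rww : (r *: w) * (r *: w) = - (x * x).
  by rewrite -scalerAl -scalerAr ww !scalerA rr mulNr mulVf // scaleN1r.
have xrw : x * (r *: w) = 0 by rewrite -scalerAr xw scaler0.
have rwx : (r *: w) * x = 0 by rewrite mulC.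
have uv : u * v = x * x + x * x.
  by rewrite /u /v mulrDl !mulrBr xrw rwx rww subr0 sub0r opprK.
have r0 : r != 0.
  by apply: contraNneq g0 => r0; move: rr; rewrite r0 mul0r => /esym/eqP; rewrite oppr_eq0 invr_eq0.
apply: (quad_indep dim4 mulC (u := u) (v := v)).
- by rewrite !scale0r addr0 /u mulrDl !mulrDr xrw rwx rww addr0 add0r subrr.
- by rewrite !scale0r addr0 /v mulrBl !mulrBr xrw rwx rww subr0 sub0r opprK subrr.
move=> a1 b1 c1 d1; rewrite /comb uv -square_unit => h.
(* Since w = n - a x, the coefficient of [w] also enters that of x, multiplied by - a. *)
have [|h1 h2 h3 h4] := @square_indep4 a1 (b1 + c1 - (b1 - c1) * r * a) (d1 *+ 2) ((b1 - c1) * r).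
  have uvE (y : E) : b1 *: (x + y) + c1 *: (x - y) = (b1 + c1) *: x + (b1 - c1) *: y.
    by rewrite scalerDr scalerBr scalerDl scalerBl [LHS](AC (2*2) ((1*3)*(2*4))).
  rewrite -[RHS]h -(addrA (a1 *: e) (b1 *: u)) /u /v uvE /w !scalerBr !scalerA !scalerBl.
  rewrite mulr2n (scalerDl (x * x)) scalerDr.
  by rewrite [LHS](AC (((1*2)*2)*1) ((1*(2*(6*3)))*(4*5))).
have bc : b1 = c1.
  by apply/eqP; rewrite -subr_eq0; move/eqP: h4; rewrite mulf_eq0 (negPf r0) orbF.
have c0 : c1 = 0.
  move: h2; rewrite bc subrr !mul0r subr0 -mulr2n -mulr_natl => /eqP.
  by rewrite mulf_eq0 (negPf (char0 1)) => /eqP.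
split=> //; first by rewrite bc.
by move: h3; rewrite -mulr_natl => /eqP; rewrite mulf_eq0 (negPf (char0 1)) => /eqP.
Qed.

End Square.
End Local.

Lemma jet_bound d (e x : E) : jet d e x -> (d <= 4)%N.
Proof.
move=> J; rewrite leqNgt; apply/negP => lt.
have [u u0 hu] := dependent dim4 (fun j : 'I_d => e * x ^+ j) lt.
pose p : {poly k} := \poly_(j < d) oapp (fun j' : 'I_d => u 0 j') 0 (insub j).
have pE (j : 'I_d) : p`_j = u 0 j by rewrite coef_poly ltn_ord valK.
case/eqP: u0; apply/rowP => j; rewrite mxE -pE; apply: (jet_coef J) => //.
by rewrite (jet_trunc mulC p J) -[RHS]hu; apply: eq_bigr => i _; rewrite pE.
Qed.

Lemma max_jet (e : E) : e * e = e -> e != 0 -> exists dx : nat * E,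
  jet dx.1 e dx.2 /\ forall d' x', jet d' e x' -> (d' <= dx.1)%N.
Proof.
move=> ee e0; suff main m d x : jet d e x -> (4 - d < m)%N -> exists dx : nat * E,
    jet dx.1 e dx.2 /\ forall d' x', jet d' e x' -> (d' <= dx.1)%N.
  (* The search starts from the trivial piece with order 1 and generator 0, and [jet_bound] stops
     it. *)
  by apply: (main 4 1%N 0) => //; split=> //; rewrite ?mulr0 ?expr1 ?expr0 ?mulr0 ?mulr1.
elim: m d x => // m IH d x J lt.
have [[d' [x' [J' lt']]]|no] := pselect (exists d' x', jet d' e x' /\ (d < d')%N).
  by apply: (IH d' x' J'); have := jet_bound J'; lia.
exists (d, x); split=> // d' x' J'; rewrite leqNgt; apply/negP => lt'.
by apply: no; exists d', x'.
Qed.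

(** In the second alternative some corner holds a nilpotent outside the polynomials in its
    generator; by [square_unit] this corner is all of [E]. *)
Theorem frobenius4_cases :
  [\/ is_type E [:: 1; 1; 1; 1]%N, is_type E [:: 2; 1; 1]%N, is_type E [:: 2; 2]%N |
   is_type E [:: 3; 1]%N \/ is_type E [:: 4]%N] \/ quad 0 0 0 0 E.
Proof.
have [r [e [[e0 eo es] el]]] := local_decomposition mulC dim4.
have ei i : e i * e i = e i by rewrite eo eqxx.
have /choice[dx hdx] i := max_jet (ei i) (e0 i).
pose d i := (dx i).1; pose x i := (dx i).2.
have J : jets d e x.
  by split=> // [i|i j ne]; [case: (hdx i) | rewrite eo (negPf ne)].
have [sp|] := pselect (forall y, exists P, y = jet_elt e x P).
  by left; apply: (jets_cases J); apply: (jets_count mulC J dim4).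
move=> /existsNP[y hy]; right.
have [i hi] : exists i, forall p, e i * y <> e i * horner_alg (x i) p.
  apply: contrapT => no; have h i : exists p, e i * y = e i * horner_alg (x i) p.
    by apply: contrapT => ni; apply: no; exists i => p hp; apply: ni; exists p.
  have /choice[P hP] := h; apply: hy; exists P.
  by rewrite /jet_elt -(eq_bigr _ (fun i _ => hP i)) -mulr_suml es mul1r.
(* Subtracting the residue makes the missing element nilpotent and does not turn it into a
   polynomial in [x i]. *)
have [c rc] := rad_dec (ei i) (el i) y.
apply: (square_quad (ei i) (e0 i) (el i) (proj1 (hdx i)) (proj2 (hdx i)) rc) => p hp.
apply: (hi (p + c%:P)); rewrite rmorphD /= mulrDr -hp horner_algC -scalerAr mulr1.
by rewrite subrK.
Qed.

End Classification.

Local Open Scope quotient_scope.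

(** * Localization of a commutative algebra at a regular element *)

Section Fractions.
Context (k : fieldType) (B : comAlgType k) (z : B).
Hypothesis zreg : forall x, x * z = 0 -> x = 0.

Lemma zcancel n (x y : B) : x * z ^+ n = y * z ^+ n -> x = y.
Proof.
elim: n => [|n IH]; rewrite ?mulr1 // !exprSr !mulrA => h; apply: IH.
by apply/eqP; rewrite -subr_eq0; apply/eqP/zreg; rewrite mulrBl h subrr.
Qed.

Definition frac_rel (x y : B * nat) := x.1 * z ^+ y.2 == y.1 * z ^+ x.2.

Lemma frac_rel_refl : reflexive frac_rel.
Proof. by move=> x; apply/eqP. Qed.

Lemma frac_rel_sym : symmetric frac_rel.
Proof. by move=> x y; rewrite /frac_rel eq_sym. Qed.

(** Cross-multiplication leaves the denominator of the middle fraction as a common factor, which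
    regularity cancels. *)
Lemma frac_rel_trans : transitive frac_rel.
Proof.
move=> [b n] [a m] [c l] /eqP /= h /eqP /= h'; apply/eqP => /=; apply: (@zcancel n).
transitivity ((a * z ^+ n) * z ^+ l); first by ring.
rewrite h; transitivity ((b * z ^+ l) * z ^+ m); first by ring.
by rewrite h'; ring.
Qed.

Canonical frac_equiv := EquivRel frac_rel frac_rel_refl frac_rel_sym frac_rel_trans.
Definition fractions : Type := {eq_quot frac_equiv}.
HB.instance Definition _ := Choice.on fractions.

Definition mkf (b : B) (n : nat) : fractions := \pi_{eq_quot frac_equiv} (b, n).

Lemma mkfP (x : fractions) : exists b n, x = mkf b n.
Proof.
exists (repr (x : {eq_quot frac_equiv})).1, (repr (x : {eq_quot frac_equiv})).2.
by rewrite /mkf -surjective_pairing reprK.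
Qed.

Lemma mkf_eq b n c m : mkf b n = mkf c m <-> b * z ^+ m = c * z ^+ n.
Proof.
split=> [/eqP|h]; first by rewrite /mkf eqmodE => /eqP.
by apply/eqP; rewrite /mkf eqmodE; apply/eqP.
Qed.

Definition rp (x : fractions) : B * nat := repr (x : {eq_quot frac_equiv}).

Lemma rp_eq b n : (rp (mkf b n)).1 * z ^+ n = b * z ^+ (rp (mkf b n)).2.
Proof. by apply/mkf_eq; rewrite /mkf -surjective_pairing reprK. Qed.

Definition fadd x y := mkf ((rp x).1 * z ^+ (rp y).2 + (rp y).1 * z ^+ (rp x).2) ((rp x).2 + (rp y).2).
Definition fopp x := mkf (- (rp x).1) (rp x).2.
Definition fmul x y := mkf ((rp x).1 * (rp y).1) ((rp x).2 + (rp y).2).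
Definition fscale (c : k) x := mkf (c *: (rp x).1) (rp x).2.

Lemma faddE b n c m : fadd (mkf b n) (mkf c m) = mkf (b * z ^+ m + c * z ^+ n) (n + m).
Proof.
apply/mkf_eq; have := rp_eq b n; have := rp_eq c m.
case: (rp _) => [c' m'] /= hc; case: (rp _) => [b' n'] /= hb.
transitivity ((b' * z ^+ n) * (z ^+ m * z ^+ m') + (c' * z ^+ m) * (z ^+ n * z ^+ n')); first by (rewrite ?exprD; ring).
by rewrite hb hc; rewrite ?exprD; ring.
Qed.

Lemma fmulE b n c m : fmul (mkf b n) (mkf c m) = mkf (b * c) (n + m).
Proof.
apply/mkf_eq; have := rp_eq b n; have := rp_eq c m.
case: (rp _) => [c' m'] /= hc; case: (rp _) => [b' n'] /= hb.
transitivity ((b' * z ^+ n) * (c' * z ^+ m)); first by (rewrite ?exprD; ring).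
by rewrite hb hc; rewrite ?exprD; ring.
Qed.

Lemma foppE b n : fopp (mkf b n) = mkf (- b) n.
Proof. by apply/mkf_eq; have := rp_eq b n; case: (rp _) => [b' n'] /= hb; rewrite !mulNr hb. Qed.

Lemma fscaleE a b n : fscale a (mkf b n) = mkf (a *: b) n.
Proof. by apply/mkf_eq; have := rp_eq b n; case: (rp _) => [b' n'] /= hb; rewrite -!scalerAl hb. Qed.

Local Ltac lift1 x := have [? [? ->]] := mkfP x.

Fact faddA : associative fadd.
Proof. by move=> x y t; lift1 x; lift1 y; lift1 t; rewrite !faddE; apply/mkf_eq; rewrite ?exprD; ring. Qed.
Fact faddC : commutative fadd.
Proof. by move=> x y; lift1 x; lift1 y; rewrite !faddE; apply/mkf_eq; rewrite ?exprD; ring. Qed.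
Fact fadd0 : left_id (mkf 0 0) fadd.
Proof. by move=> x; lift1 x; rewrite !faddE; apply/mkf_eq; rewrite ?exprD; ring. Qed.
Fact faddN : left_inverse (mkf 0 0) fopp fadd.
Proof. by move=> x; lift1 x; rewrite foppE !faddE; apply/mkf_eq; rewrite ?exprD; ring. Qed.

HB.instance Definition _ := GRing.isZmodule.Build fractions faddA faddC fadd0 faddN.

Fact fmulA : associative fmul.
Proof. by move=> x y t; lift1 x; lift1 y; lift1 t; rewrite !fmulE; apply/mkf_eq; rewrite ?exprD; ring. Qed.
Fact fmul1 : left_id (mkf 1 0) fmul.
Proof. by move=> x; lift1 x; rewrite !fmulE; apply/mkf_eq; rewrite ?exprD; ring. Qed.
Fact fmulr1 : right_id (mkf 1 0) fmul.
Proof. by move=> x; lift1 x; rewrite !fmulE; apply/mkf_eq; rewrite ?exprD; ring. Qed.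
Fact fmulDl : left_distributive fmul fadd.
Proof. by move=> x y t; lift1 x; lift1 y; lift1 t; rewrite !(faddE, fmulE); apply/mkf_eq; rewrite ?exprD; ring. Qed.
Fact fmulDr : right_distributive fmul fadd.
Proof. by move=> x y t; lift1 x; lift1 y; lift1 t; rewrite !(faddE, fmulE); apply/mkf_eq; rewrite ?exprD; ring. Qed.
Fact fone_neq0 : mkf 1 0 != mkf 0 0.
Proof. by apply/eqP => /mkf_eq /eqP; rewrite !mulr1 oner_eq0. Qed.

HB.instance Definition _ := GRing.Zmodule_isNzRing.Build fractions
  fmulA fmul1 fmulr1 fmulDl fmulDr fone_neq0.

Fact fscaleA a b x : fscale a (fscale b x) = fscale (a * b) x.
Proof. by lift1 x; rewrite !fscaleE scalerA. Qed.
Fact fscale1 : left_id 1 fscale.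
Proof. by move=> x; lift1 x; rewrite !fscaleE scale1r. Qed.
Fact fscaleDr : right_distributive fscale fadd.
Proof.
by move=> a x y; lift1 x; lift1 y; rewrite !(faddE, fscaleE) scalerDr !scalerAl.
Qed.
Fact fscaleDl x : {morph fscale^~ x : a b / a + b >-> fadd a b}.
Proof.
move=> a b; lift1 x; rewrite !fscaleE !faddE; apply/mkf_eq; rewrite -mulrDl -scalerDl.
by rewrite exprD mulrA.
Qed.

HB.instance Definition _ := GRing.Zmodule_isLmodule.Build k fractions
  fscaleA fscale1 fscaleDr fscaleDl.

Fact fscaleAl a (x y : fractions) : a *: (x * y) = (a *: x) * y.
Proof.
have [x0 [x1 ->]] := mkfP x; have [x2 [x3 ->]] := mkfP y; change (fscale a (fmul (mkf x0 x1) (mkf x2 x3)) = fmul (fscale a (mkf x0 x1)) (mkf x2 x3)).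
by rewrite !(fmulE, fscaleE) scalerAl.
Qed.

HB.instance Definition _ := GRing.Lmodule_isLalgebra.Build k fractions fscaleAl.

Fact fscaleAr a (x y : fractions) : a *: (x * y) = x * (a *: y).
Proof.
have [x0 [x1 ->]] := mkfP x; have [x2 [x3 ->]] := mkfP y; change (fscale a (fmul (mkf x0 x1) (mkf x2 x3)) = fmul (mkf x0 x1) (fscale a (mkf x2 x3))).
by rewrite !(fmulE, fscaleE) scalerAr.
Qed.

HB.instance Definition _ := GRing.Lalgebra_isAlgebra.Build k fractions fscaleAr.

Lemma mkfD b c n : mkf b n + mkf c n = mkf (b + c) n.
Proof. by apply: etrans (faddE _ _ _ _) _; apply/mkf_eq; rewrite ?exprD; ring. Qed.

Lemma mkfM b n c m : mkf b n * mkf c m = mkf (b * c) (n + m).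
Proof. exact: fmulE. Qed.

Lemma mkfZ a b n : a *: mkf b n = mkf (a *: b) n.
Proof. exact: fscaleE. Qed.

Fact iotaf_linear : linear (fun b => mkf b 0).
Proof. by move=> a b c; rewrite mkfZ mkfD. Qed.

Lemma mkfX b n m : mkf b n ^+ m = mkf (b ^+ m) (n * m).
Proof. by elim: m => [|m IH]; rewrite ?muln0 // !exprS IH mkfM mulnS. Qed.

Lemma fractions_localization : exists iota : {lrmorphism B -> fractions},
  (forall b, iota b = mkf b 0) /\ localization z iota.
Proof.
pose f b := mkf b 0.
pose M := GRing.isLinear.Build k B fractions *:%R f iotaf_linear.
have fM : monoid_morphism f by split=> // b c; rewrite /f mkfM.
pose MM := GRing.isMonoidMorphism.Build B fractions f fM.
pose iota : {lrmorphism B -> fractions} := HB.pack f M MM.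
exists iota; split=> //; split.
- exists (mkf 1 1); split; apply: etrans (mkfM _ _ _ _) _; apply/mkf_eq; rewrite ?exprD; ring.
- move=> l; have [b [n ->]] := mkfP l; exists n, b.
  by apply: etrans (congr2 *%R erefl (mkfX _ _ _)) _; rewrite mkfM mul0n addn0; apply/mkf_eq; ring.
- by move=> b /mkf_eq; rewrite mul0r => h; exists 0%N.
Qed.

End Fractions.

(** * The central conic of the family *)

Section ConicElement.
Context (k : fieldType) (al ga be de : k) (T : free_alg k) (S : algType k).
Context (p : {lrmorphism T -> S}).
Hypothesis pS : presents p (fun g => exists i, g = clif_rel al ga T i).
Local Notation sx := (sx p).
Local Notation sy := (sy p).
Local Notation sz := (sz p).

Definition clif_conic : T :=
  word [:: i2; i2] + be *: word [:: i0; i0] + de *: word [:: i1; i1].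

Lemma clif_conicE : p clif_conic = sz * sz + be *: (sx * sx) + de *: (sy * sy).
Proof. by rewrite /clif_conic !word2 !linearD !linearZ /= !rmorphM. Qed.

(** This and the next five identities make the squares of the generators central: two sign changes
    cancel each other, and so do the correction terms. *)
Lemma sxx_y : sx * sx * sy = sy * (sx * sx).
Proof. by rewrite mulrA (rel_yx pS) mulNr -!mulrA (rel_yx pS) mulrN opprK. Qed.

Lemma syy_x : sy * sy * sx = sx * (sy * sy).
Proof.
by rewrite -[LHS]mulrA (rel_yx pS) mulrN [sy * (_ * _)]mulrA (rel_yx pS) mulNr opprK -!mulrA.
Qed.

Lemma sz_xx : sz * (sx * sx) = sx * sx * sz.
Proof.
rewrite [LHS]mulrA (rel_zx pS) mulrBl mulNr -[sx * sz * sx]mulrA (rel_zx pS) mulrBr mulrN.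
by rewrite opprB opprK -scalerAl -scalerAr expr2 syy_x addrAC subrr add0r mulrA.
Qed.

Lemma sz_yy : sz * (sy * sy) = sy * sy * sz.
Proof.
rewrite [LHS]mulrA (rel_zy pS) mulrBl mulNr -[sy * sz * sy]mulrA (rel_zy pS) mulrBr mulrN.
by rewrite opprB opprK -scalerAl -scalerAr expr2 sxx_y addrAC subrr add0r mulrA.
Qed.

Lemma szz_x : sz * sz * sx = sx * (sz * sz).
Proof.
rewrite -[LHS]mulrA (rel_zx pS) mulrBr mulrN [sz * (sx * sz)]mulrA (rel_zx pS) mulrBl mulNr.
by rewrite opprB opprK -scalerAl -scalerAr expr2 sz_yy addrAC subrr add0r -mulrA.
Qed.

Lemma szz_y : sz * sz * sy = sy * (sz * sz).
Proof.
rewrite -[LHS]mulrA (rel_zy pS) mulrBr mulrN [sz * (sy * sz)]mulrA (rel_zy pS) mulrBl mulNr.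
by rewrite opprB opprK -scalerAl -scalerAr expr2 sz_xx addrAC subrr add0r -mulrA.
Qed.

Lemma clif_conic_central : central (p clif_conic).
Proof.
move=> u; rewrite clif_conicE; set f := _ + _ + _.
apply: (S_ind pS (P := fun u => f * u = u * f)) => [|c {}u v hu hv|{}u i hu].
- by rewrite mul1r mulr1.
- by rewrite (mulrDr f) (mulrDl _ _ f) -scalerAr -scalerAl hu hv.
rewrite mulrA hu -!mulrA; congr (_ * _); rewrite /f !mulrDl !mulrDr -!scalerAl -!scalerAr.
elim/ord3P: i; rewrite /sv.
- by rewrite -/sx szz_x syy_x -(mulrA sx).
- by rewrite -/sy szz_y sxx_y -(mulrA sy).
by rewrite -/sz -sz_xx -sz_yy -(mulrA sz).
Qed.

(** z^2 raises the exponent of z by two while x^2 and y^2 do not raise it, so the top coefficients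
    of [u] survive in the product. *)
Lemma clif_conic_reg u : u * p clif_conic = 0 -> u = 0.
Proof.
move=> h; have [n hn] : exists n, forall a b c, (n <= c)%N -> pbw pS a b c u = 0.
  have [n hu] := zspan_all pS u; exists n.+1 => a b c lt.
  elim: hu => [|d _ v [a' [b' [c' [le ->]]]] _ IH]; first exact: pbw0.
  by rewrite pbwP IH addr0 pbw_mon (_ : (c == c') = false) ?andbF ?mulr0 //; lia.
elim: n hn => [|n IH] hn; first by apply: (pbw_inj (pS := pS)) => a b c; apply: hn.
apply: IH => a b c; rewrite leq_eqVlt => /orP[/eqP <-|lt]; last exact: hn.
have := congr1 (pbw pS a b n.+2) h; rewrite clif_conicE !mulrDr -!scalerAr !pbwD !pbwZ pbw0 !mulrA.
rewrite -[sz]/(sv p i2) -[sx]/(sv p i0) -[sy]/(sv p i1) !pbw_act.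
have z2 : act al ga i2 (fun a b c => pbw pS a b c (u * sv p i2)) a b n.+2 = pbw pS a b n u.
  by rewrite /act /= pbw_act.
have x1 a' b' c' : (n < c')%N -> pbw pS a' b' c' (u * sv p i0) = 0.
  move=> lt; rewrite pbw_act /act /= /actx; case: a' => [|a'']; case: b' => [|[|b'']];
  by case: (odd c'); rewrite ?hn ?mulr0 ?subr0 //; lia.
have y1 a' b' c' : (n < c')%N -> pbw pS a' b' c' (u * sv p i1) = 0.
  move=> lt; rewrite pbw_act /act /= /acty; case: a' => [|[|a'']]; case: b' => [|b''];
  by case: (odd c'); rewrite ?hn ?mulr0 ?subr0 //; lia.
have x2 a' b' : act al ga i0 (fun a b c => pbw pS a b c (u * sv p i0)) a' b' n.+2 = 0.
  rewrite /act /= /actx; case: a' => [|a'']; case: b' => [|[|b'']];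
  by case: (odd n.+2); rewrite ?x1 ?mulr0 ?subr0 //; lia.
have y2 a' b' : act al ga i1 (fun a b c => pbw pS a b c (u * sv p i1)) a' b' n.+2 = 0.
  rewrite /act /= /acty; case: a' => [|[|a'']]; case: b' => [|b''];
  by case: (odd n.+2); rewrite ?y1 ?mulr0 ?subr0 //; lia.
by rewrite z2 x2 y2 !mulr0 !addr0.
Qed.

Lemma clif_conic_element :
  [/\ pgr p 2 (p clif_conic), central (p clif_conic) & regular_elt (p clif_conic)].
Proof.
split; [|exact: clif_conic_central|].
- exists clif_conic; split=> //.
  rewrite /clif_conic; apply: homogD; first apply: homogD; first exact: homog_word.
    by apply/homogZ; apply: homog_word.
  by apply/homogZ; apply: homog_word.
split=> u; last exact: clif_conic_reg.
by rewrite clif_conic_central; apply: clif_conic_reg.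
Qed.

End ConicElement.

Local Open Scope quotient_scope.

(** * Realization: the dual of the conic evaluated in E *)

Section QuadConic.
Context (k : fieldType) (al ga be de : k) (T : free_alg k) (S A B D E : algType k).
Context (p : {lrmorphism T -> S}) (q : {lrmorphism S -> A}).
Context (pB : {lrmorphism T -> B}) (pD : {lrmorphism T -> D}).
Local Notation ft := (clif_conic be de T).
Local Notation W := (clifW al ga).
Local Notation gen := (fa_gen T).
Hypothesis pS : presents p (fun g => exists i, g = wrel T W i).
Hypothesis qA : presents q (fun y => y = p ft).
Let GB g := fhomog 2 g /\ forall r, fhomog 2 r -> q (p r) = 0 -> pair2 g r = 0.
Let GD g := fhomog 2 g /\ forall r, fhomog 2 r -> p r = 0 -> pair2 g r = 0.
Hypotheses (pBB : presents pB GB) (pDD : presents pD GD).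
Variables u v : E.
Hypotheses (mulC : forall x y : E, x * y = y * x).
Hypotheses (hu : u * u = al *: v + be *: 1) (hv : v * v = ga *: u + de *: 1).
Hypothesis sp : forall x, exists a b c d, x = comb u v a b c d.
Hypothesis ind : forall a b c d, comb u v a b c d = 0 -> [/\ a = 0, b = 0, c = 0 & d = 0].

Let e (i : 'I_3) : E := if i == i0 then u else if i == i1 then v else 1.
Let ev : {linear T -> E} := lext T (fun s => \prod_(i <- s) e i).

Let ev_word s : ev (word s) = \prod_(i <- s) e i.
Proof. exact: lext_word. Qed.

Let evM x y : ev (x * y) = ev x * ev y.
Proof.
elim/tensor_ind: x => [|c s x IH]; first by rewrite mul0r linear0 mul0r.
rewrite mulrDl -scalerAl !linearP IH mulrDl -scalerAl; congr (_ *: _ + _).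
elim/tensor_ind: y {IH} => [|d t y IH]; first by rewrite mulr0 linear0 mulr0.
rewrite mulrDr -scalerAr !linearP IH mulrDr -scalerAr; congr (_ *: _ + _).
by rewrite -word_cat !ev_word big_cat.
Qed.

Let ev_gen i : ev (gen i) = e i.
Proof. by rewrite -word1 ev_word big_seq1. Qed.

Let ev1 : ev 1 = 1.
Proof. by have := ev_word [::]; rewrite word_nil big_nil. Qed.

Let ft_homog : fhomog 2 ft.
Proof.
rewrite /clif_conic; apply: homogD; first apply: homogD; first exact: homog_word.
  by apply/homogZ; apply: homog_word.
by apply/homogZ; apply: homog_word.
Qed.

Let w i := wrel T W i.

(** Relations and conic are coordinate functionals: u arises from xz, zx and, through v^2, from ga
    y^2, which is w_1. In the same way w_0 gives v, w_2 gives uv, and the conic gives 1. *)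
Let ev2 g : fhomog 2 g -> ev g =
  comb u v (pair2 g ft) (pair2 g (w i1)) (pair2 g (w i0)) (pair2 g (w i2)).
Proof.
elim/homog_ind=> [|c [|a [|b [|//]]] x // _ _ IH].
  by rewrite linear0 /comb !(pair2C 0) !pair2_0 !scale0r !addr0.
rewrite linearP IH !pair2Pl -combP; congr (_ *: _ + _).
rewrite ev_word !big_cons big_nil mulr1 !pair2_word !coef_wrel /clif_conic !fcoefD !fcoefZ !fcoef_word.
rewrite /comb; elim/ord3P: a; elim/ord3P: b;
  rewrite /clifW /e /= ?(mulr0, mulr1, mul1r, addr0, add0r, scale0r, scale1r) ?hu ?hv //;
  by [rewrite addrC | rewrite mulC].
Qed.

Let evK2 g : fhomog 2 g -> ev g = 0 -> pB g = 0.
Proof.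
move=> hg; rewrite (ev2 hg) => /ind[hf h1 h0 h2].
by apply: (conic_ker2 pS ft_homog qA pBB hg) => //; apply: ord3P.
Qed.

Let ev_ker t : pB t = 0 -> ev t = 0.
Proof.
move=> /(proj2 pBB); elim=> [|a g b x [hg gr] _ IH]; first exact: linear0.
rewrite linearD IH addr0 !evM (_ : ev g = 0) ?mulr0 ?mul0r // (ev2 hg).
have pw i : pair2 g (w i) = 0.
  apply: gr; first exact: wrel_homog.
  by rewrite (_ : p (w i) = 0) ?linear0 //; apply/(proj2 pS)/ideal_gen_incl; exists i.
rewrite !pw gr // ?/comb ?scale0r ?addr0 //.
by apply/(proj2 qA)/ideal_gen_incl.
Qed.

Let mulBC (x y : B) : x * y = y * x.
Proof.
apply: (presents_comm (proj1 pBB)) => i j; apply/eqP; rewrite -subr_eq0 -linearB; apply/eqP.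
apply: evK2; first by rewrite -!word2; apply: homogB; apply: homog_word.
by rewrite linearB !evM mulC subrr.
Qed.

Let beq2 g g' : fhomog 2 g -> fhomog 2 g' -> ev g = ev g' -> pB g = pB g'.
Proof.
move=> hg hg' h; apply/eqP; rewrite -subr_eq0 -linearB; apply/eqP/evK2; first exact: homogB.
by rewrite linearB h subrr.
Qed.

Let hM1 (x y : T) : fhomog 1 x -> fhomog 1 y -> fhomog 2 (x * y).
Proof. exact: (@homogM _ _ 1 1). Qed.

Let hg1 i : fhomog 1 (gen i).
Proof. exact: homog_tgen. Qed.

Let yz := pB (gen i2).

(** The coordinates of 1, u, v are realized by zz, zx, zy; only uv is not visibly divisible by z. *)
Let red2 g : fhomog 2 g -> exists (l : T) (d : k), fhomog 1 l /\ pB g = yz * pB l + d *: (pB (gen i0) * pB (gen i1)).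
Proof.
move=> hg; pose l := pair2 g (w i0) *: gen i1 + (pair2 g (w i1) *: gen i0 + pair2 g ft *: gen i2).
have hl : fhomog 1 l by apply: homogP => //; apply: homogP => //; apply: homogZ.
exists l, (pair2 g (w i2)); split=> //; rewrite -!rmorphM /= -linearZ -linearD /=.
apply: beq2 => //; first by apply: homogD; [apply: hM1 | apply/homogZ/hM1].
rewrite (ev2 hg) linearD linearZ /= !evM /l !linearD !linearZ /= !ev_gen /e /= mul1r /comb.
by rewrite [LHS](AC (1*1*1*1) ((3*(2*1))*4)).
Qed.

(** One degree higher the uv part becomes divisible too, by rewriting x^2 = z (al y + be z) and y^2
    = z (ga x + de z). *)
Let red3w a b c : exists2 g, fhomog 2 g & pB (word [:: a; b; c]) = yz * pB g.
Proof.
have hbc : fhomog 2 (word [:: b; c] : T) by apply: homog_word.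
have [l [d [hl e1]]] := red2 hbc.
have [g hg e2] : exists2 g, fhomog 2 g & pB (gen a) * (pB (gen i0) * pB (gen i1)) = yz * pB g.
  elim/ord3P: a.
  - pose m := al *: gen i1 + be *: gen i2; have hm : fhomog 1 m by apply: homogP => //; apply: homogZ.
    have eqx : pB (gen i0 * gen i0) = pB (gen i2 * m).
      apply: beq2; [exact: hM1 | exact: hM1 |].
      by rewrite !evM /m !linearD !linearZ /= !ev_gen /e /= mul1r hu.
    exists (m * gen i1); first exact: hM1.
    by rewrite mulrA -rmorphM /= eqx !rmorphM /= -mulrA.
  - pose m := ga *: gen i0 + de *: gen i2; have hm : fhomog 1 m by apply: homogP => //; apply: homogZ.
    have eqy : pB (gen i1 * gen i1) = pB (gen i2 * m).
      apply: beq2; [exact: hM1 | exact: hM1 |].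
      by rewrite !evM /m !linearD !linearZ /= !ev_gen /e /= mul1r hv.
    exists (gen i0 * m); first exact: hM1.
    rewrite [pB (gen i0) * _]mulBC mulrA -rmorphM /= eqy !rmorphM /= -mulrA.
    by rewrite [pB m * _]mulBC.
  - by exists (gen i0 * gen i1); [exact: hM1 | rewrite rmorphM].
exists (gen a * l + d *: g); first by apply: homogD; [apply: hM1 | apply: homogZ].
rewrite word_cons rmorphM /= e1 mulrDr -scalerAr e2 linearD linearZ rmorphM /=.
by rewrite mulrDr -scalerAr mulrA [pB (gen a) * yz]mulBC -mulrA.
Qed.

Let red3 t : fhomog 3 t -> exists2 g, fhomog 2 g & pB t = yz * pB g.
Proof.
elim/homog_ind=> [|c [|a [|b [|d [|//]]]] x // _ _ [g hg IH]].
  by exists 0; [exact: homog0 | rewrite !linear0 mulr0].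
have [g' hg' IH'] := red3w a b d; exists (c *: g' + g); first exact: homogP.
by rewrite !linearP /= IH IH' mulrDr -scalerAr.
Qed.

Let red n t : fhomog n.+2 t -> exists2 g, fhomog 2 g & pB t = yz ^+ n * pB g.
Proof.
elim: n t => [|n IH] t ht; first by exists t; rewrite ?mul1r.
elim/homog_ind: ht => [|c [//|a s] x [sz] _ [g hg IHx]].
  by exists 0; [exact: homog0 | rewrite !linear0 mulr0].
have [|g' hg' e'] := IH (word s); first by rewrite -sz; apply: homog_word.
have [|g'' hg'' e''] := @red3 (gen a * g'); first exact: (@homogM _ _ 1 2).
exists (c *: g'' + g); first exact: homogP.
rewrite !linearP /= IHx mulrDr -scalerAr word_cons rmorphM /= e'; congr (_ *: _ + _).
by rewrite mulrA [pB (gen a) * _]mulBC -mulrA -rmorphM /= e'' mulrA -exprSr.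
Qed.

(** High degrees come down to degree two after extracting powers of z, which [ev] sends to 1;
    degrees zero and one follow from the independence of 1, u, v. *)
Let evK n t : fhomog n t -> ev t = 0 -> pB t = 0.
Proof.
case: n => [|[|n]] ht.
- move=> h; have [|h0 _ _ _] := @ind (fa_coef [::] t) 0 0 0.
    rewrite /comb !scale0r !addr0 -[RHS]h [in RHS](homog0E ht) linearZ /=.
    by rewrite ev1.
  by rewrite (homog0E ht) h0 scale0r linear0.
- rewrite (homog1E ht) linear_sum sum3 !linearZ /= !ev_gen /e /= => h.
  have [|h2 h0 h1 _] := @ind (fa_coef [:: i2] t) (fa_coef [:: i0] t) (fa_coef [:: i1] t) 0.
    by rewrite /comb scale0r addr0 -[RHS]h [LHS](AC (1*1*1) (2*3*1)).
  by rewrite linear_sum sum3 !linearZ /= h0 h1 h2 !scale0r !addr0.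
have [g hg eg] := red ht => h; rewrite eg (_ : pB g = 0) ?mulr0 //; apply: evK2 => //.
have := ev_ker (t := t - gen i2 ^+ n * g); rewrite linearB rmorphM rmorphXn /= -/yz -eg subrr.
move=> /(_ erefl); rewrite linearB h evM sub0r => /eqP; rewrite oppr_eq0 => /eqP.
suff -> : ev (gen i2 ^+ n) = 1 by rewrite mul1r.
elim: n {ht eg} => [|n IH]; first by rewrite expr0 ev1.
by rewrite exprS evM IH ev_gen mulr1.
Qed.

Let beq n g g' : fhomog n g -> fhomog n g' -> ev g = ev g' -> pB g = pB g'.
Proof.
move=> hg hg' h; apply/eqP; rewrite -subr_eq0 -linearB; apply/eqP/evK; first exact: homogB hg hg'.
by rewrite linearB h subrr.
Qed.

Let zz := gen i2 * gen i2.
Let zB := pB zz.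

Let hzz : fhomog 2 zz. Proof. exact: hM1. Qed.
Let evzz : ev zz = 1. Proof. by rewrite evM !ev_gen mulr1. Qed.

Let hzzX n : fhomog (2 * n) (zz ^+ n) /\ ev (zz ^+ n) = 1.
Proof.
elim: n => [|n [h1 h2]]; first by rewrite muln0 expr0; split; [exact: homog_1 | exact: ev1].
by rewrite mulnS exprS evM h2 evzz mulr1; split=> //; apply: homogM.
Qed.

Let GB_homog g : GB g -> fhomog 2 g. Proof. by case. Qed.

(** Multiplication by [zz] does not change the value under [ev], and [ev] detects zero in each
    degree. *)
Let zB_reg x : x * zB = 0 -> x = 0.
Proof.
have [t ->] := proj1 pBB x; rewrite mulBC -rmorphM => /(proj2 pBB) h.
have [n ->] := comp_sum t; rewrite linear_sum big1 // => i _.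
have e0 : ev (hcomp i t) = 0.
  rewrite -[LHS]mul1r -evzz -evM -(@hcompM _ _ 2) //.
  by apply: ev_ker; apply/(proj2 pBB)/(ideal_gen_comp _ GB_homog).
by apply: evK (e0); apply: comp_homog.
Qed.

(** A relation of the dual of [S] is orthogonal to all w_i, so in [B] only its pairing with the
    conic remains, as a multiple of [zB]. Conversely [zz] is itself orthogonal to all w_i. *)
Let zB_kernel t : pD t = 0 <-> ideal_gen (fun x => x = zB) (pB t).
Proof.
split=> [/(proj2 pDD)|].
  elim=> [|a g b x [hg gr] _ IH]; first by rewrite linear0; apply: ideal_gen0.
  have gz : pB g = pair2 g ft *: zB.
    rewrite -linearZ; apply: beq2 => //; first exact: homogZ.
    have pw i : pair2 g (w i) = 0.
      apply: gr; first exact: wrel_homog.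
      by apply/(proj2 pS)/ideal_gen_incl; exists i.
    by rewrite (ev2 hg) !pw linearZ /= evzz /comb !scale0r !addr0.
  rewrite linearD !rmorphM /= gz -scalerAr -scalerAl; apply: ideal_gen_add => //.
  by rewrite -mulr_algl; apply/ideal_gen_mull/ideal_gen_mulr/ideal_gen_mull/ideal_gen_incl.
move=> h; have [b eb] : exists b, pB t = pB (zz * b).
  elim: h => [|x _ y r -> _ [b IH]]; first by exists 0; rewrite mulr0 !linear0.
  have [s es] := proj1 pBB (x * y); exists (s + b); rewrite mulrDr linearD /= -IH rmorphM /= -es.
  by rewrite -/zB mulrA [zB * x]mulBC.
have h0 : ideal_gen GB (t - zz * b) by apply/(proj2 pBB); rewrite linearB /= -eb subrr.
have : pD (t - zz * b) = 0.
  apply/(proj2 pDD); apply: (ideal_gen_sub _ h0) => g [hg gr]; apply: ideal_gen_incl; split=> // r hr pr.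
  by apply: gr => //; rewrite pr linear0.
rewrite linearB rmorphM /= (_ : pD zz = 0) ?mul0r ?subr0 //.
apply: (dual_ker2 pS pDD hzz) => i; rewrite /zz -word2 pair2_word coef_wrel.
by elim/ord3P: i; rewrite /clifW.
Qed.

Let bt_ex x : exists g, fhomog 2 g /\ ev g = x.
Proof.
have [a [b [c [d ->]]]] := sp x.
exists (a *: word [:: i2; i2] + (b *: word [:: i0; i2] + (c *: word [:: i1; i2] + d *: word [:: i0; i1]))).
split; first by do 3![apply: homogP; first exact: homog_word]; apply/homogZ; apply: homog_word.
rewrite !linearP linearZ /= !ev_word !big_cons !big_nil /e /= !mulr1 /comb.
by rewrite !addrA.
Qed.

(** An element of [E] goes to the fraction g / zz, where g has degree two and value x under [ev];
    identities between fractions are checked by [ev] on numerators of equal degree. *)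
Lemma quad_is_C : exists z : B, [/\ pgr pB 2 z, central z, regular_elt z,
  (forall t, pD t = 0 <-> ideal_gen (fun x => x = z) (pB t)) &
  deg0_localization (pgr pB) 2 z E].
Proof.
exists zB; split; [by exists zz | by move=> x; apply: mulBC | | exact: zB_kernel | ].
  by split=> x h; apply: zB_reg => //; rewrite mulBC.
pose BC : comAlgType k := HB.pack (B : Type) (GRing.Algebra.class B)
  (GRing.PzSemiRing_hasCommutativeMul.Build B mulBC).
have [iota [iotaE loc]] := @fractions_localization k BC (zB : BC) zB_reg.
have /choice[bt hbt] := bt_ex.
pose mk (b : B) n := @mkf k BC zB zB_reg b n.
pose f x := mk (pB (bt x)) 1%N.
have zX n : zB ^+ n = pB (zz ^+ n) by rewrite rmorphXn.
have mkE (b c : B) n m : b * zB ^+ m = c * zB ^+ n -> mk b n = mk c m by move=> h; apply/mkf_eq.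
have fl : linear f.
  move=> c x y; have [hx ex] := hbt x; have [hy ey] := hbt y; have [h0 e0] := hbt (c *: x + y).
  rewrite /f; apply: etrans (esym (etrans (congr2 +%R (mkfZ _ _ _ _) erefl) (mkfD _ _ _ _))).
  by congr (mk _ _); rewrite -[RHS]/(c *: pB _ + pB _) -linearP; apply: beq2 => //; rewrite ?linearP ?e0 ?ex ?ey //; apply: homogP.
have fM : monoid_morphism f.
  split=> [|x y].
    have [h0 e0] := hbt 1; apply: mkE; rewrite expr0 mulr1 expr1 mul1r.
    by apply: beq2 => //; rewrite e0 evzz.
  have [hx ex] := hbt x; have [hy ey] := hbt y; have [h0 e0] := hbt (x * y).
  apply: etrans (esym (mkfM _ _ _ _ _)); apply: mkE; rewrite !zX -!rmorphM.
  (* One denominator is zz and the other its square, so after cross-multiplication both sides have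
     degree 2 + 4 = 4 + 2. *)
  apply: (@beq 6); last by rewrite (evM (bt (x * y))) (evM (bt x * bt y)) (evM (bt x)) !(proj2 (hzzX _)) e0 ex ey.
    by apply: (@homogM _ _ 2 4) => //; apply: (proj1 (hzzX 2)).
  by apply: (@homogM _ _ 4 2); [apply: (@homogM _ _ 2 2) | apply: (proj1 (hzzX 1))].
pose M := GRing.isLinear.Build k E (@fractions k BC zB zB_reg) *:%R f fl.
pose MM := GRing.isMonoidMorphism.Build E (@fractions k BC zB zB_reg) f fM.
pose j : {lrmorphism E -> @fractions k BC zB zB_reg} := HB.pack f M MM.
exists (@fractions k BC zB zB_reg), iota, j; split; first exact: loc.
  move=> x y; rewrite /= /f => /mkf_eq h; have [hx ex] := hbt x; have [hy ey] := hbt y.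
  rewrite -ex -ey; apply/eqP; rewrite -subr_eq0 -linearB; apply/eqP/ev_ker.
  have h2 : pB (bt x - bt y) * zB = 0.
    rewrite linearB mulrBl; apply/eqP; rewrite subr_eq0; apply/eqP.
    by have := h; rewrite expr1.
  exact: zB_reg h2.
move=> l; split=> [[x <-]|[n [b [[t [ht ->]] h]]]].
  exists 1%N, (pB (bt x)); split; first by exists (bt x); split=> //; case: (hbt x).
  rewrite expr1 iotaE; apply: etrans (mkfM _ _ _ _ _) _; rewrite iotaE.
  by apply/mkf_eq; rewrite expr0 mulr1 addn0 expr1.
(* The fraction is t / zz^n, and its preimage is simply the value of its numerator. *)
exists (ev t); have [b0 [m lE]] := mkfP l; subst l.
move: h; rewrite !iotaE => h; have {}h := etrans (congr2 *%R erefl (esym (mkfX _ _ _ _))) h.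
move: h; rewrite mul0n => h; have /mkf_eq := etrans (esym (mkfM _ _ _ _ _)) h.
rewrite expr0 mulr1 addn0 => h'; rewrite /= /f; apply: mkE.
have [h1 e1] := hbt (ev t).
apply: (@zcancel _ BC zB zB_reg n).
have h'' : b0 * zB ^+ n = pB t * zB ^+ m := h'.
transitivity ((pB (bt (ev t)) * zB ^+ n) * zB ^+ m : BC); first by ring.
transitivity ((b0 * zB ^+ n) * zB : BC); last by ring.
rewrite h''; transitivity ((pB t * zB) * zB ^+ m : BC); last by ring.
congr (_ * _); rewrite -[zB in RHS]expr1 !zX -!rmorphM; apply: (@beq (2 + 2 * n)).
- by apply: homogM => //; apply: (proj1 (hzzX n)).
- by rewrite addnC; apply: homogM => //; apply: (proj1 (hzzX 1)).
by rewrite (evM (bt _)) (evM t) !(proj2 (hzzX _)) e1.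
Qed.

End QuadConic.

(** * Translation to the concrete definitions *)

Section Presentations.
Context (k : fieldType).
Local Notation TF := (tensor_free k).
Local Notation T := (tensor_alg k).

Definition tensor_fun (w : tensor3 k) a b c := w [tuple a; b; c].

Lemma img_pgr (A : algType k) (pi : {lrmorphism T -> A}) :
  img_grading pi = pgr (T := TF) (pi : {lrmorphism TF -> A}).
Proof. by rewrite /img_grading /pgr homog_tensor. Qed.

Lemma D_presents (w : tensor3 k) : presents (D_pi w : {lrmorphism TF -> D_alg w})
  (fun g => exists i, g = wrel TF (tensor_fun w) i).
Proof.
apply: (@quot_presents k TF).
apply: (@ideal_no1 k TF _ 1) => _ [i ->]; exact: (@wrel_homog k TF (tensor_fun w)).
Qed.

Lemma dual_presents (A : algType k) (pi : T -> A) :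
  presents (quadratic_dual_pi pi : {lrmorphism TF -> quadratic_dual pi})
  (fun g => @fhomog k TF 2 g /\ forall r, @fhomog k TF 2 r -> pi r = 0 -> @pair2 k TF g r = 0).
Proof.
rewrite homog_tensor; apply: (@quot_presents k TF).
by apply: (@ideal_no1 k TF _ 1) => g [hg _]; rewrite homog_tensor.
Qed.

(** Properness is checked in [T]: elements of the ideal of the conic lift to an ideal generated in
    degree two, which does not contain 1. *)
Lemma conic_presents (w : tensor3 k) (ft : T) : @fhomog k TF 2 ft ->
  presents (quot_pi (fun x : D_alg w => x = D_pi w ft) : {lrmorphism D_alg w -> conic (D_pi w ft)})
    (fun y => y = D_pi w ft).
Proof.
move=> hft; apply: quot_presents => h.
pose G (g : TF) := (exists i, g = wrel TF (tensor_fun w) i) \/ g = ft.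
have pull y : ideal_gen (fun x : D_alg w => x = D_pi w ft) y ->
    forall t : TF, D_pi w t = y -> ideal_gen G t.
  elim=> [|a g b x -> _ IH] t et.
    have /(proj2 (D_presents w)) h0 := et.
    by apply: (ideal_gen_sub _ h0) => g hg; apply: ideal_gen_incl; left.
  have [ta ea] := proj1 (D_presents w) a; have [tb eb] := proj1 (D_presents w) b.
  rewrite -[t](subrK (ta * ft * tb)) addrC; apply: ideal_genD; first by right.
  apply: IH; have e1 : D_pi w (ta * ft * tb) = a * D_pi w ft * b by rewrite !rmorphM /= -ea -eb.
  by rewrite linearB /= et e1 addrC addKr.
apply: (@ideal_no1 k TF G 1) => [g [[i ->]|->] //|].
  exact: (@wrel_homog k TF (tensor_fun w)).
by apply: (pull 1 h); rewrite rmorph1.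
Qed.

(** Comparing coefficients of (1 - t)^3 H = 1 up to degree three gives the dimensions 1, 3, 6,
    10. *)
Lemma hilbert_dims (A : algType k) (gr : nat -> A -> Prop) :
  hilbert_series_inv_cube gr -> has_dim (gr 2) 6 /\ has_dim (gr 3) 10.
Proof.
move=> [h [hd hs]].
have cube : (1 - 'X) ^+ 3 = 1 - 3%:P * 'X + 3%:P * 'X^2 - 'X^3 :> {poly int} by ring.
have c0 : ((1 - 'X) ^+ 3 : {poly int})`_0 = 1.
  by rewrite cube !(coefD, coefN, coefCM, coef1, coefX, coefXn).
have c1 : ((1 - 'X) ^+ 3 : {poly int})`_1 = - 3.
  by rewrite cube !(coefD, coefN, coefCM, coef1, coefX, coefXn).
have c2 : ((1 - 'X) ^+ 3 : {poly int})`_2 = 3.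
  by rewrite cube !(coefD, coefN, coefCM, coef1, coefX, coefXn).
have c3 : ((1 - 'X) ^+ 3 : {poly int})`_3 = - 1.
  by rewrite cube !(coefD, coefN, coefCM, coef1, coefX, coefXn).
have := hs 0%N; have := hs 1%N; have := hs 2%N; have := hs 3%N.
rewrite !big_ord_recr !big_ord0 /= c0 c1 c2 c3 => e3 e2 e1 e0.
have e3' : 0 + 1 * (h 3%N)%:Z + (- 3) * (h 2%N)%:Z + 3 * (h 1%N)%:Z + (- 1) * (h 0%N)%:Z = 0 := e3.
have e2' : 0 + 1 * (h 2%N)%:Z + (- 3) * (h 1%N)%:Z + 3 * (h 0%N)%:Z = 0 := e2.
have e1' : 0 + 1 * (h 1%N)%:Z + (- 3) * (h 0%N)%:Z = 0 := e1.
have e0' : 0 + 1 * (h 0%N)%:Z = 1 := e0.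
have h2 : h 2%N = 6%N by clear e0 e1 e2 e3; lia.
have h3 : h 3%N = 10%N by clear e0 e1 e2 e3; lia.
by split; [have := hd 2%N; rewrite h2 | have := hd 3%N; rewrite h3].
Qed.

End Presentations.

(** * The equivalence and the list *)

Section Equivalence.
Context (k : closedFieldType) (char0 : [pchar k] =i pred0).
Local Notation TF := (tensor_free k).

Lemma char0_nat n : n.+1%:R != 0 :> k.
Proof. by have /pcharf0P -> := char0. Qed.

Lemma is_C_frobenius (E : algType k) (w : tensor3 k) (f : D_alg w) :
  superpotential w -> symmetric_tensor w -> regular_tensor w -> conic_element f -> is_C f E ->
  commutative_frobenius4 E.
Proof.
move=> cyc sym reg [gf cf rf] isC.
have Wcyc a b c : tensor_fun w a b c = tensor_fun w b c a by apply: cyc.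
have Wsw a b c : tensor_fun w a b c = tensor_fun w a c b.
  rewrite /tensor_fun -(sym (tperm i1 i2) [tuple a; b; c]); congr (w _).
  apply: eq_from_tnth => i; rewrite tnth_mktuple.
  by elim/ord3P: i; rewrite ?tpermL ?tpermR ?tpermD // !(tnth_nth a).
have [ft [hft ef]] := gf; subst f; rewrite -homog_tensor in hft.
have [_ _ _ _] := reg; rewrite /D_grading img_pgr => /hilbert_dims[d2 d3].
have [z [gz cz rz hz dz]] := isC.
rewrite img_pgr in gz dz; case: dz => L [iota [j [loc jinj jP]]].
have pS := D_presents w; have qA := conic_presents w hft.
have pBB := dual_presents (@conic_pi k w (D_pi w ft)).
have pDD := dual_presents (D_pi w).
have two0 := char0_nat 1.
have comm := C_comm two0 Wsw pS hft cf qA pBB loc jinj.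
have dim := C_dim4 two0 Wcyc Wsw pS d2 d3 hft rf qA pBB pDD gz cz rz hz loc jinj jP.
split=> //; first apply: (C_frobenius two0 Wcyc Wsw pS d2 d3 hft cf rf qA pBB pDD gz cz rz hz loc jinj jP).
have [r [e [[e0 eo es] el]]] := local_decomposition comm dim.
exists r, e; split=> // i a; exact: local_unit.
Qed.

Lemma clifW_sw12 (al ga : k) a b c : clifW al ga a b c = clifW al ga b a c.
Proof. by elim/ord3P: a; elim/ord3P: b; elim/ord3P: c. Qed.

Lemma clifW_sw23 (al ga : k) a b c : clifW al ga a b c = clifW al ga a c b.
Proof. by elim/ord3P: a; elim/ord3P: b; elim/ord3P: c. Qed.

Definition clif_tensor (al ga : k) : tensor3 k :=
  [ffun t => clifW al ga (tnth t i0) (tnth t i1) (tnth t i2)].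

Lemma clif_tensorE al ga : tensor_fun (clif_tensor al ga) = clifW al ga.
Proof.
apply/funext => a; apply/funext => b; apply/funext => c.
by rewrite /tensor_fun ffunE !(tnth_nth a).
Qed.

(** The images of the three indices are distinct, which leaves six cases; each is a product of
    neighbour transpositions. *)
Lemma clif_symmetric al ga : symmetric_tensor (clif_tensor al ga).
Proof.
move=> s t; rewrite !ffunE !tnth_mktuple.
move: (tnth t) => g; have inj := @perm_inj _ s.
have n01 : s i0 != s i1 by rewrite (inj_eq inj).
have n02 : s i0 != s i2 by rewrite (inj_eq inj).
have n12 : s i1 != s i2 by rewrite (inj_eq inj).
move: (s i0) (s i1) (s i2) n01 n02 n12 => x y z.
elim/ord3P: x; elim/ord3P: y; elim/ord3P: z => // _ _ _.
- by rewrite clifW_sw23.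
- by rewrite clifW_sw12.
- by rewrite clifW_sw23 clifW_sw12.
- by rewrite clifW_sw12 clifW_sw23.
- by rewrite clifW_sw12 clifW_sw23 clifW_sw12.
Qed.

Lemma quad_conic (al be ga de : k) (E : algType k) : quad al be ga de E ->
  exists (w : tensor3 k) (f : D_alg w),
    [/\ superpotential w, symmetric_tensor w, regular_tensor w, conic_element f & is_C f E].
Proof.
move=> [mC [u [v [hu hv sp ind]]]]; pose w := clif_tensor al ga.
pose ft : tensor_alg k := clif_conic be de TF.
have pS := D_presents w; rewrite /w clif_tensorE -/w in pS.
have [gf cf rf] := clif_conic_element be de pS.
have hft : @fhomog k TF 2 ft.
  rewrite /ft /clif_conic; apply: homogD; first apply: homogD; first exact: homog_word.
    by apply/homogZ; apply: homog_word.
  by apply/homogZ; apply: homog_word.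
exists w, (D_pi w ft); split.
- move=> a b c; have e x y z : w [tuple x; y; z] = clifW al ga x y z by rewrite -clif_tensorE.
  by rewrite !e clifW_sw12 clifW_sw23.
- exact: clif_symmetric.
- by rewrite /regular_tensor /D_grading img_pgr; apply: clif_quantum_polynomial pS.
- by split; [rewrite /D_grading img_pgr | exact: cf | exact: rf].
have qA := conic_presents w hft.
have pBB := dual_presents (@conic_pi k w (D_pi w ft)).
have pDD := dual_presents (D_pi w).
have [z [gz cz rz hz dz]] := quad_is_C pS qA pBB pDD mC hu hv sp ind.
by exists z; split=> //; rewrite img_pgr.
Qed.

Definition listed (E : algType k) :=
     [\/ alg_iso E (k^o * k^o * k^o * k^o)%type,
         alg_iso E (trunc_poly k 2 * (k^o * k^o))%type,
         alg_iso E (trunc_poly k 2 * trunc_poly k 2)%type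
       | [\/ alg_iso E (trunc_poly k 3 * k^o)%type,
             alg_iso E (trunc_poly k 4)
           | alg_iso E (trunc_poly2 k)]].

Let kC (x y : k^o) : x * y = y * x := mulrC x y.
Let t1 := is_type_regular k.
Let d1 := has_dim_regular k.

Lemma quad_k4 : quad 0 1 0 1 (k^o * k^o * k^o * k^o)%type.
Proof.
apply: (type1111_quad char0_nat); [do 3!apply: comm_pair => // | |].
- exact: (has_dim_prod (has_dim_prod (has_dim_prod d1 d1) d1) d1).
- exact: (is_type_prodr (is_type_prodr (is_type_prodr t1 t1) t1) t1).
Qed.

Lemma quad_211 : quad 1 2 0 4 (trunc_poly k 2 * (k^o * k^o))%type.
Proof.
apply: (type211_quad char0_nat).
- by apply: comm_pair; [exact: trunc_poly_comm | apply: comm_pair].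
- exact: (has_dim_prod (has_dim_trunc k 1) (has_dim_prod d1 d1)).
- by apply: is_type_prodl; [exact: is_type_trunc | apply: is_type_prodl].
Qed.

Lemma quad_22 : quad 0 1 0 0 (trunc_poly k 2 * trunc_poly k 2)%type.
Proof.
apply: (type22_quad char0_nat).
- by apply: comm_pair; exact: trunc_poly_comm.
- exact: (has_dim_prod (has_dim_trunc k 1) (has_dim_trunc k 1)).
- by apply: is_type_prodl; exact: is_type_trunc.
Qed.

Lemma quad_31 : quad 1 3 (- 8) 12 (trunc_poly k 3 * k^o)%type.
Proof.
apply: (type31_quad char0_nat).
- by apply: comm_pair; [exact: trunc_poly_comm |].
- exact: (has_dim_prod (has_dim_trunc k 2) d1).
- by apply: is_type_prodl; [exact: is_type_trunc |].
Qed.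

Lemma quad_4 : quad 1 0 0 0 (trunc_poly k 4).
Proof.
apply: type4_quad; [exact: trunc_poly_comm | exact: has_dim_trunc | exact: is_type_trunc].
Qed.

Lemma listed_quad E : listed E -> exists al be ga de, quad al be ga de E.
Proof.
case=> [h|h|h|[h|h|h]].
- by exists 0, 1, 0, 1; apply: quad_transfer h quad_k4.
- by exists 1, 2, 0, 4; apply: quad_transfer h quad_211.
- by exists 0, 1, 0, 0; apply: quad_transfer h quad_22.
- by exists 1, 3, (- 8), 12; apply: quad_transfer h quad_31.
- by exists 1, 0, 0, 0; apply: quad_transfer h quad_4.
- by exists 0, 0, 0, 0; apply: quad_transfer h (trunc_poly2_quad k).
Qed.

(** Associativity of [beta] turns it into the functional beta(-, 1). A type yields fixed parameters
    of [quad], the listed algebra has the same ones, and [quad_iso] compares the two. *)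
Lemma frobenius4_listed E : commutative_frobenius4 E -> listed E.
Proof.
move=> [[_ [beta [bl _ ba bnd _]]] dim mC].
have lin : linear (fun x => beta x 1 : k^o) by move=> a x y; rewrite bl.
pose phi := mklin lin.
have nd x : (forall y, phi (x * y) = 0) -> x = 0.
  by move=> h; apply: bnd => y; have := h y; rewrite /= ba mulr1.
have [[t|t|t|[t|t]]|q] := frobenius4_cases char0_nat mC dim nd.
- by constructor 1; apply: (quad_iso _ quad_k4); apply: (type1111_quad char0_nat).
- by constructor 2; apply: (quad_iso _ quad_211); apply: (type211_quad char0_nat).
- by constructor 3; apply: (quad_iso _ quad_22); apply: (type22_quad char0_nat).
- by constructor 4; constructor 1; apply: (quad_iso _ quad_31); apply: (type31_quad char0_nat).
- by constructor 4; constructor 2; apply: (quad_iso _ quad_4); apply: type4_quad.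
- by constructor 4; constructor 3; apply: (quad_iso q); apply: trunc_poly2_quad.
Qed.

End Equivalence.

Theorem corollary4p10 (k : closedFieldType) (char0 : [pchar k] =i pred0) :
  (forall E : algType k,
     commutative_frobenius4 E <->
     exists (w : tensor3 k) (f : D_alg w),
       [/\ superpotential w, symmetric_tensor w, regular_tensor w,
           conic_element f & is_C f E]) /\
  (forall E : algType k,
     commutative_frobenius4 E <->
     [\/ alg_iso E (k^o * k^o * k^o * k^o)%type,
         alg_iso E (trunc_poly k 2 * (k^o * k^o))%type,
         alg_iso E (trunc_poly k 2 * trunc_poly k 2)%type
       | [\/ alg_iso E (trunc_poly k 3 * k^o)%type,
             alg_iso E (trunc_poly k 4)
           | alg_iso E (trunc_poly2 k)]]).
Proof.
have conic_frob (E : algType k) : (exists (w : tensor3 k) (f : D_alg w),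
    [/\ superpotential w, symmetric_tensor w, regular_tensor w,
        conic_element f & is_C f E]) -> commutative_frobenius4 E.
  by move=> [w [f [cyc sym reg hf hC]]]; apply: (is_C_frobenius char0 cyc sym reg hf hC).
have list_conic (E : algType k) : listed E -> exists (w : tensor3 k) (f : D_alg w),
    [/\ superpotential w, symmetric_tensor w, regular_tensor w,
        conic_element f & is_C f E].
  by move=> /(listed_quad char0)[al [be [ga [de h]]]]; apply: (quad_conic h).
split=> E; split; [move/(frobenius4_listed char0)/list_conic | exact: conic_frob |
  exact: frobenius4_listed | move/list_conic/conic_frob]; by [].
Qed.
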